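(* Let $k$ be an algebraically closed field of characteristic $0$, let $p,q$ be prime numbers with $p^4<q$, and let $H$ be a semisimple Hopf algebra over $k$ of dimension $p^2q^2$. Then either $H$ is semisolvable, or $H$ is isomorphic as a Hopf algebra to a Radford biproduct $R\# kG$, where $kG$ is the group algebra of a group $G$ of order $p^2$ and $R$ is a semisimple Yetter-Drinfeld Hopf algebra in ${}^{kG}_{kG}\mathcal{YD}$ of dimension $q^2$.
   Context: The alternative ''either ... or'' is not meant to be exclusive. Semisolvability. A Hopf algebra is called trivial if it is isomorphic to a group algebra or to the dual of a group algebra (of a finite group). A Hopf subalgebra $A\subseteq H$ of a finite-dimensional Hopf algebra is normal if $h_1AS(h_2)\subseteq A$ and $S(h_1)Ah_2\subseteq A$ for all $h\in H$; $A^+$ denotes the kernel of the counit on $A$. For a Hopf algebra map $\pi:H\to B$ put $H^{co\pi}=\{h\in H: (\mathrm{id}\otimes\pi)\Delta(h)=h\otimes 1\}$ and ${}^{co\pi}H=\{h\in H:(\pi\otimes \mathrm{id})\Delta(h)=1\otimes h\}$; $\pi$ is called normal if $H^{co\pi}={}^{co\pi}H$ (equivalently $H^{co\pi}$ is a Hopf subalgebra of $H$). $H$ is lower semisolvable if there is a chain of Hopf subalgebras $H_{n+1}=k\subseteq H_n\subseteq\cdots\subseteq H_1=H$ with $H_{i+1}$ a normal Hopf subalgebra of $H_i$ for all $i$ and all quotients $H_i/H_iH_{i+1}^+$ trivial. $H$ is upper semisolvable if there is a chain of quotient Hopf algebras $H_{(0)}=H\xrightarrow{\pi_1}H_{(1)}\xrightarrow{\pi_2}\cdots\xrightarrow{\pi_n}H_{(n)}=k$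 with each $\pi_i$ normal and all $H_{(i-1)}^{co\pi_i}$ trivial. $H$ is semisolvable if it is upper or lower semisolvable. ($H$ is upper semisolvable if and only if $H^*$ is lower semisolvable.) Radford biproduct. Let $A$ be a semisimple Hopf algebra (here $A=kG$) and ${}^A_A\mathcal{YD}$ the braided category of left-left Yetter-Drinfeld modules over $A$. Let $R$ be a Hopf algebra in ${}^A_A\mathcal{YD}$ (a Yetter-Drinfeld Hopf algebra), semisimple as an algebra, with action $g\cdot a$, coaction $\rho(a)=a_{-1}\otimes a_0\in A\otimes R$, comultiplication $\Delta_R(a)=a^1\otimes a^2$ and antipode $S_R$. The biproduct $R\#A$ is the Hopf algebra on the vector space $R\otimes A$ (with $a\#g=a\otimes g$) with multiplication $(a\#g)(b\#h)=a(g_1\cdot b)\#g_2h$, unit $1_R\#1_A$, comultiplication $\Delta(a\#g)=(a^1\#(a^2)_{-1}g_1)\otimes((a^2)_0\#g_2)$, counit $\varepsilon_R\otimes\varepsilon_A$, and antipode $S(a\#g)=(1\#S(a_{-1}g))(S_R(a_0)\#1)$. *)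

(* Defs.v *)
From HB Require Import structures.
From mathcomp Require Import all_boot all_order all_fingroup all_algebra.
From mathcomp Require Import all_field.

Set Implicit Arguments.
Unset Strict Implicit.
Unset Printing Implicit Defensive.

Import GRing.Theory.
Import VectorInternalTheory.
Local Open Scope ring_scope.

Reserved Notation "u *t v" (at level 40, left associativity).
Reserved Notation "\tsum_ ( x , y <- t ) E"
  (at level 41, E at level 41, x name, y name, t at level 50,
   format "\tsum_ ( x ,  y  <-  t )  E").

Section Tensor.
Variable K : fieldType.
Implicit Types U V W : vectType K.

(* The tensor product of finite-dimensional spaces, in coordinates: the matrix
   unit (i, j) stands for e_i (x) e_j, where e_i := r2v (delta_mx 0 i).      *)
Definition tensor U V : vectType K := 'M[K]_(dim U, dim V).

Definition tens U V (u : U) (v : V) : tensor U V := (v2r u)^T *m v2r v.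

(* For bilinear b, tlift b is the linear map with tlift b (u *t v) = b u v
   (lemma tliftE), so that \tsum_(x, y <- comul h) b x y below is the
   Sweedler sum  b(h_1, h_2).                                                *)
Definition tlift U V W (b : U -> V -> W) (t : tensor U V) : W :=
  \sum_i \sum_j (t : 'M_(_, _)) i j *:
    b (r2v (delta_mx 0 i)) (r2v (delta_mx 0 j)).

Local Notation "u *t v" := (tens u v) : ring_scope.
Local Notation "\tsum_ ( x , y <- t ) E" :=
  (tlift (fun x y => E) t) : ring_scope.

Definition tmap U V U' V' (f : U -> U') (g : V -> V') (t : tensor U V) :
  tensor U' V' := \tsum_(u, v <- t) (f u *t g v).

(* span of the u *t v with u in A and v in B *)
Definition tensv U V (A : {vspace U}) (B : {vspace V}) : {vspace tensor U V} :=
  <<[seq u *t v | u <- vbasis A, v <- vbasis B]>>%VS.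

Definition bilin U V W (b : U -> V -> W) := bilinear_for *:%R *:%R b.

Lemma tens_bilin U V : bilin (@tens U V).
Proof.
by split=> [v a u u'|u a v v']; rewrite /tens linearP;
  rewrite ?linearP /= ?mulmxDl ?mulmxDr ?scalemxAl ?scalemxAr // linearP.
Qed.

Lemma tlift_linear U V W (b : U -> V -> W) : linear (tlift b).
Proof.
move=> a s t; rewrite /tlift scaler_sumr -big_split; apply: eq_bigr => i _ /=.
rewrite scaler_sumr -big_split; apply: eq_bigr => j _ /=.
by rewrite !mxE scalerDl scalerA.
Qed.

HB.instance Definition _ U V W (b : U -> V -> W) :=
  GRing.isLinear.Build K (tensor U V) W *:%R (tlift b) (tlift_linear b).

Lemma linear_tlift U V W W' (f : W -> W') (b : U -> V -> W) t :
  linear f -> f (tlift b t) = \tsum_(u, v <- t) f (b u v).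
Proof.
move=> fL; pose fM := GRing.isLinear.Build _ _ _ _ f fL.
pose g : {linear W -> W'} := HB.pack f fM.
rewrite -[f]/(g : W -> W') linear_sum; apply: eq_bigr => i _.
by rewrite linear_sum; apply: eq_bigr => j _; rewrite linearZ.
Qed.

Lemma lfunE_lin U V (f : U -> V) : linear f -> linfun f =1 f.
Proof.
move=> fL; pose fM := GRing.isLinear.Build _ _ _ _ f fL.
pose g : {linear U -> V} := HB.pack f fM.
exact: (lfunE g).
Qed.

Lemma lin_sum U V (f : U -> V) I (r : seq I) (c : I -> K) (F : I -> U) :
  linear f -> f (\sum_(i <- r) c i *: F i) = \sum_(i <- r) c i *: f (F i).
Proof.
move=> fL; rewrite -(lfunE_lin fL) linear_sum.
by apply: eq_bigr => i _; rewrite linearZ /= lfunE_lin.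
Qed.

Lemma lin_scale U V (f : U -> V) c u : linear f -> f (c *: u) = c *: f u.
Proof. by move=> fL; rewrite -!(lfunE_lin fL) linearZ. Qed.

Lemma r2v_sum U (u : U) : u = \sum_i v2r u 0 i *: r2v (delta_mx 0 i).
Proof.
rewrite -{1}[u]v2rK {1}[v2r u]row_sum_delta linear_sum.
by apply: eq_bigr => i _; rewrite linearZ.
Qed.

Lemma tliftE U V W (b : U -> V -> W) u v : bilin b -> tlift b (u *t v) = b u v.
Proof.
case=> bl br; pose b1M y := GRing.isLinear.Build _ _ _ _ _ (bl y).
pose b1 y : {linear U -> W} := HB.pack (b^~ y) (b1M y).
pose b2M x := GRing.isLinear.Build _ _ _ _ _ (br x).
pose b2 x : {linear V -> W} := HB.pack (b x) (b2M x).
rewrite {2}[u]r2v_sum -[b _ _]/(b1 v _) linear_sum; apply: eq_bigr => i _.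
rewrite linearZ /= {2}[v]r2v_sum -[b _ (\sum_ _ _)]/(b2 _ _) linear_sum.
rewrite scaler_sumr.
apply: eq_bigr => j _; rewrite linearZ /= scalerA; congr (_ *: _).
by rewrite /tens !mxE big_ord1 !mxE.
Qed.

Lemma tens_ext U V W (f g : tensor U V -> W) :
  linear f -> linear g -> (forall u v, f (u *t v) = g (u *t v)) -> f =1 g.
Proof.
move=> fL gL fg t; suff ->: t = \tsum_(u, v <- t) (u *t v).
  rewrite (linear_tlift _ _ fL) (linear_tlift _ _ gL).
  by apply: eq_bigr => i _; apply: eq_bigr => j _; rewrite fg.
rewrite /tlift {1}[t]matrix_sum_delta; apply: eq_bigr => i _.
apply: eq_bigr => j _; congr (_ *: _); rewrite /tens !r2vK.
by rewrite trmx_delta mul_delta_mx.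
Qed.

Lemma tlift_tlift U V U' V' W (b : U' -> V' -> W) (c : U -> V -> tensor U' V')
    t :
  tlift b (tlift c t) = \tsum_(u, v <- t) tlift b (c u v).
Proof. exact/linear_tlift/tlift_linear. Qed.

Lemma eq_tlift U V W (b c : U -> V -> W) t :
  (forall u v, b u v = c u v) -> tlift b t = tlift c t.
Proof.
by move=> bc; apply: eq_bigr => i _; apply: eq_bigr => j _; rewrite bc.
Qed.

Lemma tlift_sumr U V W I (r : seq I) (F : U -> V -> I -> W) t :
  \tsum_(u, v <- t) (\sum_(i <- r) F u v i) =
  \sum_(i <- r) \tsum_(u, v <- t) F u v i.
Proof.
rewrite /tlift [RHS]exchange_big; apply: eq_bigr => i _ /=.
rewrite [RHS]exchange_big; apply: eq_bigr => j _ /=.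
by rewrite scaler_sumr.
Qed.

Lemma tlift_mul U V U' V' (b : U -> V -> K^o) (c : U' -> V' -> K^o) s t :
  (\tsum_(u, v <- s) b u v) * (\tsum_(x, y <- t) c x y) =
  \tsum_(u, v <- s) \tsum_(x, y <- t) (b u v * c x y : K^o).
Proof.
rewrite (@linear_tlift _ _ K^o _ (fun z : K^o => z * tlift c t)); last first.
  by move=> a x y; rewrite mulrDl scalerAl.
apply: eq_tlift => u v.
rewrite (@linear_tlift _ _ K^o _ (fun z : K^o => b u v * z)) // => a x y.
by rewrite mulrDr scalerAr.
Qed.

Lemma tlift_exchange U V U' V' W (b : U -> V -> U' -> V' -> W) s t :
  \tsum_(u, v <- s) \tsum_(x, y <- t) b u v x y =
  \tsum_(x, y <- t) \tsum_(u, v <- s) b u v x y.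
Proof.
rewrite [LHS]tlift_sumr; apply: eq_bigr => i _.
rewrite [LHS]tlift_sumr; apply: eq_bigr => j _.
rewrite [RHS](linear_tlift _ _ (f := *:%R _)) // => c u v.
by rewrite scalerDr !scalerA mulrC.
Qed.
Section Linearity.
Variables (V : lmodType K) (W W' W'' : vectType K) (R : algType K).

Lemma lin_id : linear (fun x : V => x). Proof. by []. Qed.
Lemma lin_lfun (f : 'Hom(W, W')) (F : V -> W) :
  linear F -> linear (fun x => f (F x)).
Proof. by move=> FL a x y; rewrite FL linearP. Qed.
Lemma lin_tlift (b : W -> W' -> W'') (F : V -> tensor W W') :
  linear F -> linear (fun x => tlift b (F x)).
Proof. by move=> FL a x y; rewrite FL linearP. Qed.
Lemma lin_tliftr (b : V -> W -> W' -> W'') t :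
  (forall w w', linear (fun x => b x w w')) -> linear (fun x => tlift (b x) t).
Proof.
move=> bL a x y; rewrite /tlift scaler_sumr -big_split; apply: eq_bigr => i _.
rewrite /= scaler_sumr -big_split; apply: eq_bigr => j _ /=.
by rewrite bL scalerDr !scalerA mulrC.
Qed.
Lemma lin_tensl (F : V -> W) (w : W') :
  linear F -> linear (fun x => F x *t w).
Proof. by move=> FL a x y; rewrite FL (tens_bilin _ _).1. Qed.
Lemma lin_tensr (F : V -> W') (w : W) :
  linear F -> linear (fun x => w *t F x).
Proof. by move=> FL a x y; rewrite FL (tens_bilin _ _).2. Qed.
Lemma lin_mull (F : V -> R) r : linear F -> linear (fun x => F x * r).
Proof. by move=> FL a x y; rewrite FL mulrDl scalerAl. Qed.
Lemma lin_mulr (F : V -> R) r : linear F -> linear (fun x => r * F x).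
Proof. by move=> FL a x y; rewrite FL mulrDr scalerAr. Qed.
Lemma lin_scalel (F : V -> K^o) (w : W) :
  linear F -> linear (fun x => (F x : K) *: w).
Proof. by move=> FL a x y; rewrite FL scalerDl scalerA. Qed.
Lemma lin_scaler (F : V -> W) (c : K) : linear F -> linear (fun x => c *: F x).
Proof. by move=> FL a x y; rewrite FL scalerDr !scalerA mulrC. Qed.
Lemma lin_eval (F : V -> 'Hom(W, W')) (w : W) :
  linear F -> linear (fun x => F x w).
Proof. by move=> FL a x y; rewrite FL add_lfunE scale_lfunE. Qed.
End Linearity.

End Tensor.

Notation "u *t v" := (tens u v) : ring_scope.
Notation "\tsum_ ( x , y <- t ) E" := (tlift (fun x y => E) t) : ring_scope.

HB.mixin Record Vector_isCoalgebra (K : fieldType) C of Vector K C := {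
  comul : 'Hom(C, tensor C C);
  counit : 'Hom(C, K^o);
  comulA : forall c : C,
    \tsum_(x, y <- comul c) \tsum_(x1, x2 <- comul x) (x1 *t (x2 *t y)) =
    \tsum_(x, y <- comul c) (x *t comul y);
  counitl : forall c : C, \tsum_(x, y <- comul c) ((counit x : K) *: y) = c;
  counitr : forall c : C, \tsum_(x, y <- comul c) ((counit y : K) *: x) = c
}.

#[short(type="coalgType")]
HB.structure Definition Coalgebra (K : fieldType) :=
  { C of Vector K C & Vector_isCoalgebra K C }.

(* an algebra and coalgebra, with no compatibility between the two *)
HB.structure Definition AlgCoalgebra (K : fieldType) :=
  { C of Falgebra K C & Coalgebra K C }.

HB.mixin Record isHopf (K : fieldType) H
    of AlgCoalgebra K H := {
  comul1 : comul (1 : H) = 1 *t 1;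
  comulM : forall g h : H, comul (g * h) =
    \tsum_(x, y <- comul g) \tsum_(z, w <- comul h) ((x * z) *t (y * w));
  counit1 : counit (1 : H) = 1;
  counitM : forall g h : H, counit (g * h) = counit g * counit h;
  antipode : 'End(H);
  antipodel : forall h : H,
    \tsum_(x, y <- comul h) (antipode x * y) = (counit h : K)%:A;
  antipoder : forall h : H,
    \tsum_(x, y <- comul h) (x * antipode y) = (counit h : K)%:A
}.

#[short(type="hopfType")]
HB.structure Definition Hopf (K : fieldType) :=
  { H of AlgCoalgebra K H & isHopf K H }.

Ltac lin := repeat first
  [ apply: lin_id | apply: lin_tensl | apply: lin_tensr
  | apply: lin_mull | apply: lin_mulr
  | apply: lin_scalel | apply: lin_scaler
  | apply: lin_lfun | apply: lin_eval | apply: lin_tlift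
  | apply: lin_tliftr => ? ? ].
Ltac bil := split=> ?; cbv beta; lin.

Section GroupAlgebra.
Variables (K : fieldType) (gT : finGroupType).

Definition group_alg := {ffun gT -> K^o}.
HB.instance Definition _ := Vector.on group_alg.
Implicit Types f g h : group_alg.

Definition galg_elt (x : gT) : group_alg := [ffun y => (y == x)%:R].
Definition galg_mul f g : group_alg :=
  [ffun x => \sum_y f y * g (y^-1 * x)%g].

Lemma galg_mulEr f g x : galg_mul f g x = \sum_y f (x * y^-1)%g * g y.
Proof.
rewrite ffunE (reindex_inj (inj_comp (mulgI x) invg_inj)) /=.
by apply: eq_bigr => y _; rewrite invMg invgK mulgKV.
Qed.

Lemma galg_mulA : associative galg_mul.
Proof.
move=> f g h; apply/ffunP=> x; rewrite [RHS]galg_mulEr ffunE.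
under eq_bigr => y _ do rewrite galg_mulEr mulr_sumr.
rewrite exchange_big; apply: eq_bigr => z _ /=.
rewrite ffunE mulr_suml; apply: eq_bigr => y _.
by rewrite mulrA mulgA.
Qed.

Lemma galg_mul1l : left_id (galg_elt 1%g) galg_mul.
Proof.
move=> f; apply/ffunP=> x; rewrite ffunE (bigD1 1%g) //= big1 => [|y y1].
  by rewrite ffunE eqxx mul1r invg1 mul1g addr0.
by rewrite ffunE (negPf y1) mul0r.
Qed.

Lemma galg_mul1r : right_id (galg_elt 1%g) galg_mul.
Proof.
move=> f; apply/ffunP=> x; rewrite galg_mulEr (bigD1 1%g) //= big1 => [|y y1].
  by rewrite ffunE eqxx mulr1 invg1 mulg1 addr0.
by rewrite ffunE (negPf y1) mulr0.
Qed.

Lemma galg_mulDl : left_distributive galg_mul +%R.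
Proof.
move=> f g h; apply/ffunP=> x; rewrite !ffunE -big_split.
by apply: eq_bigr => y _; rewrite ffunE mulrDl.
Qed.

Lemma galg_mulDr : right_distributive galg_mul +%R.
Proof.
move=> f g h; apply/ffunP=> x; rewrite !ffunE -big_split.
by apply: eq_bigr => y _; rewrite ffunE mulrDr.
Qed.

Lemma galg_1neq0 : galg_elt 1%g != 0.
Proof. by apply/eqP=> /ffunP/(_ 1%g)/eqP; rewrite !ffunE eqxx oner_eq0. Qed.

HB.instance Definition _ := GRing.Zmodule_isNzRing.Build group_alg
  galg_mulA galg_mul1l galg_mul1r galg_mulDl galg_mulDr galg_1neq0.

Lemma galg_scaleAl (a : K) f g : a *: (f * g) = a *: f * g.
Proof.
apply/ffunP=> x; rewrite !ffunE scaler_sumr; apply: eq_bigr => y _.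
by rewrite ffunE -scalerAl.
Qed.

Lemma galg_scaleAr (a : K) f g : a *: (f * g) = f * (a *: g).
Proof.
apply/ffunP=> x; rewrite !ffunE scaler_sumr; apply: eq_bigr => y _.
by rewrite ffunE -scalerAr.
Qed.

HB.instance Definition _ :=
  GRing.Lmodule_isLalgebra.Build K group_alg galg_scaleAl.
HB.instance Definition _ :=
  GRing.Lalgebra_isAlgebra.Build K group_alg galg_scaleAr.
HB.instance Definition _ := Algebra_isFalgebra.Build K group_alg.

Local Notation "'d_ x" := (galg_elt x) (at level 8, format "''d_' x").

Lemma galg_sum f : f = \sum_x f x *: 'd_ x.
Proof.
apply/ffunP=> y; rewrite sum_ffunE (bigD1 y) //= big1 => [|x xy].
  by rewrite !ffunE eqxx addr0 [_ *: _]mulr1.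
by rewrite !ffunE eq_sym (negPf xy) [_ *: _]mulr0.
Qed.

Lemma galg_ext (W : lmodType K) (F G : group_alg -> W) :
  linear F -> linear G -> (forall x, F 'd_ x = G 'd_ x) -> F =1 G.
Proof.
move=> FL GL FG f.
pose F' : {linear group_alg -> W} :=
  HB.pack F (GRing.isLinear.Build _ _ _ _ F FL).
pose G' : {linear group_alg -> W} :=
  HB.pack G (GRing.isLinear.Build _ _ _ _ G GL).
rewrite -[F]/(F' : group_alg -> W) -[G]/(G' : group_alg -> W) (galg_sum f).
rewrite !linear_sum.
by apply: eq_bigr => x _; rewrite !linearZ /= FG.
Qed.

Definition galg_lin (W : vectType K) (F : gT -> W) f := \sum_x f x *: F x.

Lemma galg_lin_linear W F : linear (@galg_lin W F).
Proof.
move=> a f g; rewrite /galg_lin scaler_sumr -big_split; apply: eq_bigr => x _.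
by rewrite !ffunE scalerDl scalerA.
Qed.
HB.instance Definition _ (W : vectType K) (F : gT -> W) :=
  GRing.isLinear.Build K group_alg W *:%R (@galg_lin W F) (galg_lin_linear F).

Lemma galg_linE W F x : @galg_lin W F 'd_ x = F x.
Proof.
rewrite /galg_lin (bigD1 x) //= big1 => [|y yx].
  by rewrite ffunE eqxx scale1r addr0.
by rewrite ffunE (negPf yx) scale0r.
Qed.

Definition galg_comul : 'Hom(group_alg, tensor group_alg group_alg) :=
  linfun (galg_lin (fun x => 'd_ x *t 'd_ x)).
Definition galg_counit : 'Hom(group_alg, K^o) :=
  linfun (galg_lin (fun=> 1 : K^o)).
Definition galg_antipode : 'End(group_alg) :=
  linfun (galg_lin (fun x => 'd_(x^-1)%g)).

Lemma galg_comulE x : galg_comul 'd_ x = 'd_ x *t 'd_ x.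
Proof. by rewrite lfunE /= galg_linE. Qed.
Lemma galg_counitE x : galg_counit 'd_ x = 1.
Proof. by rewrite lfunE /= galg_linE. Qed.
Lemma galg_antipodeE x : galg_antipode 'd_ x = 'd_(x^-1)%g.
Proof. by rewrite lfunE /= galg_linE. Qed.
Lemma galg_mulE x y : 'd_ x * 'd_ y = 'd_(x * y)%g.
Proof.
apply/ffunP=> z; rewrite ffunE (bigD1 x) //= big1 => [|t tx].
  by rewrite !ffunE eqxx mul1r addr0 -(inj_eq (mulgI x)) mulKVg.
by rewrite ffunE (negPf tx) mul0r.
Qed.

Lemma galg_comulA f :
  \tsum_(x, y <- galg_comul f) \tsum_(x1, x2 <- galg_comul x)
    (x1 *t (x2 *t y)) =
  \tsum_(x, y <- galg_comul f) (x *t galg_comul y).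
Proof.
move: f; apply: galg_ext => [||x]; [lin | lin | ].
by rewrite galg_comulE !tliftE ?galg_comulE ?tliftE //; bil.
Qed.

Lemma galg_counitl f : \tsum_(x, y <- galg_comul f) (galg_counit x *: y) = f.
Proof.
move: f; apply: galg_ext => [||x]; [lin | lin | ].
by rewrite galg_comulE tliftE ?galg_counitE ?scale1r //; bil.
Qed.

Lemma galg_counitr f : \tsum_(x, y <- galg_comul f) (galg_counit y *: x) = f.
Proof.
move: f; apply: galg_ext => [||x]; [lin | lin | ].
by rewrite galg_comulE tliftE ?galg_counitE ?scale1r //; bil.
Qed.

Lemma galg_comul1 : galg_comul 1 = 1 *t 1.
Proof. exact: galg_comulE. Qed.

Lemma galg_comulM f g : galg_comul (f * g) =
  \tsum_(x, y <- galg_comul f) \tsum_(z, w <- galg_comul g)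
    ((x * z) *t (y * w)).
Proof.
move: f; apply: galg_ext => [||x]; [lin | lin | ].
move: g; apply: galg_ext => [||y]; [lin | lin | ].
rewrite galg_mulE !galg_comulE !tliftE ?galg_mulE //; bil.
Qed.

Lemma galg_counit1 : galg_counit 1 = 1.
Proof. exact: galg_counitE. Qed.

Lemma galg_counitM f g : galg_counit (f * g) = galg_counit f * galg_counit g.
Proof.
move: f; apply: galg_ext => [||x]; [lin | lin | ].
move: g; apply: galg_ext => [||y]; [lin | lin | ].
by rewrite galg_mulE !galg_counitE mulr1.
Qed.

Lemma galg_antipodel f :
  \tsum_(x, y <- galg_comul f) (galg_antipode x * y) = (galg_counit f : K)%:A.
Proof.
move: f; apply: galg_ext => [||x]; [lin | lin | ].
rewrite galg_comulE tliftE ?galg_antipodeE ?galg_mulE ?mulVg; last bil.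
by rewrite galg_counitE scale1r.
Qed.

Lemma galg_antipoder f :
  \tsum_(x, y <- galg_comul f) (x * galg_antipode y) = (galg_counit f : K)%:A.
Proof.
move: f; apply: galg_ext => [||x]; [lin | lin | ].
rewrite galg_comulE tliftE ?galg_antipodeE ?galg_mulE ?mulgV; last bil.
by rewrite galg_counitE scale1r.
Qed.

HB.instance Definition _ := Vector_isCoalgebra.Build K group_alg
  galg_comulA galg_counitl galg_counitr.
HB.instance Definition _ := isHopf.Build K group_alg
  galg_comul1 galg_comulM galg_counit1 galg_counitM
  galg_antipodel galg_antipoder.

End GroupAlgebra.

Section Dual.
Variables (K : fieldType) (H : hopfType K).

Definition dual := 'Hom(H, K^o).
HB.instance Definition _ := Vector.on dual.
Implicit Types (f g l : dual) (x y h : H).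

Lemma dualP (f g : dual) : (forall x : H, f x = g x) -> f = g.
Proof. by move/lfunP. Qed.

Definition dual_mul_fun f g h : K^o :=
  \tsum_(x, y <- comul h) (f x * g y : K^o).
Lemma dual_mul_linear f g : linear (dual_mul_fun f g).
Proof. by rewrite /dual_mul_fun; lin. Qed.
HB.instance Definition _ f g :=
  GRing.isLinear.Build K H K^o *:%R (dual_mul_fun f g) (dual_mul_linear f g).

Definition dual_mul f g : dual := linfun (dual_mul_fun f g).
Definition dual_one : dual := counit.

Lemma dual_mulE f g h :
  dual_mul f g h = \tsum_(x, y <- comul h) (f x * g y : K^o).
Proof. by rewrite lfunE. Qed.

Lemma dual_mulA : associative dual_mul.
Proof.
move=> f g l; apply: dualP => h; rewrite !dual_mulE.
pose b (x : H) (t : tensor H H) : K^o :=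
  f x * \tsum_(y, z <- t) (g y * l z : K^o).
have bb : bilin b by rewrite /b; bil.
have := congr1 (tlift b) (comulA h); rewrite !tlift_tlift.
under eq_tlift => x y do
  [rewrite tlift_tlift; under eq_tlift => x1 x2 do
    [rewrite tliftE // /b tliftE; last by bil]].
under [RHS]eq_tlift => x y do rewrite tliftE // /b -dual_mulE.
move=> <-; apply: eq_tlift => x y; rewrite dual_mulE.
rewrite (linear_tlift _ _ (f := fun c : K^o => c * l y : K^o)); last by lin.
by apply: eq_tlift => u v; rewrite mulrA.
Qed.

Lemma dual_mul1l : left_id dual_one dual_mul.
Proof.
move=> f; apply: dualP => h; rewrite dual_mulE -{2}[h]counitl.
rewrite (linear_tlift _ _ (f := f)); last by lin.
by apply: eq_tlift => x y; rewrite linearZ.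
Qed.

Lemma dual_mul1r : right_id dual_one dual_mul.
Proof.
move=> f; apply: dualP => h; rewrite dual_mulE -{2}[h]counitr.
rewrite (linear_tlift _ _ (f := f)); last by lin.
by apply: eq_tlift => x y; rewrite linearZ mulrC.
Qed.

Lemma dual_mulPl g : linear (dual_mul^~ g).
Proof.
have lin_at h : linear (fun f : dual => dual_mul_fun f g h).
  by rewrite /dual_mul_fun; lin.
move=> a f f'; apply: dualP => h.
by rewrite add_lfunE scale_lfunE !dual_mulE [LHS]lin_at.
Qed.

Lemma dual_mulPr f : linear (dual_mul f).
Proof.
have lin_at h : linear (fun g : dual => dual_mul_fun f g h).
  by rewrite /dual_mul_fun; lin.
move=> a g g'; apply: dualP => h.
by rewrite add_lfunE scale_lfunE !dual_mulE [LHS]lin_at.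
Qed.

Lemma dual_mulDl : left_distributive dual_mul +%R.
Proof. by move=> f f' g; have := dual_mulPl g 1 f f'; rewrite !scale1r. Qed.

Lemma dual_mulDr : right_distributive dual_mul +%R.
Proof. by move=> f g g'; have := dual_mulPr f 1 g g'; rewrite !scale1r. Qed.

Lemma dual_1neq0 : dual_one != 0.
Proof.
by apply/eqP=> /lfunP/(_ 1)/eqP; rewrite /dual_one counit1 zero_lfunE oner_eq0.
Qed.

HB.instance Definition _ := GRing.Zmodule_isNzRing.Build dual
  dual_mulA dual_mul1l dual_mul1r dual_mulDl dual_mulDr dual_1neq0.

Lemma dual_scaleAl (a : K) f g : a *: (f * g) = a *: f * g.
Proof.
have := dual_mulPl g a f 0; rewrite addr0 => /= E; rewrite [RHS]E.
by rewrite [dual_mul 0 g](mul0r g) addr0.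
Qed.

Lemma dual_scaleAr (a : K) f g : a *: (f * g) = f * (a *: g).
Proof.
have := dual_mulPr f a g 0; rewrite addr0 => /= E; rewrite [RHS]E.
by rewrite [dual_mul f 0](mulr0 f) addr0.
Qed.

HB.instance Definition _ := GRing.Lmodule_isLalgebra.Build K dual dual_scaleAl.
HB.instance Definition _ := GRing.Lalgebra_isAlgebra.Build K dual dual_scaleAr.
HB.instance Definition _ := Algebra_isFalgebra.Build K dual.

Let mulE f g h : (f * g) h = \tsum_(x, y <- comul h) (f x * g y : K^o).
Proof. exact: dual_mulE. Qed.

(* contraction of the first factor against x *)
Definition contr (V : vectType K) (x : H) (t : tensor dual V) : V :=
  tlift (fun (f : dual) v => (f x : K) *: v) t.

Definition dbasis (i : 'I_(dim H)) : dual :=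
  linfun (fun h : H => v2r h 0 i : K^o).

Lemma dbasisE i h : dbasis i h = v2r h 0 i.
Proof.
by rewrite lfunE_lin // => a x y; rewrite linearP !mxE.
Qed.

Lemma contrE (V : vectType K) x f (v : V) : contr x (f *t v) = (f x : K) *: v.
Proof. by rewrite /contr tliftE //; bil. Qed.

Lemma contr_linear (V : vectType K) x : linear (@contr V x).
Proof. exact: tlift_linear. Qed.

Lemma contr_expand (V : vectType K) (t : tensor dual V) :
  t = \sum_i dbasis i *t contr (r2v (delta_mx 0 i)) t.
Proof.
pose F (t : tensor dual V) := \sum_i dbasis i *t contr (r2v (delta_mx 0 i)) t.
have FL : linear F.
  move=> a s s'; rewrite /F scaler_sumr -big_split; apply: eq_bigr => i _ /=.
  by rewrite contr_linear (tens_bilin _ _).2.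
apply: (tens_ext (f := id) (g := F)) => // f v; rewrite /F.
have {1}-> : f = \sum_i f (r2v (delta_mx 0 i)) *: dbasis i.
  apply: dualP => h; rewrite sum_lfunE {1}[h]r2v_sum linear_sum.
  by apply: eq_bigr => j _; rewrite linearZ scale_lfunE dbasisE [LHS]mulrC.
rewrite (lin_sum _ _ _ ((tens_bilin _ _).1 v)); apply: eq_bigr => j _.
by rewrite contrE -(lin_scale _ _ ((tens_bilin _ _).2 _)).
Qed.

Lemma contr_inj (V : vectType K) (s t : tensor dual V) :
  (forall x, contr x s = contr x t) -> s = t.
Proof.
move=> st; rewrite (contr_expand s) (contr_expand t).
by apply: eq_bigr => i _; rewrite st.
Qed.

Definition dual_comul_fun f : tensor dual dual :=
  \sum_i dbasis i *t (f \o amull (r2v (delta_mx 0 i)))%VF.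
Definition dual_comul : 'Hom(dual, tensor dual dual) := linfun dual_comul_fun.
Definition dual_counit : 'Hom(dual, K^o) := linfun (fun f : dual => f 1).
Definition dual_antipode : 'End(dual) :=
  linfun (fun f : dual => (f \o antipode)%VF : dual).

Lemma dual_counitE f : dual_counit f = f 1.
Proof. by rewrite lfunE_lin //; lin. Qed.

Lemma dual_antipodeE f h : dual_antipode f h = f (antipode h).
Proof.
by rewrite lfunE_lin ?comp_lfunE // => a u v; rewrite comp_lfunDl comp_lfunZl.
Qed.

Lemma contr_comul x f : contr x (dual_comul f) = (f \o amull x)%VF.
Proof.
have L : linear dual_comul_fun.
  move=> a u v; rewrite /dual_comul_fun scaler_sumr -big_split.
  apply: eq_bigr => i _ /=; rewrite comp_lfunDl -comp_lfunZl.
  exact: (tens_bilin _ _).2.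
rewrite lfunE_lin // /dual_comul_fun -[contr x _]/(tlift _ _) linear_sum /=.
apply: dualP => y; rewrite sum_lfunE comp_lfunE lfunE /= {2}[x]r2v_sum.
rewrite mulr_suml linear_sum; apply: eq_bigr => i _.
rewrite -[tlift _ _]/(contr x _) contrE scale_lfunE comp_lfunE lfunE /=.
by rewrite dbasisE -scalerAl linearZ.
Qed.

Lemma contr_comulE x y f : contr x (dual_comul f) y = f (x * y).
Proof. by rewrite contr_comul comp_lfunE lfunE. Qed.

Lemma contrEE x y (t : tensor dual dual) :
  contr x t y = tlift (fun f g : dual => f x * g y : K^o) t.
Proof.
rewrite /contr (linear_tlift _ _ (f := fun g : dual => g y)); last by lin.
by apply: eq_tlift => f g; rewrite scale_lfunE.
Qed.

Lemma dual_comulA f :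
  \tsum_(x, y <- dual_comul f) \tsum_(x1, x2 <- dual_comul x)
    (x1 *t (x2 *t y)) =
  \tsum_(x, y <- dual_comul f) (x *t dual_comul y).
Proof.
apply: contr_inj => x; apply: contr_inj => y.
rewrite !(linear_tlift _ _ (@contr_linear _ x)).
rewrite !(linear_tlift _ _ (@contr_linear _ y)).
under eq_tlift => f1 f2.
  rewrite (linear_tlift _ _ (@contr_linear _ x)).
  rewrite (linear_tlift _ _ (@contr_linear _ y)).
  under eq_tlift => g1 g2 do
    rewrite contrE (lin_scale _ _ (@contr_linear _ y)) contrE scalerA.
  rewrite -(linear_tlift (W := K^o) (f := fun c => (c : K) *: f2)); last by lin.
  rewrite -contrEE contr_comulE.
  over.
apply: dualP => z.
rewrite !(linear_tlift _ _ (f := fun g : dual => g z)); try by lin.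
under eq_tlift => f1 f2 do rewrite scale_lfunE.
under [RHS]eq_tlift => f1 f2 do
  rewrite contrE (lin_scale _ _ (@contr_linear _ y)) scale_lfunE contr_comulE.
rewrite -(contrEE (x * y) z) contr_comulE -(contrEE x (y * z)) contr_comulE.
by rewrite mulrA.
Qed.

Lemma dual_counitl f :
  \tsum_(x, y <- dual_comul f) ((dual_counit x : K) *: y) = f.
Proof.
under eq_tlift => x y do rewrite dual_counitE.
by apply: dualP => x; rewrite -[tlift _ _]/(contr 1 _) contr_comulE mul1r.
Qed.

Lemma dual_counitr f :
  \tsum_(x, y <- dual_comul f) ((dual_counit y : K) *: x) = f.
Proof.
under eq_tlift => x y do rewrite dual_counitE.
apply: dualP => x.
rewrite (linear_tlift _ _ (f := fun g : dual => g x)); last by lin.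
under eq_tlift => g l do rewrite scale_lfunE [_ *: _]mulrC.
by rewrite -contrEE contr_comulE mulr1.
Qed.

Lemma dual_comul1 : dual_comul 1 = 1 *t 1.
Proof.
apply: contr_inj => x; apply: dualP => y.
by rewrite contr_comulE contrE scale_lfunE counitM.
Qed.

Lemma dual_comulM f g : dual_comul (f * g) =
  \tsum_(x, y <- dual_comul f) \tsum_(z, w <- dual_comul g)
    ((x * z) *t (y * w)).
Proof.
apply: contr_inj => x; apply: dualP => y; rewrite contr_comulE mulE comulM.
rewrite !tlift_tlift (linear_tlift _ _ (@contr_linear _ x)).
rewrite (linear_tlift _ _ (f := fun g : dual => g y)); last by lin.
under eq_tlift => x1 x2.
  rewrite tlift_tlift.
  under eq_tlift => y1 y2 do [rewrite tliftE; last by bil].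
  over.
under [RHS]eq_tlift => f1 f2.
  rewrite (linear_tlift _ _ (@contr_linear _ x)).
  rewrite (linear_tlift _ _ (f := fun g : dual => g y)); last by lin.
  under eq_tlift => g1 g2.
    rewrite contrE scale_lfunE !mulE [_ *: _]tlift_mul.
    under eq_tlift => x1 x2 do under eq_tlift => y1 y2 do rewrite mulrACA.
    over.
  rewrite tlift_exchange; under eq_tlift => x1 x2 do rewrite tlift_exchange.
  over.
rewrite [RHS]tlift_exchange; apply: eq_tlift => x1 x2.
rewrite [RHS]tlift_exchange; apply: eq_tlift => y1 y2.
by rewrite -tlift_mul -!contrEE !contr_comulE.
Qed.

Lemma dual_counit1 : dual_counit 1 = 1.
Proof. by rewrite dual_counitE counit1. Qed.

Lemma dual_counitM f g : dual_counit (f * g) = dual_counit f * dual_counit g.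
Proof. by rewrite !dual_counitE mulE comul1 tliftE //; bil. Qed.

Lemma dual_antipodel f :
  \tsum_(x, y <- dual_comul f) (dual_antipode x * y) = (dual_counit f : K)%:A.
Proof.
apply: dualP => h.
rewrite (linear_tlift _ _ (f := fun g : dual => g h)); last by lin.
under eq_tlift => g l do
  [rewrite mulE; under eq_tlift => x y do rewrite dual_antipodeE].
rewrite tlift_exchange.
under eq_tlift => x y do rewrite -contrEE contr_comulE.
rewrite -(linear_tlift _ _ (f := f)); last by lin.
by rewrite antipodel linearZ dual_counitE scale_lfunE [LHS]mulrC.
Qed.

Lemma dual_antipoder f :
  \tsum_(x, y <- dual_comul f) (x * dual_antipode y) = (dual_counit f : K)%:A.
Proof.
apply: dualP => h.
rewrite (linear_tlift _ _ (f := fun g : dual => g h)); last by lin.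
under eq_tlift => g l do
  [rewrite mulE; under eq_tlift => x y do rewrite dual_antipodeE].
rewrite tlift_exchange.
under eq_tlift => x y do rewrite -contrEE contr_comulE.
rewrite -(linear_tlift _ _ (f := f)); last by lin.
by rewrite antipoder linearZ dual_counitE scale_lfunE [LHS]mulrC.
Qed.

HB.instance Definition _ := Vector_isCoalgebra.Build K dual
  dual_comulA dual_counitl dual_counitr.
HB.instance Definition _ := isHopf.Build K dual
  dual_comul1 dual_comulM dual_counit1 dual_counitM
  dual_antipodel dual_antipoder.

End Dual.

Section HopfNotions.
Variable K : fieldType.
Implicit Types H B : hopfType K.

(* The algebra is semisimple as a left module over itself. *)
Definition left_ideal (A : falgType K) (I : {vspace A}) := (fullv * I <= I)%VS.

Definition semisimple_alg (A : falgType K) := forall I : {vspace A},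
  left_ideal I ->
  exists J : {vspace A},
    [/\ left_ideal J, (I + J = fullv)%VS & (I :&: J = 0)%VS].

Definition hopf_subalg H (A : {vspace H}) : Prop :=
  [/\ 1 \in A, (A * A <= A)%VS, (comul @: A <= tensv A A)%VS
    & (antipode @: A <= A)%VS].

(* A is stable under the adjoint actions of B *)
Definition normal_in H (A B : {vspace H}) : Prop :=
  forall h a, h \in B -> a \in A ->
    \tsum_(x, y <- comul h) (x * a * antipode y) \in A /\
    \tsum_(x, y <- comul h) (antipode x * a * y) \in A.

Definition augmentation H (A : {vspace H}) : {vspace H} :=
  (A :&: lker counit)%VS.

(* f restricts to a Hopf algebra map on the Hopf subalgebra A of H; as in
   ahom_in, the values of f outside of A are irrelevant.                     *)
Definition hopf_hom_in H B (A : {vspace H}) (f : 'Hom(H, B)) : Prop :=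
  [/\ ahom_in A f,
      forall a, a \in A -> comul (f a) = tmap f f (comul a),
      forall a, a \in A -> counit (f a) = counit a
    & forall a, a \in A -> antipode (f a) = f (antipode a)].

Definition hopf_hom H B (f : 'Hom(H, B)) : Prop := hopf_hom_in fullv f.

(* The quotient A / I of the Hopf subalgebra A of H is isomorphic to B: B is
   the image of a Hopf algebra map defined on A, with kernel I.              *)
Definition quotient_isom H (A I : {vspace H}) B : Prop :=
  exists f : 'Hom(H, B),
    [/\ hopf_hom_in A f, (f @: A = fullv)%VS & (A :&: lker f = I)%VS].

Definition trivial_quotient H (A I : {vspace H}) : Prop :=
  exists gT : finGroupType,
    quotient_isom A I (group_alg K gT) \/
    quotient_isom A I (dual (group_alg K gT)).

Definition trivial_subalg H (A : {vspace H}) : Prop := trivial_quotient A 0%VS.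

Definition rcoinv H B (f : 'Hom(H, B)) : {vspace H} :=
  lker (linfun (fun h : H => tmap idfun f (comul h) - h *t 1)).
Definition lcoinv H B (f : 'Hom(H, B)) : {vspace H} :=
  lker (linfun (fun h : H => tmap f idfun (comul h) - 1 *t h)).

Lemma rcoinvP H B (f : 'Hom(H, B)) h :
  (h \in rcoinv f) <-> tmap idfun f (comul h) = h *t 1.
Proof.
rewrite memv_ker lfunE_lin ?subr_eq0; first by split=> /eqP.
have L1 : linear (fun h : H => tmap idfun f (comul h)) by rewrite /tmap; lin.
have L2 : linear (fun h : H => h *t (1 : B)) by lin.
by move=> a x y; rewrite L1 L2 scalerBr opprD addrACA.
Qed.

Lemma lcoinvP H B (f : 'Hom(H, B)) h :
  (h \in lcoinv f) <-> tmap f idfun (comul h) = 1 *t h.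
Proof.
rewrite memv_ker lfunE_lin ?subr_eq0; first by split=> /eqP.
have L1 : linear (fun h : H => tmap f idfun (comul h)) by rewrite /tmap; lin.
have L2 : linear (fun h : H => (1 : B) *t h) by lin.
by move=> a x y; rewrite L1 L2 scalerBr opprD addrACA.
Qed.

(* A i is the term H_{i+1} of the chain, so that A 0 = H and A n = k. *)
Definition lower_semisolvable H : Prop :=
  exists (n : nat) (A : nat -> {vspace H}),
  [/\ A 0 = fullv, A n = 1%VS,
      forall i, (i <= n)%N -> hopf_subalg (A i)
    & forall i, (i < n)%N ->
      [/\ (A i.+1 <= A i)%VS, normal_in (A i.+1) (A i)
        & trivial_quotient (A i) (A i * augmentation (A i.+1))%VS]].

Definition upper_semisolvable H : Prop :=
  exists (n : nat) (Q : nat -> hopfType K) (f : forall i, 'Hom(Q i, Q i.+1)),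
  [/\ Q 0 = H, \dim {: Q n} = 1%N
    & forall i, (i < n)%N ->
      [/\ hopf_hom (f i), limg (f i) = fullv, rcoinv (f i) = lcoinv (f i)
        & trivial_subalg (rcoinv (f i))]].

Definition semisolvable H : Prop :=
  upper_semisolvable H \/ lower_semisolvable H.

End HopfNotions.

HB.mixin Record isYetterDrinfeld (K : fieldType) (A : hopfType K) V
    of Vector K V := {
  yd_act : A -> V -> V;
  yd_coact : 'Hom(V, tensor A V);
  yd_act_bilin : bilinear_for *:%R *:%R yd_act;
  yd_act1 : forall v : V, yd_act 1 v = v;
  yd_actM : forall (g h : A) (v : V), yd_act (g * h) v = yd_act g (yd_act h v);
  yd_coactA : forall v : V,
    \tsum_(x, w <- yd_coact v) \tsum_(x1, x2 <- comul x) (x1 *t (x2 *t w)) =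
    \tsum_(x, w <- yd_coact v) (x *t yd_coact w);
  yd_coact_counit : forall v : V,
    \tsum_(x, w <- yd_coact v) ((counit x : K) *: w) = v;
  yd_coact_act : forall (g : A) (v : V), yd_coact (yd_act g v) =
    \tsum_(g1, g' <- comul g) \tsum_(g2, g3 <- comul g')
      \tsum_(x, w <- yd_coact v) ((g1 * x * antipode g3) *t yd_act g2 w)
}.

#[short(type="ydType")]
HB.structure Definition YetterDrinfeld (K : fieldType) (A : hopfType K) :=
  { V of Vector K V & isYetterDrinfeld K A V }.

(* R is a Hopf algebra in the braided category of left-left Yetter-Drinfeld
   modules over A: it is a module and comodule algebra and coalgebra, and
   comul is multiplicative for the braided product of R (x) R (yd_comulM).   *)
HB.mixin Record isYDHopf (K : fieldType) (A : hopfType K) R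
    of AlgCoalgebra K R & YetterDrinfeld K A R := {
  yd_unit_act : forall g : A, yd_act g (1 : R) = (counit g : K)%:A;
  yd_mul_act : forall (g : A) (a b : R), yd_act g (a * b) =
    \tsum_(g1, g2 <- comul g) (yd_act g1 a * yd_act g2 b);
  yd_unit_coact : yd_coact (1 : R) = (1 : A) *t 1;
  yd_mul_coact : forall a b : R, yd_coact (a * b) =
    \tsum_(x, a0 <- yd_coact a) \tsum_(y, b0 <- yd_coact b)
      (((x : A) * y) *t (a0 * b0));
  yd_counit_act : forall (g : A) (a : R),
    counit (yd_act g a) = counit g * counit a;
  yd_comul_act : forall (g : A) (a : R), comul (yd_act g a) =
    \tsum_(g1, g2 <- comul g) \tsum_(a1, a2 <- comul a)
      (yd_act g1 a1 *t yd_act g2 a2);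
  yd_counit_coact : forall a : R,
    \tsum_(x, a0 <- yd_coact a) ((counit a0 : K) *: (x : A)) =
    (counit a : K)%:A;
  yd_comul_coact : forall a : R,
    \tsum_(x, a0 <- yd_coact a) ((x : A) *t comul a0) =
    \tsum_(a1, a2 <- comul a) \tsum_(x, b <- yd_coact a1)
      \tsum_(y, c <- yd_coact a2) (((x : A) * y) *t (b *t c));
  yd_comul1 : comul (1 : R) = 1 *t 1;
  yd_comulM : forall a b : R, comul (a * b) =
    \tsum_(a1, a2 <- comul a) \tsum_(b1, b2 <- comul b)
      \tsum_(x, a20 <- yd_coact a2)
        ((a1 * yd_act (x : A) (b1 : R)) *t ((a20 : R) * b2));
  yd_counit1 : counit (1 : R) = 1;
  yd_counitM : forall a b : R, counit (a * b) = counit a * counit b;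
  yd_antipode : 'End(R);
  yd_antipodel : forall a : R,
    \tsum_(a1, a2 <- comul a) (yd_antipode a1 * a2) = (counit a : K)%:A;
  yd_antipoder : forall a : R,
    \tsum_(a1, a2 <- comul a) (a1 * yd_antipode a2) = (counit a : K)%:A;
  yd_antipode_act : forall (g : A) (a : R),
    yd_antipode (yd_act g a) = yd_act g (yd_antipode a);
  yd_antipode_coact : forall a : R, yd_coact (yd_antipode a) =
    \tsum_(x, a0 <- yd_coact a) ((x : A) *t yd_antipode a0)
}.

#[short(type="ydHopfType")]
HB.structure Definition YDHopf (K : fieldType) (A : hopfType K) :=
  { R of AlgCoalgebra K R & YetterDrinfeld K A R & isYDHopf K A R }.

Section Biproduct.
Variables (K : fieldType) (A : hopfType K) (R : ydHopfType A).

Definition biprod := tensor R A.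
Implicit Types u v : biprod.

Definition biprod_mul u v : biprod :=
  \tsum_(a, g <- u) \tsum_(b, h <- v) \tsum_(g1, g2 <- comul g)
    ((a * yd_act g1 b) *t (g2 * h)).

Definition biprod_one : biprod := 1 *t 1.

Definition biprod_comul u : tensor biprod biprod :=
  \tsum_(a, g <- u) \tsum_(a1, a2 <- comul a) \tsum_(x, a20 <- yd_coact a2)
    \tsum_(g1, g2 <- comul g) ((a1 *t (x * g1)) *t (a20 *t g2)).

Definition biprod_counit u : K :=
  \tsum_(a, g <- u) (counit a * counit g : K^o).

Definition biprod_antipode u : biprod :=
  \tsum_(a, g <- u) \tsum_(x, a0 <- yd_coact a)
    biprod_mul (1 *t antipode (x * g)) (yd_antipode a0 *t 1).

(* H is isomorphic as a Hopf algebra to the biproduct R # A, whose structure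
   maps are those defined above.                                             *)
Definition biprod_isom (H : hopfType K) : Prop :=
  exists f : 'Hom(biprod, H),
    (lker f = 0 /\ limg f = fullv)%VS /\
    [/\ forall u v, f (biprod_mul u v) = f u * f v,
        f biprod_one = 1,
        forall u, comul (f u) = tmap f f (biprod_comul u),
        forall u, counit (f u) = biprod_counit u
      & forall u, antipode (f u) = f (biprod_antipode u)].

End Biproduct.

(* Main.v *)
(* The irreducible Yetter-Drinfeld submodules of H (under the adjoint action) of
   dimension less than q span a coideal subalgebra U. If p divides dim U, then H
   has a central grouplike of order p, and the quotient of dimension p q^2 is
   semisolvable; dually for the dual of H. Otherwise U and its analogue have
   dimension q or q^2, and their annihilators yield groups of p^2 grouplikes in
   the dual and in H. By a divisibility count these pair perfectly, so the
   inclusion of the group algebra in H splits, and by Radford's theorem H is the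
   biproduct of the coinvariants with this group algebra. *)
Require Import Defs.
From HB Require Import structures.
From Stdlib Require Import Classical.
From mathcomp Require Import all_boot all_order all_fingroup all_solvable all_algebra all_field zify ring.
Set Implicit Arguments. Unset Strict Implicit. Unset Printing Implicit Defensive.
Import GRing.Theory Num.Theory VectorInternalTheory.
Local Open Scope ring_scope.

(* Sweedler sums over a coproduct, and short names for the evaluation lemmas of
   linear maps. *)
Reserved Notation "\dsum_ ( x , y <- h ) E"
 (at level 41, E at level 41, x name, y name, h at level 50).
Local Notation "\dsum_ ( x , y <- h ) E" := (tlift (fun x y => E) (comul h)): ring_scope.
Local Notation clE := comp_lfunE.
Local Notation slE := scale_lfunE.
Local Notation alE := add_lfunE.
Local Notation olE := opp_lfunE.
Local Notation ilE := id_lfunE.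
Local Notation zlE := zero_lfunE.
Local Notation smE := sum_lfunE.
Local Notation clA := comp_lfunA.
Local Notation clDl := comp_lfunDl.
Local Notation clDr := comp_lfunDr.
Local Notation clZl := comp_lfunZl.
Local Notation clZr := comp_lfunZr.
Local Notation cl1l := comp_lfun1l.
Local Notation cl1r := comp_lfun1r.
Local Notation linE := lfunE_lin.
Local Notation tlE := linear_tlift.
Local Notation eqt := eq_tlift.
Local Notation tsC := tlift_exchange.
Local Notation lsE := linear_sum.
Local Notation tsT := tlift_tlift.
Local Notation tlf F := (linear_tlift _ _ (f := F)) (only parsing).
Tactic Notation "trans" open_constr(x) := transitivity x.

(** Dimensions are counted by traces: a coideal subalgebra has a normalised integral, multiplication
    by it is idempotent, and in characteristic 0 its trace, which is its rank, is a quotient of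
    dimensions. This requires an involutive antipode, that is, the theorem of Larson and Radford,
    whose positivity argument is carried to an arbitrary closed field through cyclotomic
    polynomials. Sorting the irreducible submodules by size requires that their dimensions divide
    dim H; this theorem of Etingof and Gelaki is proved with pairs of operators in place of the
    Drinfeld double. The bound on q has one origin: submodules of dimension less than q have
    dimension at most p^2, and p^4 < q makes the product of two of them small again, so that U is
    closed under multiplication. The delicate case is dim U = q. The annihilator then has dimension
    p^2 q, and its p^2 grouplikes, which are one-dimensional representations of its dual, may
    require a representation that is nontrivial on a central grouplike. In dimension p q^t the
    counterpart is an alternative between a central grouplike of the algebra and one of its dual. *)

(** * Traces of endomorphisms *)

Section Trace.
Variable K: fieldType.
Implicit Types U V W: vectType K.
Definition ltr V (f: 'End(V)): K := \tr (f2mx f).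
Lemma lfun_r2v U V (f: 'Hom(U, V)) u: v2r (f u) = v2r u *m f2mx f.
by rewrite unlock /= ?r2vK. Qed.
Lemma f2mx_comp U V W (f: 'Hom(V, W)) (g: 'Hom(U, V)) :
 f2mx (f \o g)%VF = f2mx g *m f2mx f.
have [rowP _] := row_matrixP (f2mx (f \o g)%VF) (f2mx g *m f2mx f).
apply: rowP => i; rewrite !rowE mulmxA.
have E u (h: 'Hom(U, W)): u *m f2mx h = v2r (h (r2v u)).
 by rewrite unlock /= !r2vK.
by rewrite E clE !lfun_r2v r2vK.
Qed.
Lemma ltrC U V (f: 'Hom(U, V)) (g: 'Hom(V, U)): ltr (f \o g)%VF = ltr (g \o f)%VF.
by rewrite /ltr !f2mx_comp mxtrace_mulC. Qed.
Lemma ltrE V (f: 'End(V)): ltr f = \sum_i v2r (f (r2v (delta_mx 0 i))) 0 i.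
apply: eq_bigr => i _; rewrite lfun_r2v r2vK -rowE.
by rewrite mxE.
Qed.
Lemma ltr_linear V: linear_for *%R (@ltr V).
move=> a f g; rewrite !ltrE mulr_sumr -big_split; apply: eq_bigr => i _ /=.
by rewrite alE slE linearP !mxE.
Qed.
HB.instance Definition _ V :=
 GRing.isLinear.Build K 'End(V) K *%R (@ltr V) (@ltr_linear V).
Lemma ltr1 V: ltr (\1: 'End(V)) = (\dim {:V})%:R.
rewrite ltrE (eq_bigr (fun=> 1)) => [|i _]; last by rewrite ilE r2vK mxE !eqxx.
by rewrite sumr_const card_ord dimvf.
Qed.
Definition rk1 U V (phi: 'Hom(U, K^o)) (v: V): 'Hom(U, V) :=
 linfun (fun u => (phi u: K) *: v).
Lemma rk1E U V (phi: 'Hom(U, K^o)) (v: V) u: rk1 phi v u = (phi u: K) *: v.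
by rewrite linE //; lin. Qed.
Lemma ltr_rk1 V (phi: 'Hom(V, K^o)) (v: V): ltr (rk1 phi v) = phi v.
rewrite ltrE {2}[v]r2v_sum lsE; apply: eq_bigr => i _.
by rewrite rk1E linearZ linearZ /= mxE mulrC.
Qed.
Lemma comp_rk1 U V W (f: 'Hom(V, W)) (phi: 'Hom(U, K^o)) v :
 (f \o rk1 phi v = rk1 phi (f v))%VF.
by apply/lfunP=> u; rewrite clE !rk1E linearZ. Qed.
Lemma lfun_dual_basis V W I (r: seq I) (phi: I -> 'Hom(V, K^o)) (v: I -> V) :
 (forall x, \sum_(i <- r) (phi i x: K) *: v i = x) ->
 forall f: 'Hom(V, W), f = \sum_(i <- r) rk1 (phi i) (f (v i)).
move=> vP f; apply/lfunP=> x; rewrite smE -{1}[x]vP lsE.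
by apply: eq_bigr => i _; rewrite rk1E linearZ.
Qed.
(** The family need not be a basis: any expression of the identity as a sum of rank one maps
    computes the trace. This admits the dual bases of a bilinear form. *)
Lemma ltr_dual_basis V I (r: seq I) (phi: I -> 'Hom(V, K^o)) (v: I -> V) :
 (forall x, \sum_(i <- r) (phi i x: K) *: v i = x) ->
 forall f: 'End(V), ltr f = \sum_(i <- r) (phi i (f (v i)): K).
move=> vP f; rewrite {1}(lfun_dual_basis vP f) lsE.
by apply: eq_bigr => i _; rewrite /= ltr_rk1.
Qed.
(** f factors through its image as h (g f) with (g f) h the identity there, and the trace is cyclic.
    In characteristic 0 this turns the trace of a projection into a dimension formula; most
    numerical results below come from it. *)
Lemma ltr_idem V (f: 'End(V)): (f \o f)%VF = f -> ltr f = (\dim (limg f))%:R.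
move=> ff; pose U := limg f.
pose g: 'Hom(V, subvs_of U) := linfun (vsproj U).
pose h: 'Hom(subvs_of U, V) := linfun vsval.
have hg: f = (h \o (g \o f))%VF.
 by apply/lfunP=> x; rewrite !clE !lfunE /= vsprojK ?memv_img ?memvf.
have gh: ((g \o f) \o h)%VF = \1%VF.
 apply/lfunP=> x; rewrite !clE !lfunE /=.
 have /memv_imgP[y _ E] := subvsP x.
 by rewrite E -[f (f y)]clE ff -E vsvalK.
by rewrite {1}hg ltrC gh ltr1 dimvf /dim /=.
Qed.
Lemma lin_sum1 U V (f: U -> V) I (r: seq I) (F: I -> U): linear f ->
 f (\sum_(i <- r) F i) = \sum_(i <- r) f (F i).
move=> fL; rewrite -(linE fL) lsE.
by apply: eq_bigr => i _; exact: linE.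
Qed.
End Trace.

(** * Sweedler calculus, separation by functionals, the antipode *)

Section Sweedler.
Variables (K: fieldType) (H: hopfType K) (W: vectType K).
Implicit Types (x y g h: H) (f: dual H).
Local Notation S := (@antipode K H).
(** Coassociativity in the form used throughout: a trilinear expression in three Sweedler components
    may be bracketed either way, so that a neighbouring pair can be collapsed by the counit or the
    antipode. *)
Lemma tsumA (F: H -> H -> H -> W) h :
 (forall b c, linear (fun a => F a b c)) ->
 (forall a c, linear (fun b => F a b c)) -> (forall a b, linear (F a b)) ->
 \dsum_(x, y <- h) \dsum_(x1, x2 <- x) F x1 x2 y =
 \dsum_(x, y <- h) \dsum_(y1, y2 <- y) F x y1 y2.
move=> F1 F2 F3; pose G x (t: tensor H H): W := \tsum_(y, z <- t) F x y z.
have GL: bilin G.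
 by split=> [t|x]; rewrite /G; [apply: lin_tliftr => y z; apply: F1 | lin].
have Gt x y z: G x (y *t z) = F x y z by rewrite /G tliftE //; split.
have := congr1 (tlift G) (comulA h); rewrite !tsT.
under eqt => x y do
 [rewrite tsT; under eqt => x1 x2 do rewrite tliftE // Gt].
by move=> ->; apply: eqt => x y; rewrite tliftE.
Qed.
Lemma tsum_el (F: H -> W) h :
 linear F -> \dsum_(x, y <- h) (counit x: K) *: F y = F h.
move=> FL; rewrite -{2}[h]counitl (tlE _ _ FL).
by apply: eqt => x y; rewrite (lin_scale _ _ FL).
Qed.
Lemma tsum_er (F: H -> W) h :
 linear F -> \dsum_(x, y <- h) (counit y: K) *: F x = F h.
move=> FL; rewrite -{2}[h]counitr (tlE _ _ FL).
by apply: eqt => x y; rewrite (lin_scale _ _ FL).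
Qed.
Lemma tsum_antil (F: H -> W) h: linear F ->
 \dsum_(x, y <- h) F (S x * y) = (counit h: K) *: F 1.
by move=> FL; rewrite -(tlE _ _ FL) antipodel (lin_scale _ _ FL).
Qed.
Lemma tsum_antir (F: H -> W) h: linear F ->
 \dsum_(x, y <- h) F (x * S y) = (counit h: K) *: F 1.
by move=> FL; rewrite -(tlE _ _ FL) antipoder (lin_scale _ _ FL).
Qed.
Lemma tsumM (F: H -> H -> W) g h: bilin F ->
 \dsum_(x, y <- (g * h)) F x y =
 \dsum_(x, y <- g) \dsum_(z, w <- h) F (x * z) (y * w).
move=> FL; rewrite comulM tsT; apply: eqt => x y.
by rewrite tsT; apply: eqt => z w; rewrite tliftE.
Qed.
Lemma tsum1 (F: H -> H -> W): bilin F ->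
 \dsum_(x, y <- (1: H)) F x y = F 1 1.
by move=> FL; rewrite comul1 tliftE. Qed.
End Sweedler.

Section Separation.
Variables (K: fieldType).
Lemma vect_sep (V: vectType K) (x y: V) :
 (forall f: 'Hom(V, K^o), f x = f y) -> x = y.
move=> xy; rewrite [x]r2v_sum [y]r2v_sum; apply: eq_bigr => i _; congr (_ *: _).
have := xy (linfun (fun v: V => v2r v 0 i: K^o)).
by rewrite !linE // => a u v; rewrite linearP !mxE.
Qed.
Lemma tens_sep (U V: vectType K) (s t: tensor U V) :
 (forall (f: 'Hom(U, K^o)) (g: 'Hom(V, K^o)),
   \tsum_(x, y <- s) (f x * g y: K^o) = \tsum_(x, y <- t) (f x * g y: K^o)) ->
 s = t.
move=> st; apply/matrixP=> i j.
pose f: 'Hom(U, K^o) := linfun (fun v: U => v2r v 0 i: K^o).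
pose g: 'Hom(V, K^o) := linfun (fun v: V => v2r v 0 j: K^o).
have E (r: tensor U V): \tsum_(x, y <- r) (f x * g y: K^o) = (r: 'M_(_, _)) i j.
 rewrite /tlift (bigD1 i) //= (bigD1 j) //= !big1 ?addr0.
 - rewrite !linE ?r2vK ?mxE ?eqxx ?mulr1 ?[_ *: _]mulr1 //;
   by move=> a u v; rewrite linearP !mxE.
 - move=> i' /negPf i'i; rewrite big1 // => j' _; rewrite linE.
   by rewrite r2vK mxE eq_sym i'i andbF mul0r scaler0.
  by move=> a u v; rewrite linearP !mxE.
 - move=> j' /negPf j'j; rewrite [g _]linE.
   by rewrite r2vK mxE eq_sym j'j andbF mulr0 scaler0.
  by move=> a u v; rewrite linearP !mxE.
by rewrite -!E st.
Qed.
End Separation.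

Section Antipode.
Variables (K: fieldType) (H: hopfType K).
Implicit Types (x y g h: H) (f: dual H).
Local Notation S := (@antipode K H).
Lemma dualM (f g: dual H) h: (f * g) h = \dsum_(x, y <- h) (f x * g y: K^o).
exact: dual_mulE. Qed.
Lemma dual1 h: (1: dual H) h = counit h. by []. Qed.
Lemma dual_counitE' f: counit f = f 1. exact: dual_counitE. Qed.
Lemma dual_SE f x: (antipode f: dual H) x = f (S x).
exact: dual_antipodeE. Qed.
Lemma dcE f x y :
 \dsum_(f1, f2 <- f) ((f1: dual H) x * (f2: dual H) y: K^o) = f (x * y).
by rewrite -contrEE contr_comulE. Qed.
Lemma antipode1: S 1 = 1.
have := antipodel (1: H); rewrite tsum1; last bil.
by rewrite mulr1 counit1 scale1r.
Qed.
(** The convolution argument: the sum [E] of S(y1) S(x1) x2 y2 S(x3 y3) collapses from the right to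
    S(y) S(x) and from the left to S(x y). *)
Lemma antipodeM x y: S (x * y) = S y * S x.
pose E := \dsum_(x1, x2 <- x) \dsum_(y1, y2 <- y)
 (S y1 * S x1 * \dsum_(u, v <- (x2 * y2)) (u * S v)).
have -> : S y * S x = E.
 trans (\dsum_(x1, x2 <- x) \dsum_(y1, y2 <- y)
   (counit x2: K) *: ((counit y2: K) *: (S y1 * S x1))).
  rewrite -(tsum_er (F:=fun a => S y * S a)); last lin.
  apply: eqt => x1 x2; rewrite -(tlf (fun z => _ *: z)); last lin.
  congr (_ *: _).
  by rewrite (tsum_er (F:=fun a => S a * S x1)) //; lin.
 apply: eqt => x1 x2; apply: eqt => y1 y2.
 by rewrite antipoder counitM -scalerAr mulr1 scalerA.
rewrite /E; under [RHS]eqt => x1 x2 do under eqt => y1 y2 do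
 [rewrite (tsumM (F:=fun u v => u * S v)); last bil].
trans (\dsum_(x1, x2 <- x) \dsum_(x3, x4 <- x2)
  \dsum_(y1, y2 <- y) \dsum_(y3, y4 <- y2)
   (S y1 * (S x1 * x3) * y3 * S (x4 * y4))); last first.
 apply: eqt => x1 x2; rewrite [LHS]tsC.
 apply: eqt => y1 y2.
 rewrite (tlf (fun z => S y1 * S x1 * z)); last lin.
 apply: eqt => x3 x4.
 rewrite (tlf (fun z => S y1 * S x1 * z)); last lin.
 by apply: eqt => y3 y4; rewrite !mulrA.
rewrite -(tsumA (F:=fun x1 x3 x4 => \dsum_(y1, y2 <- y)
  \dsum_(y3, y4 <- y2) (S y1 * (S x1 * x3) * y3 * S (x4 * y4)))); try by move=> *; lin.
under [RHS]eqt => x1 x2.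
 rewrite (tsum_antil (F:=fun z => \dsum_(y1, y2 <- y)
   \dsum_(y3, y4 <- y2) (S y1 * z * y3 * S (x2 * y4)))); last lin.
 over.
rewrite (tsum_el (F:=fun z => \dsum_(y1, y2 <- y)
   \dsum_(y3, y4 <- y2) (S y1 * 1 * y3 * S (z * y4)))); last lin.
rewrite -(tsumA (F:=fun y1 y3 y4 => S y1 * 1 * y3 * S (x * y4))); try by move=> *; lin.
under [RHS]eqt => y1 y2.
 under eqt => y3 y4 do rewrite mulr1.
 rewrite (tsum_antil (F:=fun z => z * S (x * y2))); last lin.
 rewrite mul1r. over.
by rewrite (tsum_el (F:=fun z => S (x * z))) //; lin.
Qed.
Lemma counit_antipode x: counit (S x) = counit x.
have := congr1 counit (antipodel x).
rewrite linearZ /= counit1 (tlf (@counit K H)); last lin.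
under eqt => a b do rewrite counitM mulrC -[_ * _]/((counit b: K) *: (counit (S a): K^o)).
rewrite (tsum_er (F:=fun a => counit (S a))); last lin.
by move=> ->; rewrite [_ *: _]mulr1.
Qed.
End Antipode.

Section Antipode2.
Variables (K: fieldType) (H: hopfType K).
Implicit Types (x y g h: H) (f: dual H).
Local Notation S := (@antipode K H).
(** Tested against functionals f and g, this is [antipodeM] for the dual Hopf algebra. *)
Lemma comul_antipode x: comul (S x) = \dsum_(a, b <- x) (S b *t S a).
apply: tens_sep => f g.
trans (((f: dual H) * (g: dual H)) (S x)); first by rewrite dualM.
rewrite -dual_SE antipodeM dualM tsT.
apply: eqt => a b; rewrite tliftE; last bil.
by rewrite !dual_SE mulrC.
Qed.
Lemma tsumS (W: vectType K) (F: H -> H -> W) x: bilin F ->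
 \dsum_(a, b <- S x) F a b = \dsum_(a, b <- x) F (S b) (S a).
move=> FL; rewrite comul_antipode tsT.
by apply: eqt => a b; rewrite tliftE.
Qed.
End Antipode2.

(** * Translations by functionals, dual bases *)

Section Translations.
Variables (K: fieldType) (H: hopfType K).
Implicit Types (x y h: H) (f g: dual H).
Local Notation S := (@antipode K H).
(** [lt f] and [rt f] are the transposes of left and right multiplication by f on the dual.
    Consequently [lt] reverses products, [rt] preserves them, and the two commute. *)
Definition lt f: 'End(H) := linfun (fun x => \dsum_(x1, x2 <- x) (f x1: K) *: x2).
Definition rt f: 'End(H) := linfun (fun x => \dsum_(x1, x2 <- x) (f x2: K) *: x1).
Lemma ltE f x: lt f x = \dsum_(x1, x2 <- x) (f x1: K) *: x2.
by rewrite linE //; lin. Qed.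
Lemma rtE f x: rt f x = \dsum_(x1, x2 <- x) (f x2: K) *: x1.
by rewrite linE //; lin. Qed.
Lemma lt_linear: linear lt.
move=> a f g; apply/lfunP=> x; rewrite alE slE !ltE.
have L: linear (fun f: dual H => \dsum_(x1, x2 <- x) (f x1: K) *: x2) by lin.
exact: L.
Qed.
Lemma rt_linear: linear rt.
move=> a f g; apply/lfunP=> x; rewrite alE slE !rtE.
have L: linear (fun f: dual H => \dsum_(x1, x2 <- x) (f x2: K) *: x1) by lin.
exact: L.
Qed.
HB.instance Definition _ :=
 GRing.isLinear.Build K (dual H) 'End(H) *:%R lt lt_linear.
HB.instance Definition _ :=
 GRing.isLinear.Build K (dual H) 'End(H) *:%R rt rt_linear.
Lemma dual_lt f g x: g (lt f x) = (f * g) x.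
rewrite ltE dualM (tlf (g)); last lin.
by apply: eqt => a b; rewrite linearZ.
Qed.
Lemma dual_rt f g x: g (rt f x) = (g * f) x.
rewrite rtE dualM (tlf (g)); last lin.
by apply: eqt => a b; rewrite linearZ mulrC.
Qed.
Lemma ltM f g x: lt (f * g) x = lt g (lt f x).
by apply: vect_sep => l; rewrite !dual_lt mulrA. Qed.
Lemma rtM f g x: rt (f * g) x = rt f (rt g x).
by apply: vect_sep => l; rewrite !dual_rt mulrA. Qed.
Lemma lt1 x: lt 1 x = x.
by apply: vect_sep => l; rewrite dual_lt mul1r. Qed.
Lemma rt1 x: rt 1 x = x.
by apply: vect_sep => l; rewrite dual_rt mulr1. Qed.
Lemma lt_rtC f g x: lt f (rt g x) = rt g (lt f x).
by apply: vect_sep => l; rewrite dual_rt !dual_lt dual_rt mulrA.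
Qed.
Lemma counit_lt f x: counit (lt f x) = f x.
by rewrite -dual1 dual_lt mulr1. Qed.
Lemma counit_rt f x: counit (rt f x) = f x.
by rewrite -dual1 dual_rt mul1r. Qed.
Lemma lt_mul f x y :
 lt f (x * y) = \dsum_(f1, f2 <- f) (lt f1 x * lt f2 y).
rewrite ltE (tsumM (F:=fun a b => (f a: K) *: b)); last bil.
trans (\dsum_(x1, x2 <- x) \dsum_(y1, y2 <- y)
 \dsum_(f1, f2 <- f) ((((f1: dual H) x1 * (f2: dual H) y1: K)) *: (x2 * y2))).
 apply: eqt => x1 x2; apply: eqt => y1 y2.
 rewrite -dcE -(tlE (W:=K^o) (f:=fun c => (c: K) *: (x2 * y2))) //.
 by lin.
under eqt => x1 x2 do rewrite tsC.
rewrite tsC; apply: eqt => f1 f2.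
rewrite !ltE (tlf (fun z => z * _)); last lin.
apply: eqt => x1 x2.
rewrite (tlf (fun z => _ * z)); last lin.
by apply: eqt => y1 y2; rewrite -scalerAl -scalerAr scalerA.
Qed.
Lemma rt_mul f x y :
 rt f (x * y) = \dsum_(f1, f2 <- f) (rt f1 x * rt f2 y).
rewrite rtE (tsumM (F:=fun a b => (f b: K) *: a)); last bil.
trans (\dsum_(x1, x2 <- x) \dsum_(y1, y2 <- y)
 \dsum_(f1, f2 <- f) ((((f1: dual H) x2 * (f2: dual H) y2: K)) *: (x1 * y1))).
 apply: eqt => x1 x2; apply: eqt => y1 y2.
 rewrite -dcE -(tlE (W:=K^o) (f:=fun c => (c: K) *: (x1 * y1))) //.
 by lin.
under eqt => x1 x2 do rewrite tsC.
rewrite tsC; apply: eqt => f1 f2.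
rewrite !rtE (tlf (fun z => z * _)); last lin.
apply: eqt => x1 x2.
rewrite (tlf (fun z => _ * z)); last lin.
by apply: eqt => y1 y2; rewrite -scalerAl -scalerAr scalerA.
Qed.
End Translations.

Section MoreLinear.
Variables (K: fieldType) (H: hopfType K).
Lemma lin_lt (V: lmodType K) (F: V -> dual H): linear F -> linear (fun x => lt (F x)).
by move=> FL a x y; rewrite FL linearP. Qed.
Lemma lin_rt (V: lmodType K) (F: V -> dual H): linear F -> linear (fun x => rt (F x)).
by move=> FL a x y; rewrite FL linearP. Qed.
Lemma lin_compl (V: lmodType K) (U U' W: vectType K) (F: V -> 'Hom(U', W)) (g: 'Hom(U, U')) :
 linear F -> linear (fun x => (F x \o g)%VF).
by move=> FL a x y; rewrite FL clDl clZl. Qed.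
Lemma lin_compr (V: lmodType K) (U U' W: vectType K) (F: V -> 'Hom(U, U')) (g: 'Hom(U', W)) :
 linear F -> linear (fun x => (g \o F x)%VF).
by move=> FL a x y; rewrite FL clDr clZr. Qed.
Lemma lin_ltr (V: lmodType K) (U: vectType K) (F: V -> 'End(U)) :
 linear F -> linear (fun x => ltr (F x): K^o).
by move=> FL a x y; rewrite FL linearP. Qed.
Lemma lin_amull (V: lmodType K) (A: falgType K) (F: V -> A) :
 linear F -> linear (fun x => amull (F x)).
by move=> FL a x y; rewrite FL linearP. Qed.
Lemma lin_amulr (V: lmodType K) (A: falgType K) (F: V -> A) :
 linear F -> linear (fun x => amulr (F x)).
by move=> FL a x y; rewrite FL linearP. Qed.
End MoreLinear.
Ltac lin2 := repeat first
 [ apply: lin_id | apply: lin_tensl | apply: lin_tensr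
 | apply: lin_mull | apply: lin_mulr
 | apply: lin_scalel | apply: lin_scaler
 | apply: lin_lt | apply: lin_rt | apply: lin_compl | apply: lin_compr
 | apply: lin_ltr | apply: lin_amull | apply: lin_amulr
 | apply: lin_lfun | apply: lin_eval | apply: lin_tlift
 | apply: lin_tliftr => ? ? ].
Ltac bil2 := split=> ?; cbv beta; lin2.

Section DualBasis.
Variables (K: fieldType) (H: hopfType K).
Implicit Types (x y h: H) (f: dual H).
Definition hbas (i: 'I_(dim H)): H := r2v (delta_mx 0 i).
Lemma hbas_sum x: x = \sum_i (@dbasis K H i x: K) *: hbas i.
by rewrite {1}[x]r2v_sum; apply: eq_bigr => i _; rewrite dbasisE. Qed.
Lemma dbasis_sum f: f = \sum_i (f (hbas i): K) *: @dbasis K H i.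
apply: dualP => x; rewrite smE {1}[x]hbas_sum lsE.
by apply: eq_bigr => i _; rewrite linearZ slE [LHS]mulrC.
Qed.
(** All second components become left translates of x. A sum over a coproduct can thus be kept
    inside a subspace that contains x and is stable under [lt]. *)
Lemma tsum_hbasl (W: vectType K) (F: H -> H -> W) x: bilin F ->
 \dsum_(a, b <- x) F a b = \sum_i F (hbas i) (lt (@dbasis K H i) x).
case=> F1 F2; under [RHS]eq_bigr => i _ do
 [rewrite ltE (tlE _ _ (F2 _));
  under eqt => a b do rewrite (lin_scale _ _ (F2 _))].
rewrite -tlift_sumr; apply: eqt => a b.
rewrite {1}[a]hbas_sum -[F _ b](linE (F1 b)) lsE.
by apply: eq_bigr => i _; rewrite linearZ /= (linE (F1 b)).
Qed.
Lemma dual_eval (phi: 'Hom(dual H, K^o)): exists y, forall f, phi f = f y.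
exists (\sum_i (phi (@dbasis K H i): K) *: hbas i) => f.
rewrite {1}[f]dbasis_sum !lsE; apply: eq_bigr => i _.
by rewrite !linearZ /= [LHS]mulrC.
Qed.
Lemma dim_dual: \dim {: dual H} = \dim {: H}.
by rewrite !dimvf /dim /= muln1. Qed.
Lemma ltr_dualmap (A: 'End(H)) (B: 'End(dual H)) :
 (forall f: dual H, B f = (f \o A)%VF) -> ltr B = ltr A.
move=> BA; pose ev (i: 'I_(dim H)): 'Hom(dual H, K^o) := linfun (fun f: dual H => f (hbas i)).
have evE i f: ev i f = f (hbas i) by rewrite linE //; lin.
rewrite (ltr_dual_basis (r:=index_enum _) (phi:=ev) (v:=@dbasis K H)); last first.
 by move=> f; rewrite [RHS]dbasis_sum; apply: eq_bigr => i _; rewrite evE.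
rewrite (ltr_dual_basis (r:=index_enum _) (phi:=@dbasis K H) (v:=hbas)); last first.
 by move=> f; rewrite -hbas_sum.
by apply: eq_bigr => i _; rewrite evE BA clE.
Qed.
End DualBasis.

(** * Complete reducibility by averaging, Schur's lemma *)

Section OperatorModules.
Variables (K: fieldType) (I: Type).
(* The common framework for the modules
  over an algebra and for the Yetter-Drinfeld modules *)
Record opmod := OpMod { ocar: vectType K; oop: I -> 'End(ocar) }.
Implicit Types V W: opmod.
Definition stable V (U: {vspace ocar V}) :=
 forall i u, u \in U -> oop V i u \in U.
Definition omhom V W (f: 'Hom(ocar V, ocar W)) :=
 forall i u, f (oop V i u) = oop W i (f u).
(** Composing with the projection makes the definition total; the operators are the restrictions
    only when U is stable. *)
Definition submod V (U: {vspace ocar V}): opmod :=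
 OpMod (fun i => linfun (fun u: subvs_of U => vsproj U (oop V i (vsval u)))).
Definition oirr V := (0 < \dim {:ocar V})%N /\
 forall U: {vspace ocar V}, stable U -> U = 0%VS \/ U = fullv.
Definition oinj V (U: {vspace ocar V}): 'Hom(ocar (submod U), ocar V) := linfun vsval.
Lemma oopE V (U: {vspace ocar V}) i (u: subvs_of U) :
 oop (submod U) i u = vsproj U (oop V i (vsval u)).
by rewrite linE // => a x y; rewrite !linearP.
Qed.
Lemma oinjE V (U: {vspace ocar V}) (u: subvs_of U): oinj U u = vsval u.
by rewrite lfunE. Qed.
Lemma oinj_hom V (U: {vspace ocar V}): stable U -> omhom (oinj U).
by move=> sU i u; rewrite !oinjE oopE vsprojK // sU // subvsP.
Qed.
Lemma omhom_comp V1 V2 V3 (f: 'Hom(ocar V2, ocar V3)) (g: 'Hom(ocar V1, ocar V2)) :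
 omhom f -> omhom g -> omhom (f \o g)%VF.
by move=> fH gH i u; rewrite !clE gH fH. Qed.
Lemma omhom1 V: omhom (\1%VF: 'End(ocar V)).
by move=> i u; rewrite !ilE. Qed.
Lemma stable_ker V W (f: 'Hom(ocar V, ocar W)): omhom f -> stable (lker f).
by move=> fH i u; rewrite !memv_ker fH => /eqP->; rewrite linear0.
Qed.
Lemma stable_img V W (f: 'Hom(ocar V, ocar W)) (U: {vspace ocar V}) :
 omhom f -> stable U -> stable (f @: U)%VS.
move=> fH sU i _ /memv_imgP[u uU ->]; rewrite -fH.
exact: memv_img (sU _ _ uU).
Qed.
Lemma stable_full V: stable (fullv: {vspace ocar V}).
by move=> i u _; rewrite memvf. Qed.
Lemma schur_iso V W (f: 'Hom(ocar V, ocar W)): oirr V -> oirr W -> omhom f ->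
 f != 0 -> lker f = 0%VS /\ limg f = fullv.
move=> [_ iV] [_ iW] fH f0; split.
 case: (iV _ (stable_ker fH)) => // kf; case/eqP: f0; apply/lfunP=> u.
 by rewrite zlE; apply/eqP; rewrite -memv_ker kf memvf.
case: (iW _ (stable_img fH (@stable_full V))) => // If; case/eqP: f0.
apply/lfunP=> u; rewrite zlE; apply/eqP; rewrite -memv0 -If.
exact/memv_img/memvf.
Qed.

Section SemiSimple.
Variable good: opmod -> Prop.
Hypothesis good_sub: forall V (U: {vspace ocar V}), good V -> stable U -> good (submod U).
Variable avg: forall V W, 'Hom(ocar V, ocar W) -> 'Hom(ocar V, ocar W).
Hypothesis avg_hom: forall V W (E: 'Hom(ocar V, ocar W)),
 good V -> good W -> omhom (avg (V:=V) (W:=W) E).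
Hypothesis avg_id: forall V W (E: 'Hom(ocar V, ocar W)),
 good V -> good W -> omhom E -> avg E = E.
Hypothesis avg_nat: forall V V' W (E: 'Hom(ocar V, ocar W)) (f: 'Hom(ocar V', ocar V)),
 good V -> good V' -> good W -> omhom f -> avg (E \o f)%VF = (avg E \o f)%VF.
Definition odecomp V (J: finType) (M: J -> opmod)
  (inc: forall j, 'Hom(ocar (M j), ocar V)) (prj: forall j, 'Hom(ocar V, ocar (M j))) :=
 [/\ forall j, good (M j) /\ oirr (M j),
   forall j, omhom (inc j), forall j, omhom (prj j),
   forall j, (prj j \o inc j = \1)%VF & \sum_j (inc j \o prj j)%VF = \1%VF].
(** Maschke's argument with an abstract averaging operator: averaging a linear projection onto U
    gives an equivariant one, since averaging is compatible with the inclusion of U and fixes the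
    identity. It is used with Casimir elements for modules over an algebra and with integrals for
    Yetter-Drinfeld modules. *)
Lemma retract V (U: {vspace ocar V}): good V -> stable U ->
 exists P: 'Hom(ocar V, ocar (submod U)), omhom P /\ (P \o oinj U = \1)%VF.
move=> gV sU; have gU := good_sub gV sU.
pose E: 'Hom(ocar V, ocar (submod U)) := linfun (vsproj U).
exists (avg E); split; first exact: avg_hom.
rewrite -avg_nat //; last exact: oinj_hom.
have -> : (E \o oinj U = \1)%VF.
 by apply/lfunP=> u; rewrite clE ilE oinjE lfunE /= vsvalK.
by apply: avg_id => //; apply: omhom1.
Qed.
Lemma odecomposition V: good V -> exists (J: finType) (M: J -> opmod) inc prj,
 @odecomp V J M inc prj.
have [n] := ubnP (\dim {:ocar V}); elim: n V => // n IHn V leVn gV.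
have [V0 | V0] := posnP (\dim {:ocar V}).
 exists void, (fun=> V), (fun=> \1%VF), (fun=> \1%VF); split; try by case.
 rewrite big_pred0; last by case.
 apply/lfunP=> u; move/eqP: V0; rewrite dimv_eq0 => /eqP V0.
 by have := memvf u; rewrite V0 memv0 => /eqP->; rewrite !linear0.
have [iV | iV] := classic (oirr V).
 exists unit, (fun=> V), (fun=> \1%VF), (fun=> \1%VF); split=> //.
 - by move=> _; apply: omhom1.
 - by move=> _; apply: omhom1.
 - by move=> _; rewrite cl1l.
 by rewrite (bigD1 tt) //= big1 ?addr0 ?cl1l // => -[].
have [U [sU U0 U1]]: exists U: {vspace ocar V}, [/\ stable U, U != 0%VS & U != fullv].
 apply: NNPP => nU; apply: iV; split=> // U sU.
 apply: NNPP => U01; apply: nU; exists U; split=> //.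
  by apply/eqP=> E; apply: U01; left.
 by apply/eqP=> E; apply: U01; right.
have [P [Ph Pi]] := retract gV sU.
pose U' := lker P; have sU': stable U' by apply: stable_ker.
have Pu (u: subvs_of U): P (vsval u) = u.
 by have /lfunP/(_ u) := Pi; rewrite clE ilE oinjE.
pose Q: 'End(ocar V) := (\1 - (oinj U \o P))%VF.
have QU' x: Q x \in U'.
 by rewrite memv_ker alE olE ilE clE oinjE linearB /= Pu subrr.
pose P': 'Hom(ocar V, ocar (submod U')) := linfun (fun x => vsproj U' (Q x)).
have P'E x: P' x = vsproj U' (Q x).
 by rewrite linE // => a u v; rewrite !linearP.
have QH: omhom (Q: 'Hom(ocar V, ocar V)).
 move=> i u; rewrite !(alE, olE, ilE, clE) Ph (oinj_hom sU).
 by rewrite linearB.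
have P'h: omhom P'.
 move=> i u; rewrite P'E QH P'E oopE vsprojK //.
have P'i: (P' \o oinj U' = \1)%VF.
 apply/lfunP=> u; rewrite clE ilE oinjE P'E.
 rewrite alE olE ilE clE.
 by have := subvsP u; rewrite memv_ker => /eqP->; rewrite linear0 subr0 vsvalK.
have sum1: ((oinj U \o P) + (oinj U' \o P') = \1)%VF.
 apply/lfunP=> x; rewrite alE !clE !oinjE P'E vsprojK //.
 by rewrite !(alE, olE, ilE, clE) oinjE addrC subrK.
have dimU: (\dim U + \dim U' = \dim {:ocar V})%N.
 rewrite -(limg_ker_dim P fullv) capfv addnC; congr (_ + _)%N.
 have -> : limg P = fullv.
  apply/eqP; rewrite eqEsubv subvf /=; apply/subvP=> u _.
  by rewrite -[u]Pu memv_img ?memvf.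
 by rewrite dimvf.
have dimsub (X: {vspace ocar V}): \dim {:ocar (submod X)} = \dim X.
 by rewrite dimvf.
have ltU: (\dim U < \dim {:ocar V})%N.
 rewrite ltn_neqAle dimvS ?subvf // andbT; apply: contra U1 => /eqP E.
 by rewrite -(geq_leqif (dimv_leqif_eq (subvf U))) E.
have ltU': (\dim U' < \dim {:ocar V})%N.
 by rewrite -dimU -[X in (X < _)%N]add0n ltn_add2r lt0n dimv_eq0.
have lt1: (\dim {:ocar (submod U)} < n)%N by rewrite dimsub; apply: leq_trans ltU _.
have [J1 [M1 [i1 [p1 [g1 ih1 ph1 pi1 s1]]]]] := IHn _ lt1 (good_sub gV sU).
have lt2: (\dim {:ocar (submod U')} < n)%N by rewrite dimsub; apply: leq_trans ltU' _.
have [J2 [M2 [i2 [p2 [g2 ih2 ph2 pi2 s2]]]]] := IHn _ lt2 (good_sub gV sU').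
pose M (j: J1 + J2) := match j with inl a => M1 a | inr b => M2 b end.
pose i j: 'Hom(ocar (M j), ocar V) :=
 match j with inl a => (oinj U \o i1 a)%VF | inr b => (oinj U' \o i2 b)%VF end.
pose p j: 'Hom(ocar V, ocar (M j)) :=
 match j with inl a => (p1 a \o P)%VF | inr b => (p2 b \o P')%VF end.
exists (J1 + J2: finType)%type, M, i, p.
split.
- by case.
- case=> j; first exact: (omhom_comp (oinj_hom sU) (ih1 j)).
 exact: (omhom_comp (oinj_hom sU') (ih2 j)).
- case=> j; first exact: (omhom_comp (ph1 j) Ph).
 exact: (omhom_comp (ph2 j) P'h).
- case=> j.
  by rewrite -clA [(P \o _)%VF]clA Pi cl1l pi1.
 by rewrite -clA [(P' \o _)%VF]clA P'i cl1l pi2.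
rewrite big_sumType /= -sum1; congr (_ + _).
 apply/lfunP=> x; rewrite smE clE.
 have /lfunP/(_ (P x)) := s1; rewrite smE ilE => <-.
 by rewrite lsE; apply: eq_bigr => j _; rewrite !clE.
apply/lfunP=> x; rewrite smE clE.
have /lfunP/(_ (P' x)) := s2; rewrite smE ilE => <-.
by rewrite lsE; apply: eq_bigr => j _; rewrite !clE.
Qed.
Lemma odecomp_ltr V J M inc prj (f: 'End(ocar V)) (g: forall j, 'End(ocar (M j))) :
 @odecomp V J M inc prj -> (forall j, (f \o inc j = inc j \o g j)%VF) ->
 ltr f = \sum_j ltr (g j).
case=> _ _ _ pi sum1 fg; rewrite -[f]cl1r -sum1.
have -> : (f \o \sum_j (inc j \o prj j) = \sum_j ((f \o inc j) \o prj j))%VF.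
 apply/lfunP=> x; rewrite clE !smE lsE.
 by apply: eq_bigr => j _; rewrite !clE.
rewrite lsE; apply: eq_bigr => j _ /=.
by rewrite fg ltrC clA pi cl1l.
Qed.
End SemiSimple.
End OperatorModules.
Section ClosedSchur.
Variables (K: closedFieldType) (I: Type).
Lemma lfun_eigen (V: vectType K) (f: 'End(V)): (0 < \dim {:V})%N ->
 exists c v, v != 0 /\ f v = c *: v.
rewrite dimvf /dim /= => V0.
have /closed_rootP[c]: size (char_poly (f2mx f)) != 1.
 by rewrite size_char_poly eqSS -lt0n.
rewrite -eigenvalue_root_char => /eigenvalueP[v vf v0].
exists c, (r2v v); split; first by apply/eqP=> /(congr1 v2r); rewrite r2vK linear0; apply/eqP.
by apply: (can_inj v2rK); rewrite lfun_r2v linearZ /= r2vK.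
Qed.
Lemma schur_scalar (V: opmod K I) (f: 'End(ocar V)): oirr V -> omhom (V:=V) (W:=V) f ->
 exists c: K, f = c *: \1%VF.
move=> [V0 iV] fH; have [c [v [v0 fv]]] := lfun_eigen f V0.
exists c; have gH: omhom (V:=V) (W:=V) (f - c *: \1%VF).
 move=> i u; rewrite !(alE, olE, slE, ilE) fH.
 by rewrite [RHS]linearB; congr (_ - _); rewrite linearZ.
case: (iV _ (stable_ker gH)) => kf; last first.
 apply/eqP; rewrite -subr_eq0; apply/eqP/lfunP=> u; rewrite zlE.
 by apply/eqP; rewrite -memv_ker kf memvf.
case/eqP: v0; apply/eqP; rewrite -memv0 -kf memv_ker.
by rewrite !(alE, olE, slE, ilE) fv subrr.
Qed.
End ClosedSchur.

(** * The trace form of a semisimple algebra and its Casimir element *)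

Section TraceForm.
Variables (K: fieldType) (A: falgType K).
Hypothesis char0: [pchar K] =i pred0.
Implicit Types a b x y: A.
Definition atr a: K := ltr (amull a).
Lemma amullE a x: amull a x = a * x. exact: lfunE. Qed.
Lemma amulrE a x: amulr a x = x * a. exact: lfunE. Qed.
Lemma atr_linear: linear_for *%R atr.
by move=> c a b; rewrite /atr !linearP. Qed.
HB.instance Definition _ := GRing.isLinear.Build K A K *%R atr atr_linear.
Lemma atrC a b: atr (a * b) = atr (b * a).
have E x y: amull (x * y) = (amull x \o amull y)%VF.
 by apply/lfunP=> z; rewrite clE !amullE mulrA.
by rewrite /atr !E ltrC.
Qed.
Lemma char0_nat (n: nat): (n%:R == 0 :> K) = (n == 0)%N.
exact: (iffLR (pcharf0P K) char0). Qed.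
Lemma char0_natr_inj (m n: nat): m%:R = n%:R :> K -> m = n.
wlog le: m n / (m <= n)%N => [W E|].
 by have /orP[/W|/W] := leq_total m n => [|/(_ (esym E))]; [apply|].
move/eqP; rewrite eq_sym -subr_eq0 -natrB // char0_nat subn_eq0 => nm.
by apply/eqP; rewrite eqn_leq le nm.
Qed.
Definition atr_nondeg := forall x, (forall y, atr (x * y) = 0) -> x = 0.
(** The radical I of the trace form is a left ideal. Split 1 = e + f along I and a complement; then
    e is idempotent and x e = x on I. Its trace, which is its rank, vanishes by the definition of I,
    so e = 0 and I = I e = 0. *)
Lemma semisimple_atr_nondeg: semisimple_alg A -> atr_nondeg.
move=> ssA x x0.
pose L: 'Hom(A, 'Hom(A, K^o)) := linfun (fun x => linfun (fun y => atr (x * y): K^o)).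
have Lin x': linear (fun y => atr (x' * y): K^o).
 by move=> c u v; rewrite mulrDr -scalerAr linearP.
have LE a b: L a b = atr (a * b).
 rewrite linE ?linE // => c u v; apply/lfunP=> z.
 by rewrite alE slE !linE // mulrDl -scalerAl linearP.
pose I := lker L.
have memI z: (z \in I) <-> forall y, atr (z * y) = 0.
 rewrite memv_ker; split=> [/eqP E y|E]; first by rewrite -LE E zlE.
 by apply/eqP/lfunP=> y; rewrite LE zlE E.
have lI: left_ideal I.
 apply/prodvP=> a z _ /memI zI; apply/memI=> y.
 by rewrite -mulrA atrC -mulrA zI.
have [J [lJ IJ1 IJ0]] := ssA I lI.
have /memv_addP[e eI [f fJ ef]]: (1: A) \in (I + J)%VS by rewrite IJ1 memvf.
have Ie z: z \in I -> z = z * e.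
 move=> zI; apply/eqP; rewrite -subr_eq0 -memv0 -IJ0 memv_cap.
 rewrite memvB //=; last by apply/(prodvP lI); rewrite ?memvf.
 have -> : z - z * e = z * f by rewrite -{1}[z]mulr1 ef mulrDr addrC addKr.
 by apply/(prodvP lJ); rewrite ?memvf.
have ee: e * e = e by rewrite -Ie.
have: atr e = 0 by have /memI/(_ 1) := eI; rewrite mulr1.
rewrite /atr ltr_idem; last first.
 by apply/lfunP=> z; rewrite clE !amullE mulrA ee.
move/eqP; rewrite char0_nat dimv_eq0 => /eqP e0.
have e00: e = 0.
 have: amull e 1 \in limg (amull e) by rewrite memv_img ?memvf.
 by rewrite e0 memv0 amullE mulr1 => /eqP.
by rewrite [x]Ie ?e00 ?mulr0 //; apply/memI.
Qed.
End TraceForm.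

Section DualBases.
Variables (K: fieldType) (A: falgType K) (tau: 'Hom(A, K^o)).
Hypothesis tau_nondeg: forall x, (forall y, tau (x * y) = 0) -> x = 0.
Lemma frobenius_rep (phi: 'Hom(A, K^o)): exists a, forall x, phi x = tau (a * x).
pose L: 'Hom(A, 'Hom(A, K^o)) := linfun (fun x => linfun (fun y => tau (x * y))).
have Lin x': linear (fun y => tau (x' * y)) by lin.
have LE a b: L a b = tau (a * b).
 rewrite linE ?linE // => c u v; apply/lfunP=> z.
 by rewrite alE slE !linE // mulrDl -scalerAl linearP.
have kL: lker L == 0%VS.
 apply/eqP/vspaceP=> x; rewrite memv_ker memv0; apply/eqP/eqP=> [E|->]; last exact: linear0.
 by apply: tau_nondeg => y; rewrite -LE E zlE.
have: phi \in limg L.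
 suff -> : limg L = fullv by rewrite memvf.
 apply/eqP; rewrite eqEdim subvf /= limg_dim_eq ?(eqP kL) ?capv0 //.
 by rewrite !dimvf /dim /= muln1.
by case/memv_imgP=> a _ ->; exists a => x; rewrite LE.
Qed.
Definition bas (i: 'I_(dim A)): A := r2v (delta_mx 0 i).
Lemma dual_basis_exists: exists d: 'I_(dim A) -> A,
 forall x, x = \sum_i (tau (d i * x): K) *: bas i.
have H i: exists a, forall x, v2r x 0 i = tau (a * x).
 have [a aP] := frobenius_rep (linfun (fun v: A => v2r v 0 i: K^o)).
 by exists a => x; rewrite -aP linE // => c u v; rewrite linearP !mxE.
have [d dP] := fin_all_exists H; exists d => x; rewrite {1}[x]r2v_sum.
by apply: eq_bigr => i _; rewrite dP.
Qed.

Section Given.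
Variables (J: finType) (c d: J -> A).
Hypothesis cdP: forall x, x = \sum_i (tau (d i * x): K) *: c i.
Lemma dual_basis_sym (y: A): y = \sum_i (tau (y * c i): K) *: d i.
apply/eqP; rewrite -subr_eq0; apply/eqP; apply: tau_nondeg => x.
rewrite mulrBl linearB /= {1}[x]cdP mulr_sumr lsE mulr_suml lsE.
rewrite -sumrB big1 // => i _ /=.
by rewrite -scalerAr -scalerAl !linearZ /= scalerN [_ *: _]mulrC subrr.
Qed.
(** Invariance of the Casimir tensor, the sum of the c_i (x) d_i: expanding a c_i and d_i a in the
    dual bases yields the same coefficients tau(d_j a c_i) on both sides. *)
Lemma casimir (W: vectType K) (F: A -> A -> W) (a: A): bilin F ->
 \sum_i F (a * c i) (d i) = \sum_i F (c i) (d i * a).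
case=> Fl Fr.
under eq_bigr => i _ do
 rewrite [a * c i]cdP -(linE (Fl _)) lsE /=.
under [RHS]eq_bigr => i _ do
 rewrite [d i * a]dual_basis_sym -(linE (Fr _)) lsE /=.
rewrite exchange_big; apply: eq_bigr => i _; apply: eq_bigr => j _.
rewrite !linearZ /= !linE //.
by rewrite mulrA.
Qed.
Lemma ltr_dual_bases (f: 'End(A)): ltr f = \sum_i tau (d i * f (c i)).
rewrite (ltr_dual_basis (r:=index_enum J) (phi:=fun i => linfun (fun x => tau (d i * x))) (v:=c)).
 by apply: eq_bigr => i _; rewrite linE //; lin.
by move=> x; rewrite [RHS]cdP; apply: eq_bigr => i _; rewrite linE //; lin.
Qed.
End Given.
End DualBases.
Section AlgebraModules.
Variables (K: closedFieldType) (A: falgType K).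
Hypothesis char0: [pchar K] =i pred0.
Hypothesis ndA: @atr_nondeg K A.
Implicit Types a b x y: A.
Let tau: 'Hom(A, K^o) := linfun (fun x => atr x: K^o).
Let tauE x: tau x = atr x.
by rewrite linE // => c u v; rewrite linearP. Qed.
Let ndtau x: (forall y, tau (x * y) = 0) -> x = 0.
by move=> xy; apply: ndA => y; rewrite -tauE. Qed.
Definition amod (V: opmod K A) := [/\ oop V 1 = \1%VF,
 forall a b, oop V (a * b) = (oop V a \o oop V b)%VF & linear (oop V)].
Lemma amod_sub (V: opmod K A) (U: {vspace ocar V}) :
 amod V -> stable U -> amod (submod U).
case=> V1 VM VL sU; split.
- by apply/lfunP=> u; rewrite oopE V1 !ilE vsvalK.
- move=> a b; apply/lfunP=> u; rewrite clE !oopE VM clE.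
 by rewrite vsprojK // sU // subvsP.
- move=> c a b; apply/lfunP=> u; rewrite alE slE !oopE VL.
 by rewrite alE slE linearP.
Qed.
Definition regmod: opmod K A := @OpMod K A A (@amull K A).
Lemma amod_reg: amod regmod.
split; [exact: amull1 | | exact: linearP].
by move=> a b; apply/lfunP=> x; rewrite clE !amullE mulrA.
Qed.

Section Casimir.
Variables (J: finType) (c d: J -> A).
Hypothesis cdP: forall x, x = \sum_i (tau (d i * x): K) *: c i.
(** The form is here the trace of the regular representation. Computing that trace at y with the
    dual bases of the form itself gives tau(y) = tau((sum of c_i d_i) y). *)
Lemma cas1: \sum_i c i * d i = 1.
apply/eqP; rewrite -subr_eq0; apply/eqP/ndtau => y.
rewrite mulrBl mul1r linearB /= mulr_suml lsE /= [X in _ - X]tauE.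
rewrite /atr (ltr_dual_bases cdP) -sumrB big1 // => i _.
by rewrite amullE !tauE -[c i * _ * _]mulrA (atrC (c i)) mulrA subrr.
Qed.
Lemma cdP' x: x = \sum_i (tau (c i * x): K) *: d i.
rewrite {1}[x](dual_basis_sym ndtau cdP); apply: eq_bigr => i _.
by rewrite !tauE atrC.
Qed.
Definition aavg (V W: opmod K A) (E: 'Hom(ocar V, ocar W)): 'Hom(ocar V, ocar W) :=
 \sum_i (oop W (c i) \o E \o oop V (d i))%VF.
Lemma aavg_hom V W E: amod V -> amod W -> omhom (@aavg V W E).
move=> [V1 VM VL] [W1 WM WL] a u; rewrite !smE lsE.
pose F x y := oop W x (E (oop V y u)).
have FB: bilin F by split=> x b y z; rewrite /F ?VL ?WL !(alE, slE) ?linearP.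
trans (\sum_i F (c i) (d i * a)).
 by apply: eq_bigr => i _; rewrite !clE /F VM clE.
rewrite -(casimir ndtau cdP a FB); apply: eq_bigr => i _.
by rewrite /F WM !clE.
Qed.
Lemma aavg_id V W (E: 'Hom(ocar V, ocar W)) :
 amod V -> amod W -> omhom E -> aavg E = E.
move=> [V1 VM VL] [W1 WM WL] Eh; apply/lfunP=> u; rewrite smE.
trans (oop W (\sum_i c i * d i) (E u)); last by rewrite cas1 W1 ilE.
rewrite (lin_sum1 _ _ WL) smE; apply: eq_bigr => i _.
by rewrite WM !clE Eh.
Qed.
Lemma aavg_nat V V' W (E: 'Hom(ocar V, ocar W)) (f: 'Hom(ocar V', ocar V)) :
 amod V -> amod V' -> amod W -> omhom f -> aavg (E \o f)%VF = (aavg E \o f)%VF.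
move=> _ _ _ fh; apply/lfunP=> u; rewrite clE !smE.
by apply: eq_bigr => i _; rewrite !clE fh.
Qed.
(** By Schur the average is a scalar, and it has the trace of E because the sum of the d_i c_i is 1
    as well. *)
Lemma aavg_irr V (E: 'End(ocar V)): amod V -> oirr V ->
 @aavg V V E = (ltr E / (\dim {:ocar V})%:R) *: \1%VF.
move=> gV iV; have [e Ee] := schur_scalar iV (@aavg_hom V V E gV gV).
have: ltr (@aavg V V E) = ltr E.
 have [V1 VM VL] := gV.
 trans (ltr (E \o oop V (\sum_i d i * c i))%VF).
  rewrite (lin_sum1 _ _ VL).
  have -> : (E \o \sum_i oop V (d i * c i) =
   \sum_i (E \o oop V (d i * c i)))%VF.
   apply/lfunP=> u; rewrite clE !smE lsE.
   by apply: eq_bigr => i _; rewrite clE.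
  rewrite !lsE; apply: eq_bigr => i _ /=.
  by rewrite -clA ltrC VM clA.
 suff -> : \sum_i d i * c i = 1 by rewrite V1 cl1r.
 apply/eqP; rewrite -subr_eq0; apply/eqP/ndtau => y.
 rewrite mulrBl mul1r linearB /= mulr_suml lsE /= [X in _ - X]tauE.
 rewrite /atr (ltr_dual_bases cdP') -sumrB big1 // => i _.
 by rewrite amullE !tauE -[d i * _ * _]mulrA (atrC (d i)) mulrA subrr.
rewrite Ee linearZ /= ltr1 => <-; rewrite mulfK //.
by rewrite (char0_nat char0) -lt0n; case: iV.
Qed.
(** The left-hand side is the regular trace of (sum of c_i a d_i) b, and the first factor acts on
    [M j] as the scalar tr(a) / dim. The sum runs over the summands of the regular module with
    repetitions, which is why no multiplicities appear. *)
Lemma ltr_LR_sum (a b: A) (I: finType) (M: I -> opmod K A) inc prj :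
 odecomp amod (V:=regmod) (J:=I) (M:=M) inc prj ->
 ltr (amull a \o amulr b)%VF =
 \sum_j ltr (oop (M j) a) * ltr (oop (M j) b) / (\dim {:ocar (M j)})%:R.
move=> dec; have [gM ih _ _ _] := dec.
rewrite (ltr_dual_bases cdP').
trans (atr ((\sum_i c i * a * d i) * b)).
 rewrite -tauE mulr_suml lsE; apply: eq_bigr => i _.
 by rewrite clE amullE amulrE !mulrA.
rewrite /atr (odecomp_ltr (g:=fun j => oop (M j) ((\sum_i c i * a * d i) * b)) dec).
 apply: eq_bigr => j _; have [gj ij] := gM j; have [V1 VM VL] := gj.
 rewrite VM; have -> : oop (M j) (\sum_i c i * a * d i) = aavg (V:=M j) (W:=M j) (oop (M j) a).
  by rewrite (lin_sum1 _ _ VL); apply: eq_bigr => i _; rewrite !VM.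
 by rewrite aavg_irr // -clZl cl1l linearZ /= mulrAC.
by move=> j; apply/lfunP=> u; rewrite !clE ih.
Qed.
End Casimir.
Lemma ltr_LR: exists (J: finType) (M: J -> opmod K A),
 (forall j, amod (M j) /\ oirr (M j)) /\
 forall a b, ltr (amull a \o amulr b)%VF =
 \sum_j ltr (oop (M j) a) * ltr (oop (M j) b) / (\dim {:ocar (M j)})%:R.
have [d dP] := dual_basis_exists ndtau.
have [J [M [inc [prj dec]]]] := odecomposition (@amod_sub)
 (@aavg_hom _ _ _ dP) (@aavg_id _ _ _ dP) (@aavg_nat _ _ _) amod_reg.
exists J, M; split; first by case: dec.
by move=> a b; apply: ltr_LR_sum dP _ _ _ _ _ _ dec.
Qed.
End AlgebraModules.

(** * Grouplike elements *)

Section Grouplikes.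
Variables (K: fieldType) (H: hopfType K).
Implicit Types (x y g h: H) (f: dual H).
Definition grouplike g := comul g = g *t g /\ counit g = 1.
Lemma grouplikeP g: (forall f f': dual H, (f * f') g = f g * f' g) ->
 counit g = 1 -> grouplike g.
move=> gM g1; split=> //; apply: tens_sep => f f'.
by rewrite tliftE; last bil; rewrite -gM dualM.
Qed.
Lemma grouplike_dual g f f': grouplike g -> (f * f') g = f g * f' g.
by case=> gg _; rewrite dualM gg tliftE //; bil. Qed.
Lemma tsum_grouplike (W: vectType K) (F: H -> H -> W) g: grouplike g -> bilin F ->
 \dsum_(a, b <- g) F a b = F g g.
by case=> -> _ FL; rewrite tliftE. Qed.
Lemma grouplike1: grouplike 1.
by split; [apply: comul1 | apply: counit1]. Qed.
Lemma grouplikeM g h: grouplike g -> grouplike h -> grouplike (g * h).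
move=> gG hG; apply: grouplikeP; last by rewrite counitM gG.2 hG.2 mulr1.
move=> f f'; rewrite dualM (tsumM (F:=fun a b => f a * f' b: K^o)); last bil.
by rewrite tsum_grouplike // ?tsum_grouplike //; bil.
Qed.
Lemma grouplikeX g n: grouplike g -> grouplike (g ^+ n).
move=> gG; elim: n => [|n IH]; first by rewrite expr0; apply: grouplike1.
by rewrite exprS; apply: grouplikeM.
Qed.
Lemma grouplike_antipode g: grouplike g -> antipode g * g = 1 /\ g * antipode g = 1.
move=> gG; split.
 have := antipodel g; rewrite tsum_grouplike //; last bil.
 by rewrite gG.2 scale1r.
have := antipoder g; rewrite tsum_grouplike //; last bil.
by rewrite gG.2 scale1r.
Qed.
Lemma grouplikeS g: grouplike g -> grouplike (antipode g).
move=> gG; apply: grouplikeP; last by rewrite counit_antipode gG.2.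
move=> f f'; rewrite dualM (tsumS (F:=fun a b => f a * f' b: K^o)); last bil.
by rewrite tsum_grouplike //; bil.
Qed.
Lemma grouplike_eq0 g: grouplike g -> g != 0.
by move=> [_ g1]; apply/eqP=> g0; move/eqP: g1; rewrite g0 linear0 eq_sym oner_eq0.
Qed.
(** If g = sum of c_i s_i with c_j nonzero, evaluate on both sides the product of f with the j-th
    coordinate functional: this gives f(g) = f(s_j) for every f. *)
Lemma grouplikes_free (s: seq H): uniq s -> {in s, forall g, grouplike g} -> free s.
elim: s => [|g s IH] /=; first by rewrite nil_free.
case/andP=> gs us sG; rewrite free_cons IH ?andbT //; last first.
 by move=> h hs; apply: sG; rewrite inE hs orbT.
have fs: free s by apply: IH => // h hs; apply: sG; rewrite inE hs orbT.
have gG: grouplike g by apply: sG; rewrite mem_head.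
apply/negP=> gin; have := coord_span (X:=in_tuple s) gin => E.
have [j cj]: exists j, coord (in_tuple s) j g != 0.
 apply: NNPP => nc; case/eqP: (grouplike_eq0 gG); rewrite E big1 // => j _.
 have [/eqP-> | cj] := boolP (coord (in_tuple s) j g == 0); first by rewrite scale0r.
 by case: nc; exists j.
have sjG: grouplike s`_j by apply: sG; rewrite inE mem_nth ?orbT.
case/negP: gs; suff -> : g = s`_j by rewrite mem_nth.
apply: vect_sep => f.
have cL: linear (coord (in_tuple s) j: H -> K^o) by exact: linearP.
pose c: dual H := linfun (coord (in_tuple s) j: H -> K^o).
have cE x: c x = coord (in_tuple s) j x by rewrite linE.
have D: ((f: dual H) * c) g = f s`_j * c g.
 rewrite {1}E lsE (bigD1 j) //= big1 ?addr0.
  rewrite linearZ /= grouplike_dual // cE coord_free // eqxx mulr1 cE.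
  by rewrite [_ *: _]mulrC.
 move=> i ij; rewrite linearZ /= grouplike_dual; last first.
  by apply: sG; rewrite inE mem_nth ?orbT.
 by rewrite cE coord_free // (negPf ij) mulr0 scaler0.
move: D; rewrite grouplike_dual // !cE => /eqP.
by rewrite -subr_eq0 -mulrBl mulf_eq0 (negPf cj) orbF subr_eq0 => /eqP.
Qed.
Lemma grouplike_fin_order g: grouplike g -> exists2 n, (0 < n)%N & g ^+ n = 1.
move=> gG; pose N := (\dim {:H}).+1; pose s := [seq g ^+ i | i <- iota 0 N].
have ns: ~~ uniq s.
 apply/negP=> us; have: free s.
  by apply: grouplikes_free => // _ /mapP[i _ ->]; apply: grouplikeX.
 rewrite /free => /eqP fs; have := dimvS (subvf <<s>>%VS).
 by rewrite fs size_map size_iota ltnn.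
have [i [j [ij gij]]]: exists i j, (i < j)%N /\ g ^+ i = g ^+ j.
 apply: NNPP => nij; case/negP: ns; rewrite map_inj_in_uniq ?iota_uniq //.
 move=> i j _ _ gij; apply/eqP; rewrite eqn_leq leqNgt [X in _ && X]leqNgt.
 by apply/andP; split; apply/negP=> lt; apply: nij; [exists j, i | exists i, j].
exists (j - i)%N; first by rewrite subn_gt0.
have [Sg _] := grouplike_antipode (grouplikeX i gG).
have E: g ^+ j = g ^+ i * g ^+ (j - i) by rewrite -exprD subnKC // ltnW.
by rewrite -[RHS]Sg [X in _ = _ * X]gij E mulrA Sg mul1r.
Qed.
End Grouplikes.

(** * Integrals and Radford's formula for the fourth power of the antipode *)

Section Integrals.
Variables (K: fieldType) (H: hopfType K).
Implicit Types (x y g h a b: H) (f: dual H).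
Local Notation S := (@antipode K H).
(** The integral is the component of 1 in a complement of the augmentation ideal: h L - counit(h) L
    lies in that ideal and in its complement. *)
Lemma semisimple_integral: semisimple_alg H ->
 exists L: H, counit L = 1 /\ forall h, h * L = (counit h: K) *: L.
move=> ssH; have lk: left_ideal (lker (@counit K H)).
 apply/prodvP=> a x _; rewrite !memv_ker => /eqP x0.
 by rewrite counitM x0 mulr0.
have [J [lJ IJ1 IJ0]] := ssH _ lk.
have /memv_addP[i iI [L LJ E]]: (1: H) \in (lker (@counit K H) + J)%VS by rewrite IJ1 memvf.
have L1: counit L = 1.
 have := congr1 counit E; rewrite counit1 linearD /=.
 by move: iI; rewrite memv_ker => /eqP->; rewrite add0r.
exists L; split=> // h; apply/eqP; rewrite -subr_eq0 -memv0 -IJ0 memv_cap.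
apply/andP; split.
 rewrite memv_ker linearB linearZ /= counitM L1 mulr1.
 by rewrite [X in _ - X]mulr1 subrr.
rewrite memvB //; last by rewrite memvZ.
by apply/(prodvP lJ); rewrite ?memvf.
Qed.

Section Integral.
Variable L: H.
Hypothesis L1: counit L = 1.
Hypothesis Lint: forall h, h * L = (counit h: K) *: L.
Lemma int_move (W: vectType K) (F: H -> H -> W) h: bilin F ->
 \dsum_(a, b <- L) F a (h * b) = \dsum_(a, b <- L) F (S h * a) b.
move=> [F1 F2].
have FL1 (V: lmodType K) (G: V -> H) b: linear G -> linear (fun v => F (G v) b).
 by move=> GL c u v; rewrite GL F1.
have FL2 (V: lmodType K) (G: V -> H) a: linear G -> linear (fun v => F a (G v)).
 by move=> GL c u v; rewrite GL F2.
pose E := \dsum_(h1, h2 <- h) \dsum_(u, v <- (h2 * L)) F (S h1 * u) v.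
trans E; last first.
 rewrite /E; under eqt => h1 h2.
  rewrite Lint linearZ /= lin_scale; last exact: tlift_linear. over.
 rewrite (tsum_er (F:=fun z => \dsum_(u, v <- L) F (S z * u) v)) //.
 by apply: lin_tliftr => u v; apply: FL1; lin.
rewrite /E; under [RHS]eqt => h1 h2.
 rewrite (tsumM (F:=fun u v => F (S h1 * u) v)); last by split=> ?; [apply: FL1; lin | apply: FL2; lin].
 over.
rewrite -(tsumA (F:=fun h1 x y => \dsum_(z, w <- L) F (S h1 * (x * z)) (y * w))).
- under [RHS]eqt => x y.
  under eqt => x1 x2 do under eqt => z w do rewrite mulrA.
  rewrite (tsum_antil (F:=fun e => \dsum_(z, w <- L) F (e * z) (y * w))).
   under eqt => z w do rewrite mul1r.
   over.
  by apply: lin_tliftr => u v; apply: FL1; lin.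
 rewrite (tsum_el (F:=fun e => \dsum_(z, w <- L) F z (e * w))) //.
 by apply: lin_tliftr => u v; apply: FL2; lin.
- by move=> b c; apply: lin_tliftr => u v; apply: FL1; lin.
- by move=> a c; apply: lin_tliftr => u v; apply: FL1; lin.
- by move=> a b; apply: lin_tliftr => u v; apply: FL2; lin.
Qed.
Lemma int_lt f h: h * lt f L = lt (f \o amull (S h): dual H)%VF L.
rewrite !ltE (tlf (fun z => h * z)); last lin.
under eqt => a b do rewrite -scalerAr.
rewrite (int_move (F:=fun a b => (f a: K) *: b)); last bil.
by apply: eqt => a b; rewrite clE amullE.
Qed.
(** By [int_lt] the translates of L form a left ideal, so they exhaust H once 1 is among them, and
    the antipode axiom for L exhibits 1. If lt e L = 1, then h = lt e' L with e' = e(S(h) -), so h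
    depends only on S(h) and the antipode is injective. *)
Lemma int_lt1: exists f, lt f L = 1.
exists (\sum_i (@dbasis K H i \o amull (S (S (hbas i))))%VF).
rewrite lsE smE /=; trans (\sum_i S (hbas i) * lt (@dbasis K H i) L).
 by apply: eq_bigr => i _; rewrite int_lt.
rewrite -(tsum_hbasl (F:=fun a b => S a * b)); last bil.
by rewrite antipodel L1 scale1r.
Qed.
Lemma int_lt_inj f: lt f L = 0 -> f = 0.
pose F: 'Hom(dual H, H) := linfun (fun f => lt f L).
have FE f': F f' = lt f' L by rewrite linE //; lin2.
have Fs: limg F = fullv.
 apply/eqP; rewrite eqEsubv subvf; apply/subvP=> h _.
 have [e e1] := int_lt1; apply/memv_imgP.
 exists (e \o amull (S h): dual H)%VF; first by rewrite memvf.
 by rewrite FE -int_lt e1 mulr1.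
have: lker F == 0%VS.
 rewrite -dimv_eq0 -(eqn_add2r (\dim (limg F))) add0n.
 by have := limg_ker_dim F fullv; rewrite capfv => ->; rewrite Fs dim_dual.
move=> /eqP kF /eqP; rewrite -FE -memv_ker kF memv0 => /eqP; exact.
Qed.
Lemma antipode_inj: lker S == 0%VS.
apply/eqP/vspaceP=> h; rewrite memv_ker memv0; apply/eqP/eqP=> [Sh|->]; last exact: linear0.
have [e e1] := int_lt1; rewrite -[h]mulr1 -e1 int_lt Sh linear0 comp_lfun0r.
by rewrite linear0 zlE.
Qed.
End Integral.
End Integrals.
Section AntipodeInverse.
Variables (K: fieldType) (H: hopfType K).
Implicit Types (x y g h a b: H) (f: dual H).
Local Notation S := (@antipode K H).
Lemma rt_antipode f x: rt f (S x) = S (lt (antipode f) x).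
by apply: vect_sep => l; rewrite dual_rt -!dual_SE dual_lt antipodeM.
Qed.
Lemma lt_antipode f x: lt f (S x) = S (rt (antipode f) x).
by apply: vect_sep => l; rewrite dual_lt -!dual_SE dual_rt antipodeM.
Qed.
(** Multiplication by a translate is multiplication by a between two translations. Under a trace
    these combine into one, on which the antipode axiom acts; this is how traces are recognised as
    integrals. *)
Lemma amull_rt f a: amull (rt f a) =
 \dsum_(f1, f2 <- f) (rt f1 \o (amull a \o rt (antipode f2)))%VF.
apply/lfunP=> x; rewrite amullE.
rewrite (tlf (fun E: 'End(H) => E x)); last lin2.
under [RHS]eqt => f1 f2.
 rewrite !clE amullE rt_mul.
 under eqt => f3 f4 do rewrite -rtM.
 over.
rewrite (tsumA (F:=fun f3 f4 f2 => rt f3 a * rt (f4 * antipode f2) x)); try by move=> *; lin2.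
under [RHS]eqt => f1 f2.
 rewrite (tsum_antir (F:=fun e => rt f1 a * rt e x)); last lin2.
 rewrite rt1. over.
by rewrite (tsum_er (F:=fun e => rt e a * x)) //; lin2.
Qed.
Hypothesis Sinj: lker S == 0%VS.
Definition Sinv: 'End(H) := (S^-1)%VF.
Lemma SinvK x: Sinv (S x) = x.
exact: lker0_lfunK. Qed.
Lemma SK x: S (Sinv x) = x.
exact: lker0_lfunVK. Qed.
Lemma SinvM x y: Sinv (x * y) = Sinv y * Sinv x.
by rewrite -{1}[x]SK -{1}[y]SK -antipodeM SinvK. Qed.
Lemma counit_Sinv x: counit (Sinv x) = counit x.
by rewrite -{2}[x]SK counit_antipode. Qed.
(** The trace formula for an integral of the dual. The twist by the inverse square of the antipode
    is there because the antipode is not yet known to be an involution; for an involution, [lam] is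
    the trace of the regular representation. *)
Definition lam: dual H := linfun (fun a => @ltr K _ (amull a \o (Sinv \o Sinv))%VF: K^o).
Lemma lamE a: lam a = ltr (amull a \o (Sinv \o Sinv))%VF.
by rewrite linE //; lin2. Qed.
Lemma Sinv2_rt f x: Sinv (Sinv (rt f x)) = rt (antipode (antipode f)) (Sinv (Sinv x)).
rewrite -{1}[x]SK -{1}[Sinv x]SK.
by rewrite rt_antipode lt_antipode !SinvK.
Qed.
Lemma lam_int f a: (lam * f) a = lam a * f 1.
rewrite -dual_rt lamE amull_rt.
pose G (E: 'End(H)): K^o := @ltr K _ (E \o (Sinv \o Sinv))%VF.
rewrite -[LHS]/(G _) (tlf (G)); last by rewrite /G; lin2.
pose G2 (e: dual H): K^o := @ltr K H (amull a \o (rt (antipode e) \o (Sinv \o Sinv)))%VF.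
have G2L: linear G2 by rewrite /G2; lin2.
trans (\dsum_(f1, f2 <- f) G2 (antipode f1 * f2)).
 apply: eqt => f1 f2; rewrite /G -clA ltrC /G2; congr (@ltr K _ _).
 by apply/lfunP=> x; rewrite !clE Sinv2_rt antipodeM rtM.
rewrite (tsum_antil _ G2L) /G2.
rewrite antipode1 dual_counitE' mulrC; congr (_ * _); rewrite lamE; congr (@ltr K _ (_ \o _)%VF).
by apply/lfunP=> x; rewrite clE rt1.
Qed.
Lemma lam_lt a: lt lam a = (lam a: K) *: 1.
by apply: vect_sep => f; rewrite dual_lt lam_int linearZ. Qed.
Lemma lamC x y: lam (x * y) = lam (y * Sinv (Sinv x)).
rewrite !lamE; have E u v: amull (u * v) = (amull u \o amull v)%VF.
 by apply/lfunP=> z; rewrite clE !amullE mulrA.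
rewrite E -clA ltrC E -!clA; congr (@ltr K _ (_ \o _)%VF).
by apply/lfunP=> z; rewrite !clE !amullE !SinvM.
Qed.
Lemma lam1: lam 1 = ltr (Sinv \o Sinv)%VF.
by rewrite lamE amull1 cl1l. Qed.

Section WithIntegral.
Variable L: H.
Hypothesis L1: counit L = 1.
Hypothesis Lint: forall h, h * L = (counit h: K) *: L.
Lemma S_int: S L = L.
have E h: S L * h = (counit h: K) *: S L.
 by rewrite -{1}[h]SK -antipodeM Lint linearZ /= counit_Sinv.
by have := E L; rewrite L1 scale1r Lint counit_antipode L1 scale1r.
Qed.
Lemma int_r h: L * h = (counit h: K) *: L.
by rewrite -{1}S_int -{1}[h]SK -antipodeM Lint linearZ /= S_int counit_Sinv. Qed.
Lemma lamL: lam L = 1.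
rewrite lamE; have -> : (amull L \o (Sinv \o Sinv))%VF = rk1 (@counit K H) L.
 apply/lfunP=> x; rewrite !clE amullE int_r rk1E.
 by rewrite !counit_Sinv.
by rewrite ltr_rk1 L1.
Qed.
Lemma lam_nondegr x: (forall y, lam (x * y) = 0) -> x = 0.
move=> x0; have := int_lt Lint lam (Sinv x).
rewrite SK lam_lt lamL scale1r mulr1 => E.
rewrite -[x]SK E; suff -> : (lam \o amull x)%VF = 0 :> dual H by rewrite linear0 zlE linear0.
by apply/lfunP=> y; rewrite clE amullE x0 zlE.
Qed.
Lemma lam_nondegl x: (forall y, lam (y * x) = 0) -> x = 0.
move=> x0; apply: lam_nondegr => y.
by have := lamC (S (S y)) x; rewrite !SinvK x0.
Qed.
(** The difference n with the right multiple of [lam] has n(L) = 0, hence lt n L = n(L) 1 = 0, and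
    translating L is injective. *)
Lemma lam_uniq (m: dual H): (forall f a, (m * f) a = m a * f 1) -> m = (m L: K) *: lam.
move=> mP; pose n := m - (m L: K) *: lam.
have nE a: n a = m a - m L * lam a by rewrite alE olE slE.
have nP f a: (n * f) a = n a * f 1.
 by rewrite mulrBl -scalerAl alE olE slE mP lam_int nE mulrBl -mulrA.
have n0: lt n L = 0.
 apply: vect_sep => f; rewrite dual_lt nP nE lamL mulr1 subrr mul0r.
 by rewrite linear0.
apply/eqP; rewrite -subr_eq0 -/n; apply/eqP.
exact: (int_lt_inj L1 Lint n0).
Qed.
(** The distinguished grouplike element: [mul_lam] shows that it measures how far [lam] is from
    being a two-sided integral. *)
Definition dgl := rt lam L.
Lemma dglE f: f dgl = (f * lam) L. exact: dual_rt. Qed.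
Lemma mul_lam f: f * lam = (f dgl: K) *: lam.
rewrite dglE; apply: lam_uniq => f' a.
by rewrite -mulrA -dual_lt lam_int mulrC [in RHS]mulrC -dual_lt.
Qed.
Lemma rt_lam a: rt lam a = (lam a: K) *: dgl.
apply: vect_sep => f; rewrite dual_rt -[_ * _]/((f: dual H) * lam) mul_lam.
by rewrite slE linearZ [LHS]mulrC.
Qed.
Lemma dgl_grouplike: grouplike dgl.
apply: grouplikeP => [f f'|]; last by rewrite counit_rt lamL.
rewrite dglE -mulrA !mul_lam -scalerAr mul_lam !slE lamL.
by rewrite [LHS]mulrC [_ *: _]mulr1.
Qed.
Lemma tsum_dgl (W: vectType K) (F: H -> H -> W) b: bilin F ->
 \dsum_(b1, b2 <- b) F b1 (b2 * dgl) =
 \dsum_(u, v <- (b * dgl)) F (u * S dgl) v.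
move=> [F1 F2]; rewrite (tsumM (F:=fun u v => F (u * S dgl) v)); last first.
 by split=> v c x y; rewrite ?mulrDl -?scalerAl ?F1 ?F2.
apply: eqt => b1 b2; rewrite tsum_grouplike //; last first.
- by split=> v c x y; rewrite ?mulrDr ?mulrDl -?scalerAr -?scalerAl ?F1 ?F2.
- exact: dgl_grouplike.
by rewrite -mulrA (grouplike_antipode dgl_grouplike).2 mulr1.
Qed.
Lemma lamS a: lam (S a) = lam (a * dgl).
pose m: dual H := linfun (fun a => lam (Sinv a * dgl)).
have mE x: m x = lam (Sinv x * dgl) by rewrite linE //; lin.
have mP f x: (m * f) x = m x * f 1.
 rewrite dualM mE -{1}[x]SK.
 rewrite (tsumS (F:=fun a b => m a * f b: K^o)); last bil.
 under eqt => b1 b2 do rewrite mE SinvK mulrC.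
 rewrite (tsum_dgl (F:=fun b1 b2 => f (S b1) * lam b2: K^o)); last bil.
 trans (((f \o (S \o amulr (S dgl)))%VF: dual H) (rt lam (Sinv x * dgl)): K^o).
  rewrite dual_rt dualM; apply: eqt => u v.
  by rewrite !clE amulrE.
 rewrite rt_lam linearZ /= !clE amulrE.
 by rewrite (grouplike_antipode dgl_grouplike).2 antipode1.
have := lam_uniq mP => /lfunP/(_ (S a)); rewrite slE !mE SinvK.
rewrite -{1}S_int SinvK int_r linearZ /= dgl_grouplike.2 lamL => ->.
by rewrite scale1r [_ *: _]mul1r.
Qed.
(** Radford's formula when the integral of H is two-sided: [lamS] relates lam(S(a)) to
    multiplication by g = [dgl], [lamC] describes the asymmetry of [lam] by S^{-2}, and comparing
    them makes S^{-4} a conjugation by g. *)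
Lemma dgl_Sinv4 y: dgl * Sinv (Sinv (Sinv (Sinv y))) = y * dgl.
apply/eqP; rewrite -subr_eq0; apply/eqP/lam_nondegl => x.
rewrite mulrBr linearB /=; apply/eqP; rewrite subr_eq0; apply/eqP.
have E: Sinv (Sinv (S y)) = S (Sinv (Sinv y)) by rewrite SinvK SK.
have -> : lam (x * (y * dgl)) = lam (S x * Sinv (Sinv (S y))).
 by rewrite mulrA -lamS antipodeM lamC.
by rewrite E -antipodeM lamS -[in RHS]mulrA [in RHS]lamC mulrA.
Qed.
Lemma lam1_antipode4: lam 1 != 0 -> forall y, S (S (S (S y))) = y.
move=> l1; have g1: dgl = 1.
 have := rt_lam 1; rewrite rtE tsum1; last bil.
 by move=> E; apply: (scalerI (a:=lam 1: K) l1); rewrite -E.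
move=> y; have := dgl_Sinv4 (S (S (S (S y)))).
by rewrite g1 mul1r mulr1 !SinvK.
Qed.
End WithIntegral.
End AntipodeInverse.

(** * Positivity for sums of roots of unity in characteristic 0 *)

Section Positivity.
Variable K: closedFieldType.
Hypothesis char0: [pchar K] =i pred0.
Lemma char0_int (n: int): (n%:~R == 0 :> K) = (n == 0).
have nat0 m: (m%:R == 0 :> K) = (m == 0)%N by apply: (iffLR (pcharf0P K) char0).
case: n => n; first by rewrite -pmulrn nat0.
by rewrite NegzE mulrNz oppr_eq0 -pmulrn nat0.
Qed.
Lemma prim_root_exists n: (0 < n)%N -> exists z: K, n.-primitive_root z.
move=> n0; pose p: {poly K} := 'X^n - 1; have [r Dp] := closed_field_poly_normal p.
move: Dp; rewrite (monicP _) ?monicXnsubC // scale1r => Dp.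
have rn1: all n.-unity_root r by apply/allP=> z; rewrite -root_prod_XsubC -Dp.
have sz_r: (n < (size r).+1)%N by rewrite -(size_prod_XsubC r id) -Dp size_XnsubC.
have [|z] := hasP (has_prim_root n0 rn1 _ sz_r); last by exists z.
rewrite -separable_prod_XsubC -Dp separable_Xn_sub_1.
 by [].
by rewrite (iffLR (pcharf0P K) char0) -lt0n.
Qed.
Local Notation pK := (map_poly (intr: int -> K)).
Local Notation pC := (map_poly (intr: int -> algC)).
Local Notation pQ := (map_poly (intr: int -> rat)).
Lemma root_Cyclotomic_prim m (z: K): m.-primitive_root z -> root (pK 'Phi_m) z.
move=> zm; have m0 := prim_order_gt0 zm.
have dvd n: (0 < n)%N -> 'X^n - 1 = \prod_(d <- divisors n) pK 'Phi_d.
 move=> n0; trans (pK ('X^n - 1)).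
  by rewrite rmorphB /= map_polyXn rmorph1.
 by rewrite -prod_Cyclotomic // rmorph_prod.
have: root ('X^m - 1) z.
 by rewrite /root !hornerE ?hornerXn prim_expr_order // subrr.
rewrite dvd // /root horner_prod prodf_seq_eq0 => /hasP[d].
rewrite -dvdn_divisors // => dm; rewrite /= => /eqP zd.
have d0: (0 < d)%N by apply: dvdn_gt0 dm.
have: z ^+ d = 1.
 apply/eqP; rewrite -subr_eq0; have := congr1 (horner^~ z) (dvd d d0).
 rewrite /= !hornerE ?hornerXn => ->.
 rewrite horner_prod (big_rem d) /=; last by rewrite -dvdn_divisors.
 by rewrite zd mul0r.
move/eqP; rewrite -(prim_order_dvd zm) => md.
have -> : m = d by apply/eqP; rewrite eqn_dvd md dm.
by rewrite /root zd.
Qed.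
(* The integral relations of a primitive m-th root of unity do not depend on the
  field: this is how positivity is imported from algC. *)
Lemma prim_root_transfer m (z: K) (w: algC) (P: {poly int}) :
 m.-primitive_root z -> m.-primitive_root w -> root (pK P) z = root (pC P) w.
move=> zm wm; have zP := root_Cyclotomic_prim zm.
have [p [Ep _ pP]] := minCpolyP w.
have pQC (q: {poly int}): map_poly ratr (pQ q) = pC q.
 by rewrite -map_poly_comp; apply: eq_map_poly => x; rewrite /= ratr_int.
have {Ep}Ep: p = pQ 'Phi_m.
 apply: (map_inj_poly (fmorph_inj (ratr: {rmorphism rat -> algC})) (rmorph0 _)).
 by rewrite -Ep (minCpoly_cyclotomic wm) pQC (Cintr_Cyclotomic wm).
have evalE (q: {poly int}): root (pK q) z = ((pK q).[z] == 0) by [].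
have intQ (q: {poly rat}): exists (a: int) (r: {poly int}), a != 0 /\ a%:~R *: q = pQ r.
 have [r [a a0 ->]] := rat_poly_scale q; exists a, r; split=> //.
 by rewrite scalerA mulfV ?scale1r // intr_eq0.
have pQ_inj: injective pQ.
 by apply: map_inj_poly => //; apply: intr_inj.
have pQZ (a: int) (q: {poly int}): a%:~R *: pQ q = pQ (a *: q) by rewrite map_polyZ.
apply/idP/idP=> [Pz | Pw]; last first.
 have: (p %| pQ P)%R by rewrite -pP pQC.
 move=> /dvdpP[q Eq]; have [a [r [a0 ar]]] := intQ q.
 have E: a *: P = r * 'Phi_m.
  by apply: pQ_inj; rewrite rmorphM /= -pQZ Eq scalerAl ar Ep.
 have := congr1 (fun q: {poly int} => (pK q).[z]) E.
 rewrite /= rmorphM /= map_polyZ hornerZ hornerM (eqP zP) mulr0 => /eqP.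
 by rewrite mulf_eq0 char0_int (negPf a0).
apply/negPn/negP=> nPw.
have npP: ~~ (p %| pQ P)%R by rewrite -pP pQC.
have: coprimep p (pQ P).
 rewrite /coprimep; have /dvdpP[h Eh] := dvdp_gcdl p (pQ P).
 have pw: root (map_poly ratr p) w by rewrite pP dvdpp.
 rewrite Eh rmorphM rootM in pw; case/orP: pw => [hw | gw]; last first.
  case/negP: npP; rewrite pP in gw; exact: dvdp_trans gw (dvdp_gcdr _ _).
 rewrite pP in hw; have p0: p != 0.
  rewrite Ep; apply/eqP=> E0; have := Cyclotomic_monic m.
  have -> : 'Phi_m = 0 by apply: pQ_inj; rewrite E0 rmorph0.
  by rewrite monicE lead_coef0 eq_sym oner_eq0.
 have h0: h != 0 by apply: contraNneq p0 => h0; rewrite Eh h0 mul0r.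
 have g0: gcdp p (pQ P) != 0 by rewrite gcdp_eq0 negb_and p0.
 have := dvdp_leq h0 hw; rewrite {1}Eh size_mul // => le.
 have gs: (0 < size (gcdp p (pQ P)))%N by rewrite size_poly_gt0.
 move: le gs; case: (size (gcdp p (pQ P))) => // n; rewrite addnS /=.
 by rewrite -[X in (_ <= X)%N]addn0 leq_add2l leqn0 => /eqP->.
(* With denominators cleared, a Bezout identity between P and the cyclotomic polynomial has a
   nonzero integer on one side; evaluating it at z, where both polynomials vanish, is a
   contradiction. *)
move/Bezout_coprimepP=> [[u v] /= /eqpf_eq[c c0 Ec]].
have [a [U [a0 EU]]] := intQ (c^-1 *: u); have [b [V [b0 EV]]] := intQ (c^-1 *: v).
have [n n0 E]: exists2 n, n != 0 & b *: (U * 'Phi_m) + a *: (V * P) = n%:P.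
 exists (a * b); first by rewrite mulf_neq0.
 apply: pQ_inj; rewrite rmorphD /= -!pQZ !rmorphM /= -EU -EV -Ep map_polyC /=.
 have X (d e: rat) (w1 w2: {poly rat}) :
  d *: ((e *: (c^-1 *: w1)) * w2) = (e * d) *: (c^-1 *: (w1 * w2)).
  by rewrite -!scalerAl [LHS]scalerA [d * e]mulrC.
 rewrite !X [b%:~R * _]mulrC -!scalerDr Ec [c^-1 *: _]scalerA mulVf // scale1r.
 by rewrite alg_polyC map_polyC polyCM.
have := congr1 (fun q: {poly int} => (pK q).[z]) E.
rewrite /= rmorphD /= !map_polyZ !rmorphM /= hornerD !hornerZ !hornerM (eqP zP) (eqP Pz).
rewrite !mulr0 addr0 map_polyC /= hornerC => /eqP; rewrite eq_sym char0_int.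
by rewrite (negPf n0).
Qed.
End Positivity.
Section FiniteOrderTrace.
Variables (K: fieldType) (V: vectType K).
Hypothesis char0: [pchar K] =i pred0.
Variables (m: nat) (z: K).
Hypothesis zm: m.-primitive_root z.
Definition lpow (f: 'End(V)) n: 'End(V) := iter n (comp_lfun f) \1%VF.
Arguments lpow: simpl never.
Lemma prim_sum (i: nat): \sum_(k < m) (z ^+ i) ^+ k = if (m %| i)%N then m%:R else 0.
rewrite (prim_order_dvd zm); case: eqP => [-> | /eqP zi].
 rewrite (eq_bigr (fun=> 1)) => [|k _]; last by rewrite expr1n.
 by rewrite sumr_const card_ord.
have := subrX1 (z ^+ i) m; rewrite -exprM mulnC exprM (prim_expr_order zm) expr1n subrr.
move/esym/eqP; rewrite mulf_eq0 subr_eq0 (negPf zi) => /eqP E.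
by rewrite -[RHS]E; apply: eq_bigr.
Qed.
(** The eigenprojections of f are averages of its powers against z^{-i}. The exponent m - i stands
    for -i, and m.-1 * i gives the eigenvalue of the inverse g; the n i are the multiplicities. *)
Lemma ltr_finite_order (f g: 'End(V)): lpow f m = \1%VF -> (g \o f = \1)%VF ->
 exists n: 'I_m -> nat, ltr f = \sum_i (n i)%:R * z ^+ i /\
  ltr g = \sum_i (n i)%:R * z ^+ (m.-1 * i).
move=> fm gf; have m0 := prim_order_gt0 zm.
pose e (i: 'I_m) := m%:R^-1 *: \sum_(k < m) (z ^+ ((m - i) * k)) *: lpow f k.
have mK: m%:R != 0 :> K by rewrite (iffLR (pcharf0P K) char0) -lt0n.
have zi i: z ^+ i != 0.
 apply/eqP=> zi0; have := prim_expr_order zm.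
 move/eqP: zi0; rewrite expf_eq0 => /andP[_ /eqP->].
 by rewrite expr0n; case: (m) m0 => // n _ /eqP; rewrite eq_sym oner_eq0.
have fe i: (f \o e i)%VF = z ^+ i *: e i.
 rewrite /e -clZr scalerA mulrC -scalerA; congr (_ *: _).
 trans (\sum_(k < m) (z ^+ ((m - i) * k)) *: lpow f k.+1).
  apply/lfunP=> x; rewrite clE !smE lsE; apply: eq_bigr => k _.
  by rewrite !slE linearZ /= -clE.
 case: (m) fm zm (i) m0 => // n fm' zm' i' _.
 rewrite big_ord_recr big_ord_recl /= muln0 expr0 scale1r scalerDr addrC fm'.
 have zz k: z ^+ i' * z ^+ ((n.+1 - i') * k.+1) = z ^+ ((n.+1 - i') * k).
  rewrite mulnS exprD mulrA -exprD (subnKC (ltnW (ltn_ord i'))).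
  by rewrite (prim_expr_order zm') mul1r.
 congr (_ + _).
  rewrite -zz [((n.+1 - _) * n.+1)%N]mulnC exprM (prim_expr_order zm').
  by rewrite expr1n mulr1.
 rewrite scaler_sumr; apply: eq_bigr => k _.
 by rewrite scalerA /bump /= add1n zz.
have e1: \sum_i e i = \1%VF.
 rewrite -scaler_sumr exchange_big /= (bigD1 (Ordinal m0)) //=.
 rewrite [X in _ + X]big1 => [|k k0]; last first.
  rewrite -scaler_suml (_: \sum_(i < m) z ^+ ((m - i) * k) = 0) ?scale0r //.
  have E (i: 'I_m): z ^+ ((m - i) * k) = (z ^+ (m - k)) ^+ i.
   apply: (mulfI (zi (k * i)%N)); rewrite -exprM -!exprD.
   have -> : (k * i + (m - i) * k = m * k)%N.
    by rewrite [(k * i)%N]mulnC -mulnDl (subnKC (ltnW (ltn_ord i))).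
   have -> : (k * i + (m - k) * i = m * i)%N by rewrite -mulnDl (subnKC (ltnW (ltn_ord k))).
   by rewrite !exprM (prim_expr_order zm) !expr1n.
  rewrite (eq_bigr _ (fun i _ => E i)) prim_sum.
  case: ifP => // /dvdn_leq; rewrite subn_gt0 ltn_ord leqNgt => /(_ isT).
  by rewrite ltn_subrL m0 andbT lt0n; have := k0; rewrite -val_eqE /= => ->.
 rewrite (eq_bigr (fun=> \1%VF)) => [|i _]; last by rewrite muln0 expr0 scale1r.
 by rewrite sumr_const card_ord addr0 -scaler_nat scalerA mulVf // scale1r.
have fpe i k: (lpow f k \o e i)%VF = (z ^+ i) ^+ k *: e i.
 elim: k => [|k IH]; first by rewrite cl1l expr0 scale1r.
 by rewrite -clA IH -clZr fe scalerA exprSr.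
have ee i: (e i \o e i)%VF = e i.
 rewrite {1}/e -clZl.
 have -> : ((\sum_(k < m) z ^+ ((m - i) * k) *: lpow f k) \o e i =
      \sum_(k < m) e i)%VF.
  apply/lfunP=> x; rewrite clE !smE; apply: eq_bigr => k _.
  rewrite slE -clE fpe slE scalerA -exprM -exprD -mulnDl.
  by rewrite (subnK (ltnW (ltn_ord i))) exprM (prim_expr_order zm) expr1n scale1r.
 by rewrite sumr_const card_ord -scaler_nat scalerA mulVf // scale1r.
have ge i: (g \o e i)%VF = z ^+ (m.-1 * i) *: e i.
 have: (g \o (f \o e i))%VF = e i by rewrite clA gf cl1l.
 rewrite fe -clZr => E; rewrite -[in RHS]E scalerA -exprD -mulSnr prednK //.
 by rewrite exprM (prim_expr_order zm) expr1n scale1r.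
exists (fun i => \dim (limg (e i))).
have dec (h: 'End(V)) (c: 'I_m -> K): (forall i, (h \o e i)%VF = c i *: e i) ->
  ltr h = \sum_i (\dim (limg (e i)))%:R * c i.
 move=> he; rewrite -[h]cl1r -e1.
 have -> : (h \o \sum_i e i = \sum_i (h \o e i))%VF.
  apply/lfunP=> x; rewrite clE !smE lsE.
  by apply: eq_bigr => i _; rewrite clE.
 rewrite lsE; apply: eq_bigr => i _ /=.
 by rewrite he linearZ /= ltr_idem // mulrC.
by split; apply: dec.
Qed.
End FiniteOrderTrace.

Section PositiveSum.
Variable K: closedFieldType.
Hypothesis char0: [pchar K] =i pred0.
(** For a complex root of unity the second factor is the conjugate of the first, so a vanishing sum
    of squared absolute values with positive weights vanishes termwise. Clearing the denominators d
    j makes the hypothesis an integral relation, and [prim_root_transfer] moves it to the complex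
    numbers and the conclusion back. *)
Lemma positive_sum m (z: K) (J: finType) (d: J -> nat) (n: J -> 'I_m -> nat) :
 m.-primitive_root z -> (forall j, 0 < d j)%N ->
 \sum_j (\sum_i (n j i)%:R * z ^+ i) * (\sum_i (n j i)%:R * z ^+ (m.-1 * i)) / (d j)%:R = 0 ->
 forall j, \sum_i (n j i)%:R * z ^+ (m.-1 * i) = 0.
move=> zm d0 sum0; have m0 := prim_order_gt0 zm.
have [w wm] := C_prim_root_exists m0.
have nK a: (a%:R == 0 :> K) = (a == 0)%N by apply: (iffLR (pcharf0P K) char0).
pose P j: {poly int} := \sum_i (n j i)%:R * 'X^i.
pose Q j: {poly int} := \sum_i (n j i)%:R * 'X^(m.-1 * i).
pose D := (\prod_j d j)%N; pose D' j := (D %/ d j)%N.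
pose R: {poly int} := \sum_j (D' j)%:R * (P j * Q j).
have D'E j: (D' j * d j)%N = D by rewrite divnK // /D (bigD1 j) //= dvdn_mulr.
have evP (F: fieldType) (x: F) j :
  (map_poly intr (P j)).[x] = \sum_i (n j i)%:R * x ^+ i.
 rewrite rmorph_sum horner_sum; apply: eq_bigr => i _.
 by rewrite rmorphM /= map_polyXn rmorph_nat hornerM hornerXn -polyC_natr hornerC.
have evQ (F: fieldType) (x: F) j :
  (map_poly intr (Q j)).[x] = \sum_i (n j i)%:R * x ^+ (m.-1 * i).
 rewrite rmorph_sum horner_sum; apply: eq_bigr => i _.
 by rewrite rmorphM /= map_polyXn rmorph_nat hornerM hornerXn -polyC_natr hornerC.
have evR (F: fieldType) (x: F): (map_poly intr R).[x] =
  \sum_j (D' j)%:R * ((map_poly intr (P j)).[x] * (map_poly intr (Q j)).[x]).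
 rewrite rmorph_sum horner_sum; apply: eq_bigr => j _.
 by rewrite !rmorphM /= rmorph_nat !hornerM -polyC_natr hornerC.
have: root (map_poly intr R) z.
 rewrite /root evR; apply/eqP; rewrite -[RHS](mulr0 D%:R) -[X in _ = _ * X]sum0 mulr_sumr.
 apply: eq_bigr => j _; rewrite evP evQ -(D'E j) natrM -!mulrA; congr (_ * _).
 by rewrite [RHS]mulrC -!mulrA mulVf ?mulr1 // nK -lt0n.
rewrite (prim_root_transfer char0 R zm wm) /root evR => /eqP sumC j.
have cj i: (map_poly intr (Q i)).[w] = ((map_poly intr (P i)).[w])^*.
 rewrite evP evQ rmorph_sum; apply: eq_bigr => l _.
 rewrite rmorphM rmorph_nat /= rmorphXn /= exprM; congr (_ * _ ^+ _).
 have w0: w != 0.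
  apply/eqP=> w0; have := prim_expr_order wm.
  by rewrite w0 expr0n gtn_eqF //= => /eqP; rewrite eq_sym oner_eq0.
 have nw: `|w| = 1.
  apply/eqP; rewrite -(pexpr_eq1 m0) ?normr_ge0 // -normrX (prim_expr_order wm).
  by rewrite normr1.
 apply: (mulfI w0); rewrite -exprS prednK // (prim_expr_order wm).
 by rewrite -normCK nw expr1n.
have pos i: true -> 0 <= (D' i)%:R * ((map_poly intr (P i)).[w] * (map_poly intr (Q i)).[w]) :> algC.
 by move=> _; rewrite cj -normCK mulr_ge0 ?ler0n ?exprn_ge0 ?normr_ge0.
have /eqP := psumr_eq0P pos sumC (i:=j) isT.
rewrite mulf_eq0 pnatr_eq0 cj -normCK expf_eq0 normr_eq0 /= => /orP[D0 | Pw].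
 have: (0 < D)%N by apply: prodn_gt0.
 by rewrite -(D'E j) (eqP D0) mul0n.
apply/eqP; rewrite -evQ -/(root _ _) (prim_root_transfer char0 (Q j) zm wm).
by rewrite /root cj (eqP Pw) conjC0.
Qed.
End PositiveSum.

(** * The theorem of Larson and Radford: the antipode is an involution *)

Section SemisimpleUnimodular.
Variables (K: closedFieldType) (H: hopfType K).
Hypothesis char0: [pchar K] =i pred0.
Hypothesis ssH: semisimple_alg H.
Variable L: H.
Hypothesis L1: counit L = 1.
Hypothesis Lint: forall h, h * L = (counit h: K) *: L.
Let Sinj := antipode_inj L1 Lint.
Local Notation S := (@antipode K H).
Local Notation T := (Sinv H).
Local Notation lam := (lam H).
Let ndH: @atr_nondeg K H := semisimple_atr_nondeg char0 ssH.
Lemma lam_atr: exists u, forall x, lam x = atr (u * x).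
pose tau: 'Hom(H, K^o) := linfun (fun x: H => atr x: K^o).
have tauE x: tau x = atr x by rewrite linE // => c a b; rewrite linearP.
have [|u uP] := frobenius_rep (tau:=tau) _ lam.
 by move=> x xy; apply: ndH => y; rewrite -tauE.
by exists u => x; rewrite uP tauE.
Qed.
(** The trace form being nondegenerate, lam = atr(u -) for some u. Comparing the symmetry of the
    trace with [lamC] gives u x = S^{-2}(x) u, and u is invertible because [lam] is
    nondegenerate. *)
Lemma Sinv2_inner: exists u v: H, [/\ u * v = 1, v * u = 1 &
 forall x, T (T x) = u * x * v].
have [u uP] := lam_atr.
have uC x: u * x = T (T x) * u.
 apply/eqP; rewrite -subr_eq0; apply/eqP/ndH => y.
 rewrite mulrBl linearB /= -mulrA -uP (lamC Sinj) uP.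
 by rewrite [X in X - _](_: _ = atr (T (T x) * u * y)) ?subrr // mulrA atrC mulrA.
have uI x: u * x = 0 -> x = 0.
 move=> ux; apply: (lam_nondegr Sinj L1 Lint) => y.
 by rewrite uP mulrA ux mul0r linear0.
have ku: lker (amull u) = 0%VS.
 apply/vspaceP=> x; rewrite memv_ker memv0 amullE.
 by apply/eqP/eqP=> [/uI|->] //; rewrite mulr0.
have: 1 \in limg (amull u).
 suff -> : limg (amull u) = fullv by rewrite memvf.
 by apply/eqP; rewrite eqEdim subvf /= limg_dim_eq // ku capv0.
case/memv_imgP=> v _; rewrite amullE => uv; exists u, v; split=> //.
 apply/eqP; rewrite -subr_eq0; apply/eqP/uI.
 by rewrite mulrBr mulrA -uv mul1r mulr1 subrr.
by move=> x; rewrite uC -mulrA -uv mulr1.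
Qed.
(** lam(1) is the trace of S^{-2}, the conjugation by u, hence the sum of chi_j(u) chi_j(v) / dim
    M_j with v inverse to u. A power of u is central, so on each irreducible module u is a scalar
    times an operator of finite order, and the product chi_j(u) chi_j(v) has the shape of a squared
    absolute value. If the sum vanished, every chi_j(v) would vanish by positivity, against lam(L) =
    1. *)
Lemma lam1_neq0: lam 1 != 0.
apply/eqP=> l0; have [u [v [uv vu T2]]] := Sinv2_inner.
have T2E: (T \o T)%VF = (amull u \o amulr v)%VF.
 by apply/lfunP=> x; rewrite !clE amullE amulrE T2 mulrA.
have [J [M [gM sumM]]] := ltr_LR char0 ndH.
pose chi j a := ltr (oop (M j) a).
have sum0: \sum_j chi j u * chi j v / (\dim {:ocar (M j)})%:R = 0.
 by rewrite -sumM -T2E -lam1.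
have [j0 vj0]: exists j, chi j v != 0.
 apply: NNPP => nj; have := lamL Sinj L1 Lint.
 have -> : lam L = ltr (amull (L * u) \o amulr v)%VF.
  rewrite lamE T2E clA; congr (ltr (_ \o _)%VF).
  by apply/lfunP=> x; rewrite clE !amullE mulrA.
 rewrite sumM big1 => [/eqP|j _]; first by rewrite eq_sym oner_eq0.
 have [/eqP vj | vj] := boolP (chi j v == 0); last by case: nj; exists j.
 by rewrite -/(chi j v) vj mulr0 mul0r.
pose g := dgl L; have gG: grouplike g := dgl_grouplike Sinj L1 Lint.
have [n n0 gn] := grouplike_fin_order gG.
have [Sg1 Sg2] := grouplike_antipode gG.
have SSg: S (S g) = g.
 have [SSg1 _] := grouplike_antipode (grouplikeS gG).
 by rewrite -[LHS]mulr1 -Sg1 mulrA SSg1 mul1r.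
have ug: u * g = g * u.
 have: T (T g) = g by rewrite -{1}SSg !(SinvK Sinj).
 by rewrite T2 => E; rewrite -{2}E -!mulrA vu mulr1.
(* S^{-4} is conjugation by u^2 and also by the inverse of g, so w is central. As u commutes with g,
   whose n-th power is 1, the n-th power of w is u^m with m = 2n. *)
pose w := g * (u * u).
have wC y: w * y = y * w.
 have := dgl_Sinv4 Sinj L1 Lint y; rewrite !T2 -/g => E.
 rewrite /w [RHS]mulrA -E -!mulrA.
 by rewrite [v * (u * u)]mulrA vu mul1r vu mulr1.
pose m := (n + n)%N; have m0: (0 < m)%N by rewrite addn_gt0 n0.
have wn: w ^+ n = u ^+ m.
 rewrite /w exprMn_comm; last by rewrite /GRing.comm mulrA -ug -mulrA -ug mulrA.
 by rewrite gn mul1r exprMn_comm // -exprD.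
have uC y: u ^+ m * y = y * u ^+ m.
 by rewrite -wn; apply: commr_sym; apply: commrX; rewrite /GRing.comm wC.
have [z zm] := prim_root_exists char0 m0.
have H1 j: exists nj: 'I_m -> nat, exists2 b: K, b != 0 &
  chi j u = b * \sum_i (nj i)%:R * z ^+ i /\
  chi j v = b^-1 * \sum_i (nj i)%:R * z ^+ (m.-1 * i).
 have [[o1 oM oL] ij] := gM j.
 have hom: omhom (V:=M j) (W:=M j) (oop (M j) (u ^+ m)).
  by move=> a x; rewrite -clE -oM uC oM clE.
 have [c cE] := schur_scalar ij hom.
 have pow k: lpow (oop (M j) u) k = oop (M j) (u ^+ k).
  by elim: k => [|k IH]; rewrite ?expr0 ?o1 // exprS oM -IH.
 have c0: c != 0.
  apply/eqP=> c0; have: oop (M j) (v ^+ m * u ^+ m) = \1%VF.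
   by rewrite -exprMn_comm ?vu ?expr1n ?o1 // /GRing.comm vu uv.
  rewrite oM cE c0 scale0r comp_lfun0r => /lfunP E.
  have := ij.1; rewrite lt0n dimv_eq0 => /eqP; apply.
  apply/vspaceP=> x; rewrite memvf memv0; apply/esym/eqP.
  by have := E x; rewrite zlE ilE.
 have /closed_rootP[b]: size ('X^m - c%:P: {poly K}) != 1%N.
  by rewrite size_XnsubC // eqSS -lt0n.
 rewrite /root !hornerE ?hornerXn subr_eq0 => /eqP bm.
 have b0: b != 0 by apply: contraNneq c0 => b0; rewrite -bm b0 expr0n gtn_eqF.
 pose f := b^-1 *: oop (M j) u; pose f' := b *: oop (M j) v.
 have fm: lpow f m = \1%VF.
  have E k: lpow f k = b ^- k *: lpow (oop (M j) u) k.
   elim: k => [|k IH]; first by rewrite expr0 invr1 scale1r.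
   rewrite /lpow !iterS -/(lpow f k) IH -/(lpow _ k).
   by rewrite -clZr -clZl scalerA exprS invfM mulrC.
  by rewrite E pow cE scalerA bm mulVf // scale1r.
 have ff: (f' \o f)%VF = \1%VF.
  by rewrite -clZl -clZr scalerA mulfV // scale1r -oM vu o1.
 have [nj [n1 n2]] := ltr_finite_order char0 zm fm ff.
 exists nj, b => //; rewrite -n1 -n2 !linearZ /=.
 by rewrite !mulrA mulfV // mulVf // !mul1r.
have [nn {}H1] := fin_all_exists H1.
suff: chi j0 v = 0 by move/eqP; rewrite (negPf vj0).
have [b b0 [_ ->]] := H1 j0; rewrite (positive_sum char0 (d:=fun j => \dim {:ocar (M j)}) zm) ?mulr0 //.
 by move=> j; have [_ []] := gM j.
rewrite -[RHS]sum0; apply: eq_bigr => j _; congr (_ / _).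
by have [c c0 [-> ->]] := H1 j; rewrite mulrACA mulfV // mul1r.
Qed.
Lemma antipode4 x: S (S (S (S x))) = x.
exact: (lam1_antipode4 Sinj L1 Lint lam1_neq0). Qed.
End SemisimpleUnimodular.
Section LarsonRadford.
Variables (K: closedFieldType) (H: hopfType K).
Hypothesis char0: [pchar K] =i pred0.
Local Notation S := (@antipode K H).
Local Notation SD := (@antipode K (dual H)).
(** P F is the difference of the two idempotents (P + P F) / 2 and (P - P F) / 2. *)
Lemma ltr_involution (V: vectType K) (P F: 'End(V)) :
 (P \o P)%VF = P -> (F \o F)%VF = \1%VF -> (P \o F)%VF = (F \o P)%VF ->
 exists a b: nat, ltr (P \o F)%VF = a%:R - b%:R.
move=> PP FF PF; have n2: 2 != 0 :> K by rewrite (iffLR (pcharf0P K) char0).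
pose Q (c: K): 'End(V) := 2^-1 *: (P + c *: (P \o F)%VF).
have FPF: ((P \o F) \o (P \o F))%VF = P.
 by rewrite -clA [(F \o (P \o F))%VF]clA -PF -clA FF cl1r PP.
have PPF: (P \o (P \o F))%VF = (P \o F)%VF by rewrite clA PP.
have PFP: ((P \o F) \o P)%VF = (P \o F)%VF by rewrite PF -clA PP.
have QQ c: c * c = 1 -> (Q c \o Q c)%VF = Q c.
 move=> cc; rewrite /Q -clZl -clZr !clDl !clDr.
 rewrite -!clZl -!clZr PP PPF PFP FPF.
 rewrite [c *: (c *: _)]scalerA cc scale1r [c *: _ + P]addrC -mulr2n.
 by rewrite -scaler_nat [2^-1 *: (2%:R *: _)]scalerA mulVf // scale1r.
exists (\dim (limg (Q 1))), (\dim (limg (Q (-1)))).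
rewrite -!ltr_idem ?QQ ?mulr1 ?mulrNN ?mulr1 // -linearB /=; congr ltr.
rewrite /Q -scalerBr scale1r scaleN1r opprB addrC addrA subrK -mulr2n.
by rewrite -scaler_nat scalerA mulVf // scale1r.
Qed.
Hypothesis ssH: semisimple_alg H.
(** Let F be the square of the antipode of the dual, an involution, and t the regular character.
    Multiplication by t / N is an idempotent commuting with F, and tr(t F) = tr F because t(L) = 1;
    so tr F is N times an integer. It is nonzero and equals r1 - r2, where r1 + r2 = N are the
    dimensions of the eigenspaces and r1 > 0 since F fixes 1. Hence r2 = 0. *)
Lemma semisimple_involutive x: S (S x) = x.
have [L [L1 Lint]] := semisimple_integral ssH.
have Sinj := antipode_inj L1 Lint.
have S4 := antipode4 char0 ssH L1 Lint.
have T2 y: Sinv H (Sinv H y) = S (S y) by rewrite -{1}[y]S4 !(SinvK Sinj).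
have SD4 f: SD (SD (SD (SD f))) = f.
 by apply: dualP => y; rewrite !dual_SE S4.
have SDinj: lker SD == 0%VS.
 apply/eqP/vspaceP=> f; rewrite memv_ker memv0.
 by apply/eqP/eqP=> [E|->]; rewrite ?linear0 // -[f]SD4 E !linear0.
have TD2 f: Sinv (dual H) (Sinv (dual H) f) = SD (SD f).
 by rewrite -{1}[f]SD4 !(SinvK SDinj).
pose N := \dim {: H}.
have N0: (0 < N)%N.
 rewrite lt0n dimv_eq0; apply/eqP=> E; have := memvf (1: H).
 by rewrite E memv0 oner_eq0.
have nK n: (n%:R == 0 :> K) = (n == 0)%N by apply: (iffLR (pcharf0P K) char0).
pose F: 'End(dual H) := (SD \o SD)%VF.
have FE f: F f = (f \o (S \o S))%VF.
 by apply: dualP => y; rewrite !clE !dual_SE.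
have FF: (F \o F)%VF = \1%VF by apply/lfunP=> f; rewrite !clE ilE SD4.
have trF: ltr F = lam H 1.
 rewrite (ltr_dualmap FE) lam1; congr ltr; apply/lfunP=> y.
 by rewrite !clE T2.
have trF0: ltr F != 0 by rewrite trF (lam1_neq0 char0 ssH L1 Lint).
pose t: dual H := linfun (fun a: H => atr a: K^o).
have tE a: t a = atr a by rewrite linE // => c u v; rewrite linearP.
have tC a b: t (a * b) = t (b * a) by rewrite !tE atrC.
have t1: t 1 = N%:R by rewrite tE /atr amull1 ltr1.
have tL: t L = 1.
 rewrite tE /atr; have -> : amull L = rk1 (@counit K H) L.
  by apply/lfunP=> y; rewrite amullE rk1E (int_r Sinj L1 Lint).
 by rewrite ltr_rk1 L1.
have tcoc (W: vectType K) (G: dual H -> dual H -> W): bilin G ->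
  \dsum_(f, g <- t) G f g = \dsum_(f, g <- t) G g f.
 move=> GB; trans (tlift G (\dsum_(f, g <- t) (g *t f))); last first.
  by rewrite tsT; apply: eqt => f g; rewrite tliftE.
 congr tlift; apply: contr_inj => a; apply: dualP => b.
 rewrite !contrEE dcE tC -dcE tsT.
 by apply: eqt => f g; rewrite tliftE; [rewrite mulrC | bil].
have tt: t * t = N%:R *: t.
 apply: dualP => a; rewrite -dual_rt tE /atr amull_rt.
 pose G (E: 'End(H)): K^o := @ltr K _ E.
 rewrite -[LHS]/(G _) (tlf (G)); last by rewrite /G; lin2.
 pose G2 (e: dual H): K^o := @ltr K H (amull a \o rt e)%VF.
 have G2L: linear G2 by rewrite /G2; lin2.
 trans (\dsum_(f1, f2 <- t) G2 (antipode f2 * f1)).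
  apply: eqt => f1 f2; rewrite /G ltrC -clA /G2; congr (@ltr K _ (_ \o _)%VF).
  by apply/lfunP=> y; rewrite clE rtM.
 rewrite (tcoc _ (fun f1 f2 => G2 (antipode f2 * f1))); last first.
  by rewrite /G2; bil2.
 rewrite (tsum_antil _ G2L) dual_counitE' t1 slE tE; congr (_ * _).
 rewrite /G2 /atr; congr (@ltr K _ _).
 by apply/lfunP=> y; rewrite clE rt1.
have tF: F t = t.
 apply: dualP => a; rewrite FE !clE !tE.
 have [u [v [uv vu T2']]] := Sinv2_inner char0 ssH L1 Lint.
 by rewrite -T2 T2' -mulrA atrC -mulrA vu mulr1.
have trtF: ltr (amull t \o F)%VF = ltr F.
 have lamD f: lam (dual H) f = ltr (amull f \o F)%VF.
  by rewrite lamE; congr (ltr (_ \o _)%VF); apply/lfunP=> l; rewrite !clE TD2.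
 have [y yP] := dual_eval (lam (dual H)).
 have yr h: y * h = (counit h: K) *: y.
  apply: vect_sep => f; rewrite linearZ -(dcE (H:=H) f y h).
  have := lam_lt SDinj f => /lfunP/(_ h).
  rewrite slE ltE (tlf (fun l: dual H => l h)); last lin.
  move=> E; trans (lam (dual H) f * (1: dual H) h: K^o).
   by rewrite -[RHS]E; apply: eqt => f1 f2; rewrite slE -yP.
  by rewrite yP [RHS]mulrC dual1.
 have yL: y = (counit y: K) *: L by rewrite -Lint yr L1 scale1r.
 rewrite -lamD yP yL linearZ /= tL [_ *: _]mulr1 -dual1 -yP lamD.
 by rewrite amull1 cl1l.
pose P: 'End(dual H) := N%:R^-1 *: amull t.
have NK: N%:R != 0 :> K by rewrite nK -lt0n.
have PP: (P \o P)%VF = P.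
 apply/lfunP=> f; rewrite clE !slE !amullE -scalerAr mulrA tt.
 by rewrite -scalerAl [N%:R^-1 *: (N%:R *: _)]scalerA mulVf // scale1r.
have PF: (P \o F)%VF = (F \o P)%VF.
 apply/lfunP=> f; rewrite !clE !slE !amullE linearZ /= linearZ /=.
 by rewrite !antipodeM; congr (_ *: (_ * _)); rewrite -[RHS]/(SD (SD t)) -[in LHS]tF clE.
have [a [b trP]] := ltr_involution PP FF PF.
move: trP; rewrite /P -clZl linearZ /= trtF => trP.
pose Q (c: K): 'End(dual H) := 2^-1 *: (\1%VF + c *: F).
have n2: 2 != 0 :> K by rewrite nK.
have QQ c: c * c = 1 -> (Q c \o Q c)%VF = Q c.
 move=> cc; rewrite /Q -clZl -clZr !clDl !clDr.
 rewrite -!clZl -!clZr FF !cl1l !cl1r.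
 rewrite [c *: (c *: _)]scalerA cc scale1r [c *: F + _]addrC -mulr2n.
 by rewrite -scaler_nat [2^-1 *: (2%:R *: _)]scalerA mulVf // scale1r.
have [r1 [tr1 r10]]: exists r, ltr (Q 1) = r%:R /\ (0 < r)%N.
 exists (\dim (limg (Q 1))); split; first by rewrite ltr_idem ?QQ ?mulr1.
 rewrite lt0n dimv_eq0; apply/eqP=> E; have: Q 1 1 \in limg (Q 1) by rewrite memv_img ?memvf.
 rewrite E memv0 /Q slE alE ilE scale1r clE !antipode1 -mulr2n.
 by rewrite -scaler_nat scalerA mulVf // scale1r oner_eq0.
have [r2 [tr2 r20F]]: exists r, ltr (Q (-1)) = r%:R /\ (r = 0%N -> F = \1%VF).
 exists (\dim (limg (Q (-1)))); split; first by rewrite ltr_idem ?QQ ?mulrNN ?mulr1.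
 move=> r20; apply/lfunP=> f.
 have: Q (-1) f \in limg (Q (-1)) by rewrite memv_img ?memvf.
 move/eqP: r20; rewrite dimv_eq0 => /eqP->; rewrite memv0 /Q slE alE.
 by rewrite scaler_eq0 invr_eq0 (negPf n2) scaleN1r olE subr_eq0 => /eqP->.
have sumr: (r1 + r2 = N)%N.
 apply: (char0_natr_inj char0); rewrite natrD -tr1 -tr2 -linearD /=.
 rewrite /Q -scalerDr scale1r scaleN1r addrACA subrr addr0 -mulr2n.
 by rewrite -scaler_nat scalerA mulVf // scale1r ltr1 dim_dual.
have difr: ltr F = r1%:R - r2%:R.
 rewrite -tr1 -tr2 -linearB /=; congr ltr.
 rewrite /Q -scalerBr scale1r scaleN1r opprB addrC addrA subrK -mulr2n.
 by rewrite -scaler_nat scalerA mulVf // scale1r.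
have eqn: (r1 + N * b = r2 + N * a)%N.
 apply: (char0_natr_inj char0); rewrite !natrD !natrM.
 have E: r1%:R - r2%:R = N%:R * (a%:R - b%:R) :> K by rewrite -difr -trP mulrA mulfV ?mul1r.
 apply/eqP; rewrite -subr_eq0 opprD addrACA E -mulrBr -mulrDr.
 by rewrite addrA subrK subrr mulr0.
have neq: r1 <> r2 by move=> E; move/eqP: trF0; rewrite difr E subrr.
have r20: r2 = 0%N.
 clearbody N; case: (ltngtP a b) => ab; last by rewrite ab in eqn; lia.
  by have: (N * a.+1 <= N * b)%N; [rewrite leq_mul2l ab orbT | rewrite mulnS; lia].
 by have: (N * b.+1 <= N * a)%N; [rewrite leq_mul2l ab orbT | rewrite mulnS; lia].
have FI := r20F r20.
apply: vect_sep => f; have /lfunP/(_ f) := FI; rewrite FE ilE => /lfunP/(_ x).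
by rewrite !clE.
Qed.
End LarsonRadford.
Definition involutive (K: fieldType) (H: hopfType K) :=
 forall x: H, antipode (antipode x) = x.

(** * Haar functional and Haar integral *)

Section Haar.
Variables (K: fieldType) (H: hopfType K).
Hypothesis char0: [pchar K] =i pred0.
Hypothesis S2: involutive H.
Local Notation S := (@antipode K H).
Implicit Types (x y a b h: H) (f g: dual H).
Lemma involutive_inj: lker S == 0%VS.
apply/eqP/vspaceP=> x; rewrite memv_ker memv0.
by apply/eqP/eqP=> [E|->]; rewrite ?linear0 // -[x]S2 E linear0.
Qed.
Lemma involutive_dual: involutive (dual H).
by move=> f; apply: dualP => x; rewrite !dual_SE S2. Qed.
Lemma dim_neq0: (\dim {:H})%:R != 0 :> K.
rewrite char0_nat // dimv_eq0; apply/eqP=> E; have := memvf (1: H).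
by rewrite E memv0 oner_eq0.
Qed.
(** The regular trace normalised to be 1 at 1. With an involutive antipode it is a multiple of
    [lam], and it becomes a two-sided integral of the dual. *)
Definition haar: dual H := (\dim {:H})%:R^-1 *: linfun (fun a: H => atr a: K^o).
Lemma haarE a: haar a = (\dim {:H})%:R^-1 * atr a.
by rewrite slE linE // => c u v; rewrite linearP.
Qed.
Lemma haar1: haar 1 = 1.
by rewrite haarE /atr amull1 ltr1 mulVf // dim_neq0. Qed.
Lemma haarC a b: haar (a * b) = haar (b * a).
by rewrite !haarE atrC. Qed.
Lemma haar_l f a: (haar * f) a = haar a * f 1.
have E: lam H = (\dim {:H})%:R *: haar.
 apply: dualP => x; rewrite slE haarE [RHS]mulrA mulfV ?dim_neq0 // mul1r.
 rewrite lamE /atr; congr ltr; apply/lfunP=> y; rewrite !clE.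
 by rewrite -{1}[y]S2 !(SinvK involutive_inj).
apply: (mulfI dim_neq0); have := lam_int involutive_inj f a.
rewrite E; set l := haar; rewrite -[(_ *: l) * f]scalerAl !slE => X.
by rewrite [RHS]mulrA; exact: X.
Qed.
Lemma haarS a: haar (S a) = haar a.
have r f x: (f * antipode haar) x = f 1 * haar (S x).
 have := haar_l (antipode f) (S x).
 rewrite -dual_SE antipodeM involutive_dual => ->.
 by rewrite dual_SE antipode1 mulrC.
have := haar_l (antipode haar) a; rewrite r dual_SE antipode1 haar1 mulr1 mul1r.
by move=> <-.
Qed.
Lemma haar_r f a: (f * haar) a = f 1 * haar a.
have Sh: antipode haar = haar by apply: dualP => x; rewrite dual_SE haarS.
have := haar_l (antipode f) (S a).
rewrite -dual_SE antipodeM involutive_dual Sh haarS dual_SE antipode1 mulrC.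
exact.
Qed.
Lemma haar_lt a: lt haar a = (haar a: K) *: 1.
by apply: vect_sep => f; rewrite dual_lt haar_l linearZ. Qed.
Lemma haar_rt a: rt haar a = (haar a: K) *: 1.
by apply: vect_sep => f; rewrite dual_rt haar_r linearZ [RHS]mulrC. Qed.
End Haar.

Section HaarIntegral.
Variables (K: fieldType) (H: hopfType K).
Hypothesis char0: [pchar K] =i pred0.
Hypothesis S2: involutive H.
Local Notation S := (@antipode K H).
Implicit Types (x y a b h: H) (f g: dual H).
(** The Haar functional of the dual of H, read as an element of H by double duality. *)
Definition integral: H := \sum_i (haar (dual H) (@dbasis K H i): K) *: hbas i.
Lemma integralE f: f integral = haar (dual H) f.
rewrite lsE {2}[f]dbasis_sum lsE; apply: eq_bigr => i _.
by rewrite !linearZ [LHS]mulrC.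
Qed.
Let S2d := involutive_dual S2.
Lemma counit_integral: counit integral = 1.
by rewrite -dual1 integralE haar1. Qed.
Lemma integral_mulr h: integral * h = (counit h: K) *: integral.
apply: vect_sep => f; rewrite linearZ /= -(dcE (H:=H) f).
have := haar_lt char0 S2d f => /lfunP/(_ h).
rewrite slE ltE (tlf (fun l: dual H => l h)); last lin.
move=> E; trans (haar (dual H) f * (1: dual H) h: K^o).
 by rewrite -[RHS]E; apply: eqt => f1 f2; rewrite slE integralE.
by rewrite integralE dual1 [RHS]mulrC.
Qed.
Lemma integral_mull h: h * integral = (counit h: K) *: integral.
apply: vect_sep => f; rewrite linearZ /= -(dcE (H:=H) f).
have := haar_rt char0 S2d f => /lfunP/(_ h).
rewrite slE rtE (tlf (fun l: dual H => l h)); last lin.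
move=> E; trans (haar (dual H) f * (1: dual H) h: K^o).
 rewrite -[RHS]E; apply: eqt => f1 f2.
 by rewrite slE integralE mulrC.
by rewrite integralE dual1 [RHS]mulrC.
Qed.
Lemma S_integral: S integral = integral.
by apply: vect_sep => f; rewrite -dual_SE !integralE haarS. Qed.
Lemma haar_integral: haar H integral = (\dim {:H})%:R^-1.
rewrite haarE /atr; have -> : amull integral = rk1 (@counit K H) integral.
 by apply/lfunP=> y; rewrite amullE rk1E integral_mulr.
by rewrite ltr_rk1 counit_integral mulr1.
Qed.
Lemma haar_nondeg x: (forall y, haar H (x * y) = 0) -> x = 0.
move=> x0; have := int_lt integral_mull (haar H) (S x).
rewrite S2 haar_lt // haar_integral -scalerAr mulr1.
have -> : (haar H \o amull x)%VF = 0 :> dual H.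
 by apply/lfunP=> y; rewrite clE amullE x0 zlE.
rewrite linear0 zlE => /eqP; rewrite scaler_eq0 invr_eq0 (negPf (dim_neq0 _ _)) //=.
by move=> /eqP E; rewrite -[x]S2 E linear0.
Qed.
Lemma ltr_lt f: ltr (lt f) = (\dim {:H})%:R * f integral.
rewrite integralE haarE dim_dual mulrA mulfV ?dim_neq0 // mul1r.
by rewrite /atr (ltr_dualmap (A:=lt f)) // => g; apply: dualP => x; rewrite amullE clE dual_lt.
Qed.
End HaarIntegral.

(** * Yetter-Drinfeld modules: internal Hom, averaging, adjoint and regular module *)

Section FunctionalTranslates.
Variables (K: fieldType) (H: hopfType K).
Implicit Types (x y a b h: H) (f g: dual H).
Definition fL f a: dual H := (f \o amull a)%VF.
Definition fR f a: dual H := (f \o amulr a)%VF.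
Lemma fLE f a x: fL f a x = f (a * x).
by rewrite clE amullE. Qed.
Lemma fRE f a x: fR f a x = f (x * a).
by rewrite clE amulrE. Qed.
Lemma lin_fL1 (V: lmodType K) (F: V -> dual H) a: linear F -> linear (fun z => fL (F z) a).
by move=> FL; rewrite /fL; lin2. Qed.
Lemma lin_fL2 (V: lmodType K) (F: V -> H) f: linear F -> linear (fun z => fL f (F z)).
by move=> FL; rewrite /fL; lin2. Qed.
Lemma lin_fR1 (V: lmodType K) (F: V -> dual H) a: linear F -> linear (fun z => fR (F z) a).
by move=> FL; rewrite /fR; lin2. Qed.
Lemma lin_fR2 (V: lmodType K) (F: V -> H) f: linear F -> linear (fun z => fR f (F z)).
by move=> FL; rewrite /fR; lin2. Qed.
Lemma dual_tens_ext (s t: tensor (dual H) (dual H)) :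
 (forall x y, tlift (fun f g: dual H => f x * g y: K^o) s =
        tlift (fun f g: dual H => f x * g y: K^o) t) -> s = t.
by move=> st; apply: contr_inj => x; apply: dualP => y; rewrite !contrEE st.
Qed.
Lemma tsum_fL (W: vectType K) (G: dual H -> dual H -> W) f a: bilin G ->
 \dsum_(f1, f2 <- (fL f a)) G f1 f2 = \dsum_(f1, f2 <- f) G (fL f1 a) f2.
move=> GB; trans (tlift G (\dsum_(f1, f2 <- f) (fL f1 a *t f2))).
 congr tlift; apply: dual_tens_ext => x y.
 rewrite dcE fLE mulrA -dcE tsT.
 by apply: eqt => f1 f2; rewrite tliftE ?fLE //; bil.
by rewrite tsT; apply: eqt => f1 f2; rewrite tliftE.
Qed.
Lemma tsum_fR (W: vectType K) (G: dual H -> dual H -> W) f a: bilin G ->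
 \dsum_(f1, f2 <- (fR f a)) G f1 f2 = \dsum_(f1, f2 <- f) G f1 (fR f2 a).
move=> GB; trans (tlift G (\dsum_(f1, f2 <- f) (f1 *t fR f2 a))).
 congr tlift; apply: dual_tens_ext => x y.
 rewrite dcE fRE -mulrA -dcE tsT.
 by apply: eqt => f1 f2; rewrite tliftE ?fRE //; bil.
by rewrite tsT; apply: eqt => f1 f2; rewrite tliftE.
Qed.
Lemma tsum_fRL (W: vectType K) (G: dual H -> dual H -> W) f a: bilin G ->
 \dsum_(f1, f2 <- f) G (fR f1 a) f2 = \dsum_(f1, f2 <- f) G f1 (fL f2 a).
move=> GB; trans (tlift G (\dsum_(f1, f2 <- f) (fR f1 a *t f2))).
 by rewrite tsT; apply: eqt => f1 f2; rewrite tliftE.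
trans (tlift G (\dsum_(f1, f2 <- f) (f1 *t fL f2 a))); last first.
 by rewrite tsT; apply: eqt => f1 f2; rewrite tliftE.
congr tlift; apply: dual_tens_ext => x y; rewrite !tsT.
trans (f (x * a * y)).
 by rewrite -dcE; apply: eqt => f1 f2; rewrite tliftE ?fRE //; bil.
by rewrite -mulrA -dcE; apply: eqt => f1 f2; rewrite tliftE ?fLE //; bil.
Qed.
Lemma tsum_fL1 (W: vectType K) (G: dual H -> W) f a: linear G ->
 \dsum_(f1, f2 <- f) ((f1: dual H) a: K) *: G f2 = G (fL f a).
move=> GL; rewrite /fL -contr_comul /contr (tlE _ _ GL).
by apply: eqt => f1 f2; rewrite (lin_scale _ _ GL).
Qed.
Lemma tsum_fR1 (W: vectType K) (G: dual H -> W) f a: linear G ->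
 \dsum_(f1, f2 <- f) ((f2: dual H) a: K) *: G f1 = G (fR f a).
move=> GL; have -> : fR f a = \dsum_(f1, f2 <- f) ((f2: dual H) a: K) *: f1.
 apply: dualP => x; rewrite fRE -dcE.
 rewrite (tlf (fun l: dual H => l x)); last lin.
 by apply: eqt => f1 f2; rewrite slE mulrC.
rewrite (tlE _ _ GL).
by apply: eqt => f1 f2; rewrite (lin_scale _ _ GL).
Qed.
Lemma antipode_fL f a: involutive H -> antipode (fL f a) = fR (antipode f) (antipode a).
by move=> S2; apply: dualP => x; rewrite !(dual_SE, fLE, fRE) antipodeM S2.
Qed.
Lemma antipode_fR f a: involutive H -> antipode (fR f a) = fL (antipode f) (antipode a).
by move=> S2; apply: dualP => x; rewrite !(dual_SE, fLE, fRE) antipodeM S2.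
Qed.
End FunctionalTranslates.
Ltac lin3 := repeat first
 [ apply: lin_id | apply: lin_tensl | apply: lin_tensr
 | apply: lin_mull | apply: lin_mulr
 | apply: lin_scalel | apply: lin_scaler
 | apply: lin_fL1 | apply: lin_fL2 | apply: lin_fR1 | apply: lin_fR2
 | apply: lin_lt | apply: lin_rt | apply: lin_compl | apply: lin_compr
 | apply: lin_ltr | apply: lin_amull | apply: lin_amulr
 | apply: lin_lfun | apply: lin_eval | apply: lin_tlift
 | apply: lin_tliftr => ? ? ].
Ltac bil3 := split=> ?; cbv beta; lin3.

Section YetterDrinfeldModules.
Variables (K: fieldType) (H: hopfType K).
Implicit Types (x y a b h: H) (f g: dual H).
Local Notation S := (@antipode K H).
(* A left-left Yetter-Drinfeld module is given by the action of H and by the right action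
  coa f: v |-> f(v_(-1)) v_0 of the dual of H. *)
Definition ydop := opmod K (H + dual H)%type.
Implicit Types V W: ydop.
Definition act V: 'Hom(H, 'End(ocar V)) := linfun (fun h => oop V (inl h)).
Definition coa V: 'Hom(dual H, 'End(ocar V)) := linfun (fun f => oop V (inr f)).
(** The first two fields say that the operators depend linearly on their index. [yd_compat] is the
    condition h1 v(-1) (x) h2 v(0) = (h1 v)(-1) h2 (x) (h1 v)(0), contracted with f; in this form it
    does not involve the antipode. *)
Record yd V: Prop := Yd {
 yd_actE: forall h, oop V (inl h) = act V h;
 yd_coaE: forall f, oop V (inr f) = coa V f;
 yd_act1: act V 1 = \1%VF;
 yd_actM: forall a b, act V (a * b) = (act V a \o act V b)%VF;
 yd_coa1: coa V 1 = \1%VF;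
 yd_coaM: forall f g, coa V (f * g) = (coa V g \o coa V f)%VF;
 yd_compat: forall f h,
  \dsum_(h1, h2 <- h) (act V h2 \o coa V (fL f h1))%VF =
  \dsum_(h1, h2 <- h) (coa V (fR f h2) \o act V h1)%VF
}.
Definition ydmk (U: vectType K) (A: 'Hom(H, 'End(U))) (T: 'Hom(dual H, 'End(U))): ydop :=
 OpMod (fun i => match i with inl h => A h | inr f => T f end).
Lemma act_mk U A T: act (@ydmk U A T) = A.
by apply/lfunP=> h; rewrite linE //; apply: linearP. Qed.
Lemma coa_mk U A T: coa (@ydmk U A T) = T.
by apply/lfunP=> h; rewrite linE //; apply: linearP. Qed.
Lemma ydhomP V W (F: 'Hom(ocar V, ocar W)): yd V -> yd W ->
 omhom F <-> (forall h u, F (act V h u) = act W h (F u)) /\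
       (forall f u, F (coa V f u) = coa W f (F u)).
move=> yV yW; split=> [FH | [F1 F2] [h|f] u].
- by split=> [h|f] u; rewrite -?(yd_actE yV) -?(yd_actE yW) -?(yd_coaE yV) -?(yd_coaE yW) FH.
- by rewrite (yd_actE yV) (yd_actE yW) F1.
- by rewrite (yd_coaE yV) (yd_coaE yW) F2.
Qed.
Lemma yd_inj V W (i: 'Hom(ocar W, ocar V)): yd V -> omhom i -> lker i = 0%VS -> yd W.
move=> yV ih k0; have ii: injective i by apply/lker0P; rewrite k0.
have aL: linear (fun h => oop W (inl h)).
 move=> c a b; apply/lfunP=> u; apply: ii.
 by rewrite ih (yd_actE yV) alE slE !linearP /= !ih !(yd_actE yV) alE slE.
have cL: linear (fun f: dual H => oop W (inr f)).
 move=> c a b; apply/lfunP=> u; apply: ii.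
 by rewrite ih (yd_coaE yV) alE slE !linearP /= !ih !(yd_coaE yV) alE slE.
have aE h: oop W (inl h) = act W h by rewrite /act linE.
have cE f: oop W (inr f) = coa W f by rewrite /coa linE.
have ia h u: i (act W h u) = act V h (i u) by rewrite -aE ih (yd_actE yV).
have ic f u: i (coa W f u) = coa V f (i u) by rewrite -cE ih (yd_coaE yV).
split=> //.
- by apply/lfunP=> u; apply: ii; rewrite ia (yd_act1 yV) !ilE.
- by move=> a b; apply/lfunP=> u; apply: ii; rewrite ia (yd_actM yV) !clE !ia.
- by apply/lfunP=> u; apply: ii; rewrite ic (yd_coa1 yV) !ilE.
- by move=> a b; apply/lfunP=> u; apply: ii; rewrite ic (yd_coaM yV) !clE !ic.
- move=> f h; apply/lfunP=> u; apply: ii.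
 have Lv: linear (fun E: 'End(ocar V) => E (i u)) by lin.
 have Lw: linear (fun E: 'End(ocar W) => i (E u)) by lin.
 have := congr1 (fun E: 'End(ocar V) => E (i u)) (yd_compat yV f h).
 rewrite /= (tlE _ _ Lv) [X in _ = X -> _](tlE _ _ Lv) => E.
 rewrite (tlE _ _ Lw) [RHS](tlE _ _ Lw).
 trans (\dsum_(h1, h2 <- h) (act V h2 \o coa V (fL f h1))%VF (i u)).
  by apply: eqt => h1 h2; rewrite !clE ia ic.
 by rewrite E; apply: eqt => h1 h2; rewrite !clE ic ia.
Qed.
Lemma yd_sub V (U: {vspace ocar V}): yd V -> stable U -> yd (submod U).
move=> yV sU; apply: (yd_inj yV (oinj_hom sU)).
apply/vspaceP=> u; rewrite memv_ker memv0 oinjE.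
apply/eqP/eqP=> [E|->]; last exact: linear0.
by apply: (can_inj vsvalK); rewrite E linear0.
Qed.
End YetterDrinfeldModules.
Section InvolutiveAntipode.
Variables (K: fieldType) (H: hopfType K).
Hypothesis S2: involutive H.
Local Notation S := (@antipode K H).
Lemma antipodel_op (h: H): \dsum_(x, y <- h) (S y * x) = (counit h: K)%:A.
have := congr1 S (antipodel h); rewrite linearZ /= antipode1 => <-.
rewrite (tlf (S)); last lin.
by apply: eqt => x y; rewrite antipodeM S2.
Qed.
Lemma antipoder_op (h: H): \dsum_(x, y <- h) (y * S x) = (counit h: K)%:A.
have := congr1 S (antipoder h); rewrite linearZ /= antipode1 => <-.
rewrite (tlf (S)); last lin.
by apply: eqt => x y; rewrite antipodeM S2.
Qed.
End InvolutiveAntipode.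

Section YDConstructions.
Variables (K: fieldType) (H: hopfType K).
Hypothesis S2: involutive H.
Implicit Types (V W: @ydop K H).
Local Notation S := (@antipode K H).
Local Notation SD := (@antipode K (dual H)).
Definition ydtriv: @ydop K H := @ydmk K H K^o
 (linfun (fun h => (counit h: K) *: (\1%VF: 'End(K^o))))
 (linfun (fun f: dual H => (f 1: K) *: (\1%VF: 'End(K^o)))).
Lemma act_triv h: act ydtriv h = (counit h: K) *: \1%VF.
by rewrite act_mk linE //; lin. Qed.
Lemma coa_triv f: coa ydtriv f = (f 1: K) *: \1%VF.
by rewrite coa_mk linE //; lin. Qed.
Lemma yd_triv: yd ydtriv.
split.
- by move=> h; rewrite act_mk.
- by move=> f; rewrite coa_mk.
- by rewrite act_triv counit1 scale1r.
- by move=> a b; rewrite !act_triv -clZl cl1l scalerA counitM.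
- by rewrite coa_triv dual1 counit1 scale1r.
- move=> f g; rewrite !coa_triv -clZl cl1l scalerA mulrC; congr (_ *: _).
 by rewrite dualM tsum1 //; bil.
- move=> f h; under eqt => h1 h2 do
  rewrite act_triv coa_triv fLE mulr1 -clZl cl1l.
 under [RHS]eqt => h1 h2 do
  rewrite act_triv coa_triv fRE mul1r -clZl cl1l scalerA mulrC -scalerA.
 rewrite (tsum_er (F:=fun z => (f z: K) *: (\1%VF: 'End(K^o)))); last lin.
 by rewrite (tsum_el (F:=fun z => (f z: K) *: (\1%VF: 'End(K^o)))) //; lin.
Qed.
Definition hom_act V W: 'Hom(H, 'End('Hom(ocar V, ocar W))) :=
 linfun (fun h => linfun (fun E: 'Hom(ocar V, ocar W) =>
  \dsum_(h1, h2 <- h) (act W h1 \o (E \o act V (S h2)))%VF)).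
Definition hom_coa V W: 'Hom(dual H, 'End('Hom(ocar V, ocar W))) :=
 linfun (fun f => linfun (fun E: 'Hom(ocar V, ocar W) =>
  \dsum_(f1, f2 <- f) (coa W f1 \o (E \o coa V (SD f2)))%VF)).
(** The internal Hom, with h E = h1 E S(h2) and dually for the coaction. Its invariants are the
    morphisms ([ydhom_inv]), and duals and tensor products are later derived from it ([ydual],
    [yten]). *)
Definition ydhom V W: @ydop K H := ydmk (hom_act V W) (hom_coa V W).
Lemma ydhom_act V W h (E: 'Hom(ocar V, ocar W)): act (ydhom V W) h E =
 \dsum_(h1, h2 <- h) (act W h1 \o (E \o act V (S h2)))%VF.
pose F a (E: 'Hom(ocar V, ocar W)): 'Hom(ocar V, ocar W) :=
 \dsum_(h1, h2 <- a) (act W h1 \o (E \o act V (S h2)))%VF.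
have L1 a: linear (F a) by rewrite /F; lin2.
have L2 E': linear (F^~ E') by rewrite /F; lin2.
have L3: linear (fun a => linfun (F a)).
 by move=> c a b; apply/lfunP=> E'; rewrite alE slE !(linE (L1 _)) L2.
by rewrite act_mk (linE L3) (linE (L1 h)).
Qed.
Lemma ydhom_coa V W f (E: 'Hom(ocar V, ocar W)): coa (ydhom V W) f E =
 \dsum_(f1, f2 <- f) (coa W f1 \o (E \o coa V (SD f2)))%VF.
pose F (a: dual H) (E: 'Hom(ocar V, ocar W)): 'Hom(ocar V, ocar W) :=
 \dsum_(h1, h2 <- a) (coa W h1 \o (E \o coa V (SD h2)))%VF.
have L1 (a: dual H): linear (F a) by rewrite /F; lin2.
have L2 E': linear (F^~ E') by rewrite /F; lin2.
have L3: linear (fun a: dual H => linfun (F a)).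
 by move=> c a b; apply/lfunP=> E'; rewrite alE slE !(linE (L1 _)) L2.
by rewrite coa_mk (linE L3) (linE (L1 f)).
Qed.

Section Hom.
Variables (V W: @ydop K H).
Hypotheses (yV: yd V) (yW: yd W).
Lemma yd_compat_S f h :
 \dsum_(h1, h2 <- h) (coa V (SD (fL f h1)) \o act V (S h2))%VF =
 \dsum_(h1, h2 <- h) (act V (S h1) \o coa V (SD (fR f h2)))%VF.
have := yd_compat yV (SD f) (S h).
rewrite (tsumS (F:=fun a b => act V b \o coa V (fL (SD f) a))%VF); last bil3.
rewrite (tsumS (F:=fun a b => coa V (fR (SD f) b) \o act V a)%VF); last bil3.
under eqt => a b do rewrite -antipode_fR //.
by under [RHS]eqt => a b do rewrite -antipode_fL //.
Qed.
(** The element h is moved through the composite in stages: the condition for W on the outer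
    operators, a rebalancing of the two components of f in the middle, and the condition for V,
    transported by the antipodes, on the inner operators. *)
Lemma ydhom_compat f h (E: 'Hom(ocar V, ocar W)) :
 \dsum_(h1, h2 <- h) act (ydhom V W) h2 (coa (ydhom V W) (fL f h1) E) =
 \dsum_(h1, h2 <- h) coa (ydhom V W) (fR f h2) (act (ydhom V W) h1 E).
trans (\dsum_(f1, f2 <- f) \dsum_(h1, h3 <- h) \dsum_(a, b <- h3)
  ((act W a \o coa W (fL f1 h1)) \o (E \o (coa V (SD f2) \o act V (S b))))%VF).
 rewrite tsC; apply: eqt => h1 h2.
 rewrite ydhom_coa (tsum_fL (G:=fun f1 f2 => coa W f1 \o (E \o coa V (SD f2)))%VF); last bil3.
 rewrite (tlE (W' := 'Hom(ocar V, ocar W)) _ _ (f:=act (ydhom V W) h2)); last lin.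
 apply: eqt => f1 f2; rewrite ydhom_act; apply: eqt => a b.
 by rewrite !clA.
trans (\dsum_(f1, f2 <- f) \dsum_(h1, h3 <- h) \dsum_(a, b <- h1)
  ((coa W (fR f1 b) \o act W a) \o (E \o (coa V (SD f2) \o act V (S h3))))%VF).
 apply: eqt => f1 f2.
 rewrite -(tsumA (F:=fun h1 a b => ((act W a \o coa W (fL f1 h1)) \o
   (E \o (coa V (SD f2) \o act V (S b))))%VF)); try by move=> *; lin3.
 apply: eqt => h1 h2; rewrite -[LHS](tlE (W' := 'Hom(ocar V, ocar W)) _ _
   (f:=fun z => z \o (E \o (coa V (SD f2) \o act V (S h2))))%VF); last lin3.
 rewrite (yd_compat yW) (tlE (W' := 'Hom(ocar V, ocar W)) _ _
   (f:=fun z => z \o (E \o (coa V (SD f2) \o act V (S h2))))%VF) //; by lin3.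
trans (\dsum_(f1, f2 <- f) \dsum_(h1, h3 <- h) \dsum_(a, b <- h3)
  ((coa W f1 \o act W h1) \o (E \o (coa V (SD (fL f2 a)) \o act V (S b))))%VF).
 rewrite [LHS]tsC [RHS]tsC.
 under eqt => h1 h3 do rewrite tsC.
 under [RHS]eqt => h1 h3 do rewrite tsC.
 rewrite -(tsumA (F:=fun h1 a b => \dsum_(f1, f2 <- f) ((coa W f1 \o act W h1) \o
   (E \o (coa V (SD (fL f2 a)) \o act V (S b))))%VF)); try by move=> *; lin3.
 apply: eqt => h1 h3; apply: eqt => a b.
 by rewrite (tsum_fRL (G:=fun f1 f2 => ((coa W f1 \o act W a) \o
    (E \o (coa V (SD f2) \o act V (S h3))))%VF)) //; bil3.
trans (\dsum_(f1, f2 <- f) \dsum_(h1, h3 <- h) \dsum_(a, b <- h3)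
  ((coa W f1 \o act W h1) \o (E \o (act V (S a) \o coa V (SD (fR f2 b)))))%VF).
 apply: eqt => f1 f2; apply: eqt => h1 h3.
 rewrite -[LHS](tlE (W' := 'Hom(ocar V, ocar W)) _ _
   (f:=fun z => (coa W f1 \o act W h1) \o (E \o z))%VF); last lin3.
 rewrite yd_compat_S (tlE (W' := 'Hom(ocar V, ocar W)) _ _
   (f:=fun z => (coa W f1 \o act W h1) \o (E \o z))%VF) //; by lin3.
trans (\dsum_(f1, f2 <- f) \dsum_(h1, h3 <- h) \dsum_(a, b <- h1)
  ((coa W f1 \o act W a) \o (E \o (act V (S b) \o coa V (SD (fR f2 h3)))))%VF).
 apply: eqt => f1 f2.
 by rewrite -(tsumA (F:=fun h1 a b => ((coa W f1 \o act W h1) \o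
   (E \o (act V (S a) \o coa V (SD (fR f2 b)))))%VF)) //; try by move=> *; lin3.
rewrite tsC; apply: eqt => h1 h2.
rewrite ydhom_act (tlE (W' := 'Hom(ocar V, ocar W)) _ _ (f:=coa (ydhom V W) _)); last lin.
rewrite tsC; apply: eqt => a b; rewrite ydhom_coa.
rewrite (tsum_fR (G:=fun f1 f2 => (coa W f1 \o ((act W a \o (E \o act V (S b))) \o coa V (SD f2)))%VF)); last bil3.
by apply: eqt => f1 f2; rewrite !clA.
Qed.
Lemma yd_hom: yd (ydhom V W).
split.
- by move=> h; rewrite act_mk.
- by move=> f; rewrite coa_mk.
- apply/lfunP=> E; rewrite ydhom_act tsum1; last bil3.
 by rewrite antipode1 (yd_act1 yV) (yd_act1 yW) cl1l cl1r ilE.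
- move=> a b; apply/lfunP=> E; rewrite clE !ydhom_act.
 rewrite (tsumM (F:=fun x y => act W x \o (E \o act V (S y)))%VF); last bil3.
 rewrite tsC [RHS](eqt (c:=fun x y => \dsum_(u, v <- b)
   (act W x \o ((act W u \o (E \o act V (S v))) \o act V (S y)))%VF)); last first.
  move=> x y; rewrite -[RHS](tlE (W' := 'Hom(ocar V, ocar W)) _ _
   (f:=fun z => act W x \o (z \o act V (S y)))%VF) //; by lin3.
 rewrite [RHS]tsC; apply: eqt => u v; apply: eqt => x y.
 by rewrite antipodeM (yd_actM yW) (yd_actM yV) !clA.
- apply/lfunP=> E; rewrite ydhom_coa tsum1; last bil3.
 by rewrite antipode1 (yd_coa1 yV) (yd_coa1 yW) cl1l cl1r ilE.
- move=> f g; apply/lfunP=> E; rewrite clE !ydhom_coa.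
 rewrite (tsumM (F:=fun x y => coa W x \o (E \o coa V (SD y)))%VF); last bil3.
 rewrite tsC; apply: eqt => x y.
 rewrite (tlE (W' := 'Hom(ocar V, ocar W)) _ _
   (f:=fun z => coa W x \o (z \o coa V (SD y)))%VF); last lin3.
 apply: eqt => u v.
 by rewrite antipodeM (yd_coaM yW) (yd_coaM yV) !clA.
- move=> f h; apply/lfunP=> E.
 have L: linear (fun F: 'End('Hom(ocar V, ocar W)) => F E) by lin.
 rewrite (tlE _ _ L) [RHS](tlE _ _ L).
 have := ydhom_compat f h E; under eqt => h1 h2 do rewrite -clE.
 by under [RHS]eqt => h1 h2 do rewrite -clE.
Qed.
(** As [coa] reverses products, the coaction half uses the antipode identities with the factors in
    the opposite order; these hold because the antipode is an involution. *)
Lemma ydhom_inv (E: 'Hom(ocar V, ocar W)) :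
 omhom E <-> (forall h, act (ydhom V W) h E = (counit h: K) *: E) /\
       (forall f, coa (ydhom V W) f E = (f 1: K) *: E).
rewrite (ydhomP E yV yW); split=> [[E1 E2] | [E1 E2]].
 split=> [h | f].
  rewrite ydhom_act (eqt (c:=fun a b => (act W (a * S b) \o E)%VF)); last first.
   move=> a b; apply/lfunP=> v; rewrite !clE E1 (yd_actM yW) clE //.
  rewrite (tsum_antir (F:=fun z => act W z \o E)%VF); last lin3.
  by rewrite (yd_act1 yW) cl1l.
 rewrite ydhom_coa (eqt (c:=fun a b => (coa W (SD b * a) \o E)%VF)); last first.
  move=> a b; apply/lfunP=> v; rewrite !clE E2 (yd_coaM yW) clE //.
 rewrite -(tlf (fun z => (coa W z \o E)%VF)); last lin3.
 have -> : coa W (\dsum_(x, y <- f) (SD y * x)) = (f 1: K) *: \1%VF.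
  rewrite (antipodel_op (involutive_dual S2)) linearZ /= -dual_counitE'.
  by congr (_ *: _); apply: yd_coa1.
 by rewrite -clZl cl1l.
split=> [h u | f u].
 suff /lfunP/(_ u): (E \o act V h = act W h \o E)%VF by rewrite !clE.
 trans (\dsum_(h1, h2 <- h) (act (ydhom V W) h1 E \o act V h2)%VF).
  under [RHS] eqt => h1 h2 do rewrite E1 -clZl.
  by rewrite (tsum_el (F:=fun z => (E \o act V z)%VF)) //; lin3.
 under eqt => h1 h2.
  rewrite ydhom_act (tlE (W' := 'Hom(ocar V, ocar W)) _ _
   (f:=fun z => z \o act V h2)%VF); last lin3.
  over.
 rewrite (tsumA (F:=fun a b c => (act W a \o (E \o act V (S b))) \o act V c)%VF);
  try by move=> *; lin3.
 under eqt => a b.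
  under eqt => c d do rewrite -!clA -(yd_actM yV).
  rewrite (tsum_antil (F:=fun z => act W a \o (E \o act V z))%VF); last lin3.
  rewrite (yd_act1 yV) cl1r; over.
 by rewrite (tsum_er (F:=fun z => (act W z \o E)%VF)) //; lin3.
suff /lfunP/(_ u): (E \o coa V f = coa W f \o E)%VF by rewrite !clE.
trans (\dsum_(h1, h2 <- f) (coa (ydhom V W) h1 E \o coa V h2)%VF).
 under [RHS] eqt => h1 h2 do rewrite E2 -clZl -dual_counitE'.
 by rewrite (tsum_el (F:=fun z => (E \o coa V z)%VF)) //; lin3.
under eqt => h1 h2.
 rewrite ydhom_coa (tlE (W' := 'Hom(ocar V, ocar W)) _ _
  (f:=fun z => z \o coa V h2)%VF); last lin3.
 over.
rewrite (tsumA (F:=fun a b c => (coa W a \o (E \o coa V (SD b))) \o coa V c)%VF);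
 try by move=> *; lin3.
under eqt => a b.
 under eqt => c d do rewrite -!clA -(yd_coaM yV).
 rewrite -(tlf (fun z => (coa W a \o (E \o coa V z))%VF)); last lin3.
 have -> : coa V (\dsum_(x, y <- b) (y * SD x)) = (counit b: K) *: \1%VF.
  rewrite (antipoder_op (involutive_dual S2)) linearZ /=.
  by congr (_ *: _); apply: yd_coa1.
 rewrite -!clZr cl1r.
 over.
by rewrite (tsum_er (F:=fun z => (coa W z \o E)%VF)) //; lin3.
Qed.
End Hom.
End YDConstructions.
Section YDAverage.
Variables (K: fieldType) (H: hopfType K).
Hypothesis char0: [pchar K] =i pred0.
Hypothesis S2: involutive H.
Implicit Types (V W: @ydop K H).
Local Notation S := (@antipode K H).
Local Notation SD := (@antipode K (dual H)).
Lemma fLL (f: dual H) a b: fL (fL f a) b = fL f (a * b).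
by apply: dualP => x; rewrite !fLE mulrA. Qed.
Lemma fRR (f: dual H) a b: fR (fR f a) b = fR f (b * a).
by apply: dualP => x; rewrite !fRE mulrA. Qed.
Lemma fL1 (f: dual H): fL f 1 = f.
by apply: dualP => x; rewrite fLE mul1r. Qed.
Lemma fR1 (f: dual H): fR f 1 = f.
by apply: dualP => x; rewrite fRE mulr1. Qed.
Lemma yd_move V f h: yd V -> (act V h \o coa V f)%VF =
 \dsum_(x, y <- h) \dsum_(a, b <- y)
   (coa V (fR (fL f (S x)) b) \o act V a)%VF.
move=> yV; under eqt => x y do rewrite -(yd_compat yV).
under eqt => x y do under eqt => a b do rewrite fLL.
rewrite -(tsumA (F:=fun x a b => (act V b \o coa V (fL f (S x * a)))%VF)); try by move=> *; lin3.
under eqt => x y do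
 [rewrite (tsum_antil (F:=fun z => (act V y \o coa V (fL f z))%VF)); last lin3].
rewrite fL1 (tsum_el (F:=fun z => (act V z \o coa V f)%VF)) //; by lin3.
Qed.
Definition ydavg V W (E: 'Hom(ocar V, ocar W)): 'Hom(ocar V, ocar W) :=
 coa (ydhom V W) (haar H) (act (ydhom V W) (@integral K H) E).
Lemma act_integral_inv V h u: yd V ->
 act V h (act V (@integral K H) u) = (counit h: K) *: act V (@integral K H) u.
by move=> yV; rewrite -clE -(yd_actM yV) integral_mull // linearZ slE.
Qed.
Lemma coa_haar_inv V f u: yd V -> coa V f (coa V (haar H) u) = (f 1: K) *: coa V (haar H) u.
move=> yV; rewrite -clE -(yd_coaM yV).
have -> : haar H * f = (f 1: K) *: haar H :> dual H.
 by move: (haar H) (haar_l char0 S2) => l lE; apply: dualP => x; rewrite lE slE mulrC.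
by rewrite linearZ slE.
Qed.
(** Reordering by [yd_move] conjugates the Haar functional by components of h, and this is harmless
    because [haar] is a trace. So averaging first over the action and then over the coaction yields
    invariants of both. *)
Lemma act_coa_haar V h u: yd V -> (forall h, act V h u = (counit h: K) *: u) ->
 act V h (coa V (haar H) u) = (counit h: K) *: coa V (haar H) u.
move=> yV uI; rewrite -clE (yd_move _ _ yV).
have L: linear (fun E: 'End(ocar V) => E u) by lin.
rewrite (tlE _ _ L).
trans (\dsum_(x, y <- h) coa V (fR (haar H) (y * S x)) u).
 apply: eqt => x y; rewrite (tlE _ _ L).
 rewrite -(tsum_el (F:=fun z => coa V (fR (haar H) (z * S x)) u)); last lin3.
 apply: eqt => a b; rewrite clE uI linearZ; congr (_ *: coa V _ _).
 by apply: dualP => z; rewrite !fRE fLE haarC // mulrA.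
rewrite -(tlf (fun z => coa V (fR (haar H) z) u)); last lin3.
rewrite antipoder_op // (lin_scale _ _ (f:=fun z => coa V (fR (haar H) z) u)); last lin3.
by rewrite fR1.
Qed.
Lemma ydavg_hom V W (E: 'Hom(ocar V, ocar W)): yd V -> yd W -> omhom (ydavg E).
move=> yV yW; have yH := yd_hom S2 yV yW; apply/ydhom_inv => //; split=> [h | f].
 by apply: (@act_coa_haar (ydhom V W)) => // {}h; apply: (@act_integral_inv (ydhom V W)).
exact: (@coa_haar_inv (ydhom V W)).
Qed.
Lemma ydavg_id V W (E: 'Hom(ocar V, ocar W)): yd V -> yd W -> omhom E -> ydavg E = E.
move=> yV yW /(ydhom_inv S2 yV yW)[E1 E2].
by rewrite /ydavg E1 counit_integral // scale1r E2 haar1 // scale1r.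
Qed.
Lemma ydavg_nat V V' W (E: 'Hom(ocar V, ocar W)) (f: 'Hom(ocar V', ocar V)) :
 yd V -> yd V' -> yd W -> omhom f -> ydavg (E \o f)%VF = (ydavg E \o f)%VF.
move=> yV yV' yW /(ydhomP _ yV' yV)[f1 f2]; rewrite /ydavg.
have -> : act (ydhom V' W) (@integral K H) (E \o f)%VF =
     (act (ydhom V W) (@integral K H) E \o f)%VF.
 rewrite !ydhom_act (tlf (fun z => (z \o f)%VF)); last lin3.
 by apply: eqt => a b; apply/lfunP=> u; rewrite !clE f1.
rewrite !ydhom_coa (tlf (fun z => (z \o f)%VF)); last lin3.
by apply: eqt => a b; apply/lfunP=> u; rewrite !clE f2.
Qed.
Definition yd_decomp V := @odecomp K (H + dual H)%type (@yd K H) V.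
Definition yd_decomposition := odecomposition (@yd_sub K H) ydavg_hom ydavg_id ydavg_nat.
End YDAverage.

Section RegularYD.
Variables (K: fieldType) (H: hopfType K).
Hypothesis char0: [pchar K] =i pred0.
Hypothesis S2: involutive H.
Local Notation S := (@antipode K H).
(** h1 Y(h2) S(h3), the common source of two modules: Y = counit(-) x gives the adjoint action and Y
    = E(z -) the regular module. *)
Definition adY (Y: 'End(H)) h: H :=
 \dsum_(a, b <- h) \dsum_(u, v <- b) (a * Y u * S v).
Lemma lt_mul3 (f: dual H) a y s: lt f (a * y * s) =
 \dsum_(a1, a2 <- a) \dsum_(y1, y2 <- y) \dsum_(s1, s2 <- s)
   (f (a1 * y1 * s1): K) *: (a2 * y2 * s2).
rewrite ltE (tsumM (F:=fun u v => (f u: K) *: v)); last bil3.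
rewrite (tsumM (F:=fun u v => \dsum_(z, w <- s) (f (u * z): K) *: (v * w))) //.
by bil3.
Qed.
Lemma adY_compat (Y: 'End(H)) (f: dual H) h :
 \dsum_(h1, h2 <- h) \dsum_(a, b <- h2) \dsum_(u, v <- b)
   (a * lt (fL f h1) (Y u) * S v) =
 \dsum_(h1, h2 <- h) lt (fR f h2) (adY Y h1).
trans (\dsum_(a, w <- h) \dsum_(u, r <- w)
  \dsum_(a1, a2 <- a) \dsum_(y1, y2 <- Y u)
   (f (a1 * y1): K) *: (a2 * y2 * S r)).
 rewrite -(tsumA (F:=fun h1 a b => \dsum_(u, v <- b)
   (a * lt (fL f h1) (Y u) * S v))); try by move=> *; lin3.
 apply: eqt => q b; rewrite tsC; apply: eqt => u v.
 apply: eqt => h1 a.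
 rewrite ltE (tlf (fun z => a * z * S v)); last lin.
 by apply: eqt => y1 y2; rewrite fLE -scalerAr -scalerAl.
trans (\dsum_(p, c <- h) \dsum_(a, b <- p) \dsum_(u, v <- b)
  \dsum_(a1, a2 <- a) \dsum_(y1, y2 <- Y u) \dsum_(v1, v2 <- v)
   (f (a1 * y1 * (S v2 * c)): K) *: (a2 * y2 * S v1)); last first.
 apply: eqt => p c; rewrite /adY (tlf (lt (fR f c))); last lin.
 apply: eqt => a b; rewrite (tlf (lt (fR f c))); last lin.
 apply: eqt => u v; rewrite lt_mul3.
 apply: eqt => a1 a2; apply: eqt => y1 y2.
 rewrite (tsumS (F:=fun s1 s2 => (fR f c (a1 * y1 * s1): K) *: (a2 * y2 * s2))); last bil3.
 by apply: eqt => v1 v2; rewrite fRE !mulrA.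
rewrite (tsumA (F:=fun a b c => \dsum_(u, v <- b)
  \dsum_(a1, a2 <- a) \dsum_(y1, y2 <- Y u) \dsum_(v1, v2 <- v)
   (f (a1 * y1 * (S v2 * c)): K) *: (a2 * y2 * S v1))); try by move=> *; lin3.
apply: eqt => a w.
rewrite (tsumA (F:=fun u v c =>
  \dsum_(a1, a2 <- a) \dsum_(y1, y2 <- Y u) \dsum_(v1, v2 <- v)
   (f (a1 * y1 * (S v2 * c)): K) *: (a2 * y2 * S v1))); try by move=> *; lin3.
apply: eqt => u r; rewrite [RHS]tsC; apply: eqt => a1 a2.
rewrite [RHS]tsC; apply: eqt => y1 y2.
rewrite (tsumA (F:=fun v1 v2 c => (f (a1 * y1 * (S v2 * c)): K) *: (a2 * y2 * S v1)));
 try by move=> *; lin3.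
under [RHS]eqt => v1 t do
 [rewrite (tsum_antil (F:=fun z => (f (a1 * y1 * z): K) *: (a2 * y2 * S v1))); last lin3].
rewrite mulr1 (tsum_er (F:=fun z => (f (a1 * y1): K) *: (a2 * y2 * S z))) //; by lin3.
Qed.
Lemma adY1 (Y: 'End(H)): adY Y 1 = Y 1.
rewrite /adY tsum1; last bil3.
by rewrite tsum1 ?mul1r ?antipode1 ?mulr1 //; bil3.
Qed.
Lemma adYM (Y: 'End(H)) g h :
 adY Y (g * h) = adY (linfun (fun z => adY (Y \o amull z)%VF h)) g.
have L: linear (fun z => adY (Y \o amull z)%VF h) by rewrite /adY; lin3.
rewrite /adY; under [RHS]eqt => a b do under eqt => u v do rewrite (linE L).
rewrite (tsumM (F:=fun a b => \dsum_(u, v <- b) (a * Y u * S v))); last bil3.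
apply: eqt => a b.
under eqt => c d do
 [rewrite (tsumM (F:=fun u v => (a * c * Y u * S v))); last bil3].
rewrite tsC; apply: eqt => u v; rewrite /adY.
rewrite (tlf (fun z => a * z * S v)); last lin.
apply: eqt => c d; rewrite (tlf (fun z => a * z * S v)); last lin.
by apply: eqt => r s; rewrite clE amullE antipodeM !mulrA.
Qed.
Lemma adY_linl h: linear (fun Y => adY Y h).
by rewrite /adY; lin3. Qed.
Lemma adY_linr Y: linear (adY Y).
by rewrite /adY; lin3. Qed.
Definition ad h x := adY (rk1 (@counit K H) x) h.
Lemma adE h x: ad h x = \dsum_(a, b <- h) (a * x * S b).
apply: eqt => a b.
under eqt => u v do rewrite rk1E -scalerAr -scalerAl.
by rewrite (tsum_el (F:=fun v => a * x * S v)) //; lin.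
Qed.
Lemma ad_linl x: linear (ad^~ x).
exact: adY_linr. Qed.
Lemma ad_linr h: linear (ad h).
have L: linear (fun x: H => \dsum_(a, b <- h) (a * x * S b)) by lin.
by move=> c x y; rewrite !adE L.
Qed.
(* H as the Yetter-Drinfeld module induced from the trivial H-module *)
Definition ydad: @ydop K H :=
 @ydmk K H H (linfun (fun h => linfun (ad h))) (linfun (@lt K H)).
Lemma act_ad h x: act ydad h x = ad h x.
have L: linear (fun h => linfun (ad h)).
 by move=> c a b; apply/lfunP=> y; rewrite alE slE !(linE (ad_linr _)) ad_linl.
by rewrite act_mk (linE L) (linE (ad_linr h)).
Qed.
Lemma coa_ad f: coa ydad f = lt f.
by rewrite coa_mk lfunE. Qed.
Lemma yd_ad: yd ydad.
split.
- by move=> h; rewrite act_mk.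
- by move=> f; rewrite coa_mk.
- apply/lfunP=> x; rewrite act_ad ilE /ad adY1 rk1E counit1; exact: scale1r.
- move=> a b; apply/lfunP=> x; rewrite clE !act_ad /ad adYM.
 congr adY; apply/lfunP=> z.
 have L: linear (fun z => adY (rk1 counit x \o amull z)%VF b) by rewrite /adY; lin3.
 rewrite (linE L) rk1E -(lin_scale _ _ (adY_linl b)); congr adY.
 by apply/lfunP=> y; rewrite clE amullE slE !rk1E counitM scalerA.
- by rewrite coa_ad; apply/lfunP=> x; rewrite lt1 ilE.
- by move=> f g; rewrite !coa_ad; apply/lfunP=> x; rewrite ltM clE.
- move=> f h; apply/lfunP=> x.
 have L: linear (fun E: 'End(H) => E x) by lin.
 rewrite (tlE _ _ L) [RHS](tlE _ _ L).
 trans (\dsum_(h1, h2 <- h) lt (fR f h2) (adY (rk1 counit x) h1)); last first.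
  by apply: eqt => a b; rewrite clE act_ad coa_ad.
 rewrite -adY_compat; apply: eqt => a b.
 rewrite clE act_ad coa_ad /ad /adY.
 by apply: eqt => c d; apply: eqt => u v; rewrite !rk1E linearZ.
Qed.
Definition reg_act (h: H) (E: 'End(H)): 'End(H) := linfun (fun z => adY (E \o amull z)%VF h).
Lemma reg_actE h E z: reg_act h E z = adY (E \o amull z)%VF h.
have L: linear (fun z => adY (E \o amull z)%VF h) by rewrite /adY; lin3.
by rewrite (linE L).
Qed.
Lemma reg_act_linl E: linear (reg_act^~ E).
by move=> c a b; apply/lfunP=> z; rewrite alE slE !reg_actE adY_linr. Qed.
Lemma reg_act_linr h: linear (reg_act h).
move=> c a b; apply/lfunP=> z; rewrite alE slE !reg_actE -adY_linl; congr adY.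
by rewrite clDl clZl.
Qed.
Lemma comp_lt_lin: linear (fun f: dual H => linfun (fun E: 'End(H) => (lt f \o E)%VF)).
move=> c f g; apply/lfunP=> E; rewrite alE slE !linE; by lin3.
Qed.
(** A module of dimension N^2 in the role of the regular module of the Drinfeld double: by
    [count_irr] an irreducible V accounts for dim V of its summands. *)
Definition ydreg: @ydop K H :=
 @ydmk K H 'End(H) (linfun (fun h => linfun (reg_act h)))
   (linfun (fun f: dual H => linfun (fun E: 'End(H) => (lt f \o E)%VF))).
Lemma act_reg h E: act ydreg h E = reg_act h E.
have L: linear (fun h => linfun (reg_act h)).
 by move=> c a b; apply/lfunP=> y; rewrite alE slE !(linE (reg_act_linr _)) reg_act_linl.
by rewrite act_mk (linE L) (linE (reg_act_linr h)).
Qed.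
Lemma coa_reg f E: coa ydreg f E = (lt f \o E)%VF.
by rewrite coa_mk (linE comp_lt_lin) linE //; lin3. Qed.
Lemma yd_reg: yd ydreg.
split.
- by move=> h; rewrite act_mk.
- by move=> f; rewrite coa_mk.
- apply/lfunP=> E; rewrite act_reg ilE; apply/lfunP=> z.
 by rewrite reg_actE adY1 clE amullE mulr1.
- move=> a b; apply/lfunP=> E; rewrite clE !act_reg; apply/lfunP=> z.
 rewrite !reg_actE adYM; congr adY; apply/lfunP=> y; rewrite clE amullE reg_actE.
 have L: linear (fun y => adY (E \o amull z \o amull y)%VF b) by rewrite /adY; lin3.
 rewrite (linE L); congr adY; apply/lfunP=> t.
 by rewrite !clE !amullE mulrA.
- by apply/lfunP=> E; rewrite coa_reg ilE; apply/lfunP=> z; rewrite clE lt1.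
- move=> f g; apply/lfunP=> E; rewrite clE !coa_reg; apply/lfunP=> x.
 by rewrite !clE ltM.
- move=> f h; apply/lfunP=> E.
 have L: linear (fun F: 'End('End(H)) => F E) by lin.
 rewrite (tlE _ _ L) [RHS](tlE _ _ L); apply/lfunP=> z.
 have L2: linear (fun F: 'End(H) => F z) by lin.
 rewrite (tlE _ _ L2) [RHS](tlE _ _ L2).
 trans (\dsum_(h1, h2 <- h) lt (fR f h2) (adY (E \o amull z)%VF h1)); last first.
  by apply: eqt => a b; rewrite clE act_reg coa_reg clE reg_actE.
 rewrite -adY_compat; apply: eqt => a b.
 rewrite clE act_reg coa_reg reg_actE /adY.
 by apply: eqt => c d; apply: eqt => u v; rewrite !clE.
Qed.
End RegularYD.

(** * Characters of Yetter-Drinfeld modules and the Drinfeld map *)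

Section HomTrace.
Variables (K: fieldType) (U W: vectType K).
Lemma ltr_hom (A: 'End(W)) (B: 'End(U)) (F: 'End('Hom(U, W))) :
 (forall E: 'Hom(U, W), F E = (A \o (E \o B))%VF) -> ltr F = ltr A * ltr B.
move=> FE.
pose phi (T: vectType K) (i: 'I_(dim T)): 'Hom(T, K^o) := linfun (fun t: T => v2r t 0 i: K^o).
pose bas (T: vectType K) (i: 'I_(dim T)): T := r2v (delta_mx 0 i).
have phiL (T: vectType K) i: linear (fun t: T => v2r t 0 i: K^o).
 by move=> c u v; rewrite linearP !mxE.
have sumT (T: vectType K) (t: T): \sum_i (phi T i t: K) *: bas T i = t.
 by rewrite [RHS]r2v_sum; apply: eq_bigr => i _; rewrite (linE (phiL T i)).
pose psi (ij: 'I_(dim U) * 'I_(dim W)): 'Hom('Hom(U, W), K^o) :=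
 linfun (fun E: 'Hom(U, W) => phi W ij.2 (E (bas U ij.1))).
have psiE ij E: psi ij E = phi W ij.2 (E (bas U ij.1)) by rewrite linE //; lin.
rewrite (ltr_dual_basis (r:=index_enum _) (phi:=psi)
  (v:=fun ij => rk1 (phi U ij.1) (bas W ij.2))); last first.
 move=> E; rewrite -(pair_bigA _ (fun i j => (psi (i, j) E: K) *: rk1 (phi U i) (bas W j))) /=.
 apply/lfunP=> u; rewrite smE -{2}[u](sumT U) lsE; apply: eq_bigr => i _.
 rewrite smE linearZ /= -[E (bas U i)]sumT scaler_sumr; apply: eq_bigr => j _.
 by rewrite slE rk1E psiE !scalerA mulrC.
rewrite (ltr_dual_basis (sumT W) A) (ltr_dual_basis (sumT U) B) mulrC mulr_suml.
rewrite -(pair_bigA _ (fun i j => psi (i, j) (F (rk1 (phi U i) (bas W j))))) /=.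
apply: eq_bigr => i _; rewrite mulr_sumr; apply: eq_bigr => j _.
by rewrite psiE FE !clE rk1E linearZ linearZ.
Qed.
End HomTrace.

Section YDCharacters.
Variables (K: fieldType) (H: hopfType K).
Hypothesis char0: [pchar K] =i pred0.
Hypothesis S2: involutive H.
Implicit Types (V W: @ydop K H) (C: 'End(H)).
Local Notation S := (@antipode K H).
Local Notation SD := (@antipode K (dual H)).
Local Notation N := (\dim {:H}).
(** The character (f, h) |-> tr(coa f act h), stored as an endomorphism of H ([chrE]). In this
    encoding the product of characters is the convolution [conv], and the entries of the S-matrix
    are traces of composites ([ltr_Phi]). *)
Definition chr V: 'End(H) :=
 linfun (fun h => \sum_i ltr (coa V (@dbasis K H i) \o act V h)%VF *: hbas i).
Lemma chrE V (f: dual H) h: f (chr V h) = ltr (coa V f \o act V h)%VF.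
rewrite linE; last first.
 move=> c a b; rewrite scaler_sumr -big_split; apply: eq_bigr => i _ /=.
 by rewrite scalerA -scalerDl; congr (_ *: _); rewrite linearP clDr -clZr linearP.
rewrite lsE {2}[f]dbasis_sum.
have L: linear (fun g: dual H => ltr (coa V g \o act V h)%VF: K^o) by lin3.
by rewrite (lin_sum _ _ _ L); apply: eq_bigr => i _; rewrite linearZ [LHS]mulrC.
Qed.
Lemma eq_chr V W: (forall f h, ltr (coa V f \o act V h)%VF = ltr (coa W f \o act W h)%VF) ->
 chr V = chr W.
by move=> E; apply/lfunP=> h; apply: vect_sep => f; rewrite !(chrE _ (f: dual H)). Qed.
Definition conv C C': 'End(H) := linfun (fun h => \dsum_(x, y <- h) (C x * C' y)).
Lemma convE C C' h: conv C C' h = \dsum_(x, y <- h) (C x * C' y).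
by rewrite linE //; lin. Qed.
Definition cdual C: 'End(H) := (S \o (C \o S))%VF.
Lemma chr_hom V W: yd V -> yd W -> chr (ydhom V W) = conv (chr W) (cdual (chr V)).
move=> yV yW; apply/lfunP=> h; apply: vect_sep => f; rewrite (chrE _ (f: dual H)) convE.
rewrite (tlf (f)); last lin.
trans (\dsum_(a, b <- h) \dsum_(f1, f2 <- (f: dual H))
  (ltr (coa W f1 \o act W a)%VF * ltr (act V (S b) \o coa V (SD f2))%VF: K^o)); last first.
 apply: eqt => a b; rewrite -(dcE (f: dual H)); apply: eqt => f1 f2.
 by rewrite [X in _ * X]ltrC -!chrE dual_SE !clE.
have L: linear (@ltr K 'Hom(ocar V, ocar W): _ -> K^o) by move=> c a b; rewrite linearP.
pose T f1 f2 a b: 'End('Hom(ocar V, ocar W)) := linfun (fun E: 'Hom(ocar V, ocar W) =>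
  (coa W f1 \o act W a) \o (E \o (act V b \o coa V f2)))%VF.
have TE f1 f2 a b E: T f1 f2 a b E = ((coa W f1 \o act W a) \o (E \o (act V b \o coa V f2)))%VF.
 by rewrite linE //; lin3.
have -> : (coa (ydhom V W) f \o act (ydhom V W) h)%VF =
  \dsum_(a, b <- h) \dsum_(f1, f2 <- (f: dual H)) T f1 (SD f2) a (S b).
 apply/lfunP=> E; rewrite clE ydhom_act (tlf (coa (ydhom V W) f)); last lin.
 have LE: linear (fun F: 'End('Hom(ocar V, ocar W)) => F E) by lin.
 rewrite (tlE _ _ LE); apply: eqt => a b; rewrite (tlE _ _ LE).
 by rewrite ydhom_coa; apply: eqt => f1 f2; rewrite TE !clA.
rewrite (tlE _ _ L); apply: eqt => a b; rewrite (tlE _ _ L).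
by apply: eqt => f1 f2; rewrite (ltr_hom (TE _ _ _ _)).
Qed.
Lemma chr_triv: chr (ydtriv H) = rk1 (@counit K H) 1.
apply/lfunP=> h; apply: vect_sep => f; rewrite (chrE _ (f: dual H)) rk1E linearZ.
rewrite act_triv coa_triv -clZl -clZr cl1l !linearZ /= ltr1.
by rewrite dimvf /dim /= mulr1 [LHS]mulrC.
Qed.
Lemma ltr_amulr u: ltr (amulr u) = N%:R * haar H u.
rewrite -haarS // haarE // mulrA mulfV ?dim_neq0 // mul1r /atr.
have -> : amull (S u) = (S \o (amulr u \o S))%VF.
 by apply/lfunP=> x; rewrite !clE amullE amulrE antipodeM S2.
rewrite ltrC -clA; congr ltr; apply/lfunP=> x.
by rewrite !clE S2.
Qed.
Lemma chr_reg: chr (ydreg H) = (N%:R ^+ 2) *: rk1 (haar H) (@integral K H).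
apply/lfunP=> h; apply: vect_sep => f; rewrite (chrE _ (f: dual H)).
rewrite slE rk1E !linearZ.
pose T a u v: 'End('End(H)) := linfun (fun E: 'End(H) =>
  ((lt f \o (amulr (S v) \o amull a)) \o (E \o amulr u))%VF).
have TE a u v E: T a u v E = ((lt f \o (amulr (S v) \o amull a)) \o (E \o amulr u))%VF.
 by rewrite linE //; lin3.
have -> : (coa (ydreg H) f \o act (ydreg H) h)%VF =
  \dsum_(a, b <- h) \dsum_(u, v <- b) T a u v.
 apply/lfunP=> E; rewrite clE act_reg coa_reg.
 have LE: linear (fun F: 'End('End(H)) => F E) by lin.
 rewrite (tlE _ _ LE); under [RHS]eqt => a b do rewrite (tlE _ _ LE).
 apply/lfunP=> z; have Lz: linear (fun F: 'End(H) => F z) by lin.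
 rewrite clE reg_actE (tlE _ _ Lz) (tlf (lt f)); last lin.
 apply: eqt => a b.
 rewrite (tlE _ _ Lz) (tlf (lt f)); last lin.
 by apply: eqt => u v; rewrite TE !clE !amulrE !amullE.
have L: linear (@ltr K 'End(H): _ -> K^o) by move=> c a b; rewrite linearP.
rewrite (tlE _ _ L).
have LN: linear (fun z: K^o => (N%:R: K) *: z) by lin.
trans ((N%:R: K) *: \dsum_(a, b <- h) \dsum_(u, v <- b)
  ((haar H u: K) *: (ltr (lt f \o (amulr (S v) \o amull a))%VF: K^o))).
 rewrite (tlE _ _ LN); apply: eqt => a b.
 rewrite (tlE _ _ LN).
 rewrite (tlE _ _ L); apply: eqt => u v.
 by rewrite (ltr_hom (TE a u v)) ltr_amulr mulrC -mulrA.
rewrite (eqt (c:=fun a b => (haar H b: K) *: (ltr (lt f \o amull a)%VF: K^o))); last first.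
 move=> a b; have La: linear (fun z => ltr (lt f \o (amulr (S z) \o amull a))%VF: K^o) by lin3.
 trans (ltr (lt f \o (amulr (S (lt (haar H) b)) \o amull a))%VF: K^o).
  rewrite ltE (tlE _ _ La); apply: eqt => u v.
  by rewrite (lin_scale _ _ La).
 rewrite haar_lt // (lin_scale _ _ La); congr (_ *: ltr (_ \o _)%VF).
 by apply/lfunP=> z; rewrite clE amulrE antipode1 mulr1.
have La: linear (fun z => ltr (lt f \o amull z)%VF: K^o) by lin3.
trans ((N%:R: K) *: (ltr (lt f \o amull (rt (haar H) h))%VF: K^o)).
 congr (_ *: _); rewrite rtE (tlE _ _ La); apply: eqt => u v.
 by rewrite (lin_scale _ _ La).
rewrite haar_rt // (lin_scale _ _ La) amull1 cl1r ltr_lt // expr2.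
have R (n x y: K): n * (x * (n * y)) = n * n * (x * y) by ring.
exact: R.
Qed.
Lemma yd_move' V (f: dual H) h: yd V -> (coa V f \o act V h)%VF =
 \dsum_(p, c <- h) \dsum_(a, b <- p) (act V b \o coa V (fL (fR f (S c)) a))%VF.
move=> yV; under eqt => p c do rewrite (yd_compat yV).
under eqt => p c do under eqt => a b do rewrite fRR.
rewrite (tsumA (F:=fun a b c => (coa V (fR f (b * S c)) \o act V a)%VF)); try by move=> *; lin3.
under eqt => x y do
 [rewrite (tsum_antir (F:=fun z => (coa V (fR f z) \o act V x)%VF)); last lin3].
rewrite fR1 (tsum_er (F:=fun z => (coa V f \o act V z)%VF)) //; by lin3.
Qed.
(** Cyclicity of the trace together with the Yetter-Drinfeld condition. This is the invariance of a
    character on the side of the action, [chr_coad] on the side of the coaction; the two halves make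
    the operators [Phi] central. *)
Lemma chr_ad V h x: yd V ->
 \dsum_(p, c <- h) \dsum_(a, b <- p) (chr V (a * x * S c) * b) = h * chr V x.
move=> yV; apply: vect_sep => f; rewrite -(fLE (f: dual H)) chrE.
rewrite (tlf (f)); last lin.
trans (\dsum_(p, c <- h) \dsum_(a, b <- p)
 (ltr ((coa V (fR f b) \o act V a) \o act V (x * S c))%VF: K^o)).
 apply: eqt => p c; rewrite (tlf (f)); last lin.
 apply: eqt => a b; rewrite -(fRE (f: dual H)) chrE -mulrA (yd_actM yV).
 by rewrite clA.
have L c: linear (fun E: 'End(ocar V) => ltr (E \o act V (x * S c))%VF: K^o) by lin3.
under eqt => p c do rewrite -(tlE _ _ (L c)) -(yd_compat yV) (tlE _ _ (L c)).
rewrite (tsumA (F:=fun a b c => ltr ((act V b \o coa V (fL f a)) \o act V (x * S c))%VF: K^o));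
 try by move=> *; lin3.
trans (\dsum_(a, w <- h) \dsum_(b, c <- w)
 (ltr (coa V (fL f a) \o act V (x * (S c * b)))%VF: K^o)).
 apply: eqt => a w; apply: eqt => b c.
 by rewrite -clA ltrC -clA -(yd_actM yV) mulrA.
have L2 a: linear (fun z => ltr (coa V (fL f a) \o act V (x * z))%VF: K^o) by lin3.
under eqt => a w do
 rewrite -(tlE _ _ (L2 a)) antipodel_op // (lin_scale _ _ (L2 a)) mulr1.
by rewrite (tsum_er (F:=fun a => ltr (coa V (fL f a) \o act V x)%VF: K^o)) //; lin3.
Qed.
Lemma dual_conj (f g: dual H) z y :
 \dsum_(p, c <- y) \dsum_(a, b <- p) (g b * f (a * z * S c): K^o) =
 \dsum_(q, k <- f) \dsum_(f1, f2 <- q)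
   (((f2: dual H) z: K) *: ((f1 * g * SD k) y: K^o)).
pose E (f1 f2 k: dual H) a b c: K^o := (f2 z: K) *: (f1 a * g b * k (S c)).
have Rs (c: K): linear (fun t: K^o => c * t: K^o) by move=> r u v; rewrite mulrDr scalerAr.
have Rl (c: K): linear (fun t: K^o => t * c: K^o) by move=> r u v; rewrite mulrDl scalerAl.
trans (\dsum_(q, k <- f) \dsum_(f1, f2 <- q)
  \dsum_(p, c <- y) \dsum_(a, b <- p) E f1 f2 k a b c); last first.
 apply: eqt => q k; apply: eqt => f1 f2.
 have LZ: linear (fun t: K^o => ((f2: dual H) z: K) *: t) by lin.
 rewrite dualM (tlE _ _ LZ); apply: eqt => p c.
 rewrite dualM dual_SE -(tlE _ _ LZ); congr (_ *: _).
 by rewrite (tlE _ _ (Rl _)).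
trans (\dsum_(p, c <- y) \dsum_(a, b <- p)
  \dsum_(q, k <- f) \dsum_(f1, f2 <- q) E f1 f2 k a b c).
 apply: eqt => p c; apply: eqt => a b.
 rewrite -(dcE f) (tlE _ _ (Rs _)); apply: eqt => q k.
 have M3 (u v w r: K): u * (v * w * r) = w * (v * u * r) by ring.
 rewrite -(dcE (q: dual H)) (tlE _ _ (Rl _)) (tlE _ _ (Rs _)).
 by apply: eqt => f1 f2; apply: M3.
under eqt => p c do rewrite tsC.
rewrite tsC; apply: eqt => q k.
under eqt => p c do rewrite tsC.
by rewrite tsC; apply: eqt => f1 f2.
Qed.
Lemma chr_coad V (f g: dual H) x: yd V ->
 \dsum_(x1, x2 <- x) \dsum_(p, c <- (chr V x1)) \dsum_(a, b <- p)
  (g b * f (a * x2 * S c): K^o) =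
 \dsum_(x1, x2 <- x) ((f x1: K) *: (g (chr V x2): K^o)).
move=> yV; under eqt => x1 x2 do rewrite dual_conj.
rewrite tsC.
pose T (k: dual H) := (coa V (SD k) \o coa V g)%VF.
have LT k: linear (fun F: 'End(ocar V) => ltr (T k \o F)%VF: K^o) by lin3.
trans (\dsum_(q, k <- f) \dsum_(x1, x2 <- x)
  (ltr (T k \o (act V x2 \o coa V (fL q x1)))%VF: K^o)).
 apply: eqt => q k.
 rewrite -[RHS](tlE _ _ (LT k)) (yd_compat yV) (tlE _ _ (LT k)).
 apply: eqt => x1 x2.
 rewrite (tsum_fR1 (G:=fun f1: dual H => (f1 * g * SD k) (chr V x1): K^o)); last first.
  by move=> c u v; rewrite !mulrDl -!scalerAl alE slE.
 by rewrite chrE !(yd_coaM yV) /T !clA.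
rewrite tsC; apply: eqt => x1 x2.
trans (\dsum_(q, k <- f) \dsum_(q1, q2 <- q)
  ((q1: dual H) x1: K) *: (ltr (coa V g \o act V x2 \o coa V (SD k * q2))%VF: K^o)).
 apply: eqt => q k.
 rewrite (tsum_fL1 (G:=fun q2: dual H => (ltr (coa V g \o act V x2 \o coa V (SD k * q2))%VF: K^o)));
  last by lin3.
 by rewrite (yd_coaM yV) /T -clA ltrC !clA.
rewrite (tsumA (F:=fun q1 q2 k: dual H => (q1 x1: K) *:
  (ltr (coa V g \o act V x2 \o coa V (SD k * q2))%VF: K^o))); try by move=> *; lin3.
have L2: linear (fun r: dual H => ltr (coa V g \o act V x2 \o coa V r)%VF: K^o) by lin3.
trans (\dsum_(q, r <- f) (counit r: K) *:
  (((q: dual H) x1: K) *: (ltr (coa V g \o act V x2)%VF: K^o))).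
 apply: eqt => q r.
 rewrite -(tlE (W' := K^o) _ _ (f:=fun z: K^o => ((q: dual H) x1: K) *: z)); last lin.
 rewrite -(tlE _ _ L2) (antipodel_op (involutive_dual S2)).
 rewrite (lin_scale _ _ L2) (yd_coa1 yV) cl1r.
 by rewrite scalerA mulrC -scalerA.
rewrite (tsum_er (F:=fun q: dual H => (q x1: K) *: (ltr (coa V g \o act V x2)%VF: K^o)));
 last by lin3.
by rewrite chrE.
Qed.
(** The Drinfeld map: the element of the double attached to C, acting on W. On characters its values
    are endomorphisms of the module ([Phi_act], [Phi_coa]), and it turns convolution into
    composition ([Phi_conv]). *)
Definition Phi W C: 'End(ocar W) :=
 \sum_i (act W (C (hbas i)) \o coa W (@dbasis K H i))%VF.
Lemma Phi_linear W: linear (Phi W).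
move=> c C C'; rewrite /Phi scaler_sumr -big_split; apply: eq_bigr => i _ /=.
by rewrite alE slE linearP clDl clZl.
Qed.
Lemma hbas_dual (T: vectType K) (B: H -> dual H -> T) (A: 'End(H)): bilin B ->
 \sum_i B (hbas i) (@dbasis K H i \o A)%VF = \sum_i B (A (hbas i)) (@dbasis K H i).
case=> B1 B2; trans (\sum_i \sum_j (@dbasis K H i (A (hbas j)): K) *: B (hbas i) (@dbasis K H j)).
 apply: eq_bigr => i _; rewrite {1}[(_ \o _)%VF]dbasis_sum (lin_sum _ _ _ (B2 _)).
 by apply: eq_bigr => j _; rewrite clE.
rewrite exchange_big; apply: eq_bigr => j _ /=.
by rewrite {2}[A _]hbas_sum (lin_sum _ _ _ (B1 _)).
Qed.
Lemma hbas_tsum (T: vectType K) (B: H -> H -> dual H -> T) :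
 (forall h f, linear (fun a => B a h f)) -> (forall h f, linear (fun a => B h a f)) ->
 (forall h g, linear (B h g)) ->
 \sum_i \sum_j B (hbas i) (hbas j) (@dbasis K H i * @dbasis K H j) =
 \sum_k \dsum_(a, b <- hbas k) B a b (@dbasis K H k).
move=> B1 B2 B3.
trans (\sum_i \sum_j \sum_k ((@dbasis K H i * @dbasis K H j: dual H) (hbas k): K) *:
  B (hbas i) (hbas j) (@dbasis K H k)).
 apply: eq_bigr => i _; apply: eq_bigr => j _.
 by rewrite {1}[_ * _]dbasis_sum (lin_sum _ _ _ (B3 _ _)).
under eq_bigr => i _ do rewrite exchange_big.
rewrite exchange_big; apply: eq_bigr => k _ /=.
under eq_bigr => i _ do under eq_bigr => j _ do [rewrite dualM
 (tlf (fun c: K^o => (c: K) *: B (hbas i) (hbas j) (@dbasis K H k))); last lin].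
under eq_bigr => i _ do rewrite -tlift_sumr.
rewrite -tlift_sumr; apply: eqt => a b.
rewrite {2}[a]hbas_sum (lin_sum _ _ _ (B1 _ _)); apply: eq_bigr => i _.
rewrite {2}[b]hbas_sum (lin_sum _ _ _ (B2 _ _)) scaler_sumr; apply: eq_bigr => j _.
by rewrite scalerA.
Qed.
Definition adequiv C := forall h x,
 \dsum_(p, c <- h) \dsum_(a, b <- p) (C (a * x * S c) * b) = h * C x.
Lemma comp_suml (U' V' W': vectType K) I (r: seq I) (F: I -> 'Hom(V', W')) (g: 'Hom(U', V')) :
 ((\sum_(i <- r) F i) \o g = \sum_(i <- r) (F i \o g))%VF.
by apply/lfunP=> x; rewrite clE !smE; apply: eq_bigr => i _; rewrite clE. Qed.
Lemma comp_sumr (U' V' W': vectType K) I (r: seq I) (F: I -> 'Hom(U', V')) (g: 'Hom(V', W')) :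
 (g \o (\sum_(i <- r) F i) = \sum_(i <- r) (g \o F i))%VF.
apply/lfunP=> x; rewrite clE !smE lsE.
by apply: eq_bigr => i _; rewrite clE.
Qed.
(** Carrying h across the coaction conjugates the dual basis; [hbas_dual] shifts the conjugation to
    the argument of C, where [adequiv] absorbs it. *)
Lemma Phi_act W C h: yd W -> adequiv C -> (Phi W C \o act W h = act W h \o Phi W C)%VF.
move=> yW Ca.
trans (\sum_i \dsum_(p, c <- h) \dsum_(a, b <- p)
  (act W (C (hbas i) * b) \o coa W (fL (fR (@dbasis K H i) (S c)) a))%VF).
 rewrite comp_suml; apply: eq_bigr => i _; rewrite -clA (yd_move' _ _ yW).
 have L (x: H): linear (fun E: 'End(ocar W) => act W x \o E)%VF by lin3.
 rewrite (tlE _ _ (L _)); apply: eqt => p c.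
 rewrite (tlE _ _ (L _)); apply: eqt => a b.
 by rewrite clA (yd_actM yW).
trans (\sum_i \dsum_(p, c <- h) \dsum_(a, b <- p)
  (act W (C (a * hbas i * S c) * b) \o coa W (@dbasis K H i))%VF).
 rewrite -2!tlift_sumr; apply: eqt => p c; rewrite -2!tlift_sumr; apply: eqt => a b.
 have B: bilin (fun (x: H) (f: dual H) => act W (C x * b) \o coa W f)%VF by bil3.
 have := hbas_dual (amulr (S c) \o amull a)%VF B.
 under [X in _ = X -> _]eq_bigr => i _ do rewrite clE amulrE amullE.
 move=> <-; apply: eq_bigr => i _; congr (_ \o coa W _)%VF.
 by apply: dualP => z; rewrite fLE fRE !clE amulrE amullE.
rewrite comp_sumr; apply: eq_bigr => i _; rewrite clA -(yd_actM yW) -Ca.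
have L: linear (fun x => act W x \o coa W (@dbasis K H i))%VF by lin3.
rewrite (tlE _ _ L); apply: eqt => p c.
by rewrite (tlE _ _ L).
Qed.
Definition coadequiv C := forall (f g: dual H) x,
 \dsum_(x1, x2 <- x) \dsum_(p, c <- C x1) \dsum_(a, b <- p)
  (g b * f (a * x2 * S c): K^o) =
 \dsum_(x1, x2 <- x) ((f x1: K) *: (g (C x2): K^o)).
Lemma pair_tens_ext (s t: tensor H (dual H)) :
 (forall (g: dual H) x, \tsum_(u, f <- s) (g u * (f: dual H) x: K^o) =
   \tsum_(u, f <- t) (g u * (f: dual H) x: K^o)) -> s = t.
move=> st; apply: tens_sep => g phi; have [x xE] := dual_eval phi.
by under eqt => u f do rewrite xE; under [RHS]eqt => u f do rewrite xE.
Qed.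
Lemma Phi_coa W C (f: dual H): yd W -> coadequiv C ->
 (Phi W C \o coa W f = coa W f \o Phi W C)%VF.
move=> yW Cc; rewrite comp_suml comp_sumr.
pose T := 'End(ocar W).
pose B (x: H) (g: dual H): T := (act W x \o coa W g)%VF.
have Bb: bilin B by rewrite /B; bil3.
trans (tlift B (\sum_i (C (hbas i) *t (f * @dbasis K H i)))).
 rewrite lsE; apply: eq_bigr => i _.
 by rewrite /= tliftE // /B (yd_coaM yW) clA.
trans (tlift B (\sum_i \dsum_(p, c <- (C (hbas i))) \dsum_(a, b <- p)
  (b *t (@dbasis K H i * fL (fR f (S c)) a)))); last first.
 rewrite lsE; apply: eq_bigr => i _.
 rewrite clA (yd_move' _ _ yW) /= tsT.
 have L: linear (fun E: T => E \o coa W (@dbasis K H i))%VF by lin3.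
 rewrite (tlE _ _ L); apply: eqt => p c.
 rewrite (tlE _ _ L) tsT; apply: eqt => a b.
 by rewrite tliftE // /B (yd_coaM yW) clA.
congr tlift; apply: pair_tens_ext => g x; rewrite !lsE /=.
have MZ (c: K) (z: K^o): (c: K^o) * z = c *: z by [].
have Pb: bilin (fun (u: H) (l: dual H) => g u * l x: K^o) by bil.
trans (\dsum_(x1, x2 <- x) ((f x1: K) *: (g (C x2): K^o))).
 have M3 (u v w: K): u * (v * w) = v * (w * u) by ring.
 rewrite (eq_bigr (fun i => \dsum_(x1, x2 <- x)
   ((f x1: K) *: ((@dbasis K H i x2: K) *: (g (C (hbas i)): K^o))))); last first.
  move=> i _; rewrite tliftE // dualM.
  rewrite [LHS]MZ (tlE (W' := K^o) _ _ (f:=fun z: K^o => (g (C (hbas i)): K) *: z)); last lin.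
  by apply: eqt => x1 x2; apply: M3.
 rewrite -tlift_sumr; apply: eqt => x1 x2; rewrite -scaler_sumr; congr (_ *: _).
 by rewrite {2}[x2]hbas_sum !lsE; apply: eq_bigr => i _; rewrite !linearZ.
rewrite -Cc; pose G y z: K^o := \dsum_(p, c <- C y) \dsum_(a, b <- p)
  (g b * f (a * z * S c): K^o).
have GL z: linear (G^~ z) by rewrite /G; lin.
trans (\dsum_(x1, x2 <- x) \sum_i (@dbasis K H i x1: K) *: G (hbas i) x2).
 by apply: eqt => x1 x2; rewrite -(lin_sum _ _ _ (GL x2)) -hbas_sum.
rewrite tlift_sumr; apply: eq_bigr => i _; rewrite tsT.
have LZ (c: K): linear (fun z: K^o => c *: z) by lin.
under eqt => x1 x2 do rewrite /G (tlE _ _ (LZ _)).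
rewrite tsC; apply: eqt => p c.
under eqt => x1 x2 do rewrite (tlE _ _ (LZ _)).
rewrite tsC tsT; apply: eqt => a b.
rewrite tliftE // dualM [RHS]MZ (tlE _ _ (LZ (g b))); apply: eqt => x1 x2.
have M3 (u v w: K): u * (v * w) = v * (u * w) by ring.
by rewrite fLE fRE; apply: M3.
Qed.
(** [hbas_tsum] writes the operator of a convolution as a double sum over the basis, and [Phi_act]
    brings the operator of the second factor past the action. *)
Lemma Phi_conv W C C': yd W -> adequiv C' ->
 Phi W (conv C C') = (Phi W C' \o Phi W C)%VF.
move=> yW Ca; rewrite /Phi -/(Phi W C') comp_sumr.
trans (\sum_j \sum_i (act W (C (hbas j) * C' (hbas i)) \o coa W (@dbasis K H j * @dbasis K H i))%VF).
 rewrite (hbas_tsum (B:=fun a b f => act W (C a * C' b) \o coa W f)%VF); try by move=> *; lin3.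
 apply: eq_bigr => k _; rewrite convE.
 by rewrite (tlf (fun x => act W x \o coa W (@dbasis K H k))%VF) //; lin3.
apply: eq_bigr => j _; rewrite clA Phi_act // /Phi comp_sumr comp_suml.
by apply: eq_bigr => i _; rewrite (yd_actM yW) (yd_coaM yW) !clA.
Qed.
Lemma ltr_Phi W C: ltr (Phi W C) = ltr (chr W \o C)%VF.
rewrite lsE (ltr_dual_basis (r:=index_enum _) (phi:=@dbasis K H) (v:=@hbas K H)); last first.
 by move=> x; rewrite -hbas_sum.
by apply: eq_bigr => i _; rewrite /= clE chrE ltrC.
Qed.
Lemma Phi1 W: yd W -> Phi W (rk1 (@counit K H) 1) = \1%VF.
move=> yW; have -> : \1%VF = coa W (@counit K H) by rewrite -(yd_coa1 yW).
rewrite {2}[@counit K H](@dbasis_sum K H) lsE; apply: eq_bigr => i _.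
by rewrite rk1E !linearZ /= (yd_act1 yW) -clZl cl1l.
Qed.
Lemma chr_iso V W (g: 'Hom(ocar V, ocar W)) (g': 'Hom(ocar W, ocar V)): yd V -> yd W ->
 omhom g -> (g \o g' = \1)%VF -> (g' \o g = \1)%VF -> chr V = chr W.
move=> yV yW /(ydhomP _ yV yW)[g1 g2] gg' g'g; apply: eq_chr => f h.
rewrite -[(_ \o act V h)%VF]cl1l -g'g -clA ltrC; congr ltr.
apply/lfunP=> w; rewrite !clE g2 g1 -[g (g' w)]clE gg'.
by rewrite ilE.
Qed.
Lemma cdualK C: cdual (cdual C) = C.
by apply/lfunP=> x; rewrite !clE !S2. Qed.
Lemma ltr_cdual C C': ltr (cdual C \o C')%VF = ltr (C \o cdual C')%VF.
rewrite /cdual -!clA ltrC -!clA; congr ltr.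
Qed.
End YDCharacters.

(** * Dimensions of irreducible Yetter-Drinfeld modules divide dim H *)

Section IntegralRatio.
Variable K: closedFieldType.
Hypothesis char0: [pchar K] =i pred0.
Lemma integral_ratio (u v: nat): (0 < v)%N ->
 integralOver (intr: int -> K) (u%:R / v%:R) -> (v %| u)%N.
move=> v0 [P monP rP]; pose g := gcdn u v; pose u' := (u %/ g)%N; pose v' := (v %/ g)%N.
have g0: (0 < g)%N by rewrite gcdn_gt0 v0 orbT.
have uE: u = (u' * g)%N by rewrite divnK ?dvdn_gcdl.
have vE: v = (v' * g)%N by rewrite divnK ?dvdn_gcdr.
have v'0: (0 < v')%N by move: v0; rewrite vE muln_gt0 => /andP[].
have cop: coprime u' v'.
 by rewrite /coprime -(eqn_pmul2r g0) muln_gcdl -uE -vE mul1n.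
have nz (m: nat): (0 < m)%N -> m%:R != 0 :> K by move=> m0; rewrite char0_nat // -lt0n.
have E: u%:R / v%:R = u'%:R / v'%:R :> K.
 rewrite uE vE !natrM invfM mulrACA mulfV ?mulr1 ?nz //.
move: rP; rewrite E rootE horner_coef size_map_poly_id0; last first.
 by rewrite (monicP monP) rmorph1 oner_eq0.
case sP: (size P) => [|n]; first by move: monP; rewrite monicE lead_coefE (size0nil sP) nth_nil eq_sym oner_eq0.
rewrite big_ord_recr /= !coef_map /=.
have -> : P`_n = 1 by have := monicP monP; rewrite lead_coefE sP.
rewrite rmorph1 mul1r.
move=> /eqP/(congr1 (fun z => z * v'%:R ^+ n)); rewrite mul0r mulrDl mulr_suml.
rewrite -exprMn mulfVK ?nz // => Z.
have {Z}: (\sum_(i < n) P`_i * u'%:Z ^+ i * v'%:Z ^+ (n - i) + u'%:Z ^+ n)%:~R = 0 :> K.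
 rewrite rmorphD rmorph_sum rmorphXn /= -pmulrn -[RHS]Z; congr (_ + _).
 apply: eq_bigr => i _; rewrite coef_map /= !rmorphM !rmorphXn /= -!pmulrn -!mulrA; congr (_ * _).
 rewrite expr_div_n -mulrA; congr (_ * _).
 have -> : v'%:R ^+ n = v'%:R ^+ i * v'%:R ^+ (n - i) :> K.
  by rewrite -exprD subnKC // ltnW.
 by rewrite mulrA mulVf ?mul1r // expf_neq0 // nz.
move=> /eqP; rewrite char0_int // addrC addr_eq0 => /eqP Z.
have: (v'%:Z %| u'%:Z ^+ n)%Z.
 rewrite Z rpredN; apply: rpred_sum => i _.
 by apply: dvdz_mull; rewrite -(subnSK (ltn_ord i)) exprS; apply: dvdz_mulr.
rewrite dvdzE abszX /= => D.
have: coprime v' (u' ^ n) by rewrite coprimeXr // coprime_sym.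
rewrite /coprime (gcdn_idPl D) => /eqP v1.
by rewrite vE v1 mul1n dvdn_gcdl.
Qed.
End IntegralRatio.

Section EtingofGelaki.
Variables (K: closedFieldType) (H: hopfType K).
Hypothesis char0: [pchar K] =i pred0.
Hypothesis S2: involutive H.
Implicit Types (V W: @ydop K H) (C: 'End(H)).
Local Notation N := (\dim {:H}).
Local Notation algint := (integralOver (intr: int -> K)).
Lemma adequiv_chr V: yd V -> adequiv (chr V).
by move=> yV h x; apply: chr_ad. Qed.
Lemma coadequiv_chr V: yd V -> coadequiv (chr V).
by move=> yV f g x; apply: chr_coad. Qed.
Definition ydual V := ydhom V (ydtriv H).
Definition yten V W := ydhom (ydual W) V.
Lemma yd_dual V: yd V -> yd (ydual V).
by move=> yV; apply: yd_hom => //; apply: yd_triv. Qed.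
Lemma yd_ten V W: yd V -> yd W -> yd (yten V W).
by move=> yV yW; apply: yd_hom => //; apply: yd_dual. Qed.
Lemma chr_dual V: yd V -> chr (ydual V) = cdual (chr V).
move=> yV; rewrite chr_hom //; last exact: yd_triv.
apply/lfunP=> h; rewrite convE chr_triv.
under eqt => x y do rewrite rk1E -scalerAl mul1r.
by rewrite (tsum_el (F:=fun y => cdual (chr V) y)) //; lin.
Qed.
Lemma chr_ten V W: yd V -> yd W -> chr (yten V W) = conv (chr V) (chr W).
by move=> yV yW; rewrite chr_hom ?chr_dual ?cdualK //; apply: yd_dual.
Qed.
(** For irreducible W, the scalar by which the image of chr V under the Drinfeld map acts on W: an
    entry of the S-matrix divided by dim W. *)
Definition om W V: K := ltr (Phi W (chr V)) / (\dim {: ocar W})%:R.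
Lemma oirr_dim0 V: oirr V -> (\dim {: ocar V})%:R != 0 :> K.
by case=> V0 _; rewrite char0_nat // -lt0n. Qed.
Lemma Phi_scalar W V: yd W -> oirr W -> yd V -> Phi W (chr V) = om W V *: \1%VF.
move=> yW iW yV; have [|c E] := @schur_scalar _ _ W (Phi W (chr V)) iW.
 apply/(ydhomP _ yW yW); split=> [h|f] u; rewrite -!clE.
  by rewrite Phi_act //; apply: adequiv_chr.
 by rewrite Phi_coa //; apply: coadequiv_chr.
rewrite /om {1}E; congr (_ *: _); rewrite E linearZ /= ltr1 mulfK //; exact: oirr_dim0.
Qed.
Lemma om_ten W V V': yd W -> oirr W -> yd V -> yd V' ->
 om W (yten V V') = om W V' * om W V.
move=> yW iW yV yV'; rewrite {1}/om chr_ten // Phi_conv //; last exact: adequiv_chr.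
rewrite !Phi_scalar // -clZl cl1l !linearZ /= ltr1 mulrA mulfK //.
exact: oirr_dim0.
Qed.
Lemma om_dim W V: oirr W -> (\dim {: ocar W})%:R * om W V = ltr (chr W \o chr V)%VF.
move=> iW; rewrite -ltr_Phi /om; move: (ltr _) => x.
by rewrite mulrCA mulfV ?mulr1 // oirr_dim0.
Qed.
Lemma om_sym W V: oirr W -> oirr V ->
 (\dim {: ocar W})%:R * om W V = (\dim {: ocar V})%:R * om V W.
by move=> iW iV; rewrite !om_dim // ltrC. Qed.
Lemma om_dual_sym W V: yd W -> yd V -> oirr W -> oirr V ->
 (\dim {: ocar W})%:R * om W (ydual V) = (\dim {: ocar V})%:R * om V (ydual W).
by move=> yW yV iW iV; rewrite !om_dim // !chr_dual // ltrC ltr_cdual.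
Qed.
Lemma chr_decomp V J M inc prj: yd V -> @yd_decomp K H V J M inc prj ->
 chr V = \sum_j chr (M j).
move=> yV D; apply/lfunP=> h; apply: vect_sep => f.
rewrite (chrE _ (f: dual H)) smE lsE.
have [gM ih _ _ _] := D.
rewrite (odecomp_ltr (g:=fun j => (coa (M j) f \o act (M j) h)%VF) D).
 by apply: eq_bigr => j _; rewrite -chrE.
move=> j; have [[i1 i2] _] := (iffLR (ydhomP _ (gM j).1 yV) (ih j), tt).
by apply/lfunP=> u; rewrite !clE i2 i1.
Qed.
(** The trace of the averaging projection, that is, the dimension of the invariants as an element of
    K; [beta V W] is then that of the space of morphisms. *)
Definition invdim V: K := haar H (chr V (@integral K H)).
Definition beta V W := invdim (ydhom V W).
Lemma betaE V W: beta V W = ltr (coa (ydhom V W) (haar H) \o act (ydhom V W) (@integral K H))%VF.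
exact: chrE. Qed.
Lemma beta_eq0 V W: yd V -> yd W -> oirr V -> oirr W -> beta V W != 0 -> chr V = chr W.
move=> yV yW iV iW b0; apply: NNPP => nVW; case/eqP: b0; rewrite betaE.
have -> : (coa (ydhom V W) (haar H) \o act (ydhom V W) (@integral K H))%VF = 0.
 apply/lfunP=> E; rewrite clE zlE -[LHS]/(ydavg E).
 have gh := ydavg_hom char0 S2 E yV yW; apply/eqP; apply: contra_notT nVW => g0.
 have [k0 Im] := schur_iso iV iW gh g0; set g := ydavg E in gh g0 k0 Im.
 apply: (chr_iso yV yW gh (g' := (g^-1)%VF)).
  by apply/lfunP=> w; rewrite clE ilE limg_lfunVK // Im memvf.
 by apply: lker0_compVf; rewrite k0.
exact: linear0.
Qed.
Lemma beta_self V: yd V -> oirr V -> beta V V = 1.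
move=> yV iV; rewrite betaE.
have P E: exists c, (coa (ydhom V V) (haar H) \o act (ydhom V V) (@integral K H))%VF E = c *: \1%VF.
 rewrite clE -[coa _ _ _]/(ydavg E); exact: schur_scalar (ydavg_hom _ _ _ _ _).
have P1: (coa (ydhom V V) (haar H) \o act (ydhom V V) (@integral K H))%VF \1%VF = \1%VF.
 rewrite clE -[LHS]/(ydavg _) ydavg_id //; exact: omhom1.
set A := (_ \o _)%VF in P P1 *.
have d0 := oirr_dim0 iV.
pose phi: 'Hom('End(ocar V), K^o) := (\dim {:ocar V})%:R^-1 *: linfun (fun E: 'End(ocar V) => ltr (A E): K^o).
have phiE E: phi E = (\dim {:ocar V})%:R^-1 * ltr (A E).
 by rewrite slE linE //; lin2.
have -> : A = rk1 phi \1%VF.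
 apply/lfunP=> E; rewrite rk1E phiE; have [c ->] := P E; congr (_ *: _).
 by rewrite linearZ /= ltr1 mulrC mulfK.
by rewrite ltr_rk1 phiE P1 ltr1 mulVf.
Qed.
Lemma beta_chr V W: yd V -> yd W -> oirr V -> oirr W -> beta V W = (chr V == chr W)%:R.
move=> yV yW iV iW; have [E|nE] := eqVneq; last first.
 by apply/eqP; apply: contraNT nE => /(beta_eq0 yV yW iV iW) ->.
by rewrite /beta /invdim chr_hom // -E -chr_hom // -[LHS]/(beta V V) beta_self.
Qed.
Lemma beta_reg V: yd V -> beta V (ydreg H) = (\dim {: ocar V})%:R.
move=> yV; rewrite /beta /invdim chr_hom //; last exact: yd_reg.
rewrite convE chr_reg //.
have dn := dim_neq0 H char0.
set L := @integral K H.
trans (haar H (N%:R ^+ 2 *: (L * cdual (chr V) (lt (haar H) L)))).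
 congr (haar H _); rewrite ltE.
 have Lc: linear (fun z => N%:R ^+ 2 *: (L * cdual (chr V) z)) by lin.
 rewrite (tlE _ _ Lc); apply: eqt => x y.
 have -> : cdual (chr V) ((haar H x: K) *: y) = (haar H x: K) *: cdual (chr V) y by rewrite linearZ.
 by rewrite slE rk1E -scalerAr -!scalerAl.
have -> : cdual (chr V) (lt (haar H) L) = (N%:R^-1: K) *: cdual (chr V) 1.
 by rewrite haar_lt // haar_integral // linearZ.
rewrite -scalerAr integral_mulr // !linearZ /= haar_integral //.
have -> : counit (cdual (chr V) 1) = (\dim {:ocar V})%:R.
 rewrite !clE antipode1 counit_antipode -[LHS]/((1: dual H) (chr V 1)) chrE.
 by rewrite (yd_act1 yV) (yd_coa1 yV) cl1l ltr1.
set d: K := _%:R; set n: K := _%:R in dn *.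
have R: n ^+ 2 * (n^-1 * (d * n^-1)) = d by field.
exact: R.
Qed.

Section IrrList.
Variables (J: finType) (M: J -> @ydop K H) (inc: forall j, 'Hom(ocar (M j), ocar (ydreg H)))
 (prj: forall j, 'Hom(ocar (ydreg H), ocar (M j))).
Hypothesis D: yd_decomp inc prj.
Let yM j: yd (M j). by case: D => /(_ j)[]. Qed.
Let iM j: oirr (M j). by case: D => /(_ j)[]. Qed.
Lemma count_irr V: yd V -> oirr V -> (\sum_j (chr V == chr (M j)))%N = \dim {: ocar V}.
move=> yV iV; apply: (char0_natr_inj char0); rewrite -(beta_reg yV) natr_sum.
rewrite /beta /invdim chr_hom //; last exact: yd_reg.
rewrite (chr_decomp _ D); last exact: yd_reg.
rewrite convE.
under eqt => x y do rewrite smE mulr_suml.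
rewrite tlift_sumr lsE; apply: eq_bigr => j _.
by rewrite -beta_chr // /beta /invdim chr_hom // convE.
Qed.
Lemma irr_in_list V: yd V -> oirr V -> exists j, chr V = chr (M j).
move=> yV iV; apply: NNPP => nj; have := count_irr yV iV.
rewrite big1 => [|j _]; last by case: eqP => // E; case: nj; exists j.
by move=> E; case: iV; rewrite -E.
Qed.
Lemma oirr_triv: oirr (ydtriv H).
have d1: \dim {: K^o} = 1%N by rewrite dimvf.
split=> [|U _]; first by rewrite d1.
have := dimvS (subvf U); rewrite d1; case E: (\dim U) => [|[|//]] _.
 by left; apply/eqP; rewrite -dimv_eq0 E.
by right; apply/eqP; rewrite eqEdim subvf d1 E.
Qed.
Lemma om_triv W: yd W -> oirr W -> om W (ydtriv H) = 1.
by move=> yW iW; rewrite /om chr_triv Phi1 // ltr1 mulfV // oirr_dim0.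
Qed.
Lemma om_linear W: linear (fun C => ltr (Phi W C) / (\dim {: ocar W})%:R: K^o).
by move=> c C C'; rewrite Phi_linear linearP mulrDl -mulrA. Qed.
Lemma chr_nat_comb V: yd V -> exists n: J -> nat, chr V = \sum_j (n j)%:R *: chr (M j).
move=> yV; have [I [X [i [p DX]]]] := yd_decomposition char0 S2 yV.
have [r rP]: exists r: I -> J, forall a, chr (X a) = chr (M (r a)).
 apply: (fin_all_exists (P:=fun a j => chr (X a) = chr (M j))) => a.
 by case: DX => /(_ a)[yX iX] _ _ _ _; apply: irr_in_list.
exists (fun j => \sum_a (r a == j))%N; rewrite (chr_decomp yV DX).
under [RHS]eq_bigr => j _ do rewrite natr_sum scaler_suml.
rewrite exchange_big; apply: eq_bigr => a _ /=; rewrite rP (bigD1 (r a)) //= eqxx scale1r.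
by rewrite big1 ?addr0 // => j /negPf; rewrite eq_sym => ->; rewrite scale0r.
Qed.
(** For fixed W, the scalars at all irreducible modules form an eigenvector of the nonnegative
    integral matrix of multiplication by chr V, with eigenvalue [om W V]. The vector is nonzero
    since its entry at the trivial module is 1. *)
Lemma om_integral W V: yd W -> oirr W -> yd V -> algint (om W V).
move=> yW iW yV.
have [n nP]: exists n: J -> J -> nat, forall l, chr (yten V (M l)) = \sum_j (n l j)%:R *: chr (M j).
 by apply: (fin_all_exists (P:=fun l m => chr (yten V (M l)) = \sum_j (m j)%:R *: chr (M j))) => l;
  apply: chr_nat_comb; apply: yd_ten.
have omE l: om W V * om W (M l) = \sum_j (n l j)%:R * om W (M j).
 rewrite mulrC -om_ten // /om nP (lin_sum _ _ _ (om_linear W)).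
 by apply: eq_bigr.
have [l0 l0P] := irr_in_list (yd_triv H) oirr_triv.
pose A: 'M[int]_#|J| := \matrix_(i, j) (n (enum_val j) (enum_val i))%:Z.
have: eigenvalue (map_mx (intr: int -> K) A) (om W V).
 apply/eigenvalueP; exists (\row_i om W (M (enum_val i))).
  apply/rowP=> j; rewrite !mxE omE (reindex (enum_val (A:=J))) /=; last first.
   by apply: onW_bij; apply: enum_val_bij.
  by apply: eq_bigr => i _; rewrite !mxE mulrC -pmulrn.
 apply/eqP=> /rowP/(_ (enum_rank l0)); rewrite !mxE enum_rankK /om -l0P -/(om W (ydtriv H)).
 by rewrite om_triv // => /eqP; rewrite oner_eq0.
rewrite eigenvalue_root_char -map_char_poly => rt.
by exists (char_poly A); rewrite ?char_poly_monic.
Qed.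
(** Apply the Drinfeld map for the character of End(W) to the regular module. By [chr_reg] the trace
    is N^2 times the multiplicity of the trivial module in End(W), which is 1 by Schur. Decomposing
    the regular module gives the sum, once the symmetry of the S-matrix has exchanged W and
    [M j]. *)
Lemma om_sq W: yd W -> oirr W ->
 (N ^ 2)%:R / (\dim {:ocar W} ^ 2)%:R =
 \sum_j om W (M j) * om W (ydual (M j)) / (\dim {:ocar (M j)})%:R.
move=> yW iW; have dW := oirr_dim0 iW.
have E: (N ^ 2)%:R = ltr (Phi (ydreg H) (chr (ydhom W W))).
 rewrite ltr_Phi chr_reg // -clZl linearZ /=.
 rewrite ltrC comp_rk1 ltr_rk1 -[haar H _]/(beta W W) beta_self // mulr1.
 by rewrite natrX.
rewrite E (odecomp_ltr (g:=fun j => Phi (M j) (chr (ydhom W W))) D); last first.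
 move=> j; have [gM ih _ _ _] := D.
 have [i1 i2] := iffLR (ydhomP _ (gM j).1 (yd_reg H)) (ih j).
 rewrite comp_suml comp_sumr; apply: eq_bigr => i _.
 by apply/lfunP=> u; rewrite !clE i1 i2.
rewrite mulr_suml; apply: eq_bigr => j _.
rewrite chr_hom // -chr_dual // -chr_ten //; last exact: yd_dual.
have dj := oirr_dim0 (iM j).
have -> : ltr (Phi (M j) (chr (yten W (ydual W)))) =
  (\dim {: ocar (M j)})%:R * om (M j) (yten W (ydual W)) by rewrite /om mulrCA mulfV ?mulr1.
rewrite om_ten //; last exact: yd_dual.
have E1 := om_sym (iM j) iW; have E2 := om_dual_sym (yM j) yW (iM j) iW.
rewrite natrX; set d: K := _%:R in dj E1 E2 *; set w: K := _%:R in dW E1 E2 *.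
have -> : om (M j) W = w * om W (M j) / d by rewrite -E1 mulrAC mulfV ?mul1r.
have -> : om (M j) (ydual W) = w * om W (ydual (M j)) / d by rewrite -E2 mulrAC mulfV ?mul1r.
by field; rewrite dj dW.
Qed.
End IrrList.
(** The theorem of Etingof and Gelaki. In [om_sq] each isomorphism class is repeated as often as its
    dimension says, which cancels the denominators; so (N / dim W)^2 is a sum of products of
    algebraic integers, and being rational it is an integer. *)
Theorem yd_dim_dvd W: yd W -> oirr W -> (\dim {: ocar W} %| N)%N.
move=> yW iW; have [J [M [inc [prj D]]]] := yd_decomposition char0 S2 (yd_reg H).
have [gM _ _ _ _] := D.
rewrite -(@dvdn_pexp2r _ _ 2) //; apply: (integral_ratio char0).
 by rewrite expn_gt0; case: iW => ->.
rewrite (om_sq D yW iW).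
pose rep j := odflt j [pick l | chr (M l) == chr (M j)].
have repP j: chr (M (rep j)) = chr (M j).
 by rewrite /rep; case: pickP => [l /eqP|].
have repE j l: (rep j == rep l) = (chr (M j) == chr (M l)).
 apply/eqP/eqP => [E|E]; first by rewrite -(repP j) -(repP l) E.
 rewrite /rep E; case: pickP => // /(_ l); by rewrite eqxx.
rewrite (partition_big rep xpredT) //=.
apply: (big_ind algint); [exact: integral0 | exact: integral_add |] => l _.
have [rl | nl] := eqVneq (rep l) l; last first.
 rewrite big_pred0 => [|j]; first exact: integral0.
 apply/eqP=> E.
 by move/eqP: nl; apply; rewrite -{2}E; apply/eqP; rewrite repE -E repP.
rewrite (eq_bigr (fun j => om W (M l) * om W (ydual (M l)) / (\dim {:ocar (M l)})%:R * (chr (M l) == chr (M j))%:R)); last first.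
 move=> j jl; have E: chr (M l) = chr (M j) by apply/eqP; rewrite -repE rl eq_sym.
 have dE: (\dim {:ocar (M j)})%:R = (\dim {:ocar (M l)})%:R :> K.
  rewrite -(beta_reg (gM j).1) -(beta_reg (gM l).1) /beta /invdim.
  have X i: chr (ydhom (M i) (ydreg H)) = conv (chr (ydreg H)) (cdual (chr (M i))).
   by apply: chr_hom => //; [exact: (gM i).1 | exact: yd_reg].
  by rewrite !X E.
 rewrite E eqxx mulr1 dE /om !chr_dual ?E //; exact: (proj1 (gM _)).
rewrite -mulr_sumr.
have -> : \sum_(j | rep j == l) (chr (M l) == chr (M j))%:R = (\dim {:ocar (M l)})%:R :> K.
 rewrite -(count_irr D (gM l).1 (gM l).2) natr_sum big_mkcond; apply: eq_bigr => j _ /=.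
 have -> : (rep j == l) = (chr (M l) == chr (M j)) by rewrite -[RHS]repE rl eq_sym.
 by case: eqP.
rewrite mulfVK; last exact: oirr_dim0 (gM l).2.
apply: integral_mul; apply: (om_integral D) => //; first exact: (gM l).1.
exact/yd_dual/(gM l).1.
Qed.
End EtingofGelaki.

(** * Coideal subalgebras and their integrals *)

Section RestrictedTrace.
Variables (K: fieldType) (V: vectType K).
Implicit Types (U M W: {vspace V}) (E F: 'End(V)).
Lemma exists_minimal (P: {vspace V} -> Prop) U: P U -> U != 0%VS ->
 exists W, [/\ P W, (W <= U)%VS, W != 0%VS &
  forall W', P W' -> (W' <= W)%VS -> W' != 0%VS -> W' = W].
have [n] := ubnP (\dim U); elim: n U => // n IHn U leU PU U0.
have [[W' [PW' sW' W'0 nW']] | nW] := classic (exists W', [/\ P W', (W' <= U)%VS, W' != 0%VS & W' <> U]).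
 have [|W [PW sW W0 mW]] := IHn W' _ PW' W'0; last by exists W; split=> //; apply: subv_trans sW'.
 apply: (leq_trans _ (leU: (\dim U <= n)%N)); rewrite ltn_neqAle dimvS // andbT; apply/eqP=> E.
 by apply: nW'; apply/eqP; rewrite eqEdim sW' E leqnn.
exists U; split=> // W' PW' sW' W'0; apply: NNPP => nE; apply: nW.
by exists W'.
Qed.
(** The trace of the compression of E to M, hence the trace of the restriction when E preserves M;
    by [eq_rtr] only the values on M count. *)
Definition rtr M E: K := ltr (projv M \o E)%VF.
Lemma rtr_linear M: linear_for *%R (rtr M).
by move=> c E F; rewrite /rtr clDr -clZr linearP. Qed.
Lemma rtr1 M: rtr M \1%VF = (\dim M)%:R.
rewrite /rtr cl1r ltr_idem ?limg_proj //.
by apply/lfunP=> x; rewrite clE projv_proj.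
Qed.
Lemma eq_rtr M E F: (forall x, x \in M -> E x = F x) -> rtr M E = rtr M F.
move=> EF; have X (G: 'End(V)): rtr M G = ltr ((projv M \o G) \o projv M)%VF.
 rewrite ltrC clA; congr ltr; apply/lfunP=> x.
 by rewrite !clE projv_proj.
rewrite !X; congr ltr; apply/lfunP=> x; rewrite !clE EF //; exact: memv_proj.
Qed.
Lemma rtrC M E F: (forall x, x \in M -> E x \in M) -> (forall x, x \in M -> F x \in M) ->
 rtr M (E \o F)%VF = rtr M (F \o E)%VF.
have X (A B: 'End(V)): (forall x, x \in M -> B x \in M) ->
  rtr M (A \o B)%VF = ltr ((projv M \o (A \o projv M)) \o (projv M \o (B \o projv M)))%VF.
 move=> BM; rewrite /rtr.
 trans (ltr ((projv M \o (A \o B)) \o projv M)%VF).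
  by rewrite [RHS]ltrC; congr ltr; apply/lfunP=> x; rewrite !clE projv_proj.
 congr ltr; apply/lfunP=> x; rewrite !clE projv_proj.
 by rewrite (projv_id (BM _ (memv_proj _ _))).
by move=> EM FM; rewrite !X // ltrC.
Qed.
Lemma rtr_rk1 M (phi: 'Hom(V, K^o)) v: v \in M -> rtr M (rk1 phi v) = phi v.
by move=> vM; rewrite /rtr comp_rk1 ltr_rk1 projv_id. Qed.
End RestrictedTrace.

Section Fitting.
Variables (K: fieldType) (A: falgType K) (I: {vspace A}).
Hypothesis IM: forall x y, x \in I -> y \in I -> x * y \in I.
(* The powers of x act bijectively on a tail of the commutative part of I. *)
Lemma idempotent_of_nonnil x: x \in I -> (forall n, x ^+ n != 0) ->
 exists e, [/\ e \in I, e != 0 & e * e = e].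
move=> xI xn; pose P := (I :&: lker (amull x - amulr x))%VS.
have memP y: (y \in P) = (y \in I) && (x * y == y * x).
 by rewrite memv_cap memv_ker alE olE amullE amulrE subr_eq0.
have PX y: y \in P -> x * y \in P.
 by rewrite !memP => /andP[yI /eqP xy]; rewrite IM //= {1}xy mulrA.
have xP: x \in P by rewrite memP xI eqxx.
pose V n := (amull (x ^+ n) @: P)%VS.
have VS n: (V n.+1 <= V n)%VS.
 apply/subvP=> _ /memv_imgP[y yP ->]; rewrite amullE exprSr -mulrA.
 by apply/memv_imgP; exists (x * y); rewrite ?PX ?amullE.
have VSS n: V n.+1 = V n -> V n.+2 = V n.+1.
 move=> E; apply/vspaceP=> z; apply/idP/idP; first exact/subvP/VS.
 move/memv_imgP=> [y yP ->]; rewrite amullE exprS -mulrA.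
 have: x ^+ n * y \in V n.+1 by rewrite E -amullE memv_img.
 move/memv_imgP=> [y' y'P ->]; rewrite amullE mulrA -exprS.
 by rewrite -amullE memv_img.
have [m mE]: exists m, V m.+1 = V m.
 apply: NNPP => nm; have lt n: (\dim (V n) + n <= \dim P)%N.
  elim: n => [|n IHn].
   by rewrite addn0 limg_dim_eq // expr0 amull1; apply/eqP; rewrite -subv0; apply/subvP=> z /memv_capP[_]; rewrite memv_ker ilE memv0.
  rewrite addnS; apply: leq_trans IHn; rewrite ltn_add2r.
  rewrite ltn_neqAle dimvS // andbT; apply/eqP=> E; apply: nm; exists n.
  by apply/eqP; rewrite eqEdim VS E leqnn.
 by have := lt (\dim P).+1; rewrite addnS ltnNge leq_addl.
have mS j: V (m + j)%N = V m.
 suff []: V (m + j)%N = V m /\ V (m + j).+1 = V (m + j)%N by [].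
 elim: j => [|j [IH1 IH2]]; first by rewrite addn0.
 by rewrite addnS; split; [rewrite IH2 | exact: VSS].
have: x ^+ m.+1 \in V (m + m.+2)%N by rewrite mS exprSr -amullE memv_img.
move/memv_imgP=> [p pP]; rewrite amullE => xE; move: pP; rewrite memP => /andP[pI /eqP xp].
have cp n: x ^+ n * p = p * x ^+ n by apply/esym/commrX/esym.
exists (x ^+ m.+1 * p).
have ex: x ^+ m.+1 * p * x ^+ m.+1 = x ^+ m.+1.
 by rewrite -mulrA -cp mulrA -exprD [RHS]xE; congr (x ^+ _ * p); lia.
split; last by rewrite mulrA ex.
 apply: (IM _ pI); elim: (m) => [|n IHn]; first by rewrite expr1.
 by rewrite exprS IM.
apply/eqP=> E; have /eqP := xn m.+1; apply; by rewrite -ex E mul0r.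
Qed.
End Fitting.

Section CoidealSubalgebras.
Variables (K: fieldType) (H: hopfType K).
Hypothesis char0: [pchar K] =i pred0.
Hypothesis S2: involutive H.
Implicit Types (U M: {vspace H}).
Local Notation S := (@antipode K H).
Local Notation SD := (@antipode K (dual H)).
Local Notation N := (\dim {:H}).
Local Notation lambda := (haar H).
Definition ltstable U := forall (f: dual H) x, x \in U -> lt f x \in U.
Definition coid_subalg U := [/\ 1 \in U, forall x y, x \in U -> y \in U -> x * y \in U & ltstable U].
Definition adstable U := forall h x, x \in U -> ad h x \in U.
Lemma amulr_lt (f: dual H) y: amulr (lt f y) =
 \dsum_(f1, f2 <- f) (lt f2 \o (amulr y \o lt (SD f1)))%VF.
apply/lfunP=> x; have L: linear (fun E: 'End(H) => E x) by lin.
rewrite (tlE _ _ L) amulrE.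
under eqt => f1 f2 do rewrite !clE amulrE lt_mul.
rewrite -(tsumA (F:=fun f1 f2 f3: dual H => lt f2 (lt (SD f1) x) * lt f3 y)); last first.
- by move=> *; lin2.
- by move=> *; lin2.
- by move=> *; lin2.
under eqt => q f3 do
 [under eqt => f1 f2 do rewrite -ltM;
  rewrite (tsum_antil (F:=fun z: dual H => lt z x * lt f3 y)); last lin2].
rewrite lt1.
by rewrite (tsum_el (F:=fun z: dual H => x * lt z y)) //; lin2.
Qed.
(** By [amulr_lt] and cyclicity, right multiplication by lt f y has f(1) times the trace of right
    multiplication by y. For f the Haar functional, lt f y is the scalar haar(y). So the trace
    formula of the regular representation persists on every such M. *)
Lemma rtr_amulr M y: ltstable M ->
 (forall f x, x \in M -> x * lt f y \in M) -> rtr M (amulr y) = (\dim M)%:R * lambda y.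
move=> sM yM; have yM' x: x \in M -> x * y \in M by move=> /(yM 1); rewrite lt1.
have E f: rtr M (amulr (lt f y)) = (f 1: K) * rtr M (amulr y).
 rewrite amulr_lt.
 have L: linear (rtr M: _ -> K^o) by move=> c a b; rewrite rtr_linear.
 rewrite (tlE (W' := K^o) _ _ L).
 trans (\dsum_(f1, f2 <- f) (rtr M (amulr y \o lt (f2 * SD f1))%VF: K^o)).
  apply: (@eqt K _ _ K^o) => f1 f2; rewrite rtrC; first 1 last.
  - by move=> x; apply: sM.
  - by move=> x xM; rewrite clE amulrE yM' // sM.
  rewrite -clA; congr (rtr M (_ \o _)%VF).
  by apply/lfunP=> x; rewrite clE ltM.
 have L2: linear (fun z: dual H => rtr M (amulr y \o lt z)%VF: K^o).
  by move=> c a b; rewrite linearP clDr -clZr rtr_linear.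
 rewrite -(tlE _ _ L2) (antipoder_op (involutive_dual S2)) (lin_scale _ _ L2).
 rewrite -dual_counitE'; congr (_ * rtr M _); apply/lfunP=> x.
 by rewrite clE lt1.
have := E lambda; rewrite haar1 // mul1r => <-.
rewrite haar_lt // (_: amulr _ = (lambda y: K) *: \1%VF).
 by rewrite -[_ *: \1%VF]addr0 rtr_linear rtr1 /rtr comp_lfun0r linear0 addr0 mulrC.
by move: (lambda y: K) => c; apply/lfunP=> x; rewrite amulrE slE ilE -scalerAr mulr1.
Qed.

Section OneSubalgebra.
Variable U: {vspace H}.
Hypothesis cU: coid_subalg U.
Let U1: 1 \in U. by case: cU. Qed.
Let UM x y: x \in U -> y \in U -> x * y \in U. by case: cU => _ + _; apply. Qed.
Let UT: ltstable U. by case: cU. Qed.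
Lemma rtr_coid M y: ltstable M -> (forall x y, x \in M -> y \in U -> x * y \in M) ->
 y \in U -> rtr M (amulr y) = (\dim M)%:R * lambda y.
by move=> sM MU yU; apply: rtr_amulr => // f x xM; apply: MU => //; apply: UT. Qed.
Lemma ltr_amull_haar x: ltr (amull x) = N%:R * lambda x.
by rewrite haarE // mulrA mulfV ?mul1r // dim_neq0. Qed.
Lemma haar_lt_move (f: dual H) x y: lambda (lt f x * y) = lambda (x * lt (SD f) y).
have hl g z: lambda (lt g z) = g 1 * lambda z by rewrite dual_lt haar_r.
have L z: linear (fun g: dual H => lambda (z * lt (SD g) y): K^o) by lin2.
rewrite -(tsum_el (F:=fun g: dual H => lambda (x * lt (SD g) y))) //.
trans (\dsum_(f1, f2 <- f) (lambda (lt f1 (x * lt (SD f2) y)): K^o)); last first.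
 by apply: eqt => f1 f2; rewrite hl dual_counitE'.
under eqt => f1 f2 do [rewrite lt_mul (tlf (lambda)); last lin].
rewrite (tsumA (F:=fun a b c: dual H => lambda (lt a x * lt b (lt (SD c) y)): K^o)); first 1 last.
- by move=> *; lin2.
- by move=> *; lin2.
- by move=> *; lin2.
under eqt => f1 q do
 [under eqt => f2 f3 do rewrite -ltM;
  rewrite -(tlf (fun g: dual H => lambda (lt f1 x * lt g y): K^o)); last lin2].
under eqt => f1 q do
 [rewrite (antipodel_op (involutive_dual S2)) (lin_scale _ _ (f:=fun g: dual H => lambda (lt f1 x * lt g y): K^o)) ?lt1; last lin2].
by rewrite (tsum_er (F:=fun g: dual H => lambda (lt g x * y))) //; lin2.
Qed.
(** The radical I of the form on U is a translation-stable left ideal of U, and H I contains 1 by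
    the antipode axiom; so no nonzero w has I w = 0. A minimal nonzero subspace of H stable under
    left multiplication by I is therefore I w for some w in it, which gives y in I with y w = w. As
    y is not nilpotent, I contains a nonzero idempotent; but its trace N haar(e) vanishes by the
    definition of I, while it is the rank. *)
Lemma haar_coid_nondeg x: x \in U -> (forall y, y \in U -> lambda (x * y) = 0) -> x = 0.
move=> xU x0; apply/eqP; apply: contraT => xn0.
pose Phi: 'Hom(H, 'Hom(H, K^o)) := linfun (fun z: H => (lambda \o (amull z \o projv U))%VF).
have PhiE z y: Phi z y = lambda (z * projv U y).
 rewrite linE; first by rewrite !clE amullE.
 by apply: lin_compr; apply: lin_compl; apply: lin_amull; apply: lin_id.
pose I := (U :&: lker Phi)%VS.
have memI z: reflect (z \in U /\ forall y, y \in U -> lambda (z * y) = 0) (z \in I).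
 rewrite memv_cap memv_ker; apply: (iffP andP) => [[zU /eqP z0]|[zU z0]]; split=> //.
  by move=> y yU; have /lfunP/(_ y) := z0; rewrite PhiE projv_id ?zlE.
 by apply/eqP/lfunP=> y; rewrite PhiE z0 ?memv_proj ?zlE.
have IU z: z \in I -> z \in U by case/memI.
have UI y z: y \in U -> z \in I -> y * z \in I.
 move=> yU /memI[zU z0]; apply/memI; split=> [|w wU]; first exact: UM.
 by rewrite -mulrA haarC // -mulrA z0 // UM.
have IT f z: z \in I -> lt f z \in I.
 move=> /memI[zU z0]; apply/memI; split=> [|w wU]; first exact: UT.
 by rewrite haar_lt_move z0 // UT.
have xI: x \in I by apply/memI.
have [f fx]: exists f: dual H, f x != 0.
 apply: NNPP => nf; case/eqP: xn0; apply: vect_sep => f; rewrite linear0.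
 by apply: NNPP => /eqP fx; apply: nf; exists f.
have HI1: 1 \in (fullv * I)%VS.
 have: (f x: K) *: 1 \in (fullv * I)%VS.
  rewrite -counit_lt -antipodel (tsum_hbasl (F:=fun a b => S a * b)); last bil.
  apply: memv_suml => i _; apply: memv_mul; first exact: memvf.
  exact: IT _ _ (IT _ _ xI).
 by move=> /(memvZ (f x: K)^-1); rewrite scalerA mulVf // scale1r.
have killI w: (forall z, z \in I -> z * w = 0) -> w = 0.
 move=> Iw; have /subvP/(_ 1 HI1): (fullv * I <= lker (amulr w))%VS.
  by apply/prodvP=> h z _ zI; rewrite memv_ker amulrE -mulrA Iw ?mulr0.
 by rewrite memv_ker amulrE mul1r => /eqP.
have full0: fullv != 0%VS :> {vspace H}.
 by apply/eqP=> E; have := memvf (1: H); rewrite E memv0 oner_eq0.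
have [W [IW _ W0 mW]] := @exists_minimal K H (fun W => forall z w, z \in I -> w \in W -> z * w \in W)
  fullv (fun z w _ _ => memvf _) full0.
pose w0 := vpick W; have w00: w0 != 0 by rewrite vpick0.
have w0W: w0 \in W by apply: memv_pick.
have [z [zI zw]]: exists z, z \in I /\ z * w0 != 0.
 apply: NNPP => nz; case/eqP: w00; apply: killI => z zI; apply: NNPP => /eqP zw.
 by apply: nz; exists z.
have WE: (amulr w0 @: I)%VS = W.
 apply: mW.
 - move=> y _ yI /memv_imgP[v vI ->]; rewrite amulrE mulrA -amulrE memv_img // UI //.
  exact: IU.
 - by apply/subvP=> _ /memv_imgP[v vI ->]; rewrite amulrE IW.
 - by apply/eqP=> E; case/eqP: zw; apply/eqP; rewrite -memv0 -E -amulrE memv_img.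
have: w0 \in (amulr w0 @: I)%VS by rewrite WE.
move=> /memv_imgP[y yI]; rewrite amulrE => yw.
have yn n: y ^+ n * w0 = w0.
 by elim: n => [|n IHn]; rewrite ?mul1r // exprSr -mulrA -yw.
have [||e [eI e0 ee]] := @idempotent_of_nonnil K H I _ y yI.
- by move=> a b /IU aU bI; apply: UI.
- by move=> n; apply/eqP=> E; case/eqP: w00; rewrite -(yn n) E mul0r.
have := ltr_amull_haar e.
have -> : lambda e = 0 by have /memI[_ /(_ 1 U1)] := eI; rewrite mulr1.
rewrite mulr0 ltr_idem; last by apply/lfunP=> v; rewrite clE !amullE mulrA ee.
move/eqP; rewrite char0_nat // dimv_eq0 => /eqP E.
have: amull e 1 \in limg (amull e) by exact/memv_img/memvf.
by rewrite E memv0 amullE mulr1 (negPf e0).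
Qed.
(** L represents the counit of U for the nondegenerate form, which makes it an integral. Its right
    multiplication is then the rank one map y |-> counit(y) L, so counit(L) = dim U haar(L) by
    [rtr_coid]; this is nonzero, and L can be normalised. *)
Lemma coid_integral: exists L, [/\ L \in U, counit L = 1,
 forall y, y \in U -> y * L = (counit y: K) *: L & (\dim U)%:R * lambda L = 1].
pose B (u v: subvs_of U): K^o := lambda (vsval u * vsval v).
pose P: 'Hom(subvs_of U, 'Hom(subvs_of U, K^o)) := linfun (fun u => linfun (B u)).
have BL u: linear (B u) by move=> c v w; rewrite /B !linearP mulrDr -scalerAr linearP.
have PE u v: P u v = B u v.
 rewrite linE ?(linE (BL u)) // => c a b; apply/lfunP=> w.
 rewrite alE slE !(linE (BL _)) /B.
 by rewrite !linearP mulrDl -scalerAl linearP.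
have P0: lker P == 0%VS.
 rewrite -subv0; apply/subvP=> u; rewrite memv_ker memv0 => /eqP Pu.
 rewrite -(inj_eq (can_inj (@vsvalK _ _ U))) linear0; apply/eqP.
 apply: haar_coid_nondeg => [|y yU]; first exact: subvsP.
 have /lfunP/(_ (vsproj U y)) := Pu.
 by rewrite PE /B vsprojK // zlE.
have Pf: limg P = fullv.
 apply/eqP; rewrite eqEdim subvf limg_dim_eq; last by rewrite capfv; apply/eqP.
 by rewrite !dimvf /dim /= muln1.
pose ep: 'Hom(subvs_of U, K^o) := (@counit K H \o linfun vsval)%VF.
have epE u: ep u = counit (vsval u) by rewrite clE lfunE.
have /memv_imgP[u _ uE]: ep \in limg P by rewrite Pf memvf.
have [L LU Leps]: exists2 L, L \in U & forall y, y \in U -> lambda (L * y) = counit y.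
 exists (vsval u) => [|y yU]; first exact: subvsP.
 by have /lfunP/(_ (vsproj U y)) := uE; rewrite PE epE /B vsprojK.
have Ll y: y \in U -> y * L = (counit y: K) *: L.
 move=> yU; apply/eqP; rewrite -subr_eq0; apply/eqP; apply: haar_coid_nondeg.
  by rewrite rpredB ?rpredZ ?UM.
 move=> z zU; rewrite mulrBl linearB /= -scalerAl linearZ /= haarC // mulrA haarC //.
 by rewrite Leps ?UM // Leps // counitM mulrC subrr.
have dL: (\dim U)%:R * lambda L = counit L.
 rewrite -rtr_coid //.
 rewrite -(rtr_rk1 (@counit K H) LU).
 apply: (@eq_rtr K H U (amulr L) (rk1 (@counit K H) L)) => x xU.
 rewrite amulrE (Ll x xU); exact/esym/rk1E.
have nd: (\dim U)%:R != 0 :> K.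
 rewrite char0_nat // dimv_eq0; apply/eqP=> E; have := U1; rewrite E memv0.
 by rewrite oner_eq0.
have e0: counit L != 0 by rewrite -dL mulf_neq0 // -[L]mulr1 Leps // counit1 oner_neq0.
exists ((counit L: K)^-1 *: L); split.
- by rewrite rpredZ.
- by rewrite linearZ /= -[LHS]/(_ * _) mulVf.
- by move=> y yU; rewrite -scalerAr Ll // !scalerA mulrC.
by rewrite linearZ /= mulrCA dL -[LHS]/(_ * _) mulVf.
Qed.
End OneSubalgebra.
End CoidealSubalgebras.

(** * Hopf subalgebras as Hopf algebras *)

Section TensorSubspaces.
Variables (K: fieldType) (U V: vectType K).
Implicit Types (A: {vspace U}) (B: {vspace V}).
Lemma tensv_mem A B u v: u \in A -> v \in B -> u *t v \in tensv A B.
move=> /coord_vbasis -> /coord_vbasis ->; have [L1 L2] := tens_bilin U V.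
rewrite (lin_sum _ _ _ (L1 _)); apply: memv_suml => i _; apply: memvZ.
rewrite (lin_sum _ _ _ (L2 _)); apply: memv_suml => j _; apply: memvZ.
by apply/memv_span/allpairsP; exists ((vbasis A)`_i, (vbasis B)`_j); rewrite !mem_nth ?size_tuple.
Qed.
Lemma tsum_projv (W: vectType K) A B t (G: U -> V -> W): t \in tensv A B -> bilin G ->
 \tsum_(x, y <- t) G (projv A x) (projv B y) = \tsum_(x, y <- t) G x y.
move=> tAB GB; pose F: 'Hom(tensor U V, W) :=
 linfun (tlift (fun x y => G (projv A x) (projv B y))) - linfun (tlift G).
have GP: bilin (fun x y => G (projv A x) (projv B y)).
 split=> [y|x] c a b; rewrite linearP; first exact: GB.1.
 exact: GB.2.
have FE s: F s = \tsum_(x, y <- s) G (projv A x) (projv B y) - \tsum_(x, y <- s) G x y.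
 by rewrite alE olE !lfunE.
have: t \in lker F.
 apply: subvP tAB; apply/span_subvP=> _ /allpairsP[[u v] /= [uA vB ->]].
 by rewrite memv_ker FE !tliftE // !projv_id ?subrr // vbasis_mem.
by rewrite memv_ker FE subr_eq0 => /eqP.
Qed.
(** Both families of slices suffice. Applied to a coproduct, where the slices are translates, this
    reduces the coalgebra condition on a subspace to stability under [lt] and [rt]. *)
Lemma tens_mem A B (t: tensor U V) :
 (forall phi: 'Hom(U, K^o), \tsum_(x, y <- t) (phi x: K) *: y \in B) ->
 (forall psi: 'Hom(V, K^o), \tsum_(x, y <- t) (psi y: K) *: x \in A) ->
 t \in tensv A B.
move=> tB tA.
have -> : t = \tsum_(x, y <- t) (projv A x *t projv B y).
 apply: tens_sep => f g; rewrite tsT.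
 trans (\tsum_(x, y <- t) (f (projv A x) * g (projv B y): K^o)); last first.
  by apply: eqt => x y; rewrite tliftE //; bil.
 trans (\tsum_(x, y <- t) (f (projv A x) * g y: K^o)).
  trans (f (\tsum_(x, y <- t) (g y: K) *: x)).
   rewrite (tlf (f)); last lin.
   by apply: eqt => x y; rewrite linearZ mulrC.
  rewrite -(projv_id (tA g)) (tlf (fun z => f (projv A z))); last lin.
  by apply: eqt => x y; rewrite !linearZ mulrC.
 trans (g (\tsum_(x, y <- t) (f (projv A x): K) *: y)).
  rewrite (tlf (g)); last lin.
  by apply: eqt => x y; rewrite linearZ.
 have M: \tsum_(x, y <- t) (f (projv A x): K) *: y \in B.
  have := tB (f \o projv A)%VF.
  by under eqt => x y do rewrite clE.
 rewrite -(projv_id M) (tlf (fun z => g (projv B z))); last lin.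
 by apply: eqt => x y; rewrite !linearZ.
by apply: memv_suml => i _; apply: memv_suml => j _; rewrite memvZ // tensv_mem ?memv_proj.
Qed.
Lemma tens_contr A B (t: tensor U V): t \in tensv A B ->
 (forall phi: 'Hom(U, K^o), \tsum_(x, y <- t) (phi x: K) *: y \in B) /\
 (forall psi: 'Hom(V, K^o), \tsum_(x, y <- t) (psi y: K) *: x \in A).
move=> tAB; split=> [phi | psi].
 rewrite -(tsum_projv tAB); last bil.
 by apply: memv_suml => i _; apply: memv_suml => j _; rewrite !memvZ ?memv_proj.
rewrite -(tsum_projv tAB); last bil.
by apply: memv_suml => i _; apply: memv_suml => j _; rewrite !memvZ ?memv_proj.
Qed.
End TensorSubspaces.

Section HopfSubalgebraType.
Variables (K: fieldType) (H: hopfType K) (A: {vspace H}).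
(** The proof that A is a Hopf subalgebra is a parameter of the type, so that the Hopf structure can
    be attached to it by canonical instances. *)
Definition hsub of hopf_subalg A := subvs_of A.
Variable hA: hopf_subalg A.
Local Notation B := (hsub hA).
HB.instance Definition _ := Vector.on B.
Let A1: 1 \in A. by case: hA. Qed.
Let AM x y: x \in A -> y \in A -> x * y \in A.
by case: hA => _ /prodvP + _ _; apply. Qed.
Let AD x: x \in A -> comul x \in tensv A A.
by case: hA => _ _ /subvP D _ xA; apply: D; apply: memv_img. Qed.
Let AS x: x \in A -> antipode x \in A.
by case: hA => _ _ _ /subvP D xA; apply: D; apply: memv_img. Qed.
Definition hval: 'Hom(B, H) := linfun (vsval: subvs_of A -> H).
Definition hproj: 'Hom(H, B) := linfun (vsproj A: H -> subvs_of A).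
Lemma hvalE (u: B): hval u = vsval (u: subvs_of A). exact: lfunE. Qed.
Lemma hprojE x: hproj x = vsproj A x. exact: lfunE. Qed.
Lemma hvalP u: hval u \in A. by rewrite hvalE subvsP. Qed.
Lemma hvalK u: hproj (hval u) = u. by rewrite hvalE hprojE vsvalK. Qed.
Lemma hprojK x: x \in A -> hval (hproj x) = x.
by move=> xA; rewrite hvalE hprojE vsprojK. Qed.
Lemma hval_projv x: hval (hproj x) = projv A x.
by rewrite hvalE hprojE unlock. Qed.
Lemma hval_inj: injective hval. exact: can_inj hvalK. Qed.
Definition hone: B := hproj 1.
Definition hmul (u v: B): B := hproj (hval u * hval v).
Lemma hval1: hval hone = 1. exact: hprojK. Qed.
Lemma hvalM u v: hval (hmul u v) = hval u * hval v.
by rewrite hprojK // AM ?hvalP. Qed.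
Lemma hmulA: associative hmul.
by move=> u v w; apply: hval_inj; rewrite !hvalM mulrA. Qed.
Lemma hmul1l: left_id hone hmul.
by move=> u; apply: hval_inj; rewrite hvalM hval1 mul1r. Qed.
Lemma hmul1r: right_id hone hmul.
by move=> u; apply: hval_inj; rewrite hvalM hval1 mulr1. Qed.
Lemma hmulDl: left_distributive hmul +%R.
by move=> u v w; apply: hval_inj; rewrite linearD /= !hvalM linearD mulrDl. Qed.
Lemma hmulDr: right_distributive hmul +%R.
by move=> u v w; apply: hval_inj; rewrite linearD /= !hvalM linearD mulrDr. Qed.
Lemma hone_neq0: hone != 0.
by apply/eqP=> E; have /eqP := hval1; rewrite E linear0 eq_sym oner_eq0. Qed.
HB.instance Definition _ := GRing.Zmodule_isNzRing.Build B
 hmulA hmul1l hmul1r hmulDl hmulDr hone_neq0.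
Lemma hscaleAl (a: K) (u v: B): a *: (u * v) = a *: u * v.
by apply: hval_inj; rewrite linearZ /= !hvalM linearZ scalerAl. Qed.
Lemma hscaleAr (a: K) (u v: B): a *: (u * v) = u * (a *: v).
by apply: hval_inj; rewrite linearZ /= !hvalM linearZ scalerAr. Qed.
HB.instance Definition _ := GRing.Lmodule_isLalgebra.Build K B hscaleAl.
HB.instance Definition _ := GRing.Lalgebra_isAlgebra.Build K B hscaleAr.
HB.instance Definition _ := Algebra_isFalgebra.Build K B.
Definition hcomul: 'Hom(B, tensor B B) :=
 linfun (fun u: B => tmap hproj hproj (comul (hval u))).
Definition hcounit: 'Hom(B, K^o) := (counit \o hval)%VF.
Definition hanti: 'End(B) := (hproj \o (antipode \o hval))%VF.
Lemma hval_anti u: hval (hanti u) = antipode (hval u).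
by rewrite !clE hprojK // AS // hvalP. Qed.
Lemma hcounitE u: hcounit u = counit (hval u). exact: clE. Qed.
Lemma hcomul_def u: hcomul u = tmap hproj hproj (comul (hval u)).
by rewrite linE // /tmap; lin. Qed.
Lemma hcomulE (W: vectType K) (G: B -> B -> W) u: bilin G ->
 \tsum_(x, y <- hcomul u) G x y = \dsum_(x, y <- hval u) G (hproj x) (hproj y).
move=> GB; rewrite hcomul_def /tmap.
by rewrite tsT; apply: eqt => x y; rewrite tliftE.
Qed.
Lemma hcomul_val (W: vectType K) (G: H -> H -> W) u: bilin G ->
 \tsum_(x, y <- hcomul u) G (hval x) (hval y) = \dsum_(x, y <- hval u) G x y.
move=> [G1 G2]; rewrite hcomulE; last first.
 by split=> [y|x] c a b; rewrite linearP; [apply: G1 | apply: G2].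
under eqt => x y do rewrite !hval_projv.
by apply: tsum_projv => //; apply/AD/hvalP.
Qed.
Lemma hcomulA (c: B) :
 \tsum_(x, y <- hcomul c) \tsum_(x1, x2 <- hcomul x) (x1 *t (x2 *t y)) =
 \tsum_(x, y <- hcomul c) (x *t hcomul y).
pose G3 x1 x2 y: tensor B (tensor B B) := hproj x1 *t (hproj x2 *t hproj y).
trans (\dsum_(x, y <- hval c) \dsum_(x1, x2 <- x) G3 x1 x2 y).
 rewrite -hcomul_val; last by rewrite /G3; bil.
 by apply: eqt => x y; rewrite hcomulE ?/G3 ?hvalK //; bil.
rewrite tsumA; try by move=> *; rewrite /G3; lin.
rewrite -hcomul_val; last by rewrite /G3; bil.
apply: eqt => x y; rewrite hcomul_def /tmap.
rewrite (tlf (fun t => x *t t)); last lin.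
by apply: eqt => a b; rewrite /G3 hvalK.
Qed.
Lemma hcounitl (c: B): \tsum_(x, y <- hcomul c) ((hcounit x: K) *: y) = c.
apply: hval_inj; rewrite (tlf (hval)); last lin.
under eqt => x y do rewrite linearZ /= hcounitE.
by rewrite (hcomul_val (G:=fun x y => (counit x: K) *: y)) ?counitl //; bil.
Qed.
Lemma hcounitr (c: B): \tsum_(x, y <- hcomul c) ((hcounit y: K) *: x) = c.
apply: hval_inj; rewrite (tlf (hval)); last lin.
under eqt => x y do rewrite linearZ /= hcounitE.
by rewrite (hcomul_val (G:=fun x y => (counit y: K) *: x)) ?counitr //; bil.
Qed.
HB.instance Definition _ := Vector_isCoalgebra.Build K B hcomulA hcounitl hcounitr.
Lemma hvalM' (u v: B): hval (u * v) = hval u * hval v. exact: hvalM. Qed.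
Lemma hval1': hval (1: B) = 1. exact: hval1. Qed.
Lemma hprojM x y: x \in A -> y \in A -> hproj (x * y) = hproj x * hproj y.
by move=> xA yA; apply: hval_inj; rewrite hvalM' !hprojK // AM. Qed.
Lemma hcomul1: hcomul 1 = 1 *t 1.
rewrite hcomul_def /tmap.
by rewrite hval1' comul1 tliftE //; bil.
Qed.
Lemma hcomulM (g h: B): hcomul (g * h) =
 \tsum_(x, y <- hcomul g) \tsum_(z, w <- hcomul h) ((x * z) *t (y * w)).
rewrite hcomul_def /tmap.
rewrite hvalM' (tsumM (F:=fun x y => hproj x *t hproj y)); last bil.
rewrite -(hcomul_val (G:=fun x y => \dsum_(z, w <- hval h) (hproj (x * z) *t hproj (y * w)))).
 apply: eqt => x y; rewrite -(hcomul_val (G:=fun z w => hproj (_ * z) *t hproj (_ * w))).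
  by apply: eqt => z w; rewrite !hprojM ?hvalP ?hvalK.
 by bil.
by bil.
Qed.
Lemma hcounit1: hcounit 1 = 1. by rewrite hcounitE hval1' counit1. Qed.
Lemma hcounitM (g h: B): hcounit (g * h) = hcounit g * hcounit h.
by rewrite !hcounitE hvalM' counitM. Qed.
Lemma hantil (h: B): \tsum_(x, y <- hcomul h) (hanti x * y) = (hcounit h: K)%:A.
apply: hval_inj; rewrite (tlf (hval)); last lin.
under eqt => x y do rewrite hvalM' hval_anti.
rewrite (hcomul_val (G:=fun x y => antipode x * y)); last bil.
by rewrite antipodel linearZ /= hval1' hcounitE.
Qed.
Lemma hantir (h: B): \tsum_(x, y <- hcomul h) (x * hanti y) = (hcounit h: K)%:A.
apply: hval_inj; rewrite (tlf (hval)); last lin.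
under eqt => x y do rewrite hvalM' hval_anti.
rewrite (hcomul_val (G:=fun x y => x * antipode y)); last bil.
by rewrite antipoder linearZ /= hval1' hcounitE.
Qed.
HB.instance Definition _ := isHopf.Build K B hcomul1 hcomulM hcounit1 hcounitM hantil hantir.
Lemma hval_hom: hopf_hom hval.
split; last by move=> a _; rewrite -hval_anti.
- by apply/ahom_inP; split=> [u v _ _|]; rewrite ?hvalM' ?hval1'.
- move=> a _; rewrite /tmap -[comul a]/(hcomul a).
 rewrite (hcomul_val (G:=fun x y => x *t y)); last bil.
 apply: tens_sep => f g; rewrite tsT.
 by apply: eqt => x y; rewrite tliftE //; bil.
- by move=> a _; rewrite -hcounitE.
Qed.
Lemma hval_img: limg hval = A.
apply/vspaceP=> x; apply/idP/idP; first by move/memv_imgP=> [u _ ->]; apply: hvalP.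
by move=> xA; rewrite -(hprojK xA) memv_img ?memvf.
Qed.
Lemma dim_hsub: \dim {: B} = \dim A.
by rewrite dimvf. Qed.
Lemma hsub_involutive: involutive H -> involutive (B: hopfType K).
by move=> S2 u; apply: hval_inj; rewrite -[antipode _]/(hanti (hanti u)) !hval_anti S2. Qed.
End HopfSubalgebraType.

(** * Annihilators, quotient maps and coinvariants *)

Section Annihilator.
Variables (K: closedFieldType) (H: hopfType K).
Hypothesis char0: [pchar K] =i pred0.
Hypothesis S2: involutive H.
Local Notation S := (@antipode K H).
Local Notation N := (\dim {:H}).
Lemma counit_ad (h x: H): counit (ad h x) = counit h * counit x.
rewrite adE (tlf (@counit K H)); last lin.
trans (\dsum_(a, b <- h) (counit a: K) *: (counit x * counit b: K^o)).
 by apply: eqt => a b; rewrite !counitM counit_antipode -mulrA.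
by rewrite (tsum_el (F:=fun b => counit x * counit b: K^o)) 1?mulrC //; lin.
Qed.
(** Commutes y past b at the price of an adjoint action. For an adjoint-stable U this makes the
    one-sided condition defining [annih] two-sided, and thereby [annih] a Hopf subalgebra. *)
Lemma mul_ad (y b: H): y * b = \dsum_(b1, b2 <- b) (b2 * ad (S b1) y).
trans (\dsum_(q, c <- b) \dsum_(u, v <- q) (c * S v * y * u)); last first.
 apply: eqt => q c.
 rewrite adE (tsumS (F:=fun u v => u * y * S v)); last bil.
 rewrite (tlf (fun z => c * z)); last lin.
 by apply: eqt => u v; rewrite S2 !mulrA.
rewrite (tsumA (F:=fun u v c => c * S v * y * u)); try by move=> *; lin.
under eqt => u w do
 [rewrite -(tlf (fun z => z * y * u)); last lin].
under eqt => u w do rewrite antipoder_op // -!scalerAl mul1r.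
by rewrite (tsum_er (F:=fun u => y * u)) //; lin.
Qed.
Variable U: {vspace H}.
Hypotheses (cU: coid_subalg U) (aU: adstable U).
Definition annih_op (y: H): 'End(dual H) :=
 linfun (fun f: dual H => fR f y - (counit y: K) *: f).
(** The dual of the quotient of H by H U^+: the functionals with f(h y) = counit(y) f(h) for y in U.
    The intersection over a basis of U presents it as a subspace. *)
Definition annih: {vspace dual H} :=
 (\bigcap_(i < \dim U) lker (annih_op (vbasis U)`_i))%VS.
Lemma annihP f: f \in annih <-> forall y, y \in U -> fR f y = (counit y: K) *: f.
have opE y: annih_op y f = fR f y - (counit y: K) *: f.
 rewrite linE // => c u v; rewrite scalerBr.
 have L: linear (fun f: dual H => fR f y) by lin3.
 by rewrite L scalerDr !scalerA opprD addrACA [c * _]mulrC.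
split=> [fA y yU | fA]; last first.
 rewrite memvE /annih; apply/subv_bigcapP => i _; rewrite -memvE memv_ker opE.
 by rewrite fA ?subrr // vbasis_mem // mem_nth ?size_tuple.
have fi (i: 'I_(\dim U)): fR f (vbasis U)`_i = (counit (vbasis U)`_i: K) *: f.
 move: fA; rewrite memvE /annih => /subv_bigcapP/(_ i isT); rewrite -memvE memv_ker opE.
 by rewrite subr_eq0 => /eqP.
have L: linear (fR f) by lin3.
rewrite (coord_vbasis yU) (lin_sum _ _ _ L) lsE scaler_suml.
by apply: eq_bigr => i _; rewrite fi scalerA linearZ.
Qed.
Lemma annihE f: f \in annih <-> forall h y, y \in U -> f (h * y) = counit y * f h.
split=> [/annihP fA h y yU | fA].
 by rewrite -fRE fA // slE.
by apply/annihP => y yU; apply: dualP => h; rewrite fRE fA // slE.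
Qed.
Lemma annih_hopf: hopf_subalg annih.
have [U1 UM UT] := cU.
have Aw f h y b: f \in annih -> y \in U -> f (h * y * b) = counit y * f (h * b).
 move=> /annihE fA yU; rewrite -mulrA (mul_ad y).
 have L: linear (fun z => f (h * z)) by lin.
 rewrite (tlE _ _ L) -[RHS]/((counit y: K) *: (f (h * b): K^o)).
 rewrite -(tsum_el (F:=fun b2 => f (h * b2))); last lin.
 rewrite (tlE (W' := K^o) _ _ (f:=fun z: K^o => (counit y: K) *: z)); last lin.
 apply: eqt => b1 b2; rewrite mulrA fA; last exact: aU.
 by rewrite counit_ad counit_antipode scalerA [counit y * _]mulrC.
split.
- by apply/annihE => h y _; rewrite !dual1 counitM mulrC.
- apply/prodvP => f g fA gA; apply/annihE => h y yU.
 rewrite !dualM (tsumM (F:=fun u v => f u * g v: K^o)); last bil.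
 have M4 (u v w: K): u * (v * w) = v * (u * w) by ring.
 rewrite -[RHS]/((counit y: K) *: (_: K^o)).
 rewrite (tlE (W' := K^o) _ _ (f:=fun z: K^o => (counit y: K) *: z)); last lin.
 apply: eqt => h1 h2.
 rewrite (tsum_hbasl (F:=fun z w => f (h1 * z) * g (h2 * w): K^o)); last bil.
 move/annihE: gA => gA; move/annihE: fA => fA.
 under eq_bigr => i _ do rewrite gA ?UT // M4 -[_ * (_ * _)]/((counit _: K) *: _).
 trans (\dsum_(z, w <- y) (counit w: K) *: (f (h1 * z) * g h2: K^o)).
  by rewrite (tsum_hbasl (F:=fun z w => (counit w: K) *: (f (h1 * z) * g h2: K^o))) //; bil.
 rewrite (tsum_er (F:=fun z => f (h1 * z) * g h2: K^o)); last lin.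
 by rewrite fA // -mulrA.
- apply/subvP=> _ /memv_imgP[f fA ->]; apply: tens_mem => phi; have [a aE] := dual_eval phi.
  under eqt => f1 f2 do rewrite aE.
  rewrite (tsum_fL1 (G:=fun f2: dual H => f2)) //; apply/annihE => h y yU.
  by rewrite !fLE mulrA; apply: (iffLR (annihE f) fA).
 under eqt => f1 f2 do rewrite aE.
 rewrite (tsum_fR1 (G:=fun f2: dual H => f2)) //; apply/annihE => h y yU.
 by rewrite !fRE Aw.
apply/subvP=> _ /memv_imgP[f fA ->]; apply/annihE => h y yU; rewrite !dual_SE antipodeM.
have [c cE]: exists c, c = S h by exists (S h).
rewrite -cE; trans (f (((counit y: K)%:A: H) * c)); last first.
 by rewrite -scalerAl mul1r linearZ.
rewrite -antipodel.
have Lc: linear (fun z => f (z * c)) by lin.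
rewrite (tlE _ _ Lc) (tsum_hbasl (F:=fun u v => f (S u * v * c))); last bil.
under eq_bigr => i _ do rewrite Aw ?UT //.
trans (\dsum_(u, v <- y) (counit v: K) *: (f (S u * c): K^o)).
 by rewrite (tsum_er (F:=fun u => f (S u * c): K^o)) //; lin.
by rewrite (tsum_hbasl (F:=fun u v => (counit v: K) *: (f (S u * c): K^o))) //; bil.
Qed.
(** With L the integral of U, f |-> f(- L) is an idempotent with image the annihilator, and its
    trace is N haar(L) = N / dim U. *)
Lemma dim_annih: (\dim annih * \dim U)%N = N.
have [L [LU eL Ll dL]] := coid_integral char0 S2 cU.
have LL: L * L = L by rewrite Ll // eL scale1r.
pose E: 'End(dual H) := linfun (fun f: dual H => fR f L).
have LE: linear (fun f: dual H => fR f L) by lin3.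
have EE f: E f = fR f L by rewrite (linE LE).
have imE: limg E = annih.
 apply/vspaceP=> f; apply/idP/idP => [/memv_imgP[g _ ->]|fA].
  apply/annihE => h y yU; rewrite EE !fRE -mulrA Ll // -scalerAr linearZ //.
 have -> : f = E f by rewrite EE (iffLR (annihP f) fA) // eL scale1r.
 exact/memv_img/memvf.
apply: (char0_natr_inj char0); rewrite natrM -imE -ltr_idem; last first.
 by apply/lfunP=> f; rewrite clE !EE fRR LL.
rewrite (ltr_dualmap (A:=amulr L)) //.
by rewrite ltr_amulr // -mulrA [_ * (\dim U)%:R]mulrC dL mulr1.
Qed.
End Annihilator.

Section QuotientMap.
Variables (K: closedFieldType) (H: hopfType K).
Hypothesis char0: [pchar K] =i pred0.
Hypothesis S2: involutive H.
Local Notation S := (@antipode K H).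
Local Notation N := (\dim {:H}).
Variables (B: {vspace dual H}) (hB: hopf_subalg B).
Local Notation Q := (dual (hsub hB)).
(** Evaluation restricted to B: the quotient map of H that is dual to the inclusion of the Hopf
    subalgebra B of the dual. *)
Definition qmap: 'Hom(H, Q) :=
 linfun (fun h: H => linfun (fun b: hsub hB => (hval hB b: dual H) h: K^o): Q).
Lemma qmapE h b: (qmap h: Q) b = (hval hB b: dual H) h.
have L x: linear (fun b: hsub hB => (hval hB b: dual H) x: K^o) by lin.
rewrite linE ?(linE (L _)) // => c u v; apply/lfunP=> w.
by rewrite alE slE !(linE (L _)) linearP.
Qed.
Lemma qmap_hom: hopf_hom qmap.
split.
- apply/ahom_inP; split=> [x y _ _|]; apply: dualP => b; rewrite qmapE; last first.
  by rewrite [RHS]hcounitE dual_counitE'.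
 rewrite dualM -(dcE (hval hB b: dual H)).
 rewrite -(hcomul_val (hA:=hB) (G:=fun f g: dual H => (f x: K^o) * (g y: K^o))); last bil.
 by apply: eqt => f g; rewrite !qmapE.
- move=> a _; apply: dual_tens_ext => b c; rewrite dcE qmapE hvalM' dualM.
 rewrite /tmap tsT; apply: eqt => x y.
 by rewrite tliftE ?qmapE //; bil.
- by move=> a _; rewrite dual_counitE' qmapE hval1'.
move=> a _; apply: dualP => b; rewrite dual_SE !qmapE -dual_SE.
by rewrite -[antipode b]/(hanti hB b) hval_anti.
Qed.
Lemma qmap_img: limg qmap = fullv.
apply/eqP; rewrite eqEsubv subvf; apply/subvP=> y _; apply/eqP; apply: contraT => yI.
have z0: y - projv (limg qmap) y != 0.
 rewrite subr_eq0; by apply: contra yI => /eqP E; rewrite E memv_proj.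
have [phi phi0]: exists phi: 'Hom(Q, K^o), phi (y - projv (limg qmap) y) != 0.
 apply: NNPP => np; case/eqP: z0; apply: vect_sep => phi; rewrite linear0.
 by apply: NNPP => /eqP E; apply: np; exists phi.
have [b bE] := dual_eval (H:=hsub hB) (phi \o (\1 - projv (limg qmap)))%VF.
have b0: b = 0.
 apply: (@hval_inj _ _ _ hB); apply: dualP => h.
 rewrite linear0 zlE -qmapE -bE clE alE olE ilE.
 by rewrite projv_id ?subrr ?linear0 // memv_img ?memvf.
have := bE y; rewrite clE alE olE ilE b0 linear0 => E.
by rewrite E eqxx in phi0.
Qed.
Lemma dim_qmap: \dim {: Q} = \dim B.
by rewrite dim_dual dim_hsub. Qed.
Lemma ltr_rt (f: dual H): ltr (rt f) = N%:R * f (@integral K H).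
rewrite -[integral H]S_integral // -dual_SE -ltr_lt //.
have -> : lt (antipode f) = (S \o (rt f \o S))%VF.
 apply/lfunP=> x; rewrite !clE; apply: vect_sep => g.
 rewrite dual_lt -[g (S _)]dual_SE dual_rt -dual_SE antipodeM.
 by rewrite (involutive_dual S2).
by rewrite ltrC -clA; congr ltr; apply/lfunP=> x; rewrite !clE !S2.
Qed.
Lemma rcoinv_qmap x: x \in rcoinv qmap <-> forall f, f \in B -> rt f x = (f 1: K) *: x.
rewrite rcoinvP /tmap; have E (phi: 'Hom(H, K^o)) (b: hsub hB) :
  \tsum_(u, v <- \dsum_(x1, x2 <- x) (idfun x1 *t qmap x2)) (phi u * (v: Q) b: K^o)
  = phi (rt (hval hB b) x).
 rewrite tsT rtE (tlf (phi)); last lin.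
 apply: eqt => x1 x2; rewrite tliftE; last bil.
 by rewrite qmapE linearZ mulrC.
split=> [cx f fB | rx].
 apply: vect_sep => phi; rewrite -(hprojK hB fB) -E cx tliftE; last bil.
 rewrite linearZ mulrC; congr (_ * _); rewrite [LHS]hcounitE dual_counitE'.
 by [].
apply: tens_sep => phi psi; have [b bE] := dual_eval psi.
under eqt => u v do rewrite bE.
under [RHS]eqt => u v do rewrite bE.
rewrite E rx ?hvalP // tliftE; last bil.
rewrite linearZ mulrC; congr (_ * _); rewrite [RHS]hcounitE dual_counitE'.
by [].
Qed.
Lemma lcoinv_qmap x: x \in lcoinv qmap <-> forall f, f \in B -> lt f x = (f 1: K) *: x.
rewrite lcoinvP /tmap; have E (phi: 'Hom(H, K^o)) (b: hsub hB) :
  \tsum_(u, v <- \dsum_(x1, x2 <- x) (qmap x1 *t idfun x2)) ((u: Q) b * phi v: K^o)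
  = phi (lt (hval hB b) x).
 rewrite tsT ltE (tlf (phi)); last lin.
 apply: eqt => x1 x2; rewrite tliftE; last bil.
 by rewrite qmapE linearZ.
split=> [cx f fB | rx].
 apply: vect_sep => phi; rewrite -(hprojK hB fB) -E cx tliftE; last bil.
 rewrite linearZ; congr (_ * _); rewrite [LHS]hcounitE dual_counitE'.
 by [].
apply: tens_sep => psi phi; have [b bE] := dual_eval psi.
under eqt => u v do rewrite bE.
under [RHS]eqt => u v do rewrite bE.
rewrite E rx ?hvalP // tliftE; last bil.
rewrite linearZ; congr (_ * _); rewrite [RHS]hcounitE dual_counitE'.
by [].
Qed.
Lemma hopf_subalg_coid (H': hopfType K) (A: {vspace H'}): hopf_subalg A -> coid_subalg A.
case=> A1 /prodvP AM /subvP AD _; split=> // f x xA.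
rewrite ltE; have [C _] := tens_contr (AD _ (memv_img _ xA)); exact: C.
Qed.
(** The same count as for [dim_annih], with the projection [rt L] for the integral L of B. *)
Lemma dim_rcoinv: (\dim (rcoinv qmap) * \dim B)%N = N.
have [L [LB eL Ll dL]] := coid_integral char0 (involutive_dual S2) (hopf_subalg_coid hB).
rewrite dual_counitE' in eL.
have imE: limg (rt L) = rcoinv qmap.
 apply/vspaceP=> x; apply/idP/idP => [/memv_imgP[y _ ->]|].
  apply/rcoinv_qmap => f fB; rewrite -rtM Ll // linearZ slE dual_counitE'.
  by [].
 move/rcoinv_qmap=> /(_ L LB); rewrite eL scale1r => <-.
 exact/memv_img/memvf.
apply: (char0_natr_inj char0); rewrite natrM -imE -ltr_idem; last first.
 by apply/lfunP=> x; rewrite clE -rtM Ll // dual_counitE' eL scale1r.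
by rewrite ltr_rt // integralE -mulrA [_ * (\dim B)%:R]mulrC dL mulr1.
Qed.
Hypothesis RL: rcoinv qmap = lcoinv qmap.
Local Notation R := (rcoinv qmap).
Lemma memRr x f: x \in R -> f \in B -> rt f x = (f 1: K) *: x.
by move=> /rcoinv_qmap; apply. Qed.
Lemma memRl x f: x \in R -> f \in B -> lt f x = (f 1: K) *: x.
by rewrite RL => /lcoinv_qmap; apply. Qed.
Lemma qmap_R x: x \in R -> qmap x = (counit x: K) *: 1.
move=> xR; apply: dualP => b; rewrite qmapE slE -counit_rt memRr ?hvalP //.
have -> : (1: Q) b = (hval hB b: dual H) 1 by rewrite [LHS]hcounitE dual_counitE'.
by rewrite linearZ; apply: mulrC.
Qed.
Lemma tsum_in (W: vectType K) (F G: dual H -> dual H -> W) f: f \in B -> bilin F -> bilin G ->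
 (forall f1 f2, f1 \in B -> f2 \in B -> F f1 f2 = G f1 f2) ->
 \dsum_(f1, f2 <- f) F f1 f2 = \dsum_(f1, f2 <- f) G f1 f2.
move=> fB FB GB E; have [_ _ /subvP D _] := hB.
have fD := D _ (memv_img comul fB).
rewrite -(tsum_projv fD FB) -(tsum_projv fD GB).
by apply: eqt => f1 f2; rewrite E ?memv_proj.
Qed.
(** The equality of left and right coinvariants is used for the coproduct: its slices on one side
    are right coinvariants, those on the other side left coinvariants. *)
Lemma R_hopf: hopf_subalg R.
have bS f: f \in B -> antipode f \in B.
 by case: hB => _ _ _ /subvP D fB; apply: D; apply: memv_img.
split.
- apply/rcoinv_qmap => f fB; rewrite rtE tsum1 //; by bil.
- apply/prodvP => x y xR yR; apply/rcoinv_qmap => f fB; rewrite rt_mul.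
 rewrite (tsum_in (G:=fun f1 f2: dual H => (f1 1: K) *: ((f2 1: K) *: (x * y)))) //; try by bil3.
  rewrite (tsum_fL1 (G:=fun f2: dual H => (f2 1: K) *: (x * y))); last lin.
  by rewrite fLE mulr1.
 by move=> f1 f2 f1B f2B; rewrite !memRr // -scalerAl -scalerAr.
- apply/subvP=> _ /memv_imgP[x xR ->]; apply: tens_mem => phi.
  rewrite -ltE; apply/rcoinv_qmap => f fB; rewrite -lt_rtC memRr // linearZ //.
 rewrite -rtE RL; apply/lcoinv_qmap => f fB; rewrite lt_rtC memRl // linearZ //.
apply/subvP=> _ /memv_imgP[x xR ->]; apply/rcoinv_qmap => f fB.
apply: vect_sep => g; rewrite dual_rt -dual_SE antipodeM -dual_lt memRl ?bS //.
by rewrite !linearZ /= dual_SE antipode1 dual_SE.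
Qed.
Lemma tsum4 (W: vectType K) (F: H -> H -> H -> H -> W) h :
 (forall b c d, linear (fun a => F a b c d)) -> (forall a c d, linear (fun b => F a b c d)) ->
 (forall a b d, linear (fun c => F a b c d)) -> (forall a b c, linear (F a b c)) ->
 \dsum_(a, b <- h) \dsum_(a1, a2 <- a) \dsum_(b1, b2 <- b) F a1 a2 b1 b2 =
 \dsum_(a1, w <- h) \dsum_(q, b2 <- w) \dsum_(a2, b1 <- q) F a1 a2 b1 b2.
move=> F1 F2 F3 F4.
rewrite (tsumA (F:=fun a1 a2 b => \dsum_(b1, b2 <- b) F a1 a2 b1 b2)).
- apply: eqt => a1 w.
 by rewrite -(tsumA (F:=fun a2 b1 b2 => F a1 a2 b1 b2)).
- by move=> *; apply: lin_tliftr => *; apply: F1.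
- by move=> *; apply: lin_tliftr => *; apply: F2.
- by move=> *; lin.
Qed.
Lemma rt_mulR (f: dual H) a x s: f \in B -> x \in R ->
 rt f (a * x * s) = \dsum_(f1, f2 <- f) (rt f1 a * x * rt f2 s).
have R1 g: g \in B -> x \in R -> rt g (a * x) = rt g a * x.
 move=> gB xR; rewrite rt_mul (tsum_in (G:=fun f1 f2: dual H => (f2 1: K) *: (rt f1 a * x))) //.
 - by rewrite (tsum_fR1 (G:=fun f1: dual H => rt f1 a * x)) ?fR1 //; lin2.
 - by split=> ?; cbv beta; lin2.
 - by split=> ?; cbv beta; lin2.
 - by move=> f1 f2 _ f2B; rewrite (memRr xR f2B) -scalerAr.
move=> fB xR; rewrite rt_mul; apply: tsum_in => //; try by split=> ?; cbv beta; lin2.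
by move=> f1 f2 f1B _; rewrite R1.
Qed.
Lemma lt_mulR (f: dual H) a x s: f \in B -> x \in R ->
 lt f (a * x * s) = \dsum_(f1, f2 <- f) (lt f1 a * x * lt f2 s).
have R1 g: g \in B -> x \in R -> lt g (a * x) = lt g a * x.
 move=> gB xR; rewrite lt_mul (tsum_in (G:=fun f1 f2: dual H => (f2 1: K) *: (lt f1 a * x))) //.
 - by rewrite (tsum_fR1 (G:=fun f1: dual H => lt f1 a * x)) ?fR1 //; lin2.
 - by split=> ?; cbv beta; lin2.
 - by split=> ?; cbv beta; lin2.
 - by move=> f1 f2 _ f2B; rewrite (memRl xR f2B) -scalerAr.
move=> fB xR; rewrite lt_mul; apply: tsum_in => //; try by split=> ?; cbv beta; lin2.
by move=> f1 f2 f1B _; rewrite R1.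
Qed.
Lemma rt_pair (W: vectType K) (G: H -> H -> W) (f: dual H) a c: bilin G ->
 \dsum_(f1, f2 <- f) G (rt f1 a) (rt f2 c) =
 \dsum_(a1, a2 <- a) \dsum_(c1, c2 <- c) (f (a2 * c2): K) *: G a1 c1.
move=> [G1 G2].
trans (\dsum_(f1, f2 <- f) \dsum_(a1, a2 <- a) \dsum_(c1, c2 <- c)
  ((f1: dual H) a2 * (f2: dual H) c2: K) *: G a1 c1).
 apply: eqt => f1 f2; rewrite !rtE (tlE _ _ (G1 _)); apply: eqt => a1 a2.
 rewrite (lin_scale _ _ (G1 _)) (tlE _ _ (G2 _)).
 rewrite (tlf (fun z => (f1 a2: K) *: z)); last lin.
 by apply: eqt => c1 c2; rewrite (lin_scale _ _ (G2 _)) scalerA.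
rewrite tsC; apply: eqt => a1 a2.
rewrite tsC; apply: eqt => c1 c2.
rewrite -dcE (tlf (fun z: K^o => (z: K) *: G a1 c1)) //.
by lin.
Qed.
Lemma lt_pair (W: vectType K) (G: H -> H -> W) (f: dual H) a c: bilin G ->
 \dsum_(f1, f2 <- f) G (lt f1 a) (lt f2 c) =
 \dsum_(a1, a2 <- a) \dsum_(c1, c2 <- c) (f (a1 * c1): K) *: G a2 c2.
move=> [G1 G2].
trans (\dsum_(f1, f2 <- f) \dsum_(a1, a2 <- a) \dsum_(c1, c2 <- c)
  ((f1: dual H) a1 * (f2: dual H) c1: K) *: G a2 c2).
 apply: eqt => f1 f2; rewrite !ltE (tlE _ _ (G1 _)); apply: eqt => a1 a2.
 rewrite (lin_scale _ _ (G1 _)) (tlE _ _ (G2 _)).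
 rewrite (tlf (fun z => (f1 a1: K) *: z)); last lin.
 by apply: eqt => c1 c2; rewrite (lin_scale _ _ (G2 _)) scalerA.
rewrite tsC; apply: eqt => a1 a2.
rewrite tsC; apply: eqt => c1 c2.
rewrite -dcE (tlf (fun z: K^o => (z: K) *: G a2 c2)) //.
by lin.
Qed.
Lemma R_normal: normal_in R fullv.
move=> h x _ xR; split.
 apply/rcoinv_qmap => f fB.
 have L: linear (rt f) by lin.
 rewrite (tlE _ _ L).
 trans (\dsum_(a, b <- h) \dsum_(a1, a2 <- a) \dsum_(b1, b2 <- b)
   (f (a2 * S b1): K) *: (a1 * x * S b2)).
  apply: eqt => a b; rewrite rt_mulR // (rt_pair (G:=fun u v => u * x * v)); last bil.
  apply: eqt => a1 a2.
  by rewrite (tsumS (F:=fun c1 c2 => (f (a2 * c2): K) *: (a1 * x * c1))) //; bil.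
 rewrite (tsum4 (F:=fun a1 a2 b1 b2 => (f (a2 * S b1): K) *: (a1 * x * S b2))); try by move=> *; lin.
 rewrite (tlf (fun z => (f 1: K) *: z)); last lin.
 apply: eqt => a w.
 under eqt => q b2 do
  [rewrite (tsum_antir (F:=fun z => (f z: K) *: (a * x * S b2))); last lin].
 by rewrite (tsum_el (F:=fun b2 => (f 1: K) *: (a * x * S b2))) //; lin.
rewrite RL; apply/lcoinv_qmap => f fB.
have L: linear (lt f) by lin.
rewrite (tlE _ _ L).
trans (\dsum_(a, b <- h) \dsum_(a1, a2 <- a) \dsum_(b1, b2 <- b)
  (f (S a2 * b1): K) *: (S a1 * x * b2)).
 apply: eqt => a b; rewrite lt_mulR // (lt_pair (G:=fun u v => u * x * v)); last bil.
 by rewrite (tsumS (F:=fun a1 a2 => \dsum_(c1, c2 <- b) (f (a1 * c1): K) *: (a2 * x * c2))) //; bil.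
rewrite (tsum4 (F:=fun a1 a2 b1 b2 => (f (S a2 * b1): K) *: (S a1 * x * b2))); try by move=> *; lin.
rewrite (tlf (fun z => (f 1: K) *: z)); last lin.
apply: eqt => a w.
under eqt => q b2 do
 [rewrite (tsum_antil (F:=fun z => (f z: K) *: (S a * x * b2))); last lin].
by rewrite (tsum_el (F:=fun b2 => (f 1: K) *: (S a * x * b2))) //; lin.
Qed.
(** With L the integral of R, the image of right multiplication by the idempotent 1 - L lies in H
    R^+, which lies in the kernel. Its rank is N - N / dim R = N - dim B by traces, and that is the
    dimension of the kernel. *)
Lemma lker_qmap: lker qmap = (fullv * augmentation R)%VS.
have [L [LR eL Ll dL]] := coid_integral char0 S2 (hopf_subalg_coid R_hopf).
have [/ahom_inP[qM q1] _ _ _] := qmap_hom.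
have LL: L * L = L by rewrite Ll // eL scale1r.
have sub1: (fullv * augmentation R <= lker qmap)%VS.
 apply/prodvP => h x _ /memv_capP[xR]; rewrite !memv_ker => /eqP ex.
 by rewrite qM ?memvf // (qmap_R xR) ex scale0r mulr0.
have aL: 1 - L \in augmentation R.
 have [R1 _ _ _] := R_hopf.
 by rewrite memv_cap rpredB // memv_ker linearB /= eL counit1 subrr.
have sub2: (limg (amulr (1 - L)) <= fullv * augmentation R)%VS.
 by apply/subvP=> _ /memv_imgP[h _ ->]; rewrite amulrE memv_mul ?memvf.
have dN: \dim (limg (amulr (1 - L))) = \dim (lker qmap).
 have d1: (\dim (lker qmap) + \dim B)%N = N.
  have := limg_ker_dim qmap fullv; rewrite capfv => <-.
  by rewrite qmap_img dim_qmap.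
 have: (\dim (limg (amulr (1 - L)%R)) + \dim B)%N = N; last by move: d1 => <- /addIn.
 apply: (char0_natr_inj char0); rewrite natrD -ltr_idem; last first.
  apply/lfunP=> h; rewrite clE !amulrE -mulrA mulrBl mul1r.
  by rewrite [L * _]mulrBr mulr1 LL subrr subr0.
 have -> : amulr (1 - L) = \1%VF - amulr L.
  by apply/lfunP=> h; rewrite alE olE ilE !amulrE mulrBr mulr1.
 rewrite linearB /= ltr1 ltr_amulr //.
 have -> : N%:R = (\dim R)%:R * (\dim B)%:R :> K by rewrite -natrM dim_rcoinv.
 by rewrite mulrAC dL mul1r subrK.
apply/eqP; rewrite eq_sym eqEdim sub1 /= -dN; exact: dimvS.
Qed.
End QuotientMap.

(** * Divisibility of dimensions, groups of grouplikes and their spans *)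

Section CoidealDivisibility.
Variables (K: closedFieldType) (H: hopfType K).
Hypothesis char0: [pchar K] =i pred0.
Hypothesis S2: involutive H.
Implicit Types (U M: {vspace H}).
Lemma rtr_idem (V: vectType K) (W: {vspace V}) (E: 'End(V)) :
 (forall x, x \in W -> E x \in W) -> (forall x, x \in W -> E (E x) = E x) ->
 rtr W E = (\dim (E @: W))%:R.
move=> EW EE; pose F := (E \o projv W)%VF.
have FE x: F x = E (projv W x) by rewrite clE.
have FW x: F x \in W by rewrite FE EW ?memv_proj.
have -> : rtr W E = ltr F.
 rewrite /rtr ltrC -/F; by [].
rewrite ltr_idem; last first.
 by apply/lfunP=> x; rewrite clE [F (F x)]FE projv_id // FE EE // memv_proj.
suff -> : limg F = (E @: W)%VS by [].
apply/vspaceP=> y; apply/idP/idP => /memv_imgP[x xW ->].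
 by rewrite FE memv_img ?memv_proj.
by rewrite -(projv_id xW) -FE memv_img ?memvf.
Qed.
(** Right multiplication by the integral L of U is an idempotent on M whose trace, dim M haar(L) =
    dim M / dim U, is its rank. This takes the place of freeness theorems over U. *)
Lemma coid_dim_dvd U M: coid_subalg U -> ltstable M ->
 (forall x y, x \in M -> y \in U -> x * y \in M) -> (\dim U %| \dim M)%N.
move=> cU sM MU; have [L [LU eL Ll dL]] := coid_integral char0 S2 cU.
have LL: L * L = L by rewrite Ll // eL scale1r.
have := rtr_coid char0 S2 cU sM MU LU.
rewrite rtr_idem; first last.
- by move=> x _; rewrite !amulrE -mulrA LL.
- by move=> x xM; rewrite amulrE MU.
move=> E; apply/dvdnP; exists (\dim (amulr L @: M)); apply: (char0_natr_inj char0).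
have R (a b c: K): c * b = 1 -> a = a * b * c by move=> cb; rewrite -mulrA (mulrC b) cb mulr1.
by rewrite natrM E; apply: R.
Qed.
Lemma coid_dim_dvd_full U: coid_subalg U -> (\dim U %| \dim {:H})%N.
by move=> cU; apply: coid_dim_dvd cU _ _ => [f x _ | x y _ _]; exact: memvf. Qed.
End CoidealDivisibility.

Section GrouplikeGroup.
Variables (K: fieldType) (H: hopfType K).
Local Notation N := (\dim {:H}).
Lemma finite_list (T: eqType) (P: T -> Prop) n :
 (forall s, uniq s -> {in s, forall x, P x} -> (size s <= n)%N) ->
 exists2 s: seq T, uniq s & forall x, x \in s <-> P x.
move=> bP; apply: NNPP => nS.
have [s [us sP ss]]: exists s, [/\ uniq s, {in s, forall x, P x} & size s = n.+1]; last first.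
 by have := bP s us sP; rewrite ss ltnn.
elim: n.+1 => [|m [s [us sP ss]]]; first by exists [::].
have [x [xs Px]]: exists x, x \notin s /\ P x.
 apply: NNPP => nx; apply: nS; exists s => // x; split; first exact: sP.
 by move=> Px; apply: contraT => xs; case: nx; exists x.
exists (x :: s); split; rewrite /= ?xs ?ss // => y; rewrite inE => /orP[/eqP->|/sP] //.
Qed.
Lemma grouplike_inv (g: H): grouplike g -> antipode g * g = 1.
by move=> /grouplike_antipode[]. Qed.
(** Linear independence bounds the number of grouplikes by dim H, so a predicate closed under the
    operations can be listed, and the list made into a group. An abstract group with an injection v
    into H is the form in which groups of grouplikes occur from here on. *)
Lemma grouplike_group (P: H -> Prop): P 1 -> (forall x y, P x -> P y -> P (x * y)) ->
 (forall x, P x -> P (antipode x)) -> (forall x, P x -> grouplike x) ->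
 exists (gT: finGroupType) (v: gT -> H), [/\ injective v, v 1%g = 1,
  forall a b, v (a * b)%g = v a * v b & forall x, P x <-> exists a, x = v a].
move=> P1 PM PS PG.
have [|s us sP] := @finite_list H P N.
 move=> s us sP; have := grouplikes_free us (fun g gs => PG g (sP g gs)).
 by rewrite /free => /eqP <-; apply/dimvS/subvf.
pose T := seq_sub s.
have mem_mul (a b: T): ssval a * ssval b \in s by apply/sP/PM; apply/sP/ssvalP.
have mem_one: 1 \in s by apply/sP.
have mem_inv (a: T): antipode (ssval a) \in s by apply/sP/PS; apply/sP/ssvalP.
pose mul (a b: T): T := SeqSub (mem_mul a b).
pose one: T := SeqSub mem_one.
pose inv (a: T): T := SeqSub (mem_inv a).
have mulA: associative mul by move=> a b c; apply: val_inj; rewrite /= mulrA.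
have mul1: left_id one mul by move=> a; apply: val_inj; rewrite /= mul1r.
have mulV: left_inverse one inv mul.
 by move=> a; apply: val_inj; rewrite /= grouplike_inv //; apply/PG/sP/ssvalP.
pose Mx := isMulGroup.Build T mulA mul1 mulV.
pose gT: finGroupType := HB.pack T Mx.
exists gT, (fun a: gT => ssval (a: T)); split=> //.
- by move=> a b E; apply: val_inj.
- move=> x; split=> [/sP xs | [a ->]]; first by exists (SeqSub xs).
 exact/sP/ssvalP.
Qed.

Section OneGroup.
Variables (gT: finGroupType) (v: gT -> H).
Hypotheses (v_inj: injective v) (v1: v 1%g = 1) (vM: forall a b, v (a * b)%g = v a * v b).
Hypothesis vG: forall a, grouplike (v a).
Lemma vX a n: v (a ^+ n)%g = v a ^+ n.
by elim: n => [|n IH]; rewrite ?expg0 // expgS vM IH exprS. Qed.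
Lemma vS a: antipode (v a) = v (a^-1)%g.
have [Sg gS] := grouplike_antipode (vG a).
by rewrite -[LHS]mulr1 -v1 -(mulgV a) vM mulrA Sg mul1r.
Qed.
Definition gspan: {vspace H} := <<[seq v a | a: gT]>>%VS.
Lemma mem_gspan a: v a \in gspan.
by apply/memv_span/mapP; exists a; rewrite ?mem_enum. Qed.
Lemma dim_gspan: \dim gspan = #|gT|.
have: free [seq v a | a: gT].
 apply: grouplikes_free; first by rewrite map_inj_uniq ?enum_uniq.
 by move=> _ /mapP[a _ ->].
by rewrite /free size_map -cardE => /eqP.
Qed.
Lemma gspan_sub (U: {vspace H}): (forall a, v a \in U) -> (gspan <= U)%VS.
by move=> vU; apply/span_subvP=> _ /mapP[a _ ->]. Qed.
Lemma gspan_img (W: vectType K) (f: 'Hom(H, W)) (U: {vspace W}) :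
 (forall a, f (v a) \in U) -> (f @: gspan <= U)%VS.
by move=> fU; rewrite limg_span; apply/span_subvP=> _ /mapP[_ /mapP[a _ ->] ->]. Qed.
Lemma gspan_eq (W: vectType K) (f g: 'Hom(H, W)) x: (forall a, f (v a) = g (v a)) ->
 x \in gspan -> f x = g x.
move=> fg xU; apply/eqP; rewrite -subr_eq0 -olE -alE -memv_ker.
by apply: subvP xU; apply: gspan_sub => a; rewrite memv_ker alE olE fg subrr.
Qed.
Lemma gspan_hopf: hopf_subalg gspan.
split.
- by rewrite -v1 mem_gspan.
- apply/prodvP => x y xU yU; have: x \in lker (linfun (fun z => z * y - projv gspan (z * y))).
  apply: subvP xU; apply: gspan_sub => a; rewrite memv_ker linE; last first.
   by move=> c z w; rewrite mulrDl -scalerAl linearP scalerBr opprD addrACA.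
  rewrite subr_eq0 projv_id //.
  have: y \in lker (linfun (fun z => v a * z - projv gspan (v a * z))).
   apply: subvP yU; apply: gspan_sub => b; rewrite memv_ker linE; last first.
    by move=> c z w; rewrite mulrDr -scalerAr linearP scalerBr opprD addrACA.
   by rewrite subr_eq0 projv_id // -vM mem_gspan.
  rewrite memv_ker linE; last first.
   by move=> c z w; rewrite mulrDr -scalerAr linearP scalerBr opprD addrACA.
  by rewrite subr_eq0 => /eqP ->; apply: memv_proj.
 rewrite memv_ker linE; last first.
  by move=> c z w; rewrite mulrDl -scalerAl linearP scalerBr opprD addrACA.
 by rewrite subr_eq0 => /eqP ->; apply: memv_proj.
- by apply: gspan_img => a; rewrite (vG a).1 tensv_mem ?mem_gspan.
- by apply: gspan_img => a; rewrite vS mem_gspan.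
Qed.
Definition gmap: 'Hom(group_alg K gT, H) := linfun (galg_lin (K:=K) v).
Lemma gmapE a: gmap (galg_elt K a) = v a.
by rewrite (linE (galg_lin_linear (K:=K) v)) galg_linE. Qed.
Lemma gmap_hom: hopf_hom gmap.
split.
- apply/ahom_inP; split; last by rewrite -[1]/(galg_elt K 1%g) gmapE v1.
 move=> f g _ _; have Lr: linear (fun f => gmap (f * g)) by lin.
 have Lr': linear (fun f => gmap f * gmap g) by lin.
 apply: (galg_ext Lr Lr') => a.
 have Ll: linear (fun g => gmap (galg_elt K a * g)) by lin.
 have Ll': linear (fun g => gmap (galg_elt K a) * gmap g) by lin.
 by apply: (galg_ext Ll Ll') => b; rewrite galg_mulE !gmapE vM.
- move=> f _; have L: linear (fun f => comul (gmap f)) by lin.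
 have L': linear (fun f: group_alg K gT => tmap gmap gmap (comul f)) by rewrite /tmap; lin.
 apply: (galg_ext L L') => a; rewrite gmapE (vG a).1.
 by rewrite -[comul _]/(galg_comul _ _ _) galg_comulE /tmap tliftE ?gmapE //; bil.
- move=> f _; have L: linear (fun f => counit (gmap f)) by lin.
 have L': linear (fun f: group_alg K gT => counit f) by lin.
 apply: (galg_ext L L') => a; rewrite gmapE (vG a).2.
 by rewrite -[counit _]/(galg_counit _ _ _) galg_counitE.
move=> f _; have L: linear (fun f => antipode (gmap f)) by lin.
have L': linear (fun f: group_alg K gT => gmap (antipode f)) by lin.
apply: (galg_ext L L') => a; rewrite gmapE vS.
by rewrite -[antipode _]/(galg_antipode _ _ _) galg_antipodeE gmapE.
Qed.
Lemma gmap_img: limg gmap = gspan.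
apply/eqP; rewrite eqEsubv; apply/andP; split; last first.
 by apply: gspan_sub => a; rewrite -gmapE memv_img ?memvf.
apply/subvP=> _ /memv_imgP[f _ ->]; rewrite (linE (galg_lin_linear (K:=K) v)).
by apply: memv_suml => a _; rewrite memvZ ?mem_gspan.
Qed.
Lemma dim_galg: \dim {: group_alg K gT} = #|gT|.
by rewrite dimvf /dim /= muln1. Qed.
Lemma gmap_ker: lker gmap = 0%VS.
apply/eqP; rewrite -dimv_eq0; have := limg_ker_dim gmap fullv.
by rewrite capfv gmap_img dim_gspan dim_galg -[RHS]add0n => /addIn ->.
Qed.
End OneGroup.
End GrouplikeGroup.

(** * Small adjoint submodules and central grouplikes *)

Section AdjointSubmodules.
Variables (K: closedFieldType) (H: hopfType K).
Hypothesis char0: [pchar K] =i pred0.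
Hypothesis S2: involutive H.
Implicit Types (U W X: {vspace H}).
Local Notation S := (@antipode K H).
Local Notation N := (\dim {:H}).
Definition ydstable U := adstable U /\ ltstable U.
Definition central (z: H) := forall h, h * z = z * h.
Lemma stableP U: stable (V:=ydad H) U <-> ydstable U.
have yA := yd_ad H; split=> [sU | [aU lU] [h|f] x xU].
- split=> [h x xU | f x xU]; last by rewrite -coa_ad -(yd_coaE yA); apply: sU.
 by rewrite -act_ad -(yd_actE yA); apply: sU.
- by rewrite (yd_actE yA) act_ad; apply: aU.
by rewrite (yd_coaE yA) coa_ad; apply: lU.
Qed.
Lemma ad_move (h x: H): h * x = \dsum_(a, b <- h) (ad a x * b).
trans (\dsum_(q, c <- h) \dsum_(a, b <- q) (a * x * (S b * c))); last first.
 apply: eqt => q c; rewrite adE (tlf (fun z => z * c)); last lin.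
 by apply: eqt => a b; rewrite !mulrA.
rewrite (tsumA (F:=fun a b c => a * x * (S b * c))); try by move=> *; lin.
under eqt => a w do [rewrite (tsum_antil (F:=fun z => a * x * z)); last lin].
by rewrite (tsum_er (F:=fun a => a * x * 1)) ?mulr1 //; lin.
Qed.
Lemma ad_mul (h x y: H): ad h (x * y) = \dsum_(a, b <- h) (ad a x * ad b y).
trans (\dsum_(q, c <- h) \dsum_(a, b <- q) (ad a x * b * y * S c)).
 rewrite adE; apply: eqt => q c; rewrite mulrA (ad_move q x).
 rewrite (tlf (fun z => z * y * S c)) //; by lin.
have La (a: H): linear (fun b => ad b a) by apply: ad_linl.
rewrite (tsumA (F:=fun a b c => ad a x * b * y * S c)); last first.
- by move=> *; lin.
- by move=> *; lin.
- by move=> b c r u v; rewrite La !mulrDl -!scalerAl.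
apply: eqt => a w; rewrite (adE w y) (tlf (fun z => ad a x * z)); last lin.
by apply: eqt => b c; rewrite !mulrA.
Qed.
Lemma ydstable_prod U W: ydstable U -> ydstable W -> ydstable (U * W)%VS.
have aux (E: 'End(H)): (forall x y, x \in U -> y \in W -> E (x * y) \in (U * W)%VS) ->
  forall z, z \in (U * W)%VS -> E z \in (U * W)%VS.
 move=> EP z zUW; have: z \in (E @^-1: (U * W))%VS.
  by apply: subvP zUW; apply/prodvP => x y xU yW; rewrite -memv_preim EP.
 by rewrite -memv_preim.
move=> [aU lU] [aW lW]; split=> [h z zUW | f z zUW].
 rewrite -act_ad; move: z zUW; apply: aux => x y xU yW; rewrite act_ad ad_mul.
 rewrite (tsum_hbasl (F:=fun a b => ad a x * ad b y)).
  by apply: memv_suml => i _; rewrite memv_mul ?aU ?aW.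
 by split=> [b|a] c u v; rewrite ad_linl ?mulrDl ?mulrDr -?scalerAl -?scalerAr.
move: z zUW; apply: aux => x y xU yW; rewrite lt_mul.
apply: memv_suml => i _; apply: memv_suml => j _; apply: memvZ.
by rewrite memv_mul ?lU ?lW.
Qed.
Lemma ad_central h z: central z -> ad h z = (counit h: K) *: z.
move=> cz; rewrite adE; under eqt => a b do rewrite cz -mulrA.
by rewrite (tsum_antir (F:=fun x => z * x)) ?mulr1 //; lin.
Qed.
Lemma central_ad z: (forall h, ad h z = (counit h: K) *: z) -> central z.
move=> az h; rewrite ad_move; under eqt => a b do rewrite az -scalerAl.
by rewrite (tsum_el (F:=fun b => z * b)) //; lin.
Qed.
Lemma lt_grouplike (f: dual H) z: grouplike z -> lt f z = (f z: K) *: z.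
by move=> zG; rewrite ltE tsum_grouplike //; bil. Qed.
Lemma rt_grouplike (f: dual H) z: grouplike z -> rt f z = (f z: K) *: z.
by move=> zG; rewrite rtE tsum_grouplike //; bil. Qed.
Lemma ydstable_line z: grouplike z -> central z -> ydstable <[z]>%VS.
move=> zG zc; split=> [h _ /vlineP[c ->] | f _ /vlineP[c ->]].
 rewrite -act_ad linearZ /= act_ad ad_central //.
 by rewrite !memvZ // memv_line.
by rewrite linearZ /= lt_grouplike // !memvZ // memv_line.
Qed.
(** The counit cannot vanish on a nonzero translation-stable subspace, so the line has a generator z
    with counit 1. Stability under translations makes z grouplike, stability under the adjoint
    action makes it central. *)
Lemma line_ydstable U: ydstable U -> \dim U = 1%N ->
 exists z, [/\ grouplike z, central z & U = <[z]>%VS].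
move=> [aU lU] d1; have U0: U != 0%VS by rewrite -dimv_eq0 d1.
pose x := vpick U; have xU: x \in U by apply: memv_pick.
have x0: x != 0 by rewrite vpick0.
have UE: U = <[x]>%VS by apply/eqP; rewrite eq_sym eqEdim -memvE xU d1 dim_vline x0.
have lx f: exists c: K, lt f x = c *: x by apply/vlineP; rewrite -UE lU.
have e0: counit x != 0.
 apply/eqP=> e0; case/eqP: x0; apply: vect_sep => f; rewrite linear0.
 by have [c cE] := lx f; rewrite -counit_lt cE linearZ /= e0 [LHS]mulr0.
have [z [ez zU]]: exists z, counit z = 1 /\ z \in U.
 exists ((counit x: K)^-1 *: x); rewrite memvZ // linearZ /=; split=> //; exact: mulVf.
have UZ: U = <[z]>%VS.
 apply/eqP; rewrite eq_sym eqEdim -memvE zU d1 dim_vline.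
 by case: eqP => // z0; move/eqP: ez; rewrite z0 linear0 eq_sym oner_eq0.
exists z; split=> //.
 apply: grouplikeP => // f f'; rewrite -dual_lt.
 have [c cE]: exists c: K, lt f z = c *: z by apply/vlineP; rewrite -UZ lU.
 by rewrite cE linearZ -counit_lt cE linearZ /= ez [_ *: 1]mulr1.
apply: central_ad => h.
have [c cE]: exists c: K, ad h z = c *: z by apply/vlineP; rewrite -UZ aU.
have := counit_ad h z; rewrite cE linearZ /= ez [_ *: 1]mulr1 mulr1 => ->.
by [].
Qed.
Lemma central_grouplike_group: exists (gT: finGroupType) (v: gT -> H),
 [/\ injective v, v 1%g = 1, forall a b, v (a * b)%g = v a * v b,
   forall a, grouplike (v a) /\ central (v a) &
   forall z, grouplike z -> central z -> exists a, z = v a].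
have [||||gT [v [vi v1 vM vP]]] := @grouplike_group K H (fun z => grouplike z /\ central z).
- by split=> [|h]; [apply: grouplike1 | rewrite mulr1 mul1r].
- move=> x y [xG xc] [yG yc]; split; first exact: grouplikeM.
 by move=> h; rewrite mulrA xc -mulrA yc mulrA.
- move=> x [xG xc]; split; first exact: grouplikeS.
 have [Sx xS] := grouplike_antipode xG.
 by move=> h; rewrite -[h * _]mul1r -{1}Sx -mulrA (mulrA x) -xc -[h * x * _]mulrA xS mulr1.
- by move=> x [].
exists gT, v; split=> // [a | z zG zc]; first by apply/vP; exists a.
by apply/vP.
Qed.

Section SmallPart.
Variable b: nat.
Hypothesis b1: (1 < b)%N.
Variables (J: finType) (M: J -> @ydop K H) (inc: forall j, 'Hom(ocar (M j), H))
 (prj: forall j, 'Hom(H, ocar (M j))).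
Hypothesis D: @yd_decomp K H (ydad H) J M inc prj.
Let d j := \dim {: ocar (M j)}.
Let U j := limg (inc j).
Definition small_part: {vspace H} := (\sum_(j | (d j < b)%N) U j)%VS.
Let yM j: yd (M j). by case: D => /(_ j)[]. Qed.
Let iM j: oirr (M j). by case: D => /(_ j)[]. Qed.
Let ih j: omhom (V:=M j) (W:=ydad H) (inc j). by case: D. Qed.
Let ph j: omhom (V:=ydad H) (W:=M j) (prj j). by case: D. Qed.
Let pi j u: prj j (inc j u) = u.
by case: D => _ _ _ /(_ j)/lfunP/(_ u); rewrite clE ilE. Qed.
Let sum1 x: x = \sum_j inc j (prj j x).
case: D => _ _ _ _ /lfunP/(_ x); rewrite ilE => {1}<-; rewrite smE.
by apply: eq_bigr => j _; rewrite clE.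
Qed.
Lemma summand_dim j: \dim (U j) = d j.
apply: limg_dim_eq; rewrite capfv; apply/eqP/lker0P => u v E.
by rewrite -[u]pi E pi.
Qed.
Lemma summand_stable j: ydstable (U j).
apply/stableP; exact: (@stable_img K (H + dual H)%type (M j) (ydad H) (inc j) fullv (@ih j) (@stable_full _ _ _)). Qed.
Lemma summand_dvd j: (d j %| N)%N.
exact: yd_dim_dvd. Qed.
Lemma summand_sum: (\sum_j U j = fullv)%VS.
apply/eqP; rewrite eqEsubv subvf /=; apply/subvP=> x _; rewrite (sum1 x).
by apply: memv_sumr => j _; rewrite memv_img ?memvf.
Qed.
Lemma summand_dims: (\sum_j d j)%N = N.
apply: (char0_natr_inj char0); rewrite natr_sum -ltr1.
rewrite (odecomp_ltr (f:=\1%VF) (g:=fun j => \1%VF) D); last first.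
 by move=> j; rewrite cl1l cl1r.
by apply: eq_bigr => j _; rewrite ltr1.
Qed.
Lemma summand_direct: directv (\sum_j U j).
apply/directvP; rewrite /= summand_sum -summand_dims.
by apply: eq_bigr => j _; rewrite summand_dim.
Qed.
Lemma summand_inj i j: U i = U j -> i = j.
move=> E; apply/eqP; apply: contraT => ij.
have /directv_sumP/(_ i isT) X := summand_direct.
have: (U i <= U i :&: (\sum_(l | true && (l != i)) U l))%VS.
 rewrite subv_cap subvv /= {1}E; apply: (sumv_sup j) => //.
 by rewrite eq_sym.
rewrite X subv0 -dimv_eq0 summand_dim; have [d0 _] := iM i.
by rewrite /d; case: (\dim _) d0.
Qed.
Lemma small_part_dim: \dim small_part = (\sum_(j | (d j < b)%N) d j)%N.
have le (P: pred J): (\dim (\sum_(j | P j) U j)%VS <= \sum_(j | P j) d j)%N.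
 apply: leq_trans (dimv_leq_sum _ _ _) _.
 by apply/eq_leq/eq_bigr => j _; rewrite summand_dim.
have := le (fun j => (d j < b)%N); have := le (fun j => ~~ (d j < b)%N).
have: (N <= \dim small_part + \dim (\sum_(j | ~~ (d j < b)%N) U j)%VS)%N.
 rewrite -dimv_sum_cap -{1}summand_sum (bigID (fun j => (d j < b)%N)) /= addnC.
 exact: leq_addl.
have := summand_dims; rewrite (bigID (fun j => (d j < b)%N)) /= -/small_part; lia.
Qed.
Lemma small_part_stable: ydstable small_part.
split=> [h x | f x] /memv_sumP[u uU ->].
 rewrite -act_ad lsE; apply: memv_sumr => j jb /=; rewrite act_ad.
 by have [aU _] := summand_stable j; apply/aU/uU.
rewrite lsE; apply: memv_sumr => j jb /=.
by have [_ lU] := summand_stable j; apply/lU/uU.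
Qed.
(** The projection of W to an irreducible summand of dimension at least b is zero, since otherwise
    it would be onto and W too large. *)
Lemma stable_small W: ydstable W -> (\dim W < b)%N -> (W <= small_part)%VS.
move=> /stableP sW Wb; apply/subvP=> x xW; rewrite (sum1 x).
rewrite (bigID (fun j => (d j < b)%N)) /= [X in _ + X]big1 ?addr0; last first.
 move=> j jb; suff -> : prj j x = 0 by rewrite linear0.
 have [|E|E] := (iM j).2 (prj j @: W)%VS; first exact: (@stable_img K (H + dual H)%type (ydad H) (M j) (prj j) _ (@ph j)).
  by apply/eqP; rewrite -memv0 -E memv_img.
 case/negP: jb; apply: leq_ltn_trans Wb; rewrite /d -E.
 by rewrite -(limg_ker_dim (prj j) W) leq_addl.
by apply: memv_sumr => j _; rewrite memv_img ?memvf.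
Qed.
Hypothesis db: forall i j, (d i < b)%N -> (d j < b)%N -> (d i * d j < b)%N.
(** By [db] the product of two small summands is a submodule of dimension less than b, so
    [stable_small] puts it back into the small part. *)
Lemma small_part_coid: coid_subalg small_part.
split; last by case: small_part_stable.
- have c1: central 1 by move=> h; rewrite mul1r mulr1.
 have := stable_small (ydstable_line (grouplike1 H) c1).
 by rewrite -memvE dim_vline oner_neq0; apply.
move=> x y /memv_sumP[u uU ->] /memv_sumP[w wU ->].
rewrite mulr_suml; apply: memv_suml => i ib; rewrite mulr_sumr; apply: memv_suml => j jb.
have: (U i * U j <= small_part)%VS.
 apply: stable_small; first by apply: ydstable_prod; apply: summand_stable.
 by apply: leq_ltn_trans (dim_prodv _ _) _; rewrite !summand_dim db.
by move/subvP; apply; rewrite memv_mul ?uU ?wU.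
Qed.
(** The one-dimensional summands are lines of central grouplikes, distinct because the sum is
    direct. Conversely a central grouplike has a nonzero projection to some summand, which is then a
    line; as this projection respects translations, the grouplike of that line takes the same value
    under every functional and is the given one. *)
Lemma card_central (gT: finGroupType) (v: gT -> H): injective v ->
 (forall a, grouplike (v a) /\ central (v a)) ->
 (forall z, grouplike z -> central z -> exists a, z = v a) ->
 #|gT| = (\sum_(j | (d j < b)%N) (d j == 1))%N.
move=> vi vP vS.
have -> : (\sum_(j | (d j < b)%N) (d j == 1) = #|[pred j | d j == 1]|)%N.
 rewrite -sum1_card big_mkcond [RHS]big_mkcond; apply: eq_bigr => j _ /=.
 by rewrite inE; case: eqP => [->|]; rewrite ?b1 //; case: ifP.
have [a aP]: exists a: J -> gT, forall j, d j = 1 -> U j = <[v (a j)]>%VS.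
 apply: (fin_all_exists (P:=fun j a => d j = 1 -> U j = <[v a]>%VS)) => j.
 have [dj|dj] := eqVneq (d j) 1%N; last by exists 1%g => /eqP; rewrite (negPf dj).
 have [z [zG zc UE]] := line_ydstable (summand_stable j) (etrans (summand_dim j) dj).
 by have [a aE] := vS z zG zc; exists a => _; rewrite UE aE.
have gl0 c: v c != 0 by apply: grouplike_eq0; exact: (vP c).1.
have line_inj x y: grouplike x -> grouplike y -> <[x]>%VS = <[y]>%VS -> x = y.
 move=> [_ ex] [_ ey] E; have /vlineP[c cE]: x \in <[y]>%VS by rewrite -E memv_line.
 by move: ex; rewrite cE linearZ /= ey [_ *: 1]mulr1 => ->; rewrite scale1r.
rewrite -(@card_in_imset _ _ a); last first.
 move=> i j; rewrite !inE => /eqP di /eqP dj E; apply: summand_inj.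
 by rewrite (aP i di) (aP j dj) E.
rewrite -cardsT; apply: eq_card => c; rewrite inE; apply/esym/imsetP.
have [j pj]: exists j, prj j (v c) != 0.
 apply: NNPP => np; case/eqP: (gl0 c); rewrite (sum1 (v c)) big1 // => j _.
 by apply: NNPP => /eqP E; apply: np; exists j; apply: contraNneq E => ->; rewrite linear0.
have sl: stable (V:=ydad H) <[v c]>%VS by apply/stableP/ydstable_line; case: (vP c).
have Im: (prj j @: <[v c]>)%VS = fullv.
 have [|E|//] := (iM j).2 (prj j @: <[v c]>)%VS; first exact: (@stable_img K (H + dual H)%type (ydad H) (M j) (prj j) _ (@ph j)).
 case/negP: pj; rewrite -memv0 -E memv_img // memv_line //.
have dj: d j = 1%N.
 apply/eqP; rewrite eqn_leq; apply/andP; split; last by case: (iM j).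
 rewrite /d -Im; apply: leq_trans (_: _ <= \dim <[v c]>)%N _.
  by rewrite -(limg_ker_dim (prj j) <[v c]>%VS) leq_addl.
 by rewrite dim_vline; case: (_ != 0).
exists j; first by rewrite inE dj.
have [aG ac] := vP (a j).
have /vlineP[l lE]: inc j (prj j (v c)) \in <[v (a j)]>%VS by rewrite -aP // memv_img ?memvf.
have l0: l *: v (a j) != 0.
 by rewrite -lE; apply: contraNneq pj => E; rewrite -[prj j _]pi E linear0.
apply: vi; apply: vect_sep => f.
have E: (f (v c): K) *: (l *: v (a j)) = (f (v (a j)): K) *: (l *: v (a j)).
 have [i1 i2] := iffLR (ydhomP _ (yM j) (yd_ad H)) (@ih j).
 have [p1 p2] := iffLR (ydhomP _ (yd_ad H) (yM j)) (@ph j).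
 have X: inc j (prj j ((f (v c): K) *: v c)) = (f (v c): K) *: (l *: v (a j)).
  trans ((f (v c): K) *: inc j (prj j (v c))); last by rewrite lE.
  by rewrite linearZ linearZ.
 have := i2 f (prj j (v c)); rewrite -p2 !coa_ad lE linearZ /= !lt_grouplike //; last by case: (vP c).
 by rewrite X => ->; rewrite !scalerA mulrC.
apply/eqP; rewrite -subr_eq0; have := l0; apply: contraNT => nz.
move/eqP: E; rewrite -subr_eq0 -scalerBl scaler_eq0 (negPf nz) /=.
by [].
Qed.
End SmallPart.
(* Irreducible constituents of dimension less than q have dimension dividing the part of N
  that is prime to q, so their sum is a subalgebra as soon as the square of that part is
  less than q. *)
Theorem small_coideal_subalgebra (p q a t: nat): prime p -> prime q ->
 ((p ^ a) ^ 2 < q)%N -> N = (p ^ a * q ^ t.+1)%N ->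
 exists U (gT: finGroupType) (v: gT -> H),
 [/\ [/\ coid_subalg U, ydstable U, (q %| \dim U)%N, (\dim U %| N)%N &
    forall W, ydstable W -> (\dim W < q)%N -> (W <= U)%VS],
   [/\ injective v, v 1%g = 1, forall a b, v (a * b)%g = v a * v b,
    forall a, grouplike (v a) /\ central (v a) &
    forall z, grouplike z -> central z -> exists a, z = v a],
   \dim U = #|gT| %[mod p],
   a = 0%N -> \dim U = #|gT|
  & #|gT| = 1%N -> exists X, [/\ ydstable X, (1 < \dim X)%N, (\dim X %| p ^ a)%N &
    forall W, ydstable W -> (W <= X)%VS -> W = 0%VS \/ W = X]].
move=> p_pr q_pr pq NE.
have [J [M [inc [prj D]]]] := yd_decomposition char0 S2 (yd_ad H).
have [gT [v [vi v1 vM vP vS]]] := central_grouplike_group.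
have q1: (1 < q)%N by apply: prime_gt1.
pose d j := \dim {: ocar (M j)}.
have d0 j: (0 < d j)%N by case: D => /(_ j)[_ []].
have dN j: (d j %| p ^ a * q ^ t.+1)%N by rewrite -NE; apply: summand_dvd D j.
have pa0: (0 < p ^ a)%N by rewrite expn_gt0 prime_gt0.
have pa: (p ^ a < q)%N by apply: leq_ltn_trans pq; rewrite -{1}[(p ^ a)%N]expn1 leq_pexp2l.
have dp j: ~~ (q %| d j)%N -> (d j %| p ^ a)%N.
 move=> qd; rewrite -(@Gauss_dvdl _ _ (q ^ t.+1)%N) ?dN //.
 by rewrite coprimeXr // coprime_sym prime_coprime.
have small j: (d j < q)%N -> (d j %| p ^ a)%N.
 by move=> jq; apply: dp; apply: contraL jq => /(dvdn_leq (d0 j)); rewrite -leqNgt.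
have big j: ~~ (d j < q)%N -> (q %| d j)%N.
 move=> jq; apply: contraR jq => /dp/(dvdn_leq pa0) le; exact: leq_ltn_trans pa.
have db i j: (d i < q)%N -> (d j < q)%N -> (d i * d j < q)%N.
 move=> /small/(dvdn_leq pa0) le1 /small/(dvdn_leq pa0) le2.
 by apply: leq_ltn_trans pq; rewrite -mulnn leq_mul.
pose U := small_part q inc; exists U, gT, v.
have dU: \dim U = (\sum_(j | (d j < q)%N) d j)%N .
 by apply: small_part_dim D.
have card: #|gT| = (\sum_(j | (d j < q)%N) (d j == 1))%N by eapply card_central; eauto.
have cU: coid_subalg U by apply: small_part_coid D _.
(* The dimensions of the summands outside U are multiples of q, and so is N; what remains is dim
   U. *)
have qU: (q %| \dim U)%N.
 have: (q %| N)%N by rewrite NE dvdn_mull // dvdn_exp.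
 rewrite -(summand_dims D) (bigID (fun j => (d j < q)%N)) /= -dU dvdn_addl //.
 by apply: dvdn_sum => j /big.
split=> //.
- split=> //; [exact: small_part_stable D | exact: coid_dim_dvd_full | ].
 by move=> W; apply: stable_small D W.
(* Modulo p only the one-dimensional summands count, the other small dimensions being positive
   powers of p. *)
- rewrite dU card; apply: (big_ind2 (fun x y => x = y %[mod p])) => // [x1 x2 y1 y2 E1 E2 | j /small].
  by rewrite -modnDm E1 E2 modnDm.
 case/(dvdn_pfactor _ _ p_pr) => k _ ->; case: k => [|k]; first by rewrite expn0.
 rewrite -/(d j) expnS modnMr; case: eqP => [E|_]; last by rewrite mod0n.
 by move/eqP: E; rewrite muln_eq1 => /andP[/eqP E _]; rewrite E in p_pr.
- move=> a0; rewrite dU card; apply: eq_bigr => j /small; rewrite a0 expn0 dvdn1 => /eqP E.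
 by rewrite -/(d j) E.
move=> g1; have [j jq j1]: exists2 j, (d j < q)%N & (1 < d j)%N.
 apply: NNPP => nj; have: \dim U = 1%N.
  rewrite dU -g1 card; apply: eq_bigr => j jq; rewrite -/(d j).
  have: ~~ (1 < d j)%N by apply/negP=> j1; apply: nj; exists j.
  by have := d0 j; case: (d j) => [|[|]].
 by move=> U1; have := qU; rewrite U1 dvdn1 => /eqP q1'; rewrite q1' in q1.
exists (limg (inc j)); rewrite (summand_dim D); split=> //.
- exact: summand_stable D j.
- exact: small.
have [gM ih ph pi _] := D => W /stableP sW Wj.
have WE x: x \in W -> inc j (prj j x) = x.
 move=> /(subvP Wj)/memv_imgP[u _ ->].
 by have /lfunP/(_ u) := pi j; rewrite clE ilE => ->.
have [|E|E] := (gM j).2.2 (prj j @: W)%VS; first exact: (@stable_img K (H + dual H)%type (ydad H) (M j) (prj j) _ (ph j)).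
 left; apply/eqP; rewrite -subv0; apply/subvP=> x xW; rewrite memv0 -(WE x xW).
 have: prj j x \in (prj j @: W)%VS by rewrite memv_img.
 by rewrite E memv0 => /eqP ->; rewrite linear0.
right; apply/eqP; rewrite eqEsubv Wj; apply/subvP=> _ /memv_imgP[u _ ->].
have: u \in (prj j @: W)%VS by rewrite E memvf.
by move=> /memv_imgP[x xW ->]; rewrite WE.
Qed.
End AdjointSubmodules.

(** * Dimension p q^t: a central grouplike in the algebra or in its dual *)

Section CyclicGrouplikes.
Variables (K: fieldType) (H: hopfType K).
Lemma cyclic_group (z: H): grouplike z -> exists (gT: finGroupType) (v: gT -> H) (c: gT),
 [/\ injective v, v 1%g = 1, forall a b, v (a * b)%g = v a * v b, v c = z &
   (forall a, exists n, v a = z ^+ n) /\ [set: gT] = <[c]>%g].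
move=> zG; have [o o0 zo] := grouplike_fin_order zG.
have [||||gT [v [vi v1 vM vP]]] := @grouplike_group K H (fun x => exists n, x = z ^+ n).
- by exists 0%N.
- by move=> _ _ [n ->] [m ->]; exists (n + m)%N; rewrite exprD.
- move=> _ [n ->]; exists (n * o.-1)%N.
 have [Sz _] := grouplike_antipode (grouplikeX n zG).
 rewrite -[LHS]mulr1 -(expr1n _ n) -zo -exprM mulnC -{1}(prednK o0) mulnS exprD mulrA.
 by rewrite Sz mul1r.
- by move=> _ [n ->]; apply: grouplikeX.
have [c cE]: exists c, z = v c by apply/vP; exists 1%N.
have vX n: v (c ^+ n)%g = z ^+ n by elim: n => [|n IH]; rewrite ?expg0 // expgS vM IH exprS cE.
exists gT, v, c; split=> //; split=> [a|]; first by apply/vP; exists a.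
apply/setP=> a; rewrite inE; apply/esym/cycleP.
by have [n an] := iffRL (vP (v a)) (ex_intro _ a erefl); exists n; apply: vi; rewrite vX.
Qed.
Lemma cyclic_group_prime (z: H) (gT: finGroupType) (v: gT -> H) (c: gT) p :
 prime p -> injective v -> v 1%g = 1 -> (forall a b, v (a * b)%g = v a * v b) -> v c = z ->
 [set: gT] = <[c]>%g -> z ^+ p = 1 -> z != 1 -> #|gT| = p.
move=> p_pr vi v1 vM cE gE zp z1; rewrite -cardsT gE -/(order c).
have cp: (c ^+ p)%g = 1%g.
 apply: vi; rewrite v1 -zp; elim: (p) => [|n IH]; first by rewrite expg0.
 by rewrite expgS vM IH exprS cE.
have := order_dvdn c p; rewrite cp eqxx => /(primeP p_pr).2/orP[|/eqP //].
by rewrite order_eq1 => /eqP c1; rewrite -cE c1 v1 eqxx in z1.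
Qed.
Lemma lt_grouplikeM (eta: dual H) x y: grouplike eta -> lt eta (x * y) = lt eta x * lt eta y.
by move=> eG; rewrite lt_mul tsum_grouplike //; split=> ?; cbv beta; lin2. Qed.
Lemma rt_grouplikeM (eta: dual H) x y: grouplike eta -> rt eta (x * y) = rt eta x * rt eta y.
by move=> eG; rewrite rt_mul tsum_grouplike //; split=> ?; cbv beta; lin2. Qed.
Lemma grouplike_dualM (eta: dual H) x y: grouplike eta -> eta (x * y) = eta x * eta y.
by move=> eG; rewrite -dcE tsum_grouplike //; bil. Qed.
Lemma grouplike_dual1 (eta: dual H): grouplike eta -> eta 1 = 1.
by move=> [_]; rewrite dual_counitE'. Qed.
Lemma grouplike_evalM (f g: dual H) x: grouplike x -> (f * g) x = f x * g x.
by move=> xG; rewrite dualM tsum_grouplike //; bil. Qed.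
Lemma grouplikes_dualP (eta: dual H): (forall x y, eta (x * y) = eta x * eta y) -> eta 1 = 1 ->
 grouplike eta.
move=> eM e1; apply: grouplikeP; last by rewrite dual_counitE'.
move=> f f'; rewrite dualM; have [a aE] := dual_eval f; have [b bE] := dual_eval f'.
by under eqt => u w do rewrite aE bE; rewrite dcE eM aE bE.
Qed.
Lemma ltr_dim1 (V: vectType K) (E: 'End(V)): \dim {: V} = 1%N -> E = ltr E *: \1%VF.
move=> d1; have V0: fullv != 0%VS :> {vspace V} by rewrite -dimv_eq0 d1.
have [x x0]: exists x: V, x != 0 by exists (vpick fullv); rewrite vpick0.
have XE y: exists c: K, y = c *: x.
 apply/vlineP; suff -> : <[x]>%VS = fullv by apply: memvf.
 by apply/eqP; rewrite eqEdim subvf d1 dim_vline x0.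
have [c cE] := XE (E x).
have -> : E = c *: \1%VF.
 apply/lfunP=> y; have [l ->] := XE y.
 have -> : E (l *: x) = l *: E x by rewrite linearZ.
 by rewrite slE ilE cE !scalerA mulrC.
by rewrite linearZ /= ltr1 d1 mulr1.
Qed.
End CyclicGrouplikes.

Section OneDimensionalEndomorphisms.
Variables (K: closedFieldType) (H: hopfType K).
Hypothesis char0: [pchar K] =i pred0.
Hypothesis S2: involutive H.
Local Notation S := (@antipode K H).
Local Notation SD := (@antipode K (dual H)).
Local Notation N := (\dim {:H}).
Implicit Types V: @ydop K H.
Lemma ydhom_act_move V (E: 'End(ocar V)) h: yd V ->
 (act V h \o E)%VF = \dsum_(h1, h2 <- h) (act (ydhom V V) h1 E \o act V h2)%VF.
move=> yV; under eqt => h1 h2.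
 rewrite ydhom_act (tlE (W' := 'End(ocar V)) _ _
  (f:=fun z => z \o act V h2)%VF); last lin3.
 over.
rewrite (tsumA (F:=fun a b c => (act V a \o (E \o act V (S b))) \o act V c)%VF);
 try by move=> *; lin3.
under eqt => a b.
 under eqt => c d do rewrite -!clA -(yd_actM yV).
 rewrite (tsum_antil (F:=fun z => act V a \o (E \o act V z))%VF); last lin3.
 rewrite (yd_act1 yV) cl1r; over.
by rewrite (tsum_er (F:=fun z => (act V z \o E)%VF)) //; lin3.
Qed.
Lemma ydhom_coa_move V (E: 'End(ocar V)) (f: dual H): yd V ->
 (coa V f \o E)%VF = \dsum_(f1, f2 <- f) (coa (ydhom V V) f1 E \o coa V f2)%VF.
move=> yV; under eqt => h1 h2.
 rewrite ydhom_coa (tlE (W' := 'End(ocar V)) _ _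
  (f:=fun z => z \o coa V h2)%VF); last lin3.
 over.
rewrite (tsumA (F:=fun a b c => (coa V a \o (E \o coa V (SD b))) \o coa V c)%VF);
 try by move=> *; lin3.
under eqt => a b.
 under eqt => c d do rewrite -!clA -(yd_coaM yV).
 rewrite -(tlf (fun z => (coa V a \o (E \o coa V z))%VF)); last lin3.
 have -> : coa V (\dsum_(x, y <- b) (y * SD x)) = (counit b: K) *: \1%VF.
  rewrite (antipoder_op (involutive_dual S2)) linearZ /=.
  by congr (_ *: _); apply: yd_coa1.
 rewrite -!clZr cl1r; over.
by rewrite (tsum_er (F:=fun z => (coa V z \o E)%VF)) //; lin3.
Qed.
Lemma chr_counit V: yd V -> counit (chr V 1) = (\dim {: ocar V})%:R.
by move=> yV; rewrite -[LHS]/((1: dual H) (chr V 1)) chrE (yd_act1 yV) (yd_coa1 yV) cl1l ltr1.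
Qed.
(** A one-dimensional module amounts to a grouplike g of H giving the coaction and a grouplike eta
    of the dual giving the action; the Yetter-Drinfeld condition becomes a commutation rule. *)
Lemma yd_line V: yd V -> \dim {: ocar V} = 1%N -> exists (g: H) (eta: dual H),
 [/\ grouplike g, grouplike eta, forall h, act V h = (eta h: K) *: \1%VF,
   forall f, coa V f = (f g: K) *: \1%VF & forall h, rt eta h * g = g * lt eta h].
move=> yV d1.
pose eta: dual H := linfun (fun h: H => ltr (act V h): K^o).
have etaE h: eta h = ltr (act V h) by rewrite linE //; lin3.
pose gam: 'Hom(dual H, K^o) := linfun (fun f: dual H => ltr (coa V f): K^o).
have gamE f: gam f = ltr (coa V f) by rewrite linE //; lin3.
have [g gE] := dual_eval gam.
have aE h: act V h = (eta h: K) *: \1%VF by rewrite etaE -ltr_dim1.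
have cE f: coa V f = (f g: K) *: \1%VF by rewrite -gE gamE -ltr_dim1.
have t1: ltr (\1: 'End(ocar V))%VF = 1 by rewrite ltr1 d1.
have eG: grouplike eta.
 apply: grouplikes_dualP => [x y|]; last by rewrite etaE (yd_act1 yV).
 by rewrite [LHS]etaE (yd_actM yV) !aE -clZl cl1l !linearZ /= t1 !mulr1.
have gG: grouplike g.
 apply: grouplikeP => [f f'|]; last by rewrite -dual1 -gE gamE (yd_coa1 yV).
 rewrite -gE gamE (yd_coaM yV) !cE -clZl cl1l !linearZ /= t1 !mulr1 mulrC.
 by [].
exists g, eta; split=> // h; apply: vect_sep => f.
have := congr1 (fun E: 'End(ocar V) => ltr E: K^o) (yd_compat yV f h).
have L: linear (fun E: 'End(ocar V) => ltr E: K^o) by lin3.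
rewrite /= (tlE _ _ L) [X in _ = X -> _](tlE _ _ L).
rewrite rtE ltE (tlf (fun z => f (z * g))); last lin.
rewrite (tlf (fun z => f (g * z))); last lin.
move=> E; trans (\dsum_(h1, h2 <- h)
  (ltr (act V h2 \o coa V (fL f h1))%VF: K^o)).
 apply: eqt => a b; rewrite aE cE fLE -clZl cl1l !linearZ /= t1 mulr1.
 by rewrite -scalerAl linearZ.
rewrite E; apply: eqt => a b.
rewrite aE cE fRE -clZl cl1l !linearZ /= t1 mulr1.
by rewrite -scalerAr linearZ mulrC.
Qed.
Lemma nontrivial_line (p q t: nat) V: prime p -> prime q -> (p ^ 2 < q)%N ->
 N = (p * q ^ t.+1)%N -> yd V -> oirr V -> \dim {: ocar V} = p ->
 exists (g: H) (eta: dual H) (theta: 'End(ocar V)),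
 [/\ [/\ grouplike g, grouplike eta, (g != 1) || (eta != 1) & forall h, rt eta h * g = g * lt eta h],
   theta != 0, forall h, (act V h \o theta = theta \o act V (lt eta h))%VF &
   forall f, (coa V f \o theta = theta \o coa V (fL f g))%VF].
move=> p_pr q_pr pq NE yV iV dV; have yW := yd_hom S2 yV yV.
have [J [M [inc [prj D]]]] := yd_decomposition char0 S2 yW.
have [gM ih ph pi _] := D; pose d j := \dim {: ocar (M j)}.
have sd: (\sum_j d j = p * p)%N.
 apply: (char0_natr_inj char0); rewrite natr_sum.
 have -> : (p * p)%:R = ltr (\1: 'End(ocar (ydhom V V)))%VF :> K.
  by rewrite ltr1 dimvf /dim /= -dV !dimvf.
 rewrite (odecomp_ltr (f:=\1%VF) (g:=fun j => \1%VF) D); last first.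
  by move=> j; rewrite cl1l cl1r.
 by apply: eq_bigr => j _; rewrite ltr1.
have d1p j: d j = 1%N \/ d j = p.
 have dj: (d j <= p * p)%N by rewrite -sd (bigD1 j) //= leq_addr.
 have cq: coprime (d j) (q ^ t.+1).
  apply: coprimeXr; rewrite coprime_sym prime_coprime //; apply/negP=> /dvdn_leq qd.
  have d0: (0 < d j)%N by case: (gM j).2.
  by have := leq_trans (qd d0) dj; rewrite mulnn leqNgt pq.
 have: (d j %| p)%N by rewrite -(Gauss_dvdl _ cq) -NE; apply: yd_dim_dvd; case: (gM j).
 by move/(primeP p_pr).2 => /orP[/eqP|/eqP]; [left | right].
pose A := [set j | d j == 1%N].
have pA: (p %| #|A|)%N.
 have: (p %| p * p)%N by rewrite dvdn_mulr.
 rewrite -sd (bigID (fun j => d j == 1%N)) /= dvdn_addl; last first.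
  by apply: dvdn_sum => j /eqP dj; case: (d1p j) => // ->.
 rewrite (eq_bigr (fun=> 1%N)) => [|j /eqP //]; rewrite sum1_card.
 by congr (_ %| _)%N; apply: eq_card => j; rewrite inE.
have count: (\sum_j (chr (ydtriv H) == chr (M j)) = 1)%N.
 apply: (char0_natr_inj char0); rewrite natr_sum; symmetry.
 trans (beta V V); first by rewrite beta_self.
 rewrite /beta /invdim (chr_decomp yW D) smE lsE; apply: eq_bigr => j _.
 have [yj ij] := gM j.
 have <- : beta (ydtriv H) (M j) = (chr (ydtriv H) == chr (M j))%:R.
  by apply: beta_chr => //; [exact: yd_triv | exact: oirr_triv].
 rewrite /beta /invdim chr_hom //; last exact: yd_triv.
 rewrite convE; under [in RHS]eqt => x y do
  rewrite !clE chr_triv rk1E linearZ /= antipode1 counit_antipode -scalerAr mulr1.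
 by rewrite (tsum_er (F:=fun x => chr (M j) x)) //; lin.
have [j0 j0E]: exists j, chr (ydtriv H) = chr (M j).
 apply: NNPP => nj; move: count; rewrite big1 // => j _.
 by case: eqP => // E; case: nj; exists j.
have dtriv: \dim {: ocar (ydtriv H)} = 1%N by rewrite dimvf.
have j0A: j0 \in A.
 rewrite inE; apply/eqP; apply: (char0_natr_inj char0); rewrite /d -dtriv.
 by rewrite -!chr_counit ?j0E //; [exact: yd_triv | case: (gM j0)].
have [j1 j1A j10]: exists2 j1, j1 \in A & j1 != j0.
 have: (1 < #|A|)%N.
  apply: leq_trans (prime_gt1 p_pr) (dvdn_leq _ pA).
  by apply/card_gt0P; exists j0.
 rewrite (cardD1 j0) j0A ltnS => /card_gt0P[j1]; rewrite inE => /andP[j10 j1A].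
 by exists j1.
have nE: chr (ydtriv H) != chr (M j1).
 apply/eqP=> E; move: count; rewrite (bigD1 j0) //= (bigD1 j1) //= j0E eqxx -j0E E eqxx.
 by [].
have d1: \dim {: ocar (M j1)} = 1%N by move: j1A; rewrite inE => /eqP.
have [g [eta [gG eG aE cE gl]]] := yd_line (gM j1).1 d1.
have [i1 i2] := iffLR (ydhomP _ (gM j1).1 yW) (@ih j1).
pose u: ocar (M j1) := vpick fullv.
have u0: u != 0 by rewrite vpick0 -dimv_eq0 d1.
exists g, eta, (inc j1 u); split.
- split=> //; rewrite -negb_and; apply: contraNN nE => /andP[/eqP g1 /eqP e1].
 apply/eqP/eq_chr => f h; rewrite act_triv coa_triv aE cE g1 e1 dual1.
 by rewrite -!clZl !cl1l !linearZ /= !ltr1 d1 dtriv.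
- apply: contraNneq u0 => E; have /lfunP/(_ u) := pi j1.
 by rewrite clE ilE E linear0 => <-.
- move=> h; rewrite ydhom_act_move // ltE.
 have TE a: act (ydhom V V) a (inc j1 u) = (eta a: K) *: inc j1 u.
  by rewrite -i1 aE slE ilE linearZ.
 rewrite (tlf (fun z => (inc j1 u \o act V z)%VF)); last lin3.
 by apply: eqt => a b; rewrite TE -clZl linearZ /= -clZr.
move=> f; rewrite ydhom_coa_move //.
have TE f': coa (ydhom V V) f' (inc j1 u) = (f' g: K) *: inc j1 u.
 by rewrite -i2 cE slE ilE linearZ.
rewrite -(tsum_fL1 (G:=fun z => (inc j1 u \o coa V z)%VF)); last lin3.
by apply: eqt => a b; rewrite TE -clZl.
Qed.
End OneDimensionalEndomorphisms.
Section ExtensionAlternative.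
Variables (K: closedFieldType) (H: hopfType K).
Hypothesis char0: [pchar K] =i pred0.
Hypothesis S2: involutive H.
Implicit Types (X W: {vspace H}).
Local Notation S := (@antipode K H).
Local Notation N := (\dim {:H}).
Lemma rt_gspan (dT: finGroupType) (w: dT -> dual H) x: (forall a, grouplike (w a)) ->
 (forall b, rt (w b) x = x) -> forall f, f \in gspan w -> rt f x = (f 1: K) *: x.
move=> wG E f fB; have L1: linear (fun f: dual H => rt f x) by lin3.
have L2: linear (fun f: dual H => (f 1: K) *: x) by lin3.
trans (linfun (fun f: dual H => rt f x) f); first by rewrite (linE L1).
trans (linfun (fun f: dual H => (f 1: K) *: x) f); last by rewrite (linE L2).
by apply: gspan_eq fB => b; rewrite (linE L1) (linE L2) E grouplike_dual1 // scale1r.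
Qed.
(** The elements fixed by the translations [rt (w b)] form a translation-stable subspace of
    dimension N / |dT|. Since the pairing is trivial, it is stable under right multiplication by the
    v a, so |gT| divides that dimension by [coid_dim_dvd]. *)
Lemma pairing_dvd (gT dT: finGroupType) (v: gT -> H) (w: dT -> dual H) :
 injective v -> v 1%g = 1 -> (forall a b, v (a * b)%g = v a * v b) ->
 (forall a, grouplike (v a)) ->
 injective w -> w 1%g = 1 -> (forall a b, w (a * b)%g = w a * w b) ->
 (forall a, grouplike (w a)) ->
 (forall a b, (w b) (v a) = 1) -> (#|gT| * #|dT| %| N)%N.
move=> vi v1 vM vG wi w1 wM wG wv.
have hB: hopf_subalg (gspan w) by apply: gspan_hopf.
have := dim_rcoinv char0 S2 hB; set M := rcoinv _ => dM.
have MP x: x \in M <-> forall b, rt (w b) x = x.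
 rewrite rcoinv_qmap //; split=> [E b | E f fB]; last exact: rt_gspan E _ fB.
 by rewrite E ?mem_gspan // grouplike_dual1 ?scale1r.
have cU: coid_subalg (gspan v) by apply/hopf_subalg_coid/gspan_hopf.
have lM: ltstable M by move=> f x /MP xM; apply/MP => b; rewrite -lt_rtC xM.
have Mv x y: x \in M -> y \in gspan v -> x * y \in M.
 move=> /MP xM yU; have: (amull x @: gspan v <= M)%VS.
  apply: gspan_img => a; rewrite amullE; apply/MP => b.
  by rewrite rt_grouplikeM // xM rt_grouplike // wv scale1r.
 by move/subvP; apply; rewrite -(amullE x y) memv_img.
have := coid_dim_dvd char0 S2 cU lM Mv; rewrite dim_gspan // => d.
by rewrite -dM dim_gspan // dvdn_mul.
Qed.
(** The canonical map v |-> v(-1) v(0) of a Yetter-Drinfeld module is the identity on the adjoint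
    module. This special feature determines the eigenvalues in [adjoint_weights]. *)
Lemma ad_self (x: H): \dsum_(a, b <- x) ad a b = x.
trans (\dsum_(a, b <- x) \dsum_(c, d <- a) (c * b * S d)).
 by apply: eqt => a b; rewrite adE.
rewrite (tsumA (F:=fun c d b => c * b * S d)); try by move=> *; lin.
under eqt => c w.
 under eqt => d b do rewrite -mulrA.
 rewrite -(tlf (fun z => c * z)); last lin.
 rewrite (antipoder_op S2) -scalerAr mulr1; over.
by rewrite (tsum_er (F:=fun c => c)) //; lin.
Qed.
Lemma haar_ad h x: haar H (ad h x) = (counit h: K) * haar H x.
rewrite adE (tlf (haar H)); last lin.
under eqt => a b do rewrite haarC mulrA.
rewrite -(tlf (fun z => haar H (z * x))); last lin.
by rewrite (antipodel_op S2) -scalerAl mul1r linearZ.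
Qed.
Lemma adwtM x y (f g: dual H): (forall h, ad h x = (f h: K) *: x) ->
 (forall h, ad h y = (g h: K) *: y) -> forall h, ad h (x * y) = ((f * g) h: K) *: (x * y).
move=> xf yg h; rewrite ad_mul dualM.
rewrite (tlf (fun c: K^o => (c: K) *: (x * y))); last lin.
by apply: eqt => a b; rewrite xf yg -scalerAl -scalerAr scalerA.
Qed.
Definition ydirr X := ydstable X /\
 forall W, ydstable W -> (W <= X)%VS -> W = 0%VS \/ W = X.
Lemma irr_submod X: ydirr X -> X != 0%VS ->
 [/\ yd (submod (V:=ydad H) X), oirr (submod (V:=ydad H) X) &
   \dim {: ocar (submod (V:=ydad H) X)} = \dim X].
move=> [sX irX] X0; have sX': stable (V:=ydad H) X by apply/stableP.
have dV: \dim {: ocar (submod (V:=ydad H) X)} = \dim X by rewrite dimvf.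
split=> //; first exact: yd_sub (yd_ad H) sX'.
split=> [|U sU]; first by rewrite dV lt0n dimv_eq0.
have ii: injective (oinj (V:=ydad H) X) by move=> u w; rewrite !oinjE => /subvs_inj.
have iX u: oinj (V:=ydad H) X u \in X by rewrite oinjE subvsP.
have [||E|E] := irX (oinj (V:=ydad H) X @: U)%VS.
- apply/stableP; exact: (stable_img (oinj_hom sX') sU).
- by apply/subvP=> _ /memv_imgP[u _ ->].
- left; apply/eqP; rewrite -subv0; apply/subvP=> u uU; rewrite memv0; apply/eqP/ii.
 by apply/eqP; rewrite linear0 -memv0 -E memv_img.
right; apply/eqP; rewrite eqEsubv subvf; apply/subvP=> u _.
have: oinj (V:=ydad H) X u \in (oinj (V:=ydad H) X @: U)%VS by rewrite E.
by case/memv_imgP=> u' u'U /ii ->.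
Qed.
Lemma ydirr_dvd X: ydirr X -> X != 0%VS -> (\dim X %| N)%N.
by move=> iX X0; have [yV iV <-] := irr_submod iX X0; apply: yd_dim_dvd. Qed.
Lemma eval_grouplikeX (eta: dual H) g n: grouplike eta -> eta (g ^+ n) = eta g ^+ n.
move=> eG; elim: n => [|n IH]; first by rewrite !expr0 grouplike_dual1.
by rewrite !exprS grouplike_dualM // IH.
Qed.
Lemma eval_dualX (eta: dual H) g n: grouplike g -> (eta ^+ n) g = eta g ^+ n.
move=> gG; elim: n => [|n IH]; first by rewrite !expr0 dual1; case: gG.
by rewrite !exprS grouplike_evalM // IH.
Qed.
Lemma dvd_p (p q t d: nat): prime q -> (d %| p * q ^ t)%N -> (0 < d)%N -> (d < q)%N -> (d %| p)%N.
move=> q_pr dN d0 dq; rewrite -(@Gauss_dvdl _ _ (q ^ t)%N) //.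
rewrite coprimeXr // coprime_sym prime_coprime //; apply/negP=> /(dvdn_leq d0).
by rewrite leqNgt dq.
Qed.
Lemma adjoint_weights (p q t: nat) X: prime p -> prime q -> (p ^ 2 < q)%N ->
 N = (p * q ^ t.+1)%N -> ydirr X -> \dim X = p ->
 (forall z: H, grouplike z -> central z -> z = 1) ->
 (forall eta: dual H, grouplike eta -> central eta -> eta ^+ p = 1 -> eta = 1) ->
 p = 2%N /\ exists (x0 x1: H) (eta: dual H),
 [/\ [/\ x0 \in X, counit x0 != 0, forall h, ad h x0 = (counit h: K) *: x0 & lt eta x0 = - x0],
   [/\ x1 \in X, x1 != 0, forall h, ad h x1 = (eta h: K) *: x1 & lt eta x1 = x1] &
   [/\ grouplike eta, eta != 1 & eta ^+ p = 1]].
move=> p_pr q_pr pq NE iX dX noz noeta; have [sX irX] := iX.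
have p1 := prime_gt1 p_pr; have p0 := prime_gt0 p_pr.
have pltq: (p < q)%N by apply: leq_ltn_trans pq; rewrite -mulnn leq_pmulr.
have X0: X != 0%VS by rewrite -dimv_eq0 dX; case: (p) p0.
have sX': stable (V:=ydad H) X by apply/stableP.
have [yV iV dV] := irr_submod iX X0; set V := @submod K (H + dual H)%type (ydad H) X in yV iV dV.
have [i1 i2] := iffLR (ydhomP (oinj (V:=ydad H) X) yV (yd_ad H)) (oinj_hom sX'); rewrite -/V in i1 i2.
have ii: injective (oinj (V:=ydad H) X) by move=> u w; rewrite !oinjE => /subvs_inj.
have [g [eta [theta [[gG eG ge gl] th0 tA tC]]]] :=
 nontrivial_line char0 S2 p_pr q_pr pq NE yV iV (etrans dV dX).
have [Ee eE] := grouplike_antipode eG; have [Sg gS] := grouplike_antipode gG.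
have thI: injective theta.
 apply/lker0P/eqP; have [|//|E] := iV.2 (lker theta).
 - move=> [h|f] u; rewrite !memv_ker => /eqP u0.
   rewrite (yd_actE yV); have /lfunP/(_ u) := tA (lt (antipode eta) h).
   by rewrite !clE -ltM Ee lt1 u0 linear0 => <-.
  rewrite (yd_coaE yV); have /lfunP/(_ u) := tC (fL f (S g)).
  have -> : fL (fL f (S g)) g = f by apply: dualP => x; rewrite !fLE mulrA Sg mul1r.
  by rewrite !clE u0 linear0 => <-.
 - case/eqP: th0; apply/lfunP => u; rewrite zlE; apply/eqP.
  by rewrite -memv_ker E memvf.
have [x [xX ex]]: exists x, x \in X /\ counit x != 0.
 apply: NNPP => nx; case/eqP: X0; apply/eqP; rewrite -vpick0; apply/eqP/vect_sep => f.
 rewrite linear0 -counit_lt; apply: NNPP => /eqP E; apply: nx; exists (lt f (vpick X)).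
 by split=> //; apply: sX.2; rewrite memv_pick.
have [v0 v0E]: exists v0: ocar V, oinj (V:=ydad H) X v0 = ad (integral H) x.
 by exists (vsproj X (ad (integral H) x)); rewrite oinjE vsprojK // sX.1.
have ex0: counit (oinj (V:=ydad H) X v0) != 0.
 by rewrite v0E counit_ad counit_integral // mul1r.
have v0A h: act V h v0 = (counit h: K) *: v0.
 apply: ii; rewrite i1 linearZ /= v0E -act_ad -clE -(yd_actM (yd_ad H)).
 by rewrite integral_mull // linearZ slE.
have v00: v0 != 0 by apply: contraNneq ex0 => ->; rewrite !linear0.
have wt n h: act V h (iter n theta v0) = ((eta ^+ n) h: K) *: iter n theta v0.
 elim: n h => [|n IH] h; first by rewrite expr0 dual1 /= v0A.
 rewrite /=; have /lfunP/(_ (iter n theta v0)) := tA h; rewrite !clE => ->.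
 by rewrite IH linearZ /= dual_lt -exprS.
have vn0 n: iter n theta v0 != 0.
 by elim: n => // n IH; apply: contraNneq IH => /= E; rewrite -(inj_eq thI) E linear0.
have e1: eta != 1.
 apply/eqP=> e1; move: ge; rewrite e1 eqxx orbF => /eqP; apply; apply: noz => // h.
 by have := gl h; rewrite e1 rt1 lt1.
have [gT [v [c [vi v1 vM vc [vP _]]]]] := cyclic_group eG.
have vG a: grouplike (v a) by have [n ->] := vP a; apply: grouplikeX.
have [w wP]: exists w: gT -> ocar V, forall a, w a != 0 /\ forall h, act V h (w a) = (v a h: K) *: w a.
 apply: (fin_all_exists (P:=fun a u => u != 0 /\ forall h, act V h u = (v a h: K) *: u)) => a.
 by have [n ->] := vP a; exists (iter n theta v0).
have fv: free [tuple v (enum_val i) | i < #|gT|].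
 apply: grouplikes_free => [|_ /mapP[i _ ->] //].
 by rewrite map_inj_uniq ?enum_uniq // => i j /vi/enum_val_inj.
have fw: free [tuple w (enum_val i) | i < #|gT|].
 apply/freeP => k k0 i; apply/eqP; have [wi0 _] := wP (enum_val i).
 suff /eqP: k i *: w (enum_val i) = 0 by rewrite scaler_eq0 (negPf wi0) orbF.
 apply: vect_sep => phi; rewrite linear0 linearZ /=.
 have nv (j: 'I_#|gT|): [tuple v (enum_val i) | i < #|gT|]`_j = v (enum_val j) by rewrite -tnth_nth tnth_mktuple.
 have nw (j: 'I_#|gT|): [tuple w (enum_val i) | i < #|gT|]`_j = w (enum_val j) by rewrite -tnth_nth tnth_mktuple.
 move/freeP: fv => F; apply: (F (fun i: 'I_#|gT| => k i * phi (w (enum_val i)))).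
 apply: dualP => h; rewrite zlE smE.
 have := congr1 (fun u => phi (act V h u)) k0; rewrite !linear0 !lsE => E.
 apply: etrans E; apply: eq_bigr => j _; rewrite nv nw.
 rewrite !linearZ /= (wP _).2 linearZ slE /=.
 exact: (etrans (esym (mulrA _ _ _)) (congr1 _ (mulrC _ _))).
have gTp: (#|gT| <= p)%N.
 have := fw; rewrite /free size_tuple => /eqP <-.
 by rewrite -dX -dV dimvS ?subvf.
have gTd: (#|gT| %| p)%N.
 apply: (@dvd_p p q t.+1) => //; [|exact/card_gt0P/(ex_intro _ 1%g) | exact: leq_ltn_trans pltq].
 rewrite -NE -(dim_dual H) -(dim_gspan vi vG); apply: coid_dim_dvd_full => //.
  exact: involutive_dual.
 by apply/hopf_subalg_coid/gspan_hopf.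
have ep: eta ^+ p = 1.
 case/dvdnP: gTd => k ->; rewrite mulnC exprM -vc.
 by rewrite -(vX v1 vM) -cardsT expg_cardG ?inE // v1 expr1n.
(* Moving h past g twists it by eta on both sides, so eta^p = 1 makes g^p central, and the only
   central grouplike is 1. *)
have gp: g ^+ p = 1.
 pose ei: dual H := eta ^+ p.-1.
 have eei: eta * ei = 1 by rewrite -exprS prednK.
 have hg n k: k * g ^+ n = g ^+ n * lt (eta ^+ n) (rt (ei ^+ n) k).
  elim: n k => [|n IH] k; first by rewrite !expr0 rt1 lt1 mulr1 mul1r.
  rewrite [g ^+ n.+1]exprSr mulrA IH -!mulrA; congr (_ * _).
  set y := lt _ _; have -> : y = rt eta (rt ei y) by rewrite -rtM eei rt1.
  by rewrite gl; congr (_ * _); rewrite /y -lt_rtC -ltM -exprSr -rtM -exprS.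
 apply: noz => [|k]; first exact: grouplikeX.
 by rewrite hg ep [ei ^+ p]exprAC ep expr1n rt1 lt1.
have g1: g != 1.
 apply/eqP=> g1; case/eqP: e1; apply: noeta => // f; apply: dualP => y.
 by rewrite -dual_rt -dual_lt; have := gl y; rewrite g1 mulr1 mul1r => ->.
have [a aE]: exists a: K, eta g = a by exists (eta g).
(* If eta(g) = 1, the groups of order p generated by g and eta pair trivially, and p^2 would divide
   p q^(t+1). *)
have a1: a != 1.
 apply/eqP=> a1; have [dT [u [d [ui u1 uM ud [uP uD]]]]] := cyclic_group gG.
 have uG b: grouplike (u b) by have [n ->] := uP b; apply: grouplikeX.
 have gE: [set: gT] = <[c]>%g.
  apply/setP=> b; rewrite inE; apply/esym/cycleP.
  by have [n bn] := vP b; exists n; apply: vi; rewrite bn vX // vc.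
 have := @pairing_dvd _ _ u v ui u1 uM uG vi v1 vM vG.
 rewrite (cyclic_group_prime p_pr ui u1 uM ud uD gp g1) (cyclic_group_prime p_pr vi v1 vM vc gE ep e1).
 rewrite NE dvdn_pmul2l // Euclid_dvdX // dvdn_prime2 // [p == q]ltn_eqF //= => F.
 suff: false by []; apply: F => b1 b2; have [n ->] := uP b1; have [m ->] := vP b2.
 by rewrite eval_dualX ?eval_grouplikeX ?aE ?a1 ?expr1n //; apply: grouplikeX.
have ap: a ^+ p = 1 by rewrite -aE -eval_grouplikeX // gp grouplike_dual1.
have a0: a != 0.
 apply/eqP=> a00; move/eqP: ap; rewrite a00 expr0n gtn_eqF // eq_sym.
 by rewrite oner_eq0.
have idV u: \sum_i act V (hbas i) (coa V (dbasis i) u) = u.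
 apply: ii; rewrite lsE -[RHS]ad_self.
 rewrite (tsum_hbasl (F:=fun a b => ad a b)); last first.
  by split=> [b|b] r y z; rewrite ?ad_linl ?ad_linr.
 by apply: eq_bigr => i _; rewrite /= i1 i2 act_ad coa_ad.
(* theta turns the sum in [idV] into one whose basis elements are translated by eta and whose
   functionals are shifted by g. Undoing both shifts by a change of dual bases leaves the factor a
   and the operators of g and eta. *)
have key u: u = a *: act V g (coa V eta u).
 apply: thI; rewrite -{1}[theta u]idV.
 trans (\sum_i theta (act V (lt eta (hbas i)) (coa V (fL (@dbasis K H i) g) u))).
  apply: eq_bigr => i _; have /lfunP/(_ u) := tC (dbasis i).
  by rewrite !clE => ->; have /lfunP/(_ (coa V (fL (dbasis i) g) u)) := tA (hbas i); rewrite !clE.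
 rewrite -lsE; congr (theta _).
 rewrite (hbas_dual (B:=fun h f => act V (lt eta h) (coa V f u)) (amull g)); last first.
  by split=> ?; cbv beta; lin3.
 trans (a *: act V g (\sum_i act V (lt eta (hbas i)) (coa V (@dbasis K H i) u))).
  rewrite lsE scaler_sumr; apply: eq_bigr => i _.
  rewrite amullE lt_grouplikeM // lt_grouplike // aE -scalerAl linearZ slE.
  by rewrite /= (yd_actM yV) clE.
 congr (_ *: act V g _); rewrite -[RHS]idV.
 rewrite -(hbas_dual (B:=fun h f => act V h (coa V f u)) (lt eta)); last first.
  by split=> ?; cbv beta; lin3.
 apply: eq_bigr => i _; congr (act V _ _).
 have -> : (@dbasis K H i \o lt eta)%VF = eta * @dbasis K H i.
  by apply: dualP => y; rewrite clE dual_lt.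
 by rewrite (yd_coaM yV) clE.
have ce u b: act V (S g) u = b *: u -> coa V eta u = (a^-1 * b) *: u.
 move=> ub; have := congr1 (act V (S g)) (key u).
 rewrite linearZ /= -clE -(yd_actM yV) Sg (yd_act1 yV) ilE ub.
 by move/(congr1 (fun z => a^-1 *: z)); rewrite !scalerA mulVf // scale1r => ->.
have c0: coa V eta v0 = a^-1 *: v0.
 by rewrite (ce _ 1) ?mulr1 // v0A counit_antipode; case: gG => _ ->.
have eSg: eta (S g) = a^-1.
 by apply: (mulfI a0); rewrite mulfV // -aE -grouplike_dualM // gS grouplike_dual1.
have c1: coa V eta (theta v0) = (a^-1 * a^-1) *: theta v0.
 by apply: ce; have := wt 1%N (S g); rewrite /= expr1 eSg.
have c1': coa V eta (theta v0) = theta v0.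
 have /lfunP/(_ v0) := tC eta; rewrite !clE => ->.
 have -> : fL eta g = a *: eta.
  by apply: dualP => y; rewrite fLE grouplike_dualM // aE slE.
 by rewrite linearZ slE c0 scalerA mulfV // scale1r.
have a2: a ^+ 2 = 1.
 have /eqP: a^-1 * a^-1 = 1.
  apply/eqP; rewrite -subr_eq0; have := vn0 1%N; apply: contraNT => nz.
  have := c1; rewrite c1' => /eqP; rewrite -subr_eq0 -{1}[theta v0]scale1r -scalerBl.
  rewrite scaler_eq0 => /orP[|//]; rewrite subr_eq0 eq_sym -subr_eq0.
  by rewrite (negPf nz).
 by rewrite -invfM invr_eq1 -expr2 => /eqP.
have p2: p = 2%N.
 case: (even_prime p_pr) => // op; case/eqP: a1.
 by have := ap; rewrite -[p]odd_double_half op add1n exprS -mul2n exprM a2 expr1n mulr1.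
have am1: a = -1 by move/eqP: a2; rewrite sqrf_eq1 (negPf a1) => /eqP.
split=> //; exists (oinj (V:=ydad H) X v0), (oinj (V:=ydad H) X (theta v0)), eta.
split; split=> //.
- by rewrite oinjE subvsP.
- by move=> h; rewrite -act_ad -i1 v0A linearZ.
- by rewrite -coa_ad -i2 c0 am1 invrN invr1 scaleN1r linearN.
- by rewrite oinjE subvsP.
- by apply: contraNneq (vn0 1%N) => /= E; apply/eqP/ii; rewrite E linear0.
- by move=> h; rewrite -act_ad -i1; have := wt 1%N h; rewrite /= expr1 => ->; rewrite linearZ.
by rewrite -coa_ad -i2 c1'.
Qed.
End ExtensionAlternative.
Section ExtensionAlternativeTheorem.
Variables (K: closedFieldType) (H: hopfType K).
Hypothesis char0: [pchar K] =i pred0.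
Hypothesis S2: involutive H.
Implicit Types (X W: {vspace H}).
Local Notation S := (@antipode K H).
Local Notation N := (\dim {:H}).
(** Otherwise p = 2 and X has a basis x0, x1 as in [adjoint_weights]. In Y = X X the vectors of
    trivial weight are spanned by x0^2 and x1^2 and are fixed by translation by eta, whereas a
    two-dimensional irreducible submodule would contain one that is negated; and the only
    one-dimensional submodule is that of 1. So the kernel of haar on Y is 0 and Y is the line of 1.
    Then x0 x1 = 0 by its weight and x0^2 is a scalar, which annihilates x1 and is therefore 0,
    against counit(x0) being nonzero. *)
Theorem central_alternative (p q t: nat): prime p -> prime q -> (p ^ 2 < q)%N ->
 N = (p * q ^ t.+1)%N ->
 (exists z: H, [/\ grouplike z, central z & z != 1]) \/
 (exists eta: dual H, [/\ grouplike eta, central eta, eta != 1 & eta ^+ p = 1]).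
move=> p_pr q_pr pq NE; apply: NNPP => /not_or_and[nz ne].
have noz (z: H): grouplike z -> central z -> z = 1.
 by move=> zG zc; apply: NNPP => /eqP z1; apply: nz; exists z.
have noeta (eta: dual H): grouplike eta -> central eta -> eta ^+ p = 1 -> eta = 1.
 by move=> eG ec ep; apply: NNPP => /eqP e1; apply: ne; exists eta.
have p1 := prime_gt1 p_pr.
have [U [gT [v [_ [vi v1 _ vP _] _ _ irr]]]] := small_coideal_subalgebra char0 S2 (a:=1)
 p_pr q_pr (etrans (congr1 (fun x => (x ^ 2 < q)%N) (expn1 p)) pq) (etrans NE (congr1 (fun x => (x * _)%N) (esym (expn1 p)))).
have [|X [sX X1 Xp irX]] := irr.
 apply/eqP; rewrite -cardsT; apply/cards1P; exists 1%g; apply/setP=> a; rewrite !inE.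
 by apply/esym/eqP/vi; rewrite v1; apply: noz; case: (vP a).
have iX: ydirr X by [].
have dX: \dim X = p.
 by apply/eqP; move: Xp; rewrite expn1 => /(primeP p_pr).2/orP[/eqP E|//]; rewrite E in X1.
have [p2 [x0 [x1 [eta [[x0X ex0 ax0 lx0] [x1X x10 ax1 lx1] [eG e1 ep]]]]]] :=
 adjoint_weights char0 S2 p_pr q_pr pq NE iX dX noz noeta.
have ee: eta * eta = 1 by move: ep; rewrite p2 expr2.
have [k ek]: exists k, (eta k: K) != counit k.
 apply: NNPP => nk; case/eqP: e1; apply: dualP => k; rewrite dual1.
 by apply: NNPP => /eqP E; apply: nk; exists k.
have ax0' h: ad h x0 = ((1: dual H) h: K) *: x0 by rewrite dual1 ax0.
have two_wt y: (forall h, ad h y = (counit h: K) *: y) ->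
  (forall h, ad h y = (eta h: K) *: y) -> y = 0.
 move=> y1 y2; have /eqP := y1 k; rewrite y2 -subr_eq0 -scalerBl scaler_eq0 subr_eq0.
 by rewrite (negPf ek) => /eqP.
have XE: X = (<[x0]> + <[x1]>)%VS.
 apply/esym/eqP; rewrite eqEdim subv_add -!memvE x0X x1X /= dX p2.
 have I0: (<[x0]> :&: <[x1]> = 0)%VS.
  apply/eqP; rewrite -subv0; apply/subvP=> y; rewrite memv_cap memv0.
  move=> /andP[/vlineP[c yc] /vlineP[d yd']]; apply/eqP/two_wt => h.
   by rewrite yc -!act_ad linearZ /= act_ad ax0 !scalerA mulrC.
  by rewrite yd' -!act_ad linearZ /= act_ad ax1 !scalerA mulrC.
 rewrite dimv_disjoint_sum // !dim_vline x10.
 by have -> : x0 != 0 by apply: contraNneq ex0 => ->; rewrite linear0.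
pose Y := (X * X)%VS; have sY: ydstable Y by apply: ydstable_prod.
have YP y: y \in Y -> exists y1 y2, [/\ y = y1 + y2, forall h, ad h y1 = (counit h: K) *: y1,
  lt eta y1 = y1 & forall h, ad h y2 = (eta h: K) *: y2].
 rewrite /Y XE prodvDl !prodvDr !prodv_line.
 case/memv_addP=> _ /memv_addP[_ /vlineP[c00 ->] [_ /vlineP[c01 ->] ->]].
 case=> _ /memv_addP[_ /vlineP[c10 ->] [_ /vlineP[c11 ->] ->]] ->.
 exists (c00 *: (x0 * x0) + c11 *: (x1 * x1)), (c01 *: (x0 * x1) + c10 *: (x1 * x0)).
 split=> [|h||h].
 - by rewrite [c10 *: _ + _]addrC addrACA.
 - rewrite -!act_ad linearD !linearZ /= !act_ad (adwtM ax0' ax0') (adwtM ax1 ax1).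
  by rewrite ee mulr1 dual1 scalerDr !scalerA ![counit h * _]mulrC.
 - by rewrite linearD !linearZ /= !lt_grouplikeM // lx0 lx1 mulrNN.
 rewrite -!act_ad linearD !linearZ /= !act_ad (adwtM ax0' ax1) (adwtM ax1 ax0').
 by rewrite mulr1 mul1r scalerDr !scalerA ![eta h * _]mulrC.
have dY: (\dim Y < q)%N.
 apply: leq_ltn_trans pq; apply: leq_trans (dim_prodv _ _) _.
 by rewrite dX mulnn.
pose Z := (Y :&: lker (haar H))%VS.
have sZ: ydstable Z.
 split=> [h y | f y]; rewrite !memv_cap !memv_ker => /andP[yY /eqP y0].
  by rewrite sY.1 // haar_ad // y0 mulr0 eqxx.
 by rewrite sY.2 // dual_lt haar_r // y0 mulr0 eqxx.
have Z0: Z = 0%VS.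
 apply: NNPP => /eqP Z0; have [X' [sX' X'Z X'0 mX']] := exists_minimal sZ Z0.
 have iX': ydirr X'.
  split=> // W sW WX'; have [->|W0] := eqVneq W 0%VS; first by left.
  by right; apply: mX'.
 have X'Y: (X' <= Y)%VS by apply: subv_trans X'Z (capvSl _ _).
 have: (\dim X' %| p)%N.
  apply: (@dvd_p p q t.+1) => //; first by rewrite -NE; apply: ydirr_dvd.
   by rewrite lt0n dimv_eq0.
  exact: leq_ltn_trans (dimvS X'Y) dY.
 move/(primeP p_pr).2/orP=> [/eqP d1 | /eqP dp].
  have [z [zG zc zE]] := line_ydstable sX' d1; rewrite (noz z zG zc) in zE.
  have: 1 \in Z by apply: subvP X'Z _ _; rewrite zE memv_line.
  by rewrite memv_cap memv_ker haar1 // oner_eq0 andbF.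
 have [_ [y0 [y1 [eta' [[y0X ey0 ay0 ly0] [y1X y10 ay1 ly1] [e'G e'1 _]]]]]] :=
  adjoint_weights char0 S2 p_pr q_pr pq NE iX' dp noz noeta.
 (* Only the trivial weight and eta occur in Y, so the nontrivial weight of X' has to be eta. *)
 have e'E: eta' = eta.
  have [u [w [yE au lu aw]]] := YP y1 (subvP X'Y _ y1X).
  have w0: w != 0.
   apply/eqP=> w0; case/eqP: e'1; apply: dualP => h; rewrite dual1.
   rewrite w0 addr0 in yE; have /eqP := ay1 h; rewrite yE au -subr_eq0 -scalerBl -yE.
   by rewrite scaler_eq0 (negPf y10) orbF subr_eq0 => /eqP ->.
  have E h: (eta' h - counit h: K) *: u = (eta h - eta' h: K) *: w.
   have Eh: (counit h: K) *: u + (eta h: K) *: w = (eta' h: K) *: u + (eta' h: K) *: w.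
    by have := ay1 h; rewrite yE -act_ad linearD /= !act_ad au aw scalerDr.
   have {}Eh: (eta h: K) *: w = (eta' h: K) *: u + (eta' h: K) *: w - (counit h: K) *: u.
    by rewrite -Eh addrC addKr.
   by rewrite !scalerBl Eh [in RHS]addrAC addrK.
  apply: dualP => h; apply/eqP; rewrite -subr_eq0 -oppr_eq0 opprB.
  have := congr1 (ad k) (E h); rewrite -!act_ad !linearZ /= !act_ad au aw.
  rewrite [_ *: (counit k *: u)]scalerA mulrC -scalerA E !scalerA => /eqP.
  rewrite -subr_eq0 -scalerBl scaler_eq0 (negPf w0) orbF mulrC -mulrBr mulf_eq0.
  by case/orP => //; rewrite subr_eq0 eq_sym (negPf ek).
 have [u [w [yE au lu aw]]] := YP y0 (subvP X'Y _ y0X).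
 have w0: w = 0.
  apply: two_wt => // h; have -> : w = y0 - u by rewrite yE addrC addKr.
  by rewrite -act_ad linearB /= !act_ad ay0 au scalerBr.
 case/eqP: ey0; have: y0 = - y0 by rewrite -ly0 e'E yE w0 addr0 lu.
 move/eqP; rewrite -addr_eq0 -mulr2n -scaler_nat scaler_eq0 char0_nat //= => /eqP ->.
 by rewrite linear0.
have Y1: \dim Y = 1%N.
 have dE: \dim (haar H @: Y) = \dim Y.
  by rewrite -[RHS](limg_ker_dim (haar H) Y) -/Z Z0 dimv0 add0n.
 apply/eqP; rewrite eqn_leq; apply/andP; split.
  by rewrite -dE; apply: leq_trans (dimvS (subvf _)) _; rewrite dimvf.
 rewrite lt0n dimv_eq0.
 apply/eqP=> Y0; case/eqP: ex0; have: x0 * x0 \in Y by rewrite memv_mul.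
 rewrite Y0 memv0 => /eqP/(congr1 counit); rewrite counitM linear0 => /eqP.
 by rewrite mulf_eq0 orbb => /eqP.
have [z [zG zc zE]] := line_ydstable sY Y1; rewrite (noz z zG zc) in zE.
have /vlineP[c cE]: x0 * x0 \in <[1: H]>%VS by rewrite -zE memv_mul.
have /vlineP[d dE]: x0 * x1 \in <[1: H]>%VS by rewrite -zE memv_mul.
have d0: d = 0.
 have := haar_ad S2 k (x0 * x1); rewrite (adwtM ax0' ax1) mul1r dE !linearZ /= haar1 //.
 rewrite scalerA [_ *: _]mulr1 [d *: _]mulr1 => /eqP; rewrite -subr_eq0 -mulrBl mulf_eq0 subr_eq0.
 by rewrite (negPf ek) => /eqP.
case/eqP: x10; have: c *: x1 = 0 by rewrite -[x1]mul1r scalerAl -cE -mulrA dE d0 scale0r mulr0.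
move/eqP; rewrite scaler_eq0 => /orP[/eqP c0|/eqP //]; case/eqP: ex0.
have := congr1 counit cE; rewrite counitM c0 scale0r linear0 => /eqP.
by rewrite mulf_eq0 orbb => /eqP.
Qed.
End ExtensionAlternativeTheorem.

(** * Hopf maps, trivial Hopf algebras and semisolvable chains *)

Section HopfHoms.
Variable K: fieldType.
Implicit Types (H B C: hopfType K).
Lemma tmap_id (U V: vectType K) (t: tensor U V): \tsum_(u, v <- t) (u *t v) = t.
have L: linear (fun t: tensor U V => \tsum_(u, v <- t) (u *t v)) by lin.
by apply: (tens_ext L (g:=id)) => // u v; rewrite tliftE //; bil.
Qed.
Lemma hopf_hom_comp H B C (A: {vspace H}) (f: 'Hom(H, B)) (g: 'Hom(B, C)) :
 hopf_hom_in A f -> hopf_hom g -> hopf_hom_in A (g \o f)%VF.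
move=> [/ahom_inP[fM f1] fD fe fS] [/ahom_inP[gM g1] gD ge gS]; split.
- by apply/ahom_inP; split=> [x y xA yA|]; rewrite !clE ?fM ?f1 ?gM ?memvf.
- move=> a aA; rewrite clE gD ?memvf // fD // /tmap tsT.
 by apply: eqt => x y; rewrite tliftE ?clE //; bil.
- by move=> a aA; rewrite clE ge ?memvf // fe.
by move=> a aA; rewrite !clE gS ?memvf // fS.
Qed.
Lemma hopf_hom_inv H B (f: 'Hom(H, B)): hopf_hom f -> lker f = 0%VS -> limg f = fullv ->
 [/\ hopf_hom (f^-1)%VF, lker (f^-1)%VF = 0%VS & limg (f^-1)%VF = fullv].
move=> [/ahom_inP[fM f1] fD fe fS] /eqP kf imf.
have fK x: (f^-1)%VF (f x) = x by apply: lker0_lfunK.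
have Kf y: f ((f^-1)%VF y) = y by apply: limg_lfunVK; rewrite imf memvf.
split; last 2 first.
- apply/eqP; rewrite -subv0; apply/subvP=> y; rewrite memv_ker memv0 => /eqP y0.
 by rewrite -[y]Kf y0 linear0.
- apply/eqP; rewrite eqEsubv subvf; apply/subvP=> x _.
 by rewrite -[x]fK memv_img ?memvf.
split.
- apply/ahom_inP; split=> [x y _ _|]; last by rewrite -f1 fK.
 by rewrite -{1}[x]Kf -{1}[y]Kf -fM ?memvf // fK.
- move=> y _; rewrite -{2}[y]Kf fD ?memvf // /tmap tsT -{1}[comul _]tmap_id.
 by apply: eqt => u v; rewrite tliftE ?fK //; bil.
- by move=> y _; rewrite -{2}[y]Kf fe ?memvf.
by move=> y _; rewrite -{2}[y]Kf fS ?memvf // fK.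
Qed.
Definition trivial_hopf H := trivial_subalg (fullv: {vspace H}).
Lemma quotient_isom_trans H B C (A I: {vspace H}) (f: 'Hom(H, B)) :
 hopf_hom_in A f -> (f @: A = fullv)%VS -> (A :&: lker f = I)%VS ->
 Defs.quotient_isom (fullv: {vspace B}) 0%VS C -> Defs.quotient_isom A I C.
move=> hf If kf [g [hg Ig]]; rewrite capfv => /eqP/lker0P kg.
exists (g \o f)%VF; split; [exact: hopf_hom_comp | by rewrite limg_comp If|].
apply/vspaceP=> x; rewrite -kf !memv_cap !memv_ker clE.
by congr (_ && _); rewrite -{1}(linear0 g) (inj_eq kg).
Qed.
Lemma trivial_quotient_hom H B (A I: {vspace H}) (f: 'Hom(H, B)) :
 hopf_hom_in A f -> (f @: A = fullv)%VS -> (A :&: lker f = I)%VS ->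
 trivial_hopf B -> trivial_quotient A I.
by move=> hf If kf [gT [q|q]]; exists gT; [left|right]; exact: (quotient_isom_trans hf If kf q).
Qed.
Lemma spanned_trivial H (gT: finGroupType) (v: gT -> H): injective v -> v 1%g = 1 ->
 (forall a b, v (a * b)%g = v a * v b) -> (forall a, grouplike (v a)) ->
 #|gT| = \dim {: H} -> trivial_hopf H.
move=> vi v1 vM vG c; have hg := gmap_hom v1 vM vG; have kg := gmap_ker vi vG.
have ig: limg (gmap v) = fullv.
 by rewrite gmap_img; apply/eqP; rewrite eqEdim subvf dim_gspan //= c.
have [h1 h2 h3] := hopf_hom_inv hg kg ig.
by exists gT; left; exists (gmap v)^-1%VF; rewrite capfv.
Qed.

Section Transpose.
Variables (H C: hopfType K) (g: 'Hom(C, dual H)).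
Hypotheses (hg: hopf_hom g) (kg: lker g = 0%VS).
Definition transp: 'Hom(H, dual C) :=
 linfun (fun h: H => linfun (fun c: C => (g c: dual H) h: K^o): dual C).
Lemma transpE h c: (transp h: dual C) c = (g c: dual H) h.
have L h': linear (fun c: C => (g c: dual H) h': K^o) by lin.
rewrite linE ?(linE (L h)) // => a x y; apply: dualP => b.
by rewrite alE slE !(linE (L _)) linearP.
Qed.
Lemma transp_hom: hopf_hom transp.
have [/ahom_inP[gM g1] gD ge gS] := hg; split.
- apply/ahom_inP; split=> [x y _ _|]; apply: dualP => c; rewrite transpE; last first.
  by rewrite dual1 -ge ?memvf // dual_counitE'.
 rewrite dualM -dcE gD ?memvf // /tmap tsT.
 by apply: eqt => c1 c2; rewrite tliftE ?transpE //; bil.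
- move=> a _; apply: dual_tens_ext => b c; rewrite dcE transpE gM ?memvf // dualM.
 rewrite /tmap tsT; apply: eqt => x y.
 by rewrite tliftE ?transpE //; bil.
- by move=> a _; rewrite dual_counitE' transpE g1 dual1.
by move=> a _; apply: dualP => c; rewrite dual_SE !transpE -gS ?memvf // dual_SE.
Qed.
Lemma transp_img: limg transp = fullv.
apply/eqP; rewrite eqEsubv subvf; apply/subvP=> y _; apply/eqP; apply: contraT => yI.
have z0: y - projv (limg transp) y != 0.
 rewrite subr_eq0; by apply: contra yI => /eqP E; rewrite E memv_proj.
have [phi phi0]: exists phi: 'Hom(dual C, K^o), phi (y - projv (limg transp) y) != 0.
 apply: NNPP => np; case/eqP: z0; apply: vect_sep => phi; rewrite linear0.
 by apply: NNPP => /eqP E; apply: np; exists phi.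
have [b bE] := dual_eval (H:=C) (phi \o (\1 - projv (limg transp)))%VF.
have b0: b = 0.
 move/eqP/lker0P: kg; apply; apply: dualP => h.
 rewrite linear0 zlE -transpE -bE clE alE olE ilE.
 by rewrite projv_id ?subrr ?linear0 // memv_img ?memvf.
have := bE y; rewrite clE alE olE ilE b0 linear0 => E.
by rewrite E eqxx in phi0.
Qed.
End Transpose.
(** The embedding of the group algebra into the dual of H, which is onto by dimension, is transposed
    to an isomorphism of H with the dual of the group algebra. *)
Lemma cospanned_trivial H (gT: finGroupType) (w: gT -> dual H): injective w -> w 1%g = 1 ->
 (forall a b, w (a * b)%g = w a * w b) -> (forall a, grouplike (w a)) ->
 #|gT| = \dim {: H} -> trivial_hopf H.
move=> wi w1 wM wG c; have hg := gmap_hom w1 wM wG; have kg := gmap_ker wi wG.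
exists gT; right; exists (transp (gmap w)).
split; [exact: transp_hom | exact: transp_img|]; rewrite capfv; apply/eqP.
rewrite -dimv_eq0; have := limg_ker_dim (transp (gmap w)) fullv.
rewrite capfv transp_img // dim_dual dim_galg c => E.
apply/eqP; apply: (@addIn (\dim {:H})); rewrite add0n; exact: E.
Qed.
Lemma trivial_hsub H (A: {vspace H}) (hA: hopf_subalg A) :
 trivial_hopf (hsub hA) -> trivial_subalg A.
apply: (@trivial_quotient_hom H (hsub hA) A 0%VS (hproj hA)).
- have [A1 AM AD AS] := hA; split.
 + apply/ahom_inP; split=> // x y xA yA; exact: hprojM.
 + move=> a aA; rewrite -[comul _]/(hcomul hA _) hcomul_def hprojK //.
 + by move=> a aA; rewrite -[counit _]/(hcounit hA _) hcounitE hprojK.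
 move=> a aA; apply: (@hval_inj _ _ _ hA).
 by rewrite -[antipode _]/(hanti hA _) hval_anti !hprojK // (subvP AS) ?memv_img.
- apply/eqP; rewrite eqEsubv subvf; apply/subvP=> u _.
 by rewrite -(hvalK (hA:=hA) u) memv_img ?hvalP.
apply/eqP; rewrite -subv0; apply/subvP=> x; rewrite memv_cap memv_ker memv0 => /andP[xA /eqP x0].
by rewrite -(@hprojK K H A hA x xA) x0 linear0.
Qed.
Lemma upper_step H (Q: hopfType K) (f: 'Hom(H, Q)): hopf_hom f -> limg f = fullv ->
 rcoinv f = lcoinv f -> trivial_subalg (rcoinv f) ->
 upper_semisolvable Q -> upper_semisolvable H.
(* The chain for Q starts with an equality of Hopf algebras, [Q0]; substituting it lets f have the
   required target in the prolonged family. *)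
move=> hf If RL tR [n [Q' [g [Q0 dn st]]]]; subst Q.
pose QQ (i: nat): hopfType K := if i is j.+1 then Q' j else H.
pose gg (i: nat): 'Hom(QQ i, QQ i.+1) :=
 match i return 'Hom(QQ i, QQ i.+1) with 0 => f | j.+1 => g j end.
exists n.+1, QQ, gg.
by split=> // -[|i] // /st.
Qed.
Lemma dim1_upper H: \dim {: H} = 1%N -> upper_semisolvable H.
by move=> d1; exists 0%N, (fun=> H), (fun=> \1%VF). Qed.

Section LowerStep.
Variables (H: hopfType K) (A: {vspace H}) (hA: hopf_subalg A).
Implicit Types U V: {vspace (hsub hA)}.
Local Notation j := (hval hA).
Let jI := @hval_inj K H A hA.
Lemma hval_mem U x: (j x \in j @: U)%VS = (x \in U).
by apply/idP/idP => [/memv_imgP[y yU /jI ->] // | xU]; rewrite memv_img. Qed.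
Lemma hval_hopf U: hopf_subalg U -> hopf_subalg (j @: U)%VS.
move=> [U1 UM UD US]; split.
- by rewrite -(hval1' hA) hval_mem.
- apply/prodvP => _ _ /memv_imgP[x xU ->] /memv_imgP[y yU ->].
 by rewrite -hvalM' hval_mem (subvP UM) ?memv_mul.
- apply/subvP=> _ /memv_imgP[_ /memv_imgP[x xU ->] ->].
 have [_ vD _ _] := hval_hom hA; rewrite vD ?memvf // /tmap.
 rewrite -(tsum_projv (A:=U) (B:=U) (G:=fun u v => j u *t j v)); last bil.
  rewrite /tlift; apply: memv_suml => a _; apply: memv_suml => b _; apply: memvZ.
  by rewrite tensv_mem // memv_img ?memv_proj.
 by rewrite (subvP UD) ?memv_img.
apply/subvP=> _ /memv_imgP[_ /memv_imgP[x xU ->] ->].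
by rewrite -hval_anti hval_mem (subvP US) // memv_img.
Qed.
Lemma hval_normal U V: normal_in U V -> normal_in (j @: U)%VS (j @: V)%VS.
move=> n _ _ /memv_imgP[h hV ->] /memv_imgP[a aU ->]; have [n1 n2] := n h a hV aU.
split.
 rewrite -(hcomul_val (hA:=hA) (G:=fun x y => x * j a * antipode y)); last bil.
 have E: \tsum_(x, y <- hcomul hA h) (j x * j a * antipode (j y)) =
   \dsum_(u, v <- h) j (u * a * antipode v).
  by apply: eqt => x y; rewrite !hvalM' -hval_anti.
 by rewrite E -(tlf (j)) ?hval_mem //; lin.
rewrite -(hcomul_val (hA:=hA) (G:=fun x y => antipode x * j a * y)); last bil.
have E: \tsum_(x, y <- hcomul hA h) (antipode (j x) * j a * j y) =
  \dsum_(u, v <- h) j (antipode u * a * v).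
 by apply: eqt => x y; rewrite !hvalM' -hval_anti.
by rewrite E -(tlf (j)) ?hval_mem //; lin.
Qed.
Lemma hval_prod U V: (j @: (U * V) = (j @: U) * (j @: V))%VS.
apply/eqP; rewrite eqEsubv; apply/andP; split; last first.
 apply/prodvP => _ _ /memv_imgP[x xU ->] /memv_imgP[y yV ->].
 by rewrite -hvalM' memv_img // memv_mul.
apply/subvP=> _ /memv_imgP[z zUV ->].
have: z \in (j @^-1: ((j @: U) * (j @: V)))%VS.
 by apply: subvP zUV; apply/prodvP => x y xU yV; rewrite -memv_preim hvalM' memv_mul ?memv_img.
by rewrite -memv_preim.
Qed.
Lemma hval_aug U: (j @: augmentation U = augmentation (j @: U))%VS.
have [_ _ ve _] := hval_hom hA.
apply/vspaceP=> y; apply/idP/idP.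
 case/memv_imgP=> x; rewrite !memv_cap !memv_ker => /andP[xU x0] ->.
 by rewrite memv_img // ve ?memvf.
rewrite memv_cap memv_ker => /andP[/memv_imgP[x xU ->]]; rewrite ve ?memvf // => x0.
by rewrite hval_mem memv_cap xU memv_ker.
Qed.
Lemma hval_quotient U V: trivial_quotient U V -> trivial_quotient (j @: U)%VS (j @: V)%VS.
suff F C: Defs.quotient_isom U V C -> Defs.quotient_isom (j @: U)%VS (j @: V)%VS C.
 by case=> gT [q|q]; exists gT; [left|right]; apply: F.
case=> f [[/ahom_inP[fM f1] fD fe fS] If kf]; exists (f \o hproj hA)%VF.
have [/ahom_inP[vM v1] vD ve vS] := hval_hom hA.
have cK x: (f \o hproj hA)%VF (j x) = f x by rewrite clE hvalK.
split.
- split.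
 + apply/ahom_inP; split; last by rewrite -(hval1' hA) cK f1.
  by move=> _ _ /memv_imgP[x xU ->] /memv_imgP[y yU ->]; rewrite -hvalM' !cK fM.
 + move=> _ /memv_imgP[x xU ->]; rewrite cK fD // vD ?memvf // /tmap tsT.
  by apply: eqt => a b; rewrite tliftE ?cK //; bil.
 + by move=> _ /memv_imgP[x xU ->]; rewrite cK fe // ve ?memvf.
 by move=> _ /memv_imgP[x xU ->]; rewrite cK fS // -hval_anti cK.
- rewrite -If; apply/vspaceP=> y; apply/memv_imgP/memv_imgP => [[_ /memv_imgP[x xU ->] ->] | [x xU ->]].
  by exists x; rewrite ?cK.
 by exists (j x); rewrite ?memv_img ?cK.
rewrite -kf; apply/vspaceP=> y; apply/idP/memv_imgP.
 rewrite memv_cap memv_ker => /andP[/memv_imgP[x xU ->]]; rewrite cK => fx.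
 by exists x => //; rewrite memv_cap xU memv_ker.
case=> x /memv_capP[xU]; rewrite memv_ker => /eqP fx ->.
by apply/memv_capP; split; [exact: memv_img | rewrite memv_ker cK fx].
Qed.
Lemma lower_step: normal_in A fullv -> trivial_quotient fullv (fullv * augmentation A)%VS ->
 lower_semisolvable (hsub hA) -> lower_semisolvable H.
move=> nA qA [n [F [F0 Fn Fh Fs]]].
have jF: (j @: F 0%N = A)%VS by rewrite F0 hval_img.
pose G (i: nat): {vspace H} := if i is k.+1 then (j @: F k)%VS else fullv.
exists n.+1, G; split=> //.
- by rewrite /G Fn limg_line hval1'.
- case=> [|i] le; last by apply/hval_hopf/Fh.
 by split; rewrite ?memvf ?subvf //; apply/subvP=> t _; apply: tens_mem => *; rewrite memvf.
case=> [|i] le; rewrite /G; first by rewrite jF subvf.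
have [s1 s2 s3] := Fs i le; split; [exact: limgS | exact: hval_normal|].
by rewrite -hval_aug -hval_prod; apply: hval_quotient.
Qed.
End LowerStep.
Lemma trivial_lower H: trivial_hopf H -> lower_semisolvable H.
move=> tH; pose G (i: nat): {vspace H} := if i is 0 then fullv else 1%VS.
exists 1%N, G; split=> //.
- case=> [|[|//]] _.
  by split; rewrite ?memvf ?subvf //; apply/subvP=> t _; apply: tens_mem => *; rewrite memvf.
 split; rewrite ?memv_line ?prod1v //.
  apply/subvP=> _ /memv_imgP[_ /vlineP[c ->] ->].
  by rewrite linearZ /= comul1 memvZ // tensv_mem ?memv_line.
 apply/subvP=> _ /memv_imgP[_ /vlineP[c ->] ->].
 by rewrite linearZ /= antipode1 memvZ ?memv_line.
case=> // _; split; first exact: subvf.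
 move=> h _ _ /vlineP[c ->]; split.
  under eqt => x y do rewrite -scalerAr mulr1 -scalerAl.
  rewrite (tsum_antir (F:=fun z => c *: z)); last lin.
  by rewrite !memvZ ?memv_line.
 under eqt => x y do rewrite -scalerAr mulr1 -scalerAl.
 rewrite (tsum_antil (F:=fun z => c *: z)); last lin.
 by rewrite !memvZ ?memv_line.
have -> : augmentation (1%VS: {vspace H}) = 0%VS.
 apply/eqP; rewrite -subv0; apply/subvP=> _ /memv_capP[/vlineP[c ->]].
 rewrite memv_ker linearZ /= counit1 [_ *: _]mulr1 => /eqP ->.
 by rewrite scale0r memv0.
by rewrite prodv0.
Qed.
End HopfHoms.

(** * Spectral idempotents, cyclically graded algebras, commutative Hopf algebras *)

Section RootsOfUnity.
Variable K: closedFieldType.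
Hypothesis char0: [pchar K] =i pred0.
Lemma geom_sum0 n (w: K): w ^+ n = 1 -> w != 1 -> \sum_(i < n) w ^+ i = 0.
move=> wn w1; have := subrX1 w n; rewrite wn subrr => /esym/eqP.
by rewrite mulf_eq0 subr_eq0 (negPf w1) => /eqP.
Qed.
(* e j is the spectral projection of z for the eigenvalue zeta ^+ j. *)
Lemma cyclic_idempotents (A: falgType K) (z: A) n (zeta: K) :
 n.-primitive_root zeta -> z ^+ n = 1 -> exists e: 'I_n -> A,
 [/\ \sum_j e j = 1, forall j, e j * e j = e j, forall i j, i != j -> e i * e j = 0,
   forall j, z * e j = zeta ^+ j *: e j &
   forall U: {vspace A}, (forall i, z ^+ i \in U) -> forall j, e j \in U].
move=> zP zn; have n0 := prim_order_gt0 zP.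
have nK: n%:R != 0 :> K by rewrite char0_nat // -lt0n.
have z0: zeta != 0.
 apply/eqP=> z00; have /eqP := prim_expr_order zP.
 by rewrite z00 expr0n gtn_eqF // eq_sym oner_eq0.
have zj0 j: zeta ^+ j != 0 by rewrite expf_neq0.
pose w (j: 'I_n): A := (zeta ^+ j)^-1 *: z.
pose e (j: 'I_n): A := n%:R^-1 *: \sum_(i < n) w j ^+ i.
have wn j: w j ^+ n = 1.
 by rewrite exprZn zn exprVn -exprM mulnC exprM (prim_expr_order zP) expr1n invr1 scale1r.
have we j: w j * e j = e j.
 have := subrX1 (w j) n; rewrite wn subrr mulrBl mul1r => /esym/eqP.
 by rewrite subr_eq0 => /eqP E; rewrite /e -scalerAr E.
have ze j: z * e j = zeta ^+ j *: e j.
 by rewrite -[in RHS]we -scalerAl scalerA mulfV // scale1r.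
have zie i j: z ^+ i * e j = (zeta ^+ j) ^+ i *: e j.
 elim: i => [|i IH]; first by rewrite !expr0 mul1r scale1r.
 by rewrite exprSr -mulrA ze -scalerAr IH scalerA -exprS.
have ee k j: e k * e j = (n%:R^-1 * \sum_(i < n) ((zeta ^+ k)^-1 * zeta ^+ j) ^+ i) *: e j.
 rewrite {1}/e -scalerAl mulr_suml -scalerA; congr (_ *: _); rewrite scaler_suml.
 by apply: eq_bigr => i _; rewrite exprZn -scalerAl zie scalerA exprMn.
exists e; split=> [|j|i j ij|//|U zU j].
- trans (n%:R^-1 *: \sum_(i < n) (\sum_(j < n) ((zeta ^+ i)^-1) ^+ j) *: z ^+ i).
  rewrite -scaler_sumr; congr (_ *: _); rewrite exchange_big; apply: eq_bigr => i _ /=.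
  rewrite scaler_suml; apply: eq_bigr => j _; rewrite exprZn; congr (_ *: _).
  by rewrite !exprVn -!exprM mulnC.
 rewrite (bigD1 (Ordinal n0)) //= [X in _ + X]big1 ?addr0 => [|i i0].
  rewrite !expr0 invr1; under eq_bigr => j _ do rewrite expr1n.
  by rewrite sumr_const card_ord scalerA mulVf // scale1r.
 rewrite geom_sum0 ?scale0r //; first by rewrite exprVn -exprM mulnC exprM (prim_expr_order zP) expr1n invr1.
 rewrite invr_eq1 -[1](expr0 zeta) (eq_prim_root_expr zP) mod0n modn_small //.
- rewrite ee mulVf //; under eq_bigr => i _ do rewrite expr1n.
 by rewrite sumr_const card_ord mulVf // scale1r.
- rewrite ee geom_sum0 ?mulr0 ?scale0r //.
  by rewrite exprMn exprVn -!exprM ![(_ * n)%N]mulnC !exprM (prim_expr_order zP) !expr1n invr1 mulr1.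
 rewrite -(inj_eq (mulfI (zj0 i))) mulrA mulfV // mul1r mulr1 (eq_prim_root_expr zP).
 by rewrite !modn_small // eq_sym.
apply: memvZ; apply: memv_suml => i _; rewrite exprZn memvZ //.
Qed.
End RootsOfUnity.

Section GradedCommutativity.
Variables (K: fieldType) (A: falgType K) (tau: 'Hom(A, K^o)) (M: {vspace A}).
Variables (gT: finGroupType) (Mg: gT -> {vspace A}).
Hypothesis MgM: forall g, (Mg g <= M)%VS.
Hypothesis Mdec: forall x, x \in M -> exists2 y: gT -> A, (forall g, y g \in Mg g) & x = \sum_g y g.
Hypothesis MgMul: forall g h x y, x \in Mg g -> y \in Mg h -> x * y \in Mg (g * h)%g.
Hypothesis tau_nondeg: forall x, x \in M -> (forall y, y \in M -> tau (x * y) = 0) -> x = 0.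
Hypothesis tau0: forall g x, g != 1%g -> x \in Mg g -> tau x = 0.

Section OneIdempotent.
Variable e: A.
Hypotheses (ee: e * e = e) (e1: e \in Mg 1%g) (eC: forall x, x \in M -> e * x = x * e).
Hypothesis eM: forall x, x \in Mg 1%g -> exists k: K, e * x = k *: e.
(** A y with tau(x y) nonzero may be taken homogeneous, and its degree is then inverse to g because
    tau lives in degree 1. So x y has degree 1, where e cuts out only the line of e, and it is a
    nonzero multiple of e. *)
Lemma graded_inv g x: x \in Mg g -> e * x = x -> x != 0 ->
 exists w, [/\ w \in Mg g^-1%g, e * w = w, x * w = e & w * x = e].
move=> xg ex x0; have xM := subvP (MgM g) x xg.
have [y [yM ty]]: exists y, y \in M /\ tau (x * y) != 0.
 apply: NNPP => ny; case/eqP: x0; apply: tau_nondeg => // y yM.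
 by apply: NNPP => /eqP t0; apply: ny; exists y.
have [f fg yE] := Mdec yM.
have [h th]: exists h, tau (x * f h) != 0.
 apply: NNPP => nh; case/eqP: ty; rewrite yE mulr_sumr lsE big1 // => h _.
 by apply: NNPP => /eqP t0; apply: nh; exists h.
have hg: h = g^-1%g.
 apply/eqP; rewrite eq_sym eq_invg_mul; apply: contraT => gh1; case/eqP: th.
 exact: tau0 gh1 (MgMul xg (fg h)).
have fM := subvP (MgM h) _ (fg h).
pose w0 := e * f h; have w0g: w0 \in Mg g^-1%g by rewrite -hg -[h]mul1g MgMul.
have ew0: e * w0 = w0 by rewrite mulrA ee.
have xw0: x * w0 = x * f h by rewrite mulrA -eC // ex.
have [k kE]: exists k: K, x * w0 = k *: e.
 have [|k kE] := eM (x:=x * w0); first by rewrite -(mulgV g) MgMul.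
 by exists k; rewrite -kE mulrA ex.
have k0: k != 0 by apply: contraNneq th => k0; rewrite -xw0 kE k0 scale0r linear0.
pose w := k^-1 *: w0; have wg: w \in Mg g^-1%g by rewrite memvZ.
have ew: e * w = w by rewrite -scalerAr ew0.
have xw: x * w = e by rewrite -scalerAr kE scalerA mulVf // scale1r.
have [k' kE']: exists k': K, w * x = k' *: e.
 have [|k' kE'] := eM (x:=w * x); first by rewrite -(mulVg g) MgMul.
 by exists k'; rewrite -kE' mulrA ew.
have w0': w != 0 by apply: contraNneq x0 => w0'; rewrite -ex -xw w0' mulr0 mul0r.
have k1: k' = 1.
 apply/eqP; rewrite -subr_eq0; have := w0'; apply: contraNT => nz.
 have: w * x * w = w by rewrite -mulrA xw -eC ?ew // (subvP (MgM _) _ wg).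
 rewrite kE' -scalerAl ew -{2}[w]scale1r => /eqP; rewrite -subr_eq0 -scalerBl scaler_eq0.
 by rewrite (negPf nz).
by exists w; split=> //; rewrite kE' k1 scale1r.
Qed.
Lemma graded_line g x x': x \in Mg g -> e * x = x -> x != 0 -> x' \in Mg g -> e * x' = x' ->
 exists k: K, x' = k *: x.
move=> xg ex x0 x'g ex'; have [w [wg ew _ wx]] := graded_inv xg ex x0.
have [|k kE] := eM (x:=x' * w); first by rewrite -(mulgV g) MgMul.
have x'e: x' * e = x' by rewrite -eC ?ex' //; apply: subvP x'g.
have xw: x' * w = k *: e by rewrite -kE mulrA ex'.
by exists k; rewrite -[LHS]x'e -wx mulrA xw -scalerAl ex.
Qed.
Definition graded_support: {set gT} := [set g | (amull e @: Mg g)%VS != 0%VS].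
Lemma graded_supportP g: reflect (exists x, [/\ x \in Mg g, e * x = x & x != 0]) (g \in graded_support).
rewrite inE; apply: (iffP idP) => [E | [x [xg ex x0]]].
 have := memv_pick (amull e @: Mg g)%VS; rewrite -vpick0 in E.
 case/memv_imgP=> y yg yE; rewrite amullE in yE; exists (e * y); rewrite -yE E yE mulrA ee.
 by split=> //; rewrite -[g]mul1g MgMul.
apply: contraNneq x0 => E; rewrite -memv0 -E -{1}ex -amullE memv_img //.
Qed.
Lemma graded_support_group: e != 0 -> group_set graded_support.
move=> e0; apply/group_setP; split=> [|g h /graded_supportP[x [xg ex x0]] /graded_supportP[y [yh ey y0]]].
 by apply/graded_supportP; exists e.
apply/graded_supportP; exists (x * y); split; [exact: MgMul | by rewrite mulrA ex|].
have [w [_ _ _ wx]] := graded_inv xg ex x0.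
by apply: contraNneq y0 => xy; rewrite -ey -wx -mulrA xy mulr0.
Qed.
(** The part cut out by e is a twisted group algebra of its support: the components are lines
    spanned by invertible elements. The support is cyclic, so homogeneous elements are multiples of
    powers of a single u, up to the factor e, and commute. *)
Lemma graded_comm1 g h x y: cyclic [set: gT] -> x \in Mg g -> y \in Mg h -> e * x = x -> e * y = y ->
 x * y = y * x.
move=> cG xg yh ex ey; have [->|x0] := eqVneq x 0; first by rewrite mulr0 mul0r.
have [->|y0] := eqVneq y 0; first by rewrite mulr0 mul0r.
have e0: e != 0 by apply: contraNneq x0 => e0; rewrite -ex e0 mul0r.
pose G := Group (graded_support_group e0).
have [d dE]: exists d, gval G = <[d]>%g by apply/cyclicP/(cyclicS (subsetT G) cG).
have [u [ud eu u0]]: exists x, [/\ x \in Mg d, e * x = x & x != 0].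
 by apply/graded_supportP; rewrite -[graded_support]/(gval G) dE cycle_id.
have uM := subvP (MgM d) _ ud.
have ume m: u ^+ m * e \in Mg (d ^+ m)%g /\ u ^+ m * e != 0.
 elim: m => [|m [IH1 IH2]]; first by rewrite expr0 expg0 mul1r.
 rewrite exprS -mulrA expgS; split; first exact: MgMul.
 have [w [_ _ _ wu]] := graded_inv ud eu u0.
 have fx: e * (u ^+ m * e) = u ^+ m * e by rewrite eC ?(subvP (MgM _) _ IH1) // -mulrA ee.
 have wf: w * (u * (u ^+ m * e)) = u ^+ m * e by rewrite mulrA wu fx.
 by apply: contraNneq IH2 => E; rewrite -wf E mulr0.
have fx m: e * (u ^+ m * e) = u ^+ m * e by rewrite eC ?(subvP (MgM _) _ (ume m).1) // -mulrA ee.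
have P g' z: z \in Mg g' -> e * z = z -> z != 0 -> exists m (k: K), z = k *: (u ^+ m * e).
 move=> zg ez z0; have: g' \in gval G by apply/graded_supportP; exists z.
 rewrite dE => /cycleP[m gE]; exists m; apply: (graded_line (g:=g')) => //; rewrite ?gE; case: (ume m) => //.
have [m [k ->]] := P _ _ xg ex x0; have [m' [k' ->]] := P _ _ yh ey y0.
rewrite -!scalerAl -!scalerAr !scalerA [k * k']mulrC; congr (_ *: _).
have eu' i: GRing.comm e (u ^+ i) by apply: commrX; rewrite /GRing.comm eC.
have um a b: (u ^+ a * e) * (u ^+ b * e) = u ^+ (a + b) * e.
 by rewrite -mulrA [e * (_ * _)]mulrA eu' -mulrA ee mulrA -exprD.
by rewrite !um addnC.
Qed.
End OneIdempotent.
Variables (J: finType) (e: J -> A).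
Hypothesis esum: forall x, x \in M -> x = \sum_j e j * x.
Hypotheses (ee: forall j, e j * e j = e j) (e1: forall j, e j \in Mg 1%g).
Hypothesis eC: forall j x, x \in M -> e j * x = x * e j.
Hypothesis eM: forall j x, x \in Mg 1%g -> exists k: K, e j * x = k *: e j.
Lemma graded_comm: cyclic [set: gT] -> forall x y, x \in M -> y \in M -> x * y = y * x.
move=> cG; have hom g h x y: x \in Mg g -> y \in Mg h -> x * y = y * x.
 move=> xg yh; have xM := subvP (MgM g) _ xg; have yM := subvP (MgM h) _ yh.
 have xyM := subvP (MgM _) _ (MgMul xg yh); have yxM := subvP (MgM _) _ (MgMul yh xg).
 rewrite [LHS]esum // [RHS]esum //; apply: eq_bigr => j _.
 have split2 a b: a \in M -> e j * (a * b) = (e j * a) * (e j * b).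
  move=> aM; rewrite -[RHS]mulrA [a * (e j * b)]mulrA -(eC j aM) -!mulrA.
  by rewrite [RHS]mulrA ee.
 rewrite !split2 //; apply: (graded_comm1 (ee j) (e1 j) (eC j) (eM j) (g:=g) (h:=h)) => //.
 - by rewrite -[g]mul1g MgMul.
 - by rewrite -[h]mul1g MgMul.
 - by rewrite mulrA ee.
 by rewrite mulrA ee.
move=> x y xM yM; have [u ug ->] := Mdec xM; have [v vg ->] := Mdec yM.
rewrite !mulr_suml; under eq_bigr => g _ do rewrite mulr_sumr.
under [RHS]eq_bigr => g _ do rewrite mulr_sumr.
rewrite exchange_big; apply: eq_bigr => g _; apply: eq_bigr => h _; exact: hom.
Qed.
End GradedCommutativity.

Section CommutativeHopf.
Variables (K: closedFieldType) (H: hopfType K).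
Hypothesis char0: [pchar K] =i pred0.
Hypothesis S2: involutive H.
Local Notation N := (\dim {:H}).
Lemma atr_nondeg_hopf: @atr_nondeg K H.
move=> x x0; apply: (haar_nondeg char0 S2) => y.
by rewrite haarE x0 mulr0.
Qed.
(** By Schur every element acts on an irreducible module as a scalar, which defines a grouplike of
    the dual. An x on which all of these vanish is orthogonal to H for the trace form, by [ltr_LR],
    hence 0; so they span the dual. *)
Lemma comm_spanned: (forall x y: H, x * y = y * x) ->
 exists (gT: finGroupType) (w: gT -> dual H), [/\ injective w, w 1%g = 1,
  forall a b, w (a * b)%g = w a * w b, forall a, grouplike (w a) & #|gT| = N].
move=> cH; have [||||gT [w [wi w1 wM wP]]] := @grouplike_group K (dual H) (@grouplike K (dual H)).
- exact: grouplike1.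
- by move=> x y xG yG; apply: grouplikeM.
- by move=> x xG; apply: grouplikeS.
- by [].
have wG a: grouplike (w a) by apply/wP; exists a.
exists gT, w; split=> //; rewrite -(dim_gspan wi wG).
have hB: hopf_subalg (gspan w) by apply: gspan_hopf.
have k0: lker (qmap hB) = 0%VS.
 apply/eqP; rewrite -subv0; apply/subvP=> x; rewrite memv_ker memv0 => /eqP x0.
 apply/eqP/atr_nondeg_hopf => y.
 have [J [M [MP E]]] := ltr_LR char0 atr_nondeg_hopf.
 have -> : atr (x * y) = ltr (amull (x * y) \o amulr (1: H))%VF.
  by congr ltr; apply/lfunP=> z; rewrite clE !amullE amulrE mulr1.
 rewrite E big1 // => j _; have [[m1 mM mL] mI] := MP j.
 have sc a: exists c: K, oop (M j) a = c *: \1%VF.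
  apply: (schur_scalar mI) => b u; rewrite -!clE -!mM cH //.
 pose chi: dual H := linfun (fun a: H => ltr (oop (M j) a) / (\dim {: ocar (M j)})%:R: K^o).
 have d0: (\dim {: ocar (M j)})%:R != 0 :> K by rewrite char0_nat // -lt0n; case: mI.
 have cE a: chi a = ltr (oop (M j) a) / (\dim {: ocar (M j)})%:R.
  by rewrite linE // => k b c; rewrite mL linearP /= mulrDl -mulrA.
 have oE a: oop (M j) a = (chi a: K) *: \1%VF.
  by have [c E'] := sc a; rewrite cE E' linearZ /= ltr1 mulfK.
 have cG: grouplike chi.
  apply: grouplikes_dualP => [a b|]; last by rewrite cE m1 ltr1 mulfV.
  by rewrite [LHS]cE mM !oE -clZl -clZr cl1l scalerA linearZ /= ltr1 mulfK.
 have [a aE] := iffLR (wP chi) cG.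
 have cx: chi x = 0.
  have := congr1 (fun f: dual (hsub hB) => f (hproj hB chi)) x0.
  by rewrite qmapE hprojK ?zlE // aE mem_gspan.
 by rewrite mM oE cx scale0r comp_lfun0l linear0 !mul0r.
have := limg_ker_dim (qmap hB) fullv; rewrite capfv k0 dimv0 add0n qmap_img.
by rewrite dim_qmap.
Qed.
Lemma comm_trivial: (forall x y: H, x * y = y * x) -> trivial_hopf H.
by move=> cH; have [gT [w [wi w1 wM wG c]]] := comm_spanned cH; exact: (cospanned_trivial wi w1 wM wG c). Qed.
End CommutativeHopf.

(** * Quotients by central grouplikes *)

Section CentralQuotient.
Variables (K: closedFieldType) (H: hopfType K).
Hypothesis char0: [pchar K] =i pred0.
Hypothesis S2: involutive H.
Local Notation N := (\dim {:H}).
Variables (gT: finGroupType) (v: gT -> H).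
Hypotheses (v_inj: injective v) (v1: v 1%g = 1) (vM: forall a b, v (a * b)%g = v a * v b).
Hypotheses (vG: forall a, grouplike (v a)) (vC: forall a, central (v a)).
Let vh: hopf_subalg (gspan v). exact: gspan_hopf. Qed.
Let vcoid: coid_subalg (gspan v). exact: hopf_subalg_coid. Qed.
Let vad: adstable (gspan v).
move=> h x xv; rewrite -act_ad; have: (act (ydad H) h @: gspan v <= gspan v)%VS.
 by apply: gspan_img => a; rewrite act_ad ad_central // memvZ ?mem_gspan.
by move/subvP; apply; apply: memv_img.
Qed.
Definition central_annih: {vspace dual H} := annih (gspan v).
Lemma central_annih_hopf: hopf_subalg central_annih.
exact: annih_hopf. Qed.
Local Notation hB := central_annih_hopf.
Local Notation pi := (qmap hB).
Local Notation Q := (dual (hsub hB)).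
Lemma dim_central_annih: (\dim central_annih * #|gT|)%N = N.
by rewrite -(dim_gspan v_inj vG) dim_annih. Qed.
Lemma dim_central_quotient: (\dim {: Q} * #|gT|)%N = N.
by rewrite dim_qmap dim_central_annih. Qed.
Lemma central_quotient_involutive: involutive Q.
exact/involutive_dual/hsub_involutive/involutive_dual. Qed.
Lemma annih_v f a: f \in central_annih -> f (v a) = f 1.
by move=> /(annihE _ _) E; rewrite -[v a]mul1r E ?mem_gspan //; case: (vG a) => _ ->; rewrite mul1r.
Qed.
Lemma rcoinv_central: rcoinv pi = gspan v.
apply/esym/eqP; rewrite eqEdim; apply/andP; split.
 apply: gspan_sub => a; rewrite rcoinv_qmap // => f fB.
 by rewrite rt_grouplike // annih_v.
have := dim_rcoinv char0 S2 hB; rewrite -dim_central_annih mulnC => /eqP.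
rewrite eqn_pmul2l ?dim_gspan // => [/eqP -> //|].
have := dim_central_annih; have: (0 < N)%N by rewrite lt0n dimv_eq0 -subv0; apply/negP=> /subvP/(_ 1); rewrite memvf memv0 oner_eq0 => /(_ isT).
by move=> N0 E; move: N0; rewrite -E muln_gt0 => /andP[].
Qed.
Lemma lcoinv_central: lcoinv pi = gspan v.
apply/esym/eqP; rewrite eqEdim; apply/andP; split.
 apply: gspan_sub => a; rewrite lcoinv_qmap // => f fB.
 by rewrite lt_grouplike // annih_v.
have SI: injective (@antipode K H) by move=> x y E; rewrite -[x]S2 E S2.
have <- : \dim (antipode @: lcoinv pi) = \dim (lcoinv pi).
 apply: limg_dim_eq; apply/eqP; rewrite -subv0; apply/subvP=> x.
 by rewrite memv_cap memv_ker memv0 => /andP[_]; rewrite -{1}(linear0 (@antipode K H)) (inj_eq SI).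
rewrite -rcoinv_central dimvS //; apply/subvP=> _ /memv_imgP[x xl ->].
rewrite rcoinv_qmap // => f fB; have [_ _ _ BS] := hB.
have SfB: antipode f \in central_annih by rewrite (subvP BS) ?memv_img.
have := iffLR (lcoinv_qmap hB x) xl _ SfB; rewrite ltE rtE => E.
rewrite tsumS; last bil.
trans (antipode (\dsum_(x1, x2 <- x) ((antipode f: dual H) x1: K) *: x2)).
 rewrite (tlf (@antipode K H)); last lin.
 by apply: eqt => a b; rewrite linearZ dual_SE.
by rewrite E linearZ /= dual_SE antipode1.
Qed.
Lemma central_quotient_RL: rcoinv pi = lcoinv pi.
by rewrite rcoinv_central lcoinv_central. Qed.
Lemma gspan_hsub_trivial (hv: hopf_subalg (gspan v)): trivial_hopf (hsub hv).
pose w a: hsub hv := hproj hv (v a).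
have wv a: hval hv (w a) = v a by rewrite hprojK ?mem_gspan.
have [_ _ ve _] := hval_hom hv.
apply: (@spanned_trivial K (hsub hv) gT w) => [a b E|||a|].
- by apply: v_inj; rewrite -!wv E.
- by apply: (@hval_inj _ _ _ hv); rewrite wv v1 hval1'.
- by move=> a b; apply: (@hval_inj _ _ _ hv); rewrite hvalM' !wv.
- apply: grouplikeP => [f f'|]; last by rewrite -ve ?memvf // wv; case: (vG a).
 rewrite dualM -[comul _]/(hcomul hv _) hcomulE; last bil.
 by rewrite wv tsum_grouplike //; bil.
by rewrite dim_hsub dim_gspan.
Qed.
Lemma gspan_trivial: trivial_subalg (gspan v).
exact: trivial_hsub (gspan_hsub_trivial vh). Qed.
Lemma upper_central: upper_semisolvable (Q: hopfType K) -> upper_semisolvable H.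
apply: (@upper_step K H Q pi); [exact: qmap_hom | exact: qmap_img | exact: central_quotient_RL|].
by rewrite rcoinv_central; apply: gspan_trivial.
Qed.
Lemma lower_central: trivial_hopf (Q: hopfType K) -> lower_semisolvable H.
move=> tQ; have RL := central_quotient_RL.
have R_n: normal_in (rcoinv pi) fullv by apply: R_normal.
have lk: lker pi = (fullv * augmentation (rcoinv pi))%VS by apply: lker_qmap.
rewrite rcoinv_central in R_n lk.
apply: (@lower_step K H (gspan v) vh R_n).
 apply: (@trivial_quotient_hom K H Q fullv _ pi) => //; [exact: qmap_hom | exact: qmap_img|].
 by rewrite capfv lk.
exact/trivial_lower/gspan_hsub_trivial.
Qed.
(* The components of H for a group of grouplikes of the central quotient. *)
Section Graded.
Variables (dT: finGroupType) (w: dT -> (Q: hopfType K)).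
Hypotheses (w_inj: injective w) (w1: w 1%g = 1) (wM: forall a b, w (a * b)%g = w a * w b).
Hypothesis wG: forall a, grouplike (w a).
Definition comp_op (g: dT) (b: hsub hB): 'End(H) :=
 linfun (fun x => rt (hval hB b) x - ((w g: Q) b: K) *: x).
Definition comp (g: dT): {vspace H} :=
 (\bigcap_(i < \dim {: hsub hB}) lker (comp_op g (vbasis fullv)`_i))%VS.
Lemma compP g x: x \in comp g <-> forall b, rt (hval hB b) x = ((w g: Q) b: K) *: x.
have opE b: (x \in lker (comp_op g b)) = (rt (hval hB b) x == ((w g: Q) b: K) *: x).
 rewrite memv_ker linE ?subr_eq0 // => c y z.
 by rewrite linearP scalerDr scalerA mulrC -scalerA scalerBr opprD addrACA.
split=> [xc b|E]; last by rewrite memvE; apply/subv_bigcapP => i _; rewrite -memvE opE E.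
have L1: linear (fun b: hsub hB => rt (hval hB b) x) by lin3.
have L2: linear (fun b: hsub hB => ((w g: Q) b: K) *: x) by lin3.
have: b \in lker (linfun (fun b => rt (hval hB b) x) - linfun (fun b: hsub hB => ((w g: Q) b: K) *: x))%VF.
 apply: (subvP _ b (memvf b)); rewrite -(span_basis (vbasisP fullv)).
 apply/span_subvP => u uB; have [i ib <-] := nthP 0 uB; rewrite size_tuple in ib.
 rewrite memv_ker alE olE subr_eq0 (linE L1) (linE L2) -opE.
 by move: xc; rewrite memvE => /subv_bigcapP/(_ (Ordinal ib) isT); rewrite -memvE.
by rewrite memv_ker alE olE subr_eq0 (linE L1) (linE L2) => /eqP.
Qed.
Lemma comp_mul g h x y: x \in comp g -> y \in comp h -> x * y \in comp (g * h)%g.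
move=> /compP xg /compP yh; apply/compP => b; rewrite wM dualM rt_mul.
rewrite -(hcomul_val (hA:=hB) (G:=fun f1 f2 => rt f1 x * rt f2 y)); last by split=> ?; cbv beta; lin3.
rewrite (tlf (fun c: K^o => (c: K) *: (x * y))); last lin.
by apply: eqt => b1 b2; rewrite xg yh -scalerAl -scalerAr scalerA.
Qed.
Lemma comp_lt g f x: x \in comp g -> lt f x \in comp g.
by move=> /compP xg; apply/compP => b; rewrite -lt_rtC xg linearZ. Qed.
Lemma comp1: comp 1%g = gspan v.
apply/vspaceP => x; rewrite -rcoinv_central; apply/idP/idP.
 move=> /compP E; apply/rcoinv_qmap => // f fB; rewrite -{1}(@hprojK K (dual H) _ hB f fB) E w1 dual1.
 by rewrite -[counit _]/(hcounit hB _) hcounitE hprojK // dual_counitE'.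
move/rcoinv_qmap => E; apply/compP => b; rewrite E ?hvalP // w1 dual1.
by rewrite -[counit _]/(hcounit hB _) hcounitE dual_counitE'.
Qed.
Definition comp_sum: {vspace H} := (\sum_g comp g)%VS.
Lemma comp_sum_coid: coid_subalg comp_sum.
have cs g x: x \in comp g -> x \in comp_sum by apply/subvP/sumv_sup.
split.
- by apply: (cs 1%g); rewrite comp1 -v1 mem_gspan.
- move=> x y /memv_sumP[u uc ->] /memv_sumP[u' uc' ->].
 rewrite mulr_suml; apply: memv_suml => g _; rewrite mulr_sumr; apply: memv_suml => h _.
 by apply: (cs (g * h)%g); rewrite comp_mul ?uc ?uc'.
move=> f x /memv_sumP[u uc ->]; rewrite lsE; apply: memv_suml => g _.
by apply: (cs g); rewrite comp_lt ?uc.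
Qed.
Lemma comp_haar g x: g != 1%g -> x \in comp g -> haar H x = 0.
move=> g1 /compP xg; apply: NNPP => /eqP hx.
case/eqP: g1; apply: w_inj; rewrite w1; apply: dualP => b.
have := congr1 (haar H) (xg b); rewrite dual_rt haar_l // linearZ /= => /eqP.
rewrite mulrC -subr_eq0 -mulrBl mulf_eq0 (negPf hx) orbF subr_eq0 => /eqP <-.
by rewrite dual1 -[counit _]/(hcounit hB _) hcounitE dual_counitE'.
Qed.
(** The b g are dual to the w g. Elements of B on which all w g vanish annihilate x by the
    hypothesis; modulo these, 1 is the sum of the b g, and each c multiplies b g by the scalar w g
    (c). So rt (b g) x is the component of x in degree g. *)
Lemma mem_comp_sum x: (forall f, pi (lt f x) \in gspan w) -> x \in comp_sum.
move=> xw.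
have fw: free [tuple w (enum_val i) | i < #|dT|].
 apply: grouplikes_free => [|_ /mapP[i _ ->] //].
 by rewrite map_inj_uniq ?enum_uniq // => i j /w_inj/enum_val_inj.
have nw (j: 'I_#|dT|): [tuple w (enum_val i) | i < #|dT|]`_j = w (enum_val j).
 by rewrite -tnth_nth tnth_mktuple.
have [b bE]: exists b: dT -> hsub hB, forall h g, (w g: Q) (b h) = (g == h)%:R.
 apply: (fin_all_exists (P:=fun h b => forall g, (w g: Q) b = (g == h)%:R)) => h.
 pose cf (y: Q): K^o := coord [tuple w (enum_val i) | i < #|dT|] (enum_rank h) y.
 have cl: linear cf by move=> r y y'; rewrite /cf linearP.
 have [b bE] := dual_eval (H:=hsub hB) (linfun cf).
 exists b => g; rewrite -bE (linE cl) /cf -{1}(enum_rankK g) -nw coord_free //.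
 by rewrite (inj_eq enum_rank_inj).
have kill (c: hsub hB): (forall g, (w g: Q) c = 0) -> rt (hval hB c) x = 0.
 move=> c0; apply: vect_sep => f; rewrite linear0 dual_rt -dual_lt -qmapE.
 have L: linear (fun y: Q => y c: K^o) by lin.
 rewrite -[LHS](linE L); trans ((0: 'Hom(Q, K^o)) (pi (lt f x))); last by rewrite zlE.
 by apply: gspan_eq (xw f) => g; rewrite (linE L) zlE c0.
have -> : x = \sum_g rt (hval hB (b g)) x.
 have: rt (hval hB (1 - \sum_g b g)) x = 0.
  apply: kill => g; rewrite linearB /= lsE (bigD1 g) //= bE eqxx big1 => [|h hg].
   by rewrite addr0 (grouplike_dual1 (wG g)) subrr.
  by rewrite bE eq_sym (negPf hg).
 have L: linear (fun c: hsub hB => rt (hval hB c) x) by lin3.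
 rewrite -(linE L) linearB /= lsE (linE L) hval1' rt1 => /eqP.
 rewrite subr_eq0 => /eqP E; rewrite [LHS]E; apply: eq_bigr => g _ /=.
 by rewrite (linE L).
apply: memv_sumr => g _; apply/compP => c; rewrite -rtM -hvalM'.
have L: linear (fun c: hsub hB => rt (hval hB c) x) by lin3.
have E: linfun (fun c: hsub hB => rt (hval hB c) x) (c * b g - ((w g: Q) c: K) *: b g) = 0.
 rewrite (linE L) kill // => h; rewrite linearB linearZ /= (grouplike_dualM _ _ (wG h)) !bE.
 have [->|hg] := eqVneq h g; first by rewrite mulr1 [_ *: _]mulr1 subrr.
 by rewrite mulr0 scaler0 subr0.
by move/eqP: E; rewrite linearB linearZ /= subr_eq0 !(linE L) => /eqP.
Qed.
(** [graded_comm] for the Haar functional and the spectral idempotents of the central generator v c.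
    Its hypothesis on degree 1 holds because that component is the span of the v a, powers of v c,
    which act on each idempotent as scalars. *)
Lemma comp_sum_comm (c: gT): [set: gT] = <[c]>%g -> cyclic [set: dT] ->
 forall x y, x \in comp_sum -> y \in comp_sum -> x * y = y * x.
move=> gE cD; pose n := #|gT|; have n0: (0 < n)%N by apply/card_gt0P; exists 1%g.
have zn: v c ^+ n = 1 by rewrite -(vX v1 vM) /n -cardsT expg_cardG ?inE.
have [zeta zP] := prim_root_exists char0 n0.
have [e [es ee _ ze eU]] := cyclic_idempotents char0 zP zn.
have eg j: e j \in gspan v by apply: eU => i; rewrite -(vX v1 vM) mem_gspan.
have eC j x: e j * x = x * e j.
 have: e j \in lker (amulr x - amull x)%VF.
  apply: eU => i; rewrite memv_ker alE olE amullE amulrE subr_eq0.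
  by rewrite -(vX v1 vM) vC.
 by rewrite memv_ker alE olE amullE amulrE subr_eq0 => /eqP.
apply: (@graded_comm K H (haar H) comp_sum dT comp _ _ _ _ _ 'I_n e _ _ _ _ _ cD) => //.
- by move=> g; apply: sumv_sup.
- by move=> x /memv_sumP[y yc ->]; exists y => // g; apply: yc.
- by move=> g h x y; apply: comp_mul.
- by move=> x xc x0; apply: (haar_coid_nondeg char0 S2 comp_sum_coid).
- by move=> g x; apply: comp_haar.
- by move=> x _; rewrite -mulr_suml es mul1r.
- by move=> j; rewrite comp1.
move=> j x; rewrite comp1 => xv; have: (amull (e j) @: gspan v <= <[e j]>)%VS.
 apply: gspan_img => a; rewrite amullE; have: a \in <[c]>%g by rewrite -gE inE.
 case/cycleP=> m ->; rewrite (vX v1 vM); elim: m => [|m IH]; first by rewrite expr0 mulr1 memv_line.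
 rewrite exprSr mulrA (vC c (e j * v c ^+ m)); move/vlineP: IH => [k ->].
 by rewrite -scalerAr ze scalerA memvZ // memv_line.
by move/subvP/(_ _ (memv_img _ xv)); rewrite amullE => /vlineP.
Qed.
End Graded.
End CentralQuotient.

(** * Dimensions q, q^2, p q and p q^2 *)

Section SmallDimensions.
Variable K: closedFieldType.
Hypothesis char0: [pchar K] =i pred0.
Implicit Type H: hopfType K.
Definition central_group H (gT: finGroupType) (v: gT -> H) :=
 [/\ injective v, v 1%g = 1, forall a b, v (a * b)%g = v a * v b,
   forall a, grouplike (v a) & forall a, central (v a)].
Lemma central_cyclic H (z: H) r: prime r -> grouplike z -> central z -> z ^+ r = 1 -> z != 1 ->
 exists (gT: finGroupType) (v: gT -> H) (c: gT),
 [/\ central_group v, #|gT| = r, [set: gT] = <[c]>%g & v c = z].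
move=> r_pr zG zc zr z1; have [gT [v [c [vi v1 vM vc [vP gE]]]]] := cyclic_group zG.
exists gT, v, c; split=> //; last exact: cyclic_group_prime r_pr vi v1 vM vc gE zr z1.
split=> // a; have [n ->] := vP a; first exact: grouplikeX.
by elim: n => [|n IH] h; rewrite ?expr0 ?mulr1 ?mul1r // exprS mulrA zc -mulrA IH !mulrA.
Qed.
Lemma central_Cauchy H (gT: finGroupType) (v: gT -> H) r: central_group v -> prime r ->
 (r %| #|gT|)%N -> exists z: H, [/\ grouplike z, central z, z ^+ r = 1 & z != 1].
move=> [vi v1 vM vG vC] r_pr; rewrite -cardsT => /(Cauchy r_pr)[c _ oc].
exists (v c); split=> //; first by rewrite -(vX v1 vM) -oc expg_order.
by rewrite -v1 (inj_eq vi) -order_eq1 oc; case: (r) r_pr => [|[]].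
Qed.
Lemma central_prime H (z: H): involutive H -> grouplike z -> central z -> z != 1 ->
 exists r (z': H), [/\ prime r, (r %| \dim {: H})%N, grouplike z' & central z'] /\ z' ^+ r = 1 /\ z' != 1.
move=> S2 zG zc z1; have [gT [v [c [vi v1 vM vc [vP gE]]]]] := cyclic_group zG.
have vG a: grouplike (v a) by have [n ->] := vP a; apply: grouplikeX.
have g1: (1 < #|gT|)%N.
 rewrite -cardsT ltnNge; apply/negP=> /card_le1_eqP E; case/eqP: z1.
 by rewrite -vc -v1; congr v; apply: E; rewrite inE.
have cv: central_group v.
 split=> // a; have [n ->] := vP a.
 by elim: n => [|n IH] h; rewrite ?expr0 ?mulr1 ?mul1r // exprS mulrA zc -mulrA IH !mulrA.
have [z' [z'G z'c z'r z'1]] := central_Cauchy cv (pdiv_prime g1) (pdiv_dvd _).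
exists (pdiv #|gT|), z'; split=> //; split=> //; first exact: pdiv_prime.
apply: dvdn_trans (pdiv_dvd _) _; rewrite -(dim_gspan vi vG).
by apply: coid_dim_dvd_full => //; apply/hopf_subalg_coid/gspan_hopf.
Qed.
(** The case a = 0 of [small_coideal_subalgebra], with q passed for both primes: since p^0 = 1, the
    small constituents are the lines of the central grouplikes, and q divides their number. *)
Lemma central_prime_power H q t: involutive H -> prime q -> \dim {: H} = (q ^ t.+1)%N ->
 exists (gT: finGroupType) (v: gT -> H),
 [/\ central_group v, (q %| #|gT|)%N & (#|gT| %| \dim {: H})%N].
move=> S2 q_pr NE; have [|U [gT [v [[_ _ qU UN _] [vi v1 vM vP _] _ a0 _]]]] :=
 small_coideal_subalgebra char0 S2 (a:=0) q_pr q_pr _ (etrans NE (esym (mul1n _))).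
 by rewrite expn0 exp1n prime_gt1.
exists gT, v; rewrite -a0 //; split=> //; split=> // a; by case: (vP a).
Qed.
Lemma dim_prime H q: involutive H -> prime q -> \dim {: H} = q ->
 exists (gT: finGroupType) (v: gT -> H), central_group v /\ #|gT| = q.
move=> S2 q_pr NE; have [gT [v [cv qg gN]]] := central_prime_power (t:=0) S2 q_pr (etrans NE (esym (expn1 q))).
by exists gT, v; split=> //; apply/eqP; rewrite eqn_dvd qg andbT -[X in (_ %| X)%N]NE.
Qed.
Lemma dim_prime_trivial H q: involutive H -> prime q -> \dim {: H} = q -> trivial_hopf H.
move=> S2 q_pr NE; have [gT [v [[vi v1 vM vG _] c]]] := dim_prime S2 q_pr NE.
by apply: (spanned_trivial vi v1 vM vG); rewrite NE.
Qed.
(** The quotient by the central group has prime dimension, so it is spanned by a group of prime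
    order. Every element of H then lies in [comp_sum], which is commutative. *)
Lemma central_ext_comm H r q (z: H): involutive H -> prime r -> prime q ->
 \dim {: H} = (r * q)%N -> grouplike z -> central z -> z ^+ r = 1 -> z != 1 ->
 forall x y: H, x * y = y * x.
move=> S2 r_pr q_pr NE zG zc zr z1.
have [gT [v [c [[vi v1 vM vG vC] gc gE _]]]] := central_cyclic r_pr zG zc zr z1.
pose Q: hopfType K := dual (hsub (central_annih_hopf S2 v1 vM vG vC)).
have dQ: \dim {: Q} = q.
 apply/eqP; rewrite -(eqn_pmul2r (prime_gt0 r_pr)) -{1}gc; apply/eqP.
 by rewrite dim_central_quotient // NE mulnC.
have S2Q: involutive Q by apply: central_quotient_involutive.
have [dT [w [[wi w1 wM wG _] dc]]] := dim_prime S2Q q_pr dQ.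
have full: gspan w = fullv.
 by apply/eqP; rewrite eqEdim subvf /= (dim_gspan wi wG) dc; exact: (eq_leq dQ).
move=> x y.
have cD: cyclic [set: dT] by rewrite prime_cyclic // cardsT dc.
by apply: (comp_sum_comm char0 vi wi w1 wM gE cD); apply: mem_comp_sum => // f; rewrite full memvf.
Qed.
Lemma dim_prime2_comm H q: involutive H -> prime q -> \dim {: H} = (q ^ 2)%N ->
 forall x y: H, x * y = y * x.
move=> S2 q_pr NE; have [gT0 [v0 [cv0 q0g _]]] := central_prime_power (t:=1) S2 q_pr NE.
have [z [zG zc zq z1]] := central_Cauchy cv0 q_pr q0g.
exact: (central_ext_comm S2 q_pr q_pr NE zG zc zq z1).
Qed.
Lemma dim_prime2_trivial H q: involutive H -> prime q -> \dim {: H} = (q ^ 2)%N -> trivial_hopf H.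
by move=> S2 q_pr NE; apply: comm_trivial => //; apply: dim_prime2_comm NE. Qed.
Lemma upper_quotient H r n: involutive H -> prime r -> \dim {: H} = (r * n)%N ->
 (exists z: H, [/\ grouplike z, central z, z ^+ r = 1 & z != 1]) ->
 (forall Q: hopfType K, involutive Q -> \dim {: Q} = n -> upper_semisolvable Q) ->
 upper_semisolvable H.
move=> S2 r_pr NE [z [zG zc zr z1]] IH.
have [gT [v [c [[vi v1 vM vG vC] gc _ _]]]] := central_cyclic r_pr zG zc zr z1.
apply: (@upper_central K H char0 S2 gT v vi v1 vM vG vC); apply: IH.
 exact: central_quotient_involutive.
apply/eqP; rewrite -(eqn_pmul2r (prime_gt0 r_pr)) -{1}gc; apply/eqP.
by rewrite dim_central_quotient // NE mulnC.
Qed.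
Lemma lower_quotient H r n: involutive H -> prime r -> \dim {: H} = (r * n)%N ->
 (exists z: H, [/\ grouplike z, central z, z ^+ r = 1 & z != 1]) ->
 (forall Q: hopfType K, involutive Q -> \dim {: Q} = n -> trivial_hopf Q) ->
 lower_semisolvable H.
move=> S2 r_pr NE [z [zG zc zr z1]] IH.
have [gT [v [c [[vi v1 vM vG vC] gc _ _]]]] := central_cyclic r_pr zG zc zr z1.
apply: (@lower_central K H char0 S2 gT v vi v1 vM vG vC); apply: IH.
 exact: central_quotient_involutive.
apply/eqP; rewrite -(eqn_pmul2r (prime_gt0 r_pr)) -{1}gc; apply/eqP.
by rewrite dim_central_quotient // NE mulnC.
Qed.
Lemma prime_upper H q: involutive H -> prime q -> \dim {: H} = q -> upper_semisolvable H.
move=> S2 q_pr NE; have [gT [v [cv c]]] := dim_prime S2 q_pr NE.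
have [|z zP] := central_Cauchy cv q_pr; first by rewrite c.
apply: (@upper_quotient H q 1) => //; [by rewrite muln1 | by exists z|].
by move=> Q _; apply: dim1_upper.
Qed.
Lemma prime2_upper H q: involutive H -> prime q -> \dim {: H} = (q ^ 2)%N -> upper_semisolvable H.
move=> S2 q_pr NE; have [gT [v [cv qg _]]] := central_prime_power (t:=1) S2 q_pr NE.
have [z zP] := central_Cauchy cv q_pr qg.
apply: (@upper_quotient H q q) => //; [by exists z|].
by move=> Q S2Q; apply: prime_upper.
Qed.

Section CentralDual.
Variables (H: hopfType K) (r n: nat) (eta: dual H).
Hypotheses (S2: involutive H) (r_pr: prime r) (NE: \dim {: H} = (r * n)%N).
Hypotheses (eG: grouplike eta) (ec: central eta) (er: eta ^+ r = 1) (e1: eta != 1).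
(** The powers of eta span a central Hopf subalgebra of the dual. Centrality makes left and right
    translation by it agree, so the corresponding quotient map is normal, and its coinvariants have
    dimension n. *)
Lemma central_dual: exists (B: {vspace dual H}) (hB: hopf_subalg B),
 [/\ rcoinv (qmap hB) = lcoinv (qmap hB), \dim {: dual (hsub hB)} = r,
   \dim (rcoinv (qmap hB)) = n & forall x, rt eta x = x -> x \in rcoinv (qmap hB)].
have [gT [v [c [[vi v1 vM vG vC] gc gE vc]]]] := central_cyclic r_pr eG ec er e1.
have hB: hopf_subalg (gspan v) by apply: gspan_hopf.
exists (gspan v), hB; split.
- apply/vspaceP=> x; have fE f: f \in gspan v -> rt f x = lt f x.
  move=> fB; apply: vect_sep => g; rewrite dual_rt dual_lt.
  have L1: linear (fun f: dual H => (g: dual H) * f) by lin.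
  have L2: linear (fun f: dual H => f * (g: dual H)) by lin.
  congr (fun_of_lfun _ x); rewrite -(linE L1) -(linE L2).
  by apply: gspan_eq fB => a; rewrite (linE L1) (linE L2) vC.
 apply/idP/idP => [/rcoinv_qmap|/lcoinv_qmap] E; [apply/lcoinv_qmap | apply/rcoinv_qmap] => // f fB.
  by rewrite -fE // E.
 by rewrite fE // E.
- by rewrite dim_qmap dim_gspan.
- apply/eqP; rewrite -(eqn_pmul2r (prime_gt0 r_pr)) -{1}gc -{1}(dim_gspan vi vG).
 by rewrite dim_rcoinv // NE mulnC.
move=> x tx; apply/rcoinv_qmap => // f fB; apply: rt_gspan (f) fB => // a.
have: a \in <[c]>%g by rewrite -gE inE.
case/cycleP=> i ->; rewrite (vX v1 vM) vc; elim: i => [|i IH]; first by rewrite expr0 rt1.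
by rewrite exprS rtM IH.
Qed.
Lemma upper_dual: (forall R: hopfType K, involutive R -> \dim {: R} = n -> trivial_hopf R) ->
 upper_semisolvable H.
move=> IH; have [B [hB [RL dQ dR _]]] := central_dual.
have hR: hopf_subalg (rcoinv (qmap hB)) by apply: R_hopf.
apply: (@upper_step K H (dual (hsub hB)) (qmap hB)) => //; [exact: qmap_hom | exact: qmap_img| |].
 apply: (trivial_hsub (hA:=hR)); apply: IH; first exact: hsub_involutive.
 by rewrite dim_hsub.
apply: (prime_upper _ r_pr) => //.
exact/involutive_dual/hsub_involutive/involutive_dual.
Qed.
Lemma lower_dual: (forall R: hopfType K, involutive R -> \dim {: R} = n -> lower_semisolvable R) ->
 lower_semisolvable H.
move=> IH; have [B [hB [RL dQ dR _]]] := central_dual.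
have hR: hopf_subalg (rcoinv (qmap hB)) by apply: R_hopf.
have R_n: normal_in (rcoinv (qmap hB)) fullv by apply: R_normal.
have lk: lker (qmap hB) = (fullv * augmentation (rcoinv (qmap hB)))%VS by apply: lker_qmap.
apply: (@lower_step K H _ hR R_n); last first.
 by apply: IH; [exact: hsub_involutive | rewrite dim_hsub].
apply: (@trivial_quotient_hom K H (dual (hsub hB)) fullv _ (qmap hB)) => //.
- exact: qmap_hom.
- exact: qmap_img.
- by rewrite capfv lk.
apply: (dim_prime_trivial _ r_pr) => //.
exact/involutive_dual/hsub_involutive/involutive_dual.
Qed.
End CentralDual.
Lemma double_dual_grouplike H (zeta: dual (dual H)): grouplike zeta ->
 exists z: H, grouplike z /\ forall f, zeta f = f z.
move=> zG; have [z zE] := dual_eval zeta; exists z; split=> //.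
apply: grouplikeP => [f f'|]; first by rewrite -!zE grouplike_dualM.
by rewrite -dual1 -zE grouplike_dual1.
Qed.
Lemma double_dual_central H (zeta: dual (dual H)) n: grouplike zeta -> central zeta ->
 zeta ^+ n = 1 -> zeta != 1 ->
 exists z: H, [/\ grouplike z, central z, z ^+ n = 1 & z != 1].
move=> zG zc zn z1; have [z [z'G zE]] := double_dual_grouplike zG; exists z; split=> //.
- move=> h; apply: vect_sep => f.
 pose evh: dual (dual H) := linfun (fun f: dual H => f h: K^o).
 have evE (g: dual H): evh g = g h by rewrite linE //; lin.
 have := congr1 (fun F: dual (dual H) => F (f: dual H)) (zc evh); rewrite !dualM.
 under eqt => a b do rewrite evE zE.
 under [X in _ = X -> _]eqt => a b do rewrite evE zE.
 by rewrite !dcE.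
- apply: vect_sep => f; have := congr1 (fun F: dual (dual H) => F (f: dual H)) zn.
 have -> m: (zeta ^+ m) f = (f: dual H) (z ^+ m).
  elim: m f => [|m IH] f; first by rewrite !expr0 dual1 dual_counitE'.
  rewrite !exprS dualM -dcE; apply: eqt => a b.
  by rewrite zE IH.
 by rewrite dual1 dual_counitE'.
apply: contraNneq z1 => z1; apply/eqP/dualP => f.
by rewrite zE z1 dual1 dual_counitE'.
Qed.
Lemma prime_dvd_pq p q r t: prime p -> prime q -> prime r -> (r %| p * q ^ t)%N -> r = p \/ r = q.
move=> p_pr q_pr r_pr; rewrite Euclid_dvdM // Euclid_dvdX // !dvdn_prime2 //.
by case/orP=> [/eqP|/andP[/eqP]]; [left | right].
Qed.
(** Each outcome of [central_alternative] splits off one prime: a central grouplike of H gives a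
    quotient, one of the dual a normal Hopf subalgebra. For the upper chain it is applied to H, for
    the lower chain to the dual. The bound on t leaves only the dimensions p, q, q^2 and p q, where
    the factor is trivial or the induction applies. *)
Lemma pq_semisolvable H p q t: involutive H -> prime p -> prime q -> (p ^ 2 < q)%N -> (t <= 1)%N ->
 \dim {: H} = (p * q ^ t.+1)%N -> upper_semisolvable H /\ lower_semisolvable H.
move=> + p_pr q_pr pq; elim: t H => [|t IH] H S2 t1 NE.
all: have S2d := involutive_dual S2; have NEd := etrans (dim_dual H) NE.
- rewrite expn1 in NE NEd; have NE' := etrans NE (mulnC _ _).
 have U (Q: hopfType K) r: prime r -> involutive Q -> \dim {: Q} = r -> upper_semisolvable Q.
  by move=> r_pr S2Q; apply: prime_upper.
 have T (Q: hopfType K) r: prime r -> involutive Q -> \dim {: Q} = r -> trivial_hopf Q.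
  by move=> r_pr S2Q; apply: dim_prime_trivial.
 split.
  have [[z [zG zc z1]]|[eta [eG ec e1 ep]]] := central_alternative (t:=0) char0 S2 p_pr q_pr pq (etrans NE (congr1 _ (esym (expn1 q)))).
   have [r [z' [[r_pr rN z'G z'c] [z'r z'1]]]] := central_prime S2 zG zc z1.
   have [rE|rE]: r = p \/ r = q by apply: (@prime_dvd_pq p q r 1) => //; rewrite expn1 -NE.
    by apply: (upper_quotient S2 r_pr (n:=q)); [rewrite rE | exists z' | move=> Q; apply: U].
   by apply: (upper_quotient S2 r_pr (n:=p)); [rewrite rE | exists z' | move=> Q; apply: U].
  by apply: (upper_dual S2 p_pr NE eG ec ep e1) => Q; apply: T.
 have [[z [zG zc z1]]|[eta [eG ec e1 ep]]] := central_alternative (t:=0) char0 S2d p_pr q_pr pq (etrans NEd (congr1 _ (esym (expn1 q)))).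
  have [r [z' [[r_pr rN z'G z'c] [z'r z'1]]]] := central_prime S2d zG zc z1.
  rewrite NEd in rN; have [rE|rE]: r = p \/ r = q by apply: (@prime_dvd_pq p q r 1) => //; rewrite expn1.
   apply: (lower_dual (n:=q) S2 r_pr _ z'G z'c z'r z'1); first by rewrite rE.
   by move=> Q S2Q dQ; apply/trivial_lower/(T Q q).
  apply: (lower_dual (n:=p) S2 r_pr _ z'G z'c z'r z'1); first by rewrite rE.
  by move=> Q S2Q dQ; apply/trivial_lower/(T Q p).
 have zP := double_dual_central eG ec ep e1.
 by apply: (lower_quotient S2 p_pr NE zP) => Q; apply: T.
have t0: t = 0%N by case: (t) t1.
rewrite t0 in NE NEd IH; have NE': \dim {: H} = (q * (p * q ^ 1))%N by rewrite NE expn1 -mulnn mulnCA.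
split.
 have [[z [zG zc z1]]|[eta [eG ec e1 ep]]] := central_alternative char0 S2 p_pr q_pr pq NE.
  have [r [z' [[r_pr rN z'G z'c] [z'r z'1]]]] := central_prime S2 zG zc z1.
  rewrite NE in rN; have [rE|rE] := prime_dvd_pq p_pr q_pr r_pr rN.
   apply: (upper_quotient S2 r_pr (n:=(q ^ 2)%N)); [by rewrite rE | by exists z'|].
   by move=> Q S2Q; apply: prime2_upper.
  apply: (upper_quotient S2 r_pr (n:=(p * q ^ 1)%N)); [by rewrite rE | by exists z'|].
  by move=> Q S2Q dQ; have [] := IH Q S2Q isT dQ.
 by apply: (upper_dual S2 p_pr NE eG ec ep e1) => Q S2Q; apply: dim_prime2_trivial.
have [[z [zG zc z1]]|[eta [eG ec e1 ep]]] := central_alternative char0 S2d p_pr q_pr pq NEd.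
 have [r [z' [[r_pr rN z'G z'c] [z'r z'1]]]] := central_prime S2d zG zc z1.
 rewrite NEd in rN; have [rE|rE] := prime_dvd_pq p_pr q_pr r_pr rN.
  apply: (lower_dual (n:=(q ^ 2)%N) S2 r_pr _ z'G z'c z'r z'1); first by rewrite rE.
  by move=> Q S2Q dQ; apply/trivial_lower/(dim_prime2_trivial S2Q q_pr dQ).
 apply: (lower_dual (n:=(p * q ^ 1)%N) S2 r_pr _ z'G z'c z'r z'1); first by rewrite rE.
 by move=> Q S2Q dQ; have [] := IH Q S2Q isT dQ.
have zP := double_dual_central eG ec ep e1.
by apply: (lower_quotient S2 p_pr NE zP) => Q S2Q; apply: dim_prime2_trivial.
Qed.
End SmallDimensions.

(** * Construction of a one-dimensional representation *)

Section PrimitiveIdempotents.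
Variables (K: closedFieldType) (A: falgType K) (M: {vspace A}).
Hypothesis MM: forall x y, x \in M -> y \in M -> x * y \in M.
Hypothesis Mc: forall x y, x \in M -> y \in M -> x * y = y * x.
Hypothesis Mred: forall x, x \in M -> x * x = 0 -> x = 0.
Lemma reduced_exp x n: x \in M -> x != 0 -> x ^+ n != 0.
move=> xM x0; have P k: x ^+ (2 ^ k) \in M /\ x ^+ (2 ^ k) != 0.
 elim: k => [|k [IH1 IH2]]; first by rewrite expn0 expr1.
 rewrite expnS mulnC exprM expr2; split; first exact: MM.
 by apply: contraNneq IH2 => /(Mred IH1) ->.
have [_] := P n; apply: contraNneq => xn.
by rewrite -(subnKC (ltnW (ltn_expl n (isT: 1 < 2)%N))) exprD xn mul0r.
Qed.
(** If e M is not the line of e, some y0 in it is not a multiple of e but has an eigenvector w in e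
    M, which gives y = y0 - c e, nonzero with y w = 0. As M is reduced, y M contains a nonzero
    idempotent e'; it kills w, so e - e' is nonzero too, and the induction applies to both. *)
Lemma primitive_idempotents e: e \in M -> e * e = e -> e != 0 ->
 exists (J: finType) (f: J -> A), [/\ forall j, [/\ f j \in M, f j * f j = f j & f j != 0],
  forall j x, x \in M -> exists k: K, f j * x = k *: f j,
  forall i j, i != j -> f i * f j = 0 & \sum_j f j = e].
have [n] := ubnP (\dim (amull e @: M)%VS); elim: n e => // n IH e dn eM ee e0.
case: (classic (forall x, x \in M -> exists k: K, e * x = k *: e)) => [triv | ntriv].
 exists unit, (fun=> e); split=> [_|_ x xM|[] []|] //; first exact: triv.
 by rewrite (big_pred1 tt) // => -[].
have [x [xM xk]]: exists x, x \in M /\ forall k: K, e * x != k *: e.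
 apply: NNPP => nx; apply: ntriv => x xM; apply: NNPP => nk; apply: nx; exists x; split=> // k.
 by apply/eqP=> E; apply: nk; exists k.
pose V := (amull e @: M)%VS; have VP y: y \in V -> y \in M /\ e * y = y.
 by case/memv_imgP=> u uM ->; rewrite amullE mulrA ee MM.
have VI y: y \in M -> e * y = y -> y \in V by move=> yM <-; rewrite -amullE memv_img.
pose y0 := e * x; have y0M: y0 \in M by rewrite MM.
have ey0: e * y0 = y0 by rewrite mulrA ee.
have [c [w [wV w0 wc]]]: exists (c: K) w, [/\ w \in V, w != 0 & y0 * w = c *: w].
 have dV: (0 < \dim {: subvs_of V})%N.
  by rewrite dimvf /dim /= lt0n dimv_eq0; apply: contraNneq e0 => V0; rewrite -memv0 -V0 VI.
 have L: linear (fun u: subvs_of V => vsproj V (y0 * vsval u)) by move=> a u u'; rewrite linearP mulrDr -scalerAr linearP.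
 have [c [u [u0 uc]]] := lfun_eigen (linfun (fun u: subvs_of V => vsproj V (y0 * vsval u))) dV.
 exists c, (vsval u); split; [exact: subvsP | by rewrite -(inj_eq (@subvs_inj _ _ V)) linear0 in u0|].
 have [uM eu] := VP _ (subvsP u).
 rewrite (linE L) in uc; have := congr1 vsval uc; rewrite vsprojK ?linearZ //.
 by rewrite VI ?MM // mulrA ey0.
have [wM ew] := VP _ wV.
pose y := y0 - c *: e; have yM: y \in M by rewrite rpredB ?rpredZ.
have ey: e * y = y by rewrite mulrBr ey0 -scalerAr ee.
have y00: y != 0 by rewrite subr_eq0.
have yw: y * w = 0 by rewrite mulrBl wc -scalerAl ew subrr.
have [e' [e'I e'0 e'e']]: exists e', [/\ e' \in (amull y @: M)%VS, e' != 0 & e' * e' = e'].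
 apply: (@idempotent_of_nonnil K A (amull y @: M)%VS _ (y * y)) => [a b /memv_imgP[u uM ->] /memv_imgP[u' u'M ->]||m].
 - by rewrite !amullE -mulrA -amullE memv_img // !MM.
 - by rewrite -amullE memv_img.
 by rewrite -expr2 -exprM reduced_exp.
have [a aM e'E] := memv_imgP e'I; rewrite amullE in e'E.
have e'M: e' \in M by rewrite e'E MM.
have ee': e * e' = e' by rewrite e'E mulrA ey.
have e'w: e' * w = 0 by rewrite e'E (Mc yM aM) -mulrA yw mulr0.
pose e2 := e - e'; have e2M: e2 \in M by rewrite rpredB.
have e'e: e' * e = e' by rewrite Mc.
have e2e': e2 * e' = 0 by rewrite mulrBl ee' e'e' subrr.
have e'e2: e' * e2 = 0 by rewrite mulrBr e'e e'e' subrr.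
have e22: e2 * e2 = e2 by rewrite {2}/e2 mulrBr e2e' subr0 mulrBl ee e'e.
have ee2: e * e2 = e2 by rewrite mulrBr ee ee'.
have e20: e2 != 0.
 rewrite subr_eq0; apply: contraNneq w0 => E; by rewrite -ew E e'w.
have sub g: g \in M -> e * g = g -> (amull g @: M <= V)%VS.
 by move=> gM eg; apply/subvP=> _ /memv_imgP[u uM ->]; rewrite amullE VI ?MM // mulrA eg.
have lt g h: g \in M -> e * g = g -> h \in V -> g * g = g -> g * h = 0 -> h != 0 -> (\dim (amull g @: M) < n)%N.
 move=> gM eg hV gg gh h0; apply: (@leq_trans (\dim V)); last by rewrite -ltnS.
 rewrite ltn_neqAle dimvS ?sub // andbT.
 apply/eqP=> dE; have /eqP E: (amull g @: M)%VS == V by rewrite eqEdim sub //= dE leqnn.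
 case/eqP: h0; have := hV; rewrite -E => /memv_imgP[u _ hE]; rewrite amullE in hE.
 by rewrite -gh hE mulrA gg.
have [J1 [f1 [f1P f1k f1o f1s]]] := IH e' (lt _ _ e'M ee' wV e'e' e'w w0) e'M e'e' e'0.
have [J2 [f2 [f2P f2k f2o f2s]]] := IH e2 (lt _ _ e2M ee2 (VI _ e'M ee') e22 e2e' e'0) e2M e22 e20.
have f1e j: f1 j * e' = f1 j.
 have [_ fj _] := f1P j; rewrite -f1s mulr_sumr (bigD1 j) //= fj big1 ?addr0 // => i ij.
 by rewrite f1o // eq_sym.
have f2e j: e2 * f2 j = f2 j.
 have [_ fj _] := f2P j; rewrite -f2s mulr_suml (bigD1 j) //= fj big1 ?addr0 // => i ij.
 by rewrite f2o.
have o12 i j: f1 i * f2 j = 0 by rewrite -f1e -f2e -mulrA (mulrA e') e'e2 mul0r mulr0.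
have o21 i j: f2 i * f1 j = 0.
 by have [m1 _ _] := f1P j; have [m2 _ _] := f2P i; rewrite Mc.
exists (J1 + J2)%type, (fun j => match j with inl i => f1 i | inr i => f2 i end).
split=> [[j|j]|[j|j] z zM|[i|i] [j|j] ij|]; [exact: f1P | exact: f2P | exact: f1k | exact: f2k
 | exact: f1o | exact: o12 | exact: o21 | exact: f2o|].
by rewrite big_sumType /= f1s f2s addrC subrK.
Qed.
End PrimitiveIdempotents.
Lemma ltr_sqr0 (K: fieldType) (V: vectType K) (E: 'End(V)): (E \o E = 0)%VF -> ltr E = 0.
move=> EE; have PE: (projv (lker E) \o E)%VF = E.
 apply/lfunP=> x; rewrite clE projv_id // memv_ker.
 by have /lfunP/(_ x) := EE; rewrite clE zlE => ->.
have EP: (E \o projv (lker E))%VF = 0.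
 apply/lfunP=> x; rewrite clE zlE; apply/eqP.
 by rewrite -memv_ker memv_proj.
by rewrite -PE ltrC EP linear0.
Qed.

Section OneDimensionalRepresentation.
Variables (K: closedFieldType) (H: hopfType K).
Hypothesis char0: [pchar K] =i pred0.
Hypothesis S2: involutive H.
Local Notation N := (\dim {:H}).
(** Left multiplication by x is nilpotent and has trace 0. As [haar] is nondegenerate on coideal
    subalgebras, the commutative ones are therefore reduced ([fixed_reduced]). *)
Lemma haar_sqr0 x: x * x = 0 -> haar H x = 0.
move=> xx; have := ltr_amull_haar char0 x; rewrite ltr_sqr0 => [/esym/eqP|]; last first.
 by apply/lfunP=> y; rewrite clE !amullE mulrA xx mul0r zlE.
by rewrite mulf_eq0 (negPf (dim_neq0 H char0)) => /eqP.
Qed.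
(** Right multiplication by e projects U onto the line of e, so its trace on U is 1. *)
Lemma primitive_haar U e: coid_subalg U -> e \in U -> e * e = e -> e != 0 ->
 (forall x, x \in U -> exists k: K, x * e = k *: e) -> (\dim U)%:R * haar H e = 1.
move=> cU eU ee e0 ek; have [_ UM lU] := cU.
rewrite -(rtr_coid char0 S2 cU lU) // rtr_idem //.
- have -> : (amulr e @: U)%VS = <[e]>%VS.
  apply/eqP; rewrite eqEsubv -memvE; apply/andP; split.
   by apply/subvP=> _ /memv_imgP[x xU ->]; rewrite amulrE; apply/vlineP/ek.
  by rewrite -{1}ee -amulrE memv_img.
 by rewrite dim_vline e0.
- by move=> x xU; rewrite amulrE UM.
by move=> x xU; rewrite !amulrE -mulrA ee.
Qed.
Variables (n: nat) (zeta: K) (theta: dual H).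
Hypotheses (r_pr: prime n.+2) (zP: n.+2.-primitive_root zeta).
Hypotheses (tG: grouplike theta) (tr: theta ^+ n.+2 = 1).
Definition fixed_subalg: {vspace H} := lker (rt theta - \1)%VF.
Local Notation M := fixed_subalg.
Lemma fixedP x: (x \in M) = (rt theta x == x).
by rewrite memv_ker alE olE ilE subr_eq0. Qed.
Hypothesis Mc: forall x y, x \in M -> y \in M -> x * y = y * x.
Hypothesis dM: (\dim M * n.+2)%N = N.
Lemma fixed_coid: coid_subalg M.
split=> [|x y|f x]; rewrite !fixedP.
- by rewrite rt_grouplike ?grouplike_dual1 ?scale1r //; apply: grouplike1.
- by rewrite rt_grouplikeM // => /eqP -> /eqP ->.
by rewrite -lt_rtC => /eqP ->.
Qed.
Lemma fixed_reduced x: x \in M -> x * x = 0 -> x = 0.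
move=> xM xx; apply: (haar_coid_nondeg char0 S2 fixed_coid) => // y yM.
by apply: haar_sqr0; rewrite mulrA -(mulrA x) -(Mc xM yM) !mulrA xx !mul0r.
Qed.
Lemma eigen_split x: exists y: 'I_n.+2 -> H, [/\ x = \sum_g y g,
 forall g, rt theta (y g) = zeta ^+ g *: y g &
 forall E: 'End(H), (forall u, E (rt theta u) = rt theta (E u)) -> E x = 0 -> forall g, E (y g) = 0].
have [e [es _ _ te eU]] := cyclic_idempotents char0 zP tr.
exists (fun g => rt (e g) x); split=> [|g|E Et Ex g].
- have L: linear (fun f: dual H => rt f x) by lin3.
 rewrite -[LHS]rt1 -es -[LHS](linE L) lsE.
 by apply: eq_bigr => g _; rewrite /= (linE L).
- by rewrite -rtM te linearZ slE.
have L: linear (fun f: dual H => E (rt f x)) by lin3.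
suff: e g \in lker (linfun (fun f: dual H => E (rt f x))) by rewrite memv_ker (linE L) => /eqP.
apply: eU => i; rewrite memv_ker (linE L); apply/eqP.
elim: i => [|i IH]; first by rewrite expr0 rt1.
by rewrite exprS rtM Et IH linear0.
Qed.
Variables (f: H) (m: nat).
Hypotheses (fM: f \in M) (ff: f * f = f) (f0: f != 0) (fC: central f).
Hypotheses (fm: (\dim M)%:R * haar H f = m%:R) (rm: ~~ (n.+2 %| m)%N).
(* e S e has dimension 1 for all primitive idempotents e of M below f only if these fall into
  classes of n.+2 elements. *)
Lemma split_idempotent: exists e, [/\ e \in M, e * e = e, e * f = e,
 forall x, x \in M -> exists k: K, e * x = k *: e &
 exists x, forall k: K, e * x * e != k *: e].
have MM x y: x \in M -> y \in M -> x * y \in M by case: fixed_coid => _ + _; apply.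
have [J [e [eP ek eo es]]] := primitive_idempotents MM Mc fixed_reduced fM ff f0.
have eM j: e j \in M by case: (eP j).
have ee j: e j * e j = e j by case: (eP j).
have e0 j: e j != 0 by case: (eP j).
have ef j: e j * f = e j.
 by rewrite -es mulr_sumr (bigD1 j) //= ee big1 ?addr0 // => i ij; rewrite eo // eq_sym.
have eh j: (\dim M)%:R * haar H (e j) = 1.
 apply: primitive_haar => //; first exact: fixed_coid.
 by move=> x xM; rewrite Mc //; apply: ek.
have cardJ: #|J| = m.
 apply: (char0_natr_inj char0); rewrite -fm -es lsE mulr_sumr.
 by under eq_bigr => j _ do rewrite /= eh; rewrite sumr_const.
apply: NNPP => nx.
(* Assume that e_j H e_j is the line of e_j for all j. Then a nonzero element of e_i H e_j is
   invertible between e_i and e_j, these spaces have dimension at most 1, and their being nonzero is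
   an equivalence relation. The class of i has dim e_i H = N haar(e_i) = n.+2 elements, so n.+2
   divides the number m of idempotents. *)
have one j x: exists k: K, e j * x * e j = k *: e j.
 apply: NNPP => nk; apply: nx; exists (e j); split=> //; first exact: ek.
 by exists x => k; apply/eqP=> E; apply: nk; exists k.
have inv i j x: e i * x * e j = x -> x != 0 -> exists y, [/\ e j * y * e i = y, x * y = e i & y * x = e j].
 move=> ex x0; have eix: e i * x = x by rewrite -ex !mulrA ee.
 have xej: x * e j = x by rewrite -ex -!mulrA ee.
 have [y hy]: exists y, haar H (x * y) != 0.
  apply: NNPP => ny; case/eqP: x0; apply: (haar_nondeg char0 S2) => y.
  by apply: NNPP => /eqP t0; apply: ny; exists y.
 pose y1 := e j * y * e i; have xy1: x * y1 = x * y * e i by rewrite /y1 !mulrA xej.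
 have [k kE] := one i (x * y); have xyk: x * y1 = k *: e i by rewrite -kE xy1 !mulrA eix.
 have k0: k != 0.
  apply: contraNneq hy => k0; have := congr1 (haar H) xyk.
  by rewrite k0 scale0r linear0 xy1 haarC mulrA eix => ->.
 pose y2 := k^-1 *: y1; have y2e: e j * y2 * e i = y2.
  by rewrite /y2 -scalerAr -scalerAl; congr (_ *: _); rewrite /y1 !mulrA ee -!mulrA ee.
 have xy2: x * y2 = e i by rewrite -scalerAr xyk scalerA mulVf // scale1r.
 have [k' k'E] := one j (y2 * x).
 have y2x: y2 * x = k' *: e j by rewrite -k'E -y2e !mulrA ee -!mulrA xej.
 have y20: y2 != 0 by apply: contraNneq (e0 i) => E; rewrite -xy2 E mulr0.
 exists y2; split=> //; rewrite y2x.
 have y2ei: y2 * e i = y2.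
  by have := congr1 (fun u => u * e i) y2e; rewrite /= -mulrA ee y2e => <-.
 have ejy2: e j * y2 = y2.
  by have := congr1 (fun u => e j * u) y2e; rewrite /= !mulrA ee y2e => <-.
 have: y2 * x * y2 = y2 by rewrite -mulrA xy2 y2ei.
 rewrite y2x -scalerAl ejy2 -{2}[y2]scale1r => /eqP.
 rewrite -subr_eq0 -scalerBl scaler_eq0 (negPf y20) orbF subr_eq0 => /eqP ->.
 by rewrite scale1r.
pose E i j := (amull (e i) \o amulr (e j))%VF.
have EE i j x: E i j x = e i * x * e j by rewrite clE amullE amulrE mulrA.
pose R := [rel i j | E i j != 0].
have RP i j: reflect (exists x, e i * x * e j = x /\ x != 0) (R i j).
 apply: (iffP idP) => [Eij | [x [ex x0]]]; last first.
  by apply: contraNneq x0 => E0; rewrite -ex -EE E0 zlE.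
 have [x x0]: exists x, E i j x != 0.
  apply: NNPP => nE; case/eqP: Eij; apply/lfunP=> x; rewrite zlE.
  by apply: NNPP => /eqP xE; apply: nE; exists x.
 by exists (E i j x); rewrite EE !mulrA ee -!mulrA ee !mulrA -EE.
have Rrefl i: R i i by apply/RP; exists (e i); rewrite !ee.
have Rsym i j: R i j -> R j i.
 move/RP=> [x [ex x0]]; have [y [ey xy _]] := inv i j x ex x0; apply/RP; exists y; split=> //.
 by apply: contraNneq (e0 i) => y0; rewrite -xy y0 mulr0.
have Rtrans i j k: R i j -> R j k -> R i k.
 move=> /RP[x [ex x0]] /RP[y [ey y0]]; apply/RP; exists (x * y).
 have eix: e i * x = x by rewrite -ex !mulrA ee.
 have yek: y * e k = y by rewrite -ey -!mulrA ee.
 have ejy: e j * y = y by rewrite -ey !mulrA ee.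
 split; first by rewrite mulrA eix -mulrA yek.
 have [w [_ _ wx]] := inv i j x ex x0.
 by apply: contraNneq y0 => xy; rewrite -ejy -wx -mulrA xy mulr0.
have tE i j: ltr (E i j) = (R i j)%:R.
 have idE: (E i j \o E i j)%VF = E i j.
  by apply/lfunP=> x; rewrite clE !EE !mulrA ee -!mulrA ee.
 rewrite ltr_idem //; case: (boolP (R i j)) => [/RP[x [ex x0]] | ]; last first.
  rewrite negbK => /eqP E0; suff -> : limg (E i j) = 0%VS by rewrite dimv0.
  apply/eqP; rewrite -subv0; apply/subvP=> _ /memv_imgP[u _ ->].
  by rewrite E0 zlE mem0v.
 have [w [we _ wx]] := inv i j x ex x0.
 have -> : limg (E i j) = <[x]>%VS.
  apply/eqP; rewrite eqEsubv -memvE; apply/andP; split; last first.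
   by rewrite -ex -EE memv_img ?memvf.
  apply/subvP=> _ /memv_imgP[s _ ->]; rewrite EE -wx mulrA.
  have eix: e i * x = x by rewrite -ex !mulrA ee.
  have [k kE] := one i (s * w); apply/vlineP; exists k.
  by rewrite -[in RHS]eix scalerAl -kE -!mulrA eix.
 by rewrite dim_vline x0.
have row i: #|[set j | R i j]| = n.+2.
 apply: (char0_natr_inj char0); rewrite -sum1_card natr_sum big_mkcond /=.
 trans (\sum_j ltr (E i j)).
  by apply: eq_bigr => j _; rewrite tE inE /=; case: (E i j != 0).
 have -> : \sum_j ltr (E i j) = ltr (amull (e i)).
  rewrite -lsE; congr ltr; apply/lfunP=> x; rewrite smE amullE.
  by under eq_bigr => j _ do rewrite EE; rewrite -mulr_sumr es -mulrA fC mulrA ef.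
 rewrite ltr_amull_haar // -dM natrM mulrAC eh mul1r.
 by [].
have eqR: {in [set: J] & &, equivalence_rel R}.
 move=> i j k _ _ _; split; first exact: Rrefl.
 by move=> ij; apply/idP/idP; [apply: Rtrans; apply: Rsym | apply: Rtrans].
case/negP: rm; rewrite -cardJ -cardsT (@card_uniform_partition _ n.+2 (equivalence_partition R setT)).
- by rewrite dvdn_mull.
- by move=> B /imsetP[i _ ->]; rewrite -(row i); apply: eq_card => j; rewrite !inE.
exact: equivalence_partitionP.
Qed.
(** T = e H e is graded by the eigenvalues of [rt theta], and its neutral component is the line of
    e. As T is larger, its support, a subgroup of a group of prime order, is everything. T is
    commutative by [graded_comm1]'s argument, and invertible elements in all degrees force e H = e H
    e. A primitive idempotent d of T thus satisfies d x = om(x) d for all x in H, and om is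
    multiplicative. *)
Lemma one_dim_rep: exists2 om: dual H, grouplike om & om f = 1.
have [e [eM ee ef ek [x0 x0k]]] := split_idempotent.
have e0: e != 0 by apply: contraNneq (x0k 0) => ->; rewrite mulr0 scaler0.
pose T := limg (amull e \o amulr e)%VF.
have TP x: (x \in T) = (e * x * e == x).
 apply/memv_imgP/eqP => [[u _ ->] | ex]; first by rewrite clE amullE amulrE !mulrA ee -!mulrA ee.
 by exists x; rewrite ?memvf // clE amullE amulrE mulrA ex.
have Te x: x \in T -> e * x = x /\ x * e = x.
 by rewrite TP => /eqP ex; split; rewrite -{1}ex; [rewrite !mulrA ee ex | rewrite -!mulrA ee mulrA ex].
have te: rt theta e = e by apply/eqP; rewrite -fixedP.
have eT: e \in T by rewrite TP !ee.
have TM x y: x \in T -> y \in T -> x * y \in T.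
 move=> /Te[ex xe] /Te[ey ye]; rewrite TP mulrA ex -mulrA ye; exact: eqxx.
(* ['I_n.+2] serves as the cyclic group of integers modulo n + 2, its addition written as group
   multiplication; this explains the form n.+2 of the order of theta. *)
pose Sg (g: 'I_n.+2): {vspace H} := (lker (rt theta - zeta ^+ g *: \1)%VF :&: T)%VS.
have SgP g x: (x \in Sg g) = (rt theta x == zeta ^+ g *: x) && (x \in T).
 by rewrite memv_cap memv_ker alE olE slE ilE subr_eq0.
have rtm (g h: 'I_n.+2) x y: rt theta x = zeta ^+ g *: x -> rt theta y = zeta ^+ h *: y ->
  rt theta (x * y) = zeta ^+ (g * h)%g *: (x * y).
 move=> gx hy; rewrite rt_grouplikeM // gx hy -scalerAl -scalerAr scalerA -exprD.
 by congr (_ *: _); rewrite -(prim_expr_mod zP).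
have SgM g: (Sg g <= T)%VS by apply: capvSr.
have Sdec x: x \in T -> exists2 y: 'I_n.+2 -> H, (forall g, y g \in Sg g) & x = \sum_g y g.
 move=> xT; have [y [xE yt yE]] := eigen_split x; exists y => // g; rewrite SgP yt eqxx TP /=.
 have: (amull e \o amulr e - \1)%VF (y g) = 0.
  apply: yE => [u|]; rewrite !(alE, olE, ilE, clE, amullE, amulrE).
   by rewrite linearB /= !rt_grouplikeM // te.
  by move: xT; rewrite TP mulrA => /eqP ->; rewrite subrr.
 move/eqP; rewrite alE olE ilE clE amullE amulrE mulrA.
 by rewrite subr_eq0.
have SMul g h x y: x \in Sg g -> y \in Sg h -> x * y \in Sg (g * h)%g.
 by rewrite !SgP => /andP[/eqP gx xT] /andP[/eqP hy yT]; rewrite TM // andbT (rtm g h).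
have nd x: x \in T -> (forall y, y \in T -> haar H (x * y) = 0) -> x = 0.
 move=> xT x1; apply: (haar_nondeg char0 S2) => y; have [ex xe] := Te x xT.
 rewrite -ex -mulrA haarC -mulrA -{1}xe -!mulrA x1 // TP.
 by rewrite !mulrA ee -!mulrA ee eqxx.
have t0 g x: g != 1%g -> x \in Sg g -> haar H x = 0.
 rewrite SgP => g1 /andP[/eqP gx _]; have := congr1 (haar H) gx.
 rewrite dual_rt haar_l // grouplike_dual1 // mulr1 linearZ /= => /eqP.
 rewrite -{1}[haar H x]mul1r -subr_eq0 -mulrBl mulf_eq0 => /orP[|/eqP //].
 rewrite subr_eq0 -[1](expr0 zeta) (eq_prim_root_expr zP) mod0n modn_small // => /eqP g0.
 by case/eqP: g1; apply/val_inj.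
have e1: e \in Sg 1%g by rewrite SgP te eT expr0 scale1r eqxx.
have eC x: x \in T -> e * x = x * e by case/Te=> -> ->.
have ek1 x: x \in Sg 1%g -> exists k: K, e * x = k *: e.
 by rewrite SgP expr0 scale1r => /andP[tx _]; apply: ek; rewrite fixedP.
have cyc: cyclic [set: 'I_n.+2] by rewrite prime_cyclic // cardsT card_ord.
have supP := graded_supportP (Mg:=Sg) SMul ee e1.
pose G := Group (graded_support_group SgM Sdec SMul nd t0 ee e1 eC ek1 e0).
have Gfull: gval G = setT.
 have x0T: e * x0 * e \in T by rewrite TP !mulrA ee -!mulrA ee.
 have [g g1 gG]: exists2 g, g != 1%g & g \in gval G.
  apply: NNPP => ng; have [y yS yE] := Sdec _ x0T.
  have y0 g: g != 1%g -> y g = 0.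
   move=> g1; apply: NNPP => /eqP y0; apply: ng; exists g => //; apply/supP; exists (y g).
   by have := subvP (SgM g) _ (yS g) => /Te[]; split.
  have [k kE] := ek1 _ (yS 1%g); have := x0k k.
  rewrite yE (bigD1 1%g) //= big1 ?addr0 => [|g /y0 //].
  by rewrite -kE; have /Te[-> _] := subvP (SgM 1%g) _ (yS 1%g); rewrite eqxx.
 apply/eqP; rewrite eqEcard subsetT /=; have := cardSg (subsetT G).
 rewrite [X in (_ %| X)%N -> _]cardsT card_ord => /(primeP r_pr).2/orP[/eqP c1|/eqP ->].
  by move/eqP: c1; rewrite -trivg_card1 => /eqP GE; move: gG; rewrite GE inE (negPf g1).
 by rewrite cardsT card_ord.
(* Let y be a homogeneous part of s = e x - e x e and u an invertible element of T of the opposite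
   degree. Then u y is fixed by theta, hence commutes with e, so u y = e u y = u y e = 0 and y =
   0. *)
have eS x: e * x = e * x * e.
 pose s := e * x - e * x * e; suff: s = 0 by move/eqP; rewrite subr_eq0 => /eqP.
 have es: e * s = s by rewrite mulrBr !mulrA ee.
 have se: s * e = 0 by rewrite mulrBl -!mulrA ee subrr.
 have [y [sE yt yE]] := eigen_split s; rewrite sE big1 // => g _.
 have ey: e * y g = y g.
  have: (amull e - \1)%VF (y g) = 0.
   apply: yE => [u|]; rewrite !(alE, olE, ilE, amullE).
    by rewrite linearB /= rt_grouplikeM // te.
   by rewrite es subrr.
  by rewrite alE olE ilE amullE => /eqP; rewrite subr_eq0 => /eqP.
 have ye: y g * e = 0.
  rewrite -amulrE; apply: yE => [u|]; rewrite !amulrE //.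
  by rewrite rt_grouplikeM // te.
 have: (g^-1)%g \in gval G by rewrite Gfull inE.
 case/supP=> u [ug eu u0].
 have [w [_ _ _ wu]] := graded_inv SgM Sdec SMul nd t0 ee e1 eC ek1 ug eu u0.
 have uyM: u * y g \in M.
  move: ug; rewrite SgP => /andP[/eqP ut _].
  by rewrite fixedP (rtm _ _ _ _ ut (yt g)) mulVg expr0 scale1r.
 have uy0: u * y g = 0 by rewrite -eu -mulrA Mc // -mulrA ye mulr0.
 by rewrite -ey -wu -mulrA uy0 mulr0.
have Tc x y: x \in T -> y \in T -> x * y = y * x.
 apply: (@graded_comm K H (haar H) T 'I_n.+2 Sg _ _ _ _ _ 'I_1 (fun=> e) _ _ _ _ _ cyc) => //.
 by move=> u uT; rewrite big_ord1; have [-> _] := Te u uT.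
have Tred x: x \in T -> x * x = 0 -> x = 0.
 move=> xT xx; apply: (nd x) => // y yT; apply: haar_sqr0.
 by rewrite mulrA -(mulrA x) -(Tc x y) // !mulrA xx !mul0r.
have [J [d [dP dk _ ds]]] := primitive_idempotents TM Tc Tred eT ee e0.
have [j _]: exists j: J, True.
 by apply: NNPP => nj; have /eqP[] := e0; rewrite -ds big1 // => j _; case: nj; exists j.
have [dT dd d0] := dP j; have [ed de] := Te _ dT.
have [phi phi1]: exists phi: 'Hom(H, K^o), phi (d j) = 1.
 have [phi p0]: exists phi: 'Hom(H, K^o), phi (d j) != 0.
  apply: NNPP => np; case/eqP: d0; apply: vect_sep => phi; rewrite linear0.
  by apply: NNPP => /eqP p0; apply: np; exists phi.
 by exists ((phi (d j))^-1 *: phi); rewrite slE; apply: mulVf.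
pose om: dual H := (phi \o amull (d j))%VF.
have omE x: om x = phi (d j * x) by rewrite clE amullE.
have dx x: d j * x = (om x: K) *: d j.
 have [|k kE] := dk j (e * x); first by rewrite eS TP !mulrA ee -!mulrA ee.
 by rewrite mulrA de in kE; rewrite omE kE linearZ /= phi1 [k *: 1]mulr1.
exists om; last by rewrite omE -de -mulrA ef de phi1.
apply: grouplikes_dualP => [x y|]; last by rewrite omE mulr1.
by rewrite omE mulrA dx -scalerAl dx scalerA linearZ /= phi1 [_ *: 1]mulr1.
Qed.
End OneDimensionalRepresentation.

(** * Dimension p^2 q: p^2 grouplikes in the dual *)

Section GrouplikesOfDimP2Q.
Variable K: closedFieldType.
Hypothesis char0: [pchar K] =i pred0.
Implicit Types H: hopfType K.
Definition grouplike_family H (gT: finGroupType) (v: gT -> H) :=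
 [/\ injective v, v 1%g = 1, forall a b, v (a * b)%g = v a * v b & forall a, grouplike (v a)].
Lemma hopf_hom_grouplike H (B: hopfType K) (f: 'Hom(H, B)) g: hopf_hom f -> grouplike g -> grouplike (f g).
move=> [_ fD fe _] [gD ge]; split; last by rewrite fe ?memvf.
by rewrite fD ?memvf // gD /tmap tliftE //; bil.
Qed.
Lemma hval_family H (A: {vspace H}) (hA: hopf_subalg A) (gT: finGroupType) (v: gT -> hsub hA) :
 grouplike_family v -> grouplike_family (fun a => hval hA (v a)).
move=> [vi v1 vM vG]; split=> [a b /hval_inj/vi //||a b|a].
- by rewrite v1 hval1'.
- by rewrite vM hvalM'.
exact: hopf_hom_grouplike (hval_hom hA) (vG a).
Qed.
Lemma double_dual_family (H: hopfType K) (gT: finGroupType) (w: gT -> dual (dual H)) :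
 grouplike_family w -> exists v: gT -> H, grouplike_family v.
move=> [wi w1 wM wG].
have [v vP]: exists v: gT -> H, forall a, grouplike (v a) /\ forall f, w a f = f (v a).
 by apply: (fin_all_exists (P:=fun a z => grouplike z /\ forall f, w a f = f z)) => a; apply: double_dual_grouplike.
exists v; split=> [a b E||a b|a]; last by case: (vP a).
- by apply: wi; apply: dualP => f; rewrite !(vP _).2 E.
- by apply: vect_sep => f; rewrite -(vP _).2 w1 dual1 dual_counitE'.
apply: vect_sep => f; rewrite -(vP _).2 wM dualM -dcE; apply: eqt => x y.
by rewrite !(vP _).2.
Qed.
Lemma prime2_grouplikes H p: involutive H -> prime p -> \dim {: H} = (p ^ 2)%N ->
 exists (gT: finGroupType) (v: gT -> H), grouplike_family v /\ #|gT| = (p ^ 2)%N.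
move=> S2 p_pr NE; have S2d := involutive_dual S2; have NEd := etrans (dim_dual H) NE.
have [gT [w [wi w1 wM wG wc]]] := comm_spanned char0 S2d (dim_prime2_comm char0 S2d p_pr NEd).
have [v fv] := double_dual_family (And4 wi w1 wM wG).
by exists gT, v; split; last by rewrite wc NEd.
Qed.
Lemma hvalX H (A: {vspace H}) (hA: hopf_subalg A) x n: hval hA (x ^+ n) = hval hA x ^+ n.
by elim: n => [|n IH]; rewrite ?expr0 ?hval1' // !exprS hvalM' IH. Qed.
(** Both outcomes of the alternative in dimension p q provide the data that [p2q_grouplikes]
    requires of its quotient. In one case w is the central group and theta comes from its
    annihilator; in the other theta is the central grouplike of the dual and w spans the
    coinvariants. *)
Lemma pq_quotient H p q: involutive H -> prime p -> prime q -> (p ^ 2 < q)%N ->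
 \dim {: H} = (p * q)%N ->
 (exists (dT: finGroupType) (w: dT -> H) (theta: dual H) r,
 [/\ grouplike_family w, [/\ prime #|dT|, prime r & (#|dT| * r = p * q)%N], grouplike theta,
   theta ^+ r = 1 /\ theta != 1 & forall x, rt theta x = x -> x \in gspan w]) /\
 exists eta: dual H, [/\ grouplike eta, eta ^+ p = 1 & eta != 1].
move=> S2 p_pr q_pr pq NE.
have [[z [zG zc z1]]|[eta [eG ec e1 ep]]] := central_alternative (t:=0) char0 S2 p_pr q_pr pq (etrans NE (congr1 _ (esym (expn1 q)))).
 have [r0 [z' [[r0_pr r0N z'G z'c] [z'r z'1]]]] := central_prime char0 S2 zG zc z1.
 have [r [r_pr rE]]: exists r, prime r /\ (r0 * r = p * q)%N.
  have [->|->]: r0 = p \/ r0 = q by apply: (@prime_dvd_pq p q r0 1) => //; rewrite expn1 -NE.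
   by exists q.
  by exists p; rewrite mulnC.
 have NE': \dim {: H} = (r0 * r)%N by rewrite NE rE.
 split; last first.
  have cH := central_ext_comm char0 S2 r0_pr r_pr NE' z'G z'c z'r z'1.
  have [gT [w [wi w1 wM wG wc]]] := comm_spanned char0 S2 cH.
  have [|c _ oc] := @Cauchy _ p [set: gT] p_pr; first by rewrite cardsT wc NE dvdn_mulr.
  exists (w c); split=> //; first by rewrite -(vX w1 wM) -oc expg_order w1.
  by rewrite -w1 (inj_eq wi) -order_eq1 oc; case: (p) p_pr => [|[]].
 have [dT [w [c [[wi w1 wM wG wC] wc gE _]]]] := central_cyclic r0_pr z'G z'c z'r z'1.
 pose hB := central_annih_hopf S2 w1 wM wG wC.
 have dB: \dim (central_annih w) = r.
  apply/eqP; rewrite -(eqn_pmul2r (prime_gt0 r0_pr)) -{1}wc; apply/eqP.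
  by rewrite dim_central_annih // NE' mulnC.
 have S2B: involutive (hsub hB) by apply/hsub_involutive/involutive_dual.
 have [gT' [v' [cv' c']]] := dim_prime char0 S2B r_pr (etrans (dim_hsub hB) dB).
 have [|b [bG bc br b1]] := central_Cauchy cv' r_pr; first by rewrite c'.
 have [gT [v [d [[vi v1 vM vG _] gc gE' vd]]]] := central_cyclic r_pr bG bc br b1.
 have [ui u1 uM uG]: grouplike_family (fun a => hval hB (v a)) by apply: hval_family; split.
 exists dT, w, (hval hB b), r; split=> //; first by rewrite wc.
 - exact: hopf_hom_grouplike (hval_hom hB) bG.
 - by rewrite -hvalX br hval1'; split=> //; apply: contraNneq b1 => E; apply/eqP/(@hval_inj _ _ _ hB); rewrite E hval1'.
 move=> x tx; rewrite -(rcoinv_central char0 S2 wi w1 wM wG wC).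
 have BE: central_annih w = gspan (fun a => hval hB (v a)).
  apply/esym/eqP; rewrite eqEdim dim_gspan // gc dB leqnn andbT.
  by apply: gspan_sub => a; apply: hvalP.
 apply/rcoinv_qmap => // f; rewrite BE => fB; apply: rt_gspan (f) fB => // a.
 have: a \in <[d]>%g by rewrite -gE' inE.
 case/cycleP=> i ->; rewrite (vX v1 vM) vd hvalX; elim: i => [|i IH]; first by rewrite expr0 rt1.
 by rewrite exprS rtM IH.
split; last by exists eta.
have [B [hB [RL _ dR Rx]]] := central_dual char0 S2 p_pr NE eG ec ep e1.
have hR: hopf_subalg (rcoinv (qmap hB)) by apply: R_hopf.
have S2R: involutive (hsub hR) by apply: hsub_involutive.
have [dT [w [[wi w1 wM wG _] wc]]] := dim_prime char0 S2R q_pr (etrans (dim_hsub hR) dR).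
have fam: grouplike_family (fun a => hval hR (w a)) by apply: hval_family; split.
exists dT, (fun a => hval hR (w a)), eta, p; split=> //; first by rewrite wc mulnC.
have RE: rcoinv (qmap hB) = gspan (fun a => hval hR (w a)).
 have [ui u1 uM uG] := fam; apply/esym/eqP; rewrite eqEdim dim_gspan // wc dR leqnn andbT.
 by apply: gspan_sub => a; apply: hvalP.
by move=> x /Rx xR; rewrite -RE.
Qed.
Lemma grouplike_family_sylow H (gT: finGroupType) (v: gT -> H) p q: grouplike_family v -> prime p ->
 prime q -> p != q -> (#|gT| %| p ^ 2 * q)%N -> (p ^ 2 %| #|gT|)%N ->
 exists (dT: finGroupType) (w: dT -> H), grouplike_family w /\ #|dT| = (p ^ 2)%N.
move=> [vi v1 vM vG] p_pr q_pr pq gd pd; have [P sylP] := Sylow_exists p [set: gT].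
have cP: #|P| = (p ^ 2)%N.
 rewrite (card_Hall sylP) p_part cardsT; congr (_ ^ _)%N; apply/eqP; rewrite eqn_leq.
 have g0: (0 < #|gT|)%N by apply/card_gt0P; exists 1%g.
 rewrite -pfactor_dvdn // pd andbT.
 have n0: (0 < p ^ 2 * q)%N by rewrite muln_gt0 expn_gt0 !prime_gt0.
 apply: leq_trans (dvdn_leq_log p n0 gd) _.
 by rewrite lognM ?expn_gt0 ?prime_gt0 // pfactorK // logn_prime // (negPf pq) addn0.
have [||||dT [w [wi w1 wM wP]]] := @grouplike_group K H (fun x => exists2 a, a \in P & x = v a).
- by exists 1%g.
- by move=> _ _ [a aP ->] [b bP ->]; exists (a * b)%g; rewrite ?groupM ?vM.
- by move=> _ [a aP ->]; exists (a^-1)%g; rewrite ?groupV // (vS v1 vM vG).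
- by move=> _ [a _ ->].
have [h hP]: exists h: dT -> gT, forall a, h a \in P /\ w a = v (h a).
 apply: (fin_all_exists (P:=fun a b => b \in P /\ w a = v b)) => a.
 by have [b bP bE] := iffRL (wP (w a)) (ex_intro _ a erefl); exists b.
exists dT, w; split; first by split=> // a; rewrite (hP a).2.
have hi: injective h by move=> a b E; apply: wi; rewrite !(hP _).2 E.
rewrite -cP -cardsT -(card_imset _ hi); apply: eq_card => b.
apply/imsetP/idP => [[a _ ->]|bP]; first by case: (hP a).
have [a aE] := iffLR (wP (v b)) (ex_intro2 _ _ b bP erefl).
by exists a; rewrite ?inE //; apply: vi; rewrite -(hP a).2.
Qed.
Lemma pullM H (B: hopfType K) (f: 'Hom(H, B)) (g g': dual B): hopf_hom f ->
 (((g * g'): dual B) \o f)%VF = ((g \o f)%VF: dual H) * (g' \o f)%VF.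
move=> [_ fD _ _]; apply: dualP => x; rewrite clE !dualM fD ?memvf // /tmap tsT.
by apply: eqt => a b; rewrite tliftE ?clE //; bil.
Qed.
Lemma pull1 H (B: hopfType K) (f: 'Hom(H, B)): hopf_hom f -> (((1: dual B) \o f)%VF: dual H) = 1.
by move=> [_ _ fe _]; apply: dualP => x; rewrite clE !dual1 fe ?memvf. Qed.
Lemma pullX H (B: hopfType K) (f: 'Hom(H, B)) (g: dual B) n: hopf_hom f ->
 (((g ^+ n): dual B) \o f)%VF = ((g \o f)%VF: dual H) ^+ n.
by move=> hf; elim: n => [|n IH]; rewrite ?expr0 ?pull1 // !exprS pullM // IH.
Qed.
Lemma pull_grouplike H (B: hopfType K) (f: 'Hom(H, B)) (g: dual B): hopf_hom f -> grouplike g ->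
 grouplike ((g \o f)%VF: dual H).
move=> [/ahom_inP[fM f1] _ _ _] gG; apply: grouplikes_dualP => [x y|].
 by rewrite !clE fM ?memvf // grouplike_dualM.
by rewrite clE f1 grouplike_dual1.
Qed.
Lemma pull_inj H (B: hopfType K) (f: 'Hom(H, B)) (g g': dual B): limg f = fullv ->
 ((g \o f)%VF: dual H) = (g' \o f)%VF -> g = g'.
move=> If E; apply: dualP => y; have: y \in limg f by rewrite If memvf.
by case/memv_imgP=> x _ ->; rewrite -!clE E.
Qed.
Lemma pull_rt H (B: hopfType K) (f: 'Hom(H, B)) (g: dual B) x: hopf_hom f ->
 rt g (f x) = f (rt (g \o f)%VF x).
move=> [_ fD _ _]; rewrite !rtE fD ?memvf // /tmap tsT.
rewrite (tlf (f)); last lin.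
by apply: eqt => a b; rewrite tliftE ?linearZ ?clE //; bil.
Qed.
(** If p does not divide dim U, then dim U = q and the annihilator, of dimension p^2, supplies the
    group. Otherwise there is a central z of order p, and the quotient of dimension p q supplies a
    grouplike [et] of the dual of order p with et(z) = 1, while [one_dim_rep] supplies one whose
    value at z has order p. So p divides both the order and the index of the kernel of evaluation at
    z, and a Sylow subgroup has order p^2. *)
Theorem p2q_grouplikes H p q: involutive H -> prime p -> prime q -> (p ^ 4 < q)%N ->
 \dim {: H} = (p ^ 2 * q)%N ->
 exists (gT: finGroupType) (w: gT -> dual H), grouplike_family w /\ #|gT| = (p ^ 2)%N.
move=> S2 p_pr q_pr pq NE; have p1 := prime_gt1 p_pr; have p0 := prime_gt0 p_pr.
have pltq: (p < q)%N by apply: leq_ltn_trans pq; rewrite -{1}[p]expn1 leq_pexp2l.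
have p2q: (p ^ 2 < q)%N by apply: leq_ltn_trans pq; rewrite leq_pexp2l.
have pneq: p != q by rewrite ltn_eqF.
have [|U [gT0 [v0 [[cU [aU _] qU UN _] [v0i v01 v0M v0P _] U0 _ _]]]] :=
 small_coideal_subalgebra char0 S2 (a:=2) (t:=0) p_pr q_pr _ (etrans NE (congr1 _ (esym (expn1 q)))).
 by rewrite -expnM.
case: (boolP (p %| \dim U)%N) => pU; last first.
 have dU: \dim U = q.
  case/dvdnP: qU => k kE; rewrite kE NE dvdn_pmul2r ?prime_gt0 // in UN.
  case/(dvdn_pfactor _ _ p_pr): UN => [[|j] _ kj]; first by rewrite kE kj mul1n.
  by case/negP: pU; rewrite kE kj expnS -mulnA dvdn_mulr.
 have hB: hopf_subalg (annih U) by apply: annih_hopf.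
 have dB: \dim {: hsub hB} = (p ^ 2)%N.
  rewrite dim_hsub; apply/eqP; rewrite -(eqn_pmul2r (prime_gt0 q_pr)) -{1}dU; apply/eqP.
  by rewrite dim_annih.
 have [|gT [v [fam c]]] := prime2_grouplikes _ p_pr dB; first exact/hsub_involutive/involutive_dual.
 by exists gT, (fun a => hval hB (v a)); split=> //; apply: hval_family.
have pg0: (p %| #|gT0|)%N by move: U0 pU => U0; rewrite /dvdn U0.
have cv0: central_group v0 by split=> // a; case: (v0P a).
have [z [zG zc zp z1]] := central_Cauchy cv0 p_pr pg0.
have [gT [v [c [[vi v1 vM vG vC] gc gE vc]]]] := central_cyclic p_pr zG zc zp z1.
pose hB := central_annih_hopf S2 v1 vM vG vC.
pose Q: hopfType K := dual (hsub hB); pose pi: 'Hom(H, Q) := qmap hB.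
have hpi: hopf_hom pi := qmap_hom hB; have Ipi: limg pi = fullv := qmap_img hB.
have dQ: \dim {: Q} = (p * q)%N.
 apply/eqP; rewrite -(eqn_pmul2r p0) -{1}gc; apply/eqP.
 by rewrite dim_central_quotient // NE -mulnn mulnAC.
have S2Q: involutive Q by apply: central_quotient_involutive.
have piv a: pi (v a) = 1.
 rewrite qmap_R; first by case: (vG a) => _ ->; rewrite scale1r.
 by rewrite rcoinv_central // mem_gspan.
have [[dT [w [thb [r [famw [dT_pr r_pr dr] tbG [tbr tb1] tbw]]]]] [etb [etG etp et1]]] :=
 pq_quotient S2Q p_pr q_pr p2q dQ.
have [wi w1 wM wG] := famw.
pose theta: dual H := (thb \o pi)%VF.
have tG: grouplike theta by apply: pull_grouplike.
have tr: theta ^+ r = 1 by rewrite -pullX // tbr pull1.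
have t1: theta != 1.
 by apply: contraNneq tb1 => E; apply/eqP/(pull_inj Ipi); rewrite pull1.
case: r r_pr dr tbr tr => [|[|n]] // r_pr dr tbr tr.
have [zeta zP] := prim_root_exists char0 (isT: 0 < n.+2)%N.
have Mcs x: x \in fixed_subalg theta -> x \in comp_sum w.
 rewrite fixedP => /eqP xt; apply: mem_comp_sum => // f; apply: tbw.
 by rewrite pull_rt // -/theta -lt_rtC xt.
have cD: cyclic [set: dT] by rewrite prime_cyclic // cardsT.
have Mc x y: x \in fixed_subalg theta -> y \in fixed_subalg theta -> x * y = y * x.
 by move=> /Mcs xM /Mcs yM; apply: (comp_sum_comm char0 vi wi w1 wM gE cD).
have dM: (\dim (fixed_subalg theta) * n.+2)%N = \dim {: H}.
 have [eT [u [d [ui u1 uM ud [uP uD]]]]] := cyclic_group tG.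
 have uG b: grouplike (u b) by have [i ->] := uP b; apply: grouplikeX.
 have hU: hopf_subalg (gspan u) by apply: gspan_hopf.
 have -> : fixed_subalg theta = rcoinv (qmap hU).
  apply/vspaceP=> x; rewrite fixedP; apply/eqP/idP => [tx | /rcoinv_qmap E].
   apply/rcoinv_qmap => // f fB; apply: rt_gspan (f) fB => // b; have [i ->] := uP b.
   by elim: i => [|i IH]; rewrite ?expr0 ?rt1 // exprS rtM IH.
  by rewrite -ud E ?mem_gspan // grouplike_dual1 ?scale1r.
 rewrite -(cyclic_group_prime r_pr ui u1 uM ud uD tr t1) -(dim_gspan ui uG).
 exact: dim_rcoinv.
have [ze zeP] := prim_root_exists char0 p0.
have zp': v c ^+ p = 1 by rewrite vc.
have [e [es ee _ vce eU]] := cyclic_idempotents char0 zeP zp'.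
(* The index 1 selects the eigenvalue [ze] of z itself, a primitive p-th root of unity: a
   representation with value 1 at f has value [ze] at z. *)
pose k1: 'I_p := Ordinal p1; pose f := e k1.
have eg j: e j \in gspan v by apply: eU => i; rewrite -(vX v1 vM) mem_gspan.
have vX' a: exists i, v a = v c ^+ i.
 have: a \in <[c]>%g by rewrite -gE inE.
 by case/cycleP=> i ->; exists i; rewrite (vX v1 vM).
have vce' i j: v c ^+ i * e j = (ze ^+ j) ^+ i *: e j.
 elim: i => [|i IH]; first by rewrite !expr0 mul1r scale1r.
 by rewrite exprSr -mulrA vce -scalerAr IH scalerA -exprS.
have f0: f != 0.
 apply/eqP=> f0; have: (gspan v <= \sum_(j | j != k1) <[e j]>)%VS.
  apply: gspan_sub => a; have [i ->] := vX' a.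
  rewrite -[_ ^+ i]mulr1 -es mulr_sumr (bigD1 k1) //= vce' -/f f0 scaler0 add0r.
  by apply: memv_sumr => j _; rewrite vce' memvZ // memv_line.
 move/dimvS; rewrite dim_gspan // gc leqNgt; case/negP.
 apply: leq_ltn_trans (dimv_leq_sum _ _ _) _.
 apply: leq_ltn_trans (_: (\sum_(j: 'I_p | j != k1) 1 < p)%N).
  by apply: leq_sum => j _; rewrite dim_vline; case: (_ != 0).
 by rewrite sum1_card cardC1 card_ord prednK.
have fgv: f \in gspan v by apply: eg.
have vfix a: v a \in fixed_subalg theta.
 by rewrite fixedP rt_grouplike // clE piv grouplike_dual1 ?scale1r.
have fM: f \in fixed_subalg theta by apply: subvP fgv; apply: gspan_sub.
have gspan_comm x y: x \in gspan v -> x * y = y * x.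
 move=> xv; have: x \in lker (amulr y - amull y)%VF.
  by apply: subvP xv; apply: gspan_sub => a; rewrite memv_ker alE olE amullE amulrE vC subrr.
 by rewrite memv_ker alE olE amullE amulrE subr_eq0 => /eqP.
have fC: central f by move=> h; rewrite (gspan_comm f).
have fh: p%:R * haar H f = 1.
 rewrite -{1}gc -(dim_gspan vi vG); apply: (primitive_haar char0 S2) => //.
 - exact/hopf_subalg_coid/gspan_hopf.
 - exact: ee.
 move=> x xv; have: (amulr f @: gspan v <= <[f]>)%VS.
  by apply: gspan_img => a; rewrite amulrE; have [i ->] := vX' a; rewrite vce' memvZ // memv_line.
 by move/subvP/(_ _ (memv_img _ xv)); rewrite amulrE => /vlineP.
have dMp: \dim (fixed_subalg theta) = (#|dT| * p)%N.
 apply/eqP; rewrite -(eqn_pmul2r (isT: 0 < n.+2)%N) dM NE mulnAC dr -mulnn.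
 by apply/eqP; rewrite mulnAC.
have fm: (\dim (fixed_subalg theta))%:R * haar H f = #|dT|%:R.
 by rewrite dMp natrM -mulrA fh mulr1.
(* The primes #|dT| and n.+2 have product p q with p different from q, so they are distinct. *)
have rm: ~~ (n.+2 %| #|dT|)%N.
 rewrite dvdn_prime2 //; apply/eqP=> E; move: dr; rewrite -E mulnn => /eqP dr.
 have: (p %| n.+2 ^ 2)%N by rewrite (eqP dr) dvdn_mulr.
 rewrite Euclid_dvdX // dvdn_prime2 // => /andP[/eqP pE _].
 by move: dr; rewrite -pE -mulnn eqn_pmul2l // (negPf pneq).
have [om oG of1] := one_dim_rep char0 S2 r_pr zP tG tr Mc dM fM (ee k1) f0 fC fm rm.
have omz: om z = ze.
 have := congr1 om (vce k1); rewrite grouplike_dualM // linearZ /= of1 mulr1 vc expr1 => ->.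
 by rewrite [_ *: 1]mulr1.
pose et: dual H := (etb \o pi)%VF.
have eG: grouplike et by apply: pull_grouplike.
have ep: et ^+ p = 1 by rewrite -pullX // etp pull1.
have e1: et != 1 by apply: contraNneq et1 => E; apply/eqP/(pull_inj Ipi); rewrite pull1.
have etz: et z = 1 by rewrite clE -vc piv grouplike_dual1.
have [||||lT [l [li l1 lM lP]]] := @grouplike_group K (dual H) (@grouplike K (dual H)).
- exact: grouplike1.
- by move=> x y xG yG; apply: grouplikeM.
- by move=> x xG; apply: grouplikeS.
- by [].
have lG a: grouplike (l a) by apply/lP; exists a.
apply: (@grouplike_family_sylow _ lT l p q) => //.
 rewrite -NE -(dim_dual H) -(dim_gspan li lG); apply: coid_dim_dvd_full => //; first exact: involutive_dual.
 exact/hopf_subalg_coid/gspan_hopf.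
have phiM a b: l (a * b)%g z = l a z * l b z by rewrite lM grouplike_evalM.
have phi1: l 1%g z = 1 by rewrite l1 dual1; case: zG.
have Kg: group_set [set a | l a z == 1].
 apply/group_setP; split=> [|a b]; rewrite !inE ?phi1 // phiM => /eqP -> /eqP ->.
 by rewrite mulr1.
pose Kz := Group Kg.
have KzP a: (a \in gval Kz) = (l a z == 1) by rewrite inE.
have nK: [set: lT] \subset 'N(Kz)%g.
 apply/subsetP=> b _; apply/normP/setP=> a; rewrite mem_conjg !KzP conjgE !phiM.
 by rewrite mulrCA -phiM mulVg phi1 mulr1.
have [a aE] := iffLR (lP et) eG; have [b bE] := iffLR (lP om) oG.
have pK: (p %| #|Kz|)%N.
 have aK: a \in gval Kz by rewrite KzP -aE etz.
 have := order_dvdG aK; suff -> : #[a]%g = p by [].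
 have: (#[a]%g %| p)%N by rewrite order_dvdn -(inj_eq li) (vX l1 lM) -aE ep l1.
 move/(primeP p_pr).2/orP => [|/eqP //]; rewrite order_eq1 => /eqP a1.
 by case/eqP: e1; rewrite aE a1 l1.
have bK: b \notin gval Kz.
 rewrite KzP -bE omz -[1](expr0 ze) -[ze in X in X == _]expr1 (eq_prim_root_expr zeP) mod0n.
 by rewrite modn_small.
have bN: b \in 'N(Kz)%g by apply: (subsetP nK); rewrite inE.
have ob: #[coset Kz b]%g = p.
 have: (#[coset Kz b]%g %| p)%N.
  rewrite order_dvdn -morphX //; apply/eqP; apply: coset_id.
  by rewrite KzP (vX l1 lM) -bE eval_dualX // omz (prim_expr_order zeP).
 move/(primeP p_pr).2/orP => [|/eqP //]; rewrite order_eq1 => /eqP b1.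
 by case/negP: bK; apply: coset_idr b1.
have pI: (p %| #|[set: lT]: Kz|%g)%N.
 by rewrite -card_quotient // -ob order_dvdG // mem_quotient // inE.
by rewrite -cardsT -(Lagrange (subsetT Kz)) -mulnn dvdn_mul.
Qed.
End GrouplikesOfDimP2Q.

(** * Radford's theorem: the biproduct structure on the coinvariants *)

Section SymmetricForm.
Variables (K: closedFieldType) (A: falgType K).
Hypothesis char0: [pchar K] =i pred0.
Variable tau: 'Hom(A, K^o).
Hypothesis tauC: forall x y, tau (x * y) = tau (y * x).
Hypothesis tau_nondeg: forall x, (forall y, tau (x * y) = 0) -> x = 0.
Hypothesis tau_tr: forall y, ltr (amulr y) = (\dim {:A})%:R * tau y.
(* For dual bases c, d of tau, sum d_i c_i = dim A, so that averaging a
  projection over d_i (x) c_i gives a retraction of modules. *)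
Lemma symmetric_semisimple: semisimple_alg A.
move=> I /prodvP IL; pose n: K := (\dim {:A})%:R.
have n0: n != 0.
 by rewrite char0_nat // -lt0n lt0n dimv_eq0 -subv0; apply/negP=> /subvP/(_ 1 (memvf _)); rewrite memv0 oner_eq0.
have [d dP]: exists d, forall x, x = \sum_i (tau (d i * x): K) *: @bas K A i by apply: dual_basis_exists.
have cP x: x = \sum_i (tau (bas i * x): K) *: d i.
 rewrite [LHS](dual_basis_sym tau_nondeg dP); apply: eq_bigr => i _; by rewrite tauC.
have dc: \sum_i d i * bas i = n%:A.
 apply/eqP; rewrite -subr_eq0; apply/eqP; apply: tau_nondeg => x.
 rewrite mulrBl linearB /= -scalerAl mul1r linearZ /= -[n *: _]/(n * _) -tau_tr.
 rewrite (ltr_dual_bases dP) mulr_suml lsE -sumrB big1 //= => i _.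
 by rewrite amulrE mulrA subrr.
pose Q: 'End(A) := linfun (fun x => n^-1 *: \sum_i d i * projv I (bas i * x)).
have QE x: Q x = n^-1 *: \sum_i d i * projv I (bas i * x).
 rewrite linE // => c y z; rewrite scalerA mulrC -scalerA -scalerDr; congr (_ *: _).
 rewrite scaler_sumr -big_split; apply: eq_bigr => i _ /=.
 by rewrite mulrDr -scalerAr linearP mulrDr -scalerAr.
have QI x: Q x \in I.
 by rewrite QE memvZ // memv_suml // => i _; rewrite IL ?memvf ?memv_proj.
have Qid x: x \in I -> Q x = x.
 move=> xI; rewrite QE; under eq_bigr => i _ do rewrite projv_id ?IL ?memvf // mulrA.
 by rewrite -mulr_suml dc -scalerAl mul1r scalerA mulVf // scale1r.
have QM y x: Q (y * x) = y * Q x.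
 rewrite !QE -scalerAr; congr (_ *: _); rewrite mulr_sumr.
 have B: bilin (fun u w: A => u * projv I (w * x)) by bil.
 have := casimir tau_nondeg cP y B; under eq_bigr => i _ do rewrite -mulrA.
 by move=> ->; apply: eq_bigr => i _; rewrite mulrA.
exists (lker Q); split.
- apply/prodvP=> u w _; rewrite !memv_ker QM => /eqP ->; by rewrite mulr0.
- apply/eqP; rewrite eqEsubv subvf; apply/subvP=> x _.
 rewrite -[x](addrNK (Q x)) addrC memv_add //.
 by rewrite memv_ker linearB /= (Qid _ (QI x)) subrr.
- apply/eqP; rewrite -subv0; apply/subvP=> x /memv_capP[xI]; rewrite memv_ker memv0.
 by rewrite Qid.
Qed.
End SymmetricForm.

Section TranslationTensors.
Variables (K: fieldType) (H: hopfType K) (W: vectType K) (F: H -> H -> W).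
Hypothesis FB: bilin F.
Lemma comul_lt (f: dual H) h: comul (lt f h) = tmap (lt f) idfun (comul h).
apply: tens_sep => g g'; rewrite -dualM dual_lt /tmap tsT mulrA [LHS]dualM.
by apply: eqt => x y; rewrite tliftE ?dual_lt //; bil.
Qed.
Lemma rt_lt_comul (f: dual H) h: tmap (rt f) idfun (comul h) = tmap idfun (lt f) (comul h).
apply: tens_sep => g g'; rewrite /tmap !tsT.
trans (((g: dual H) * f * (g': dual H)) h).
 by rewrite dualM; apply: eqt => x y; rewrite tliftE ?dual_rt //; bil.
by rewrite -mulrA dualM; apply: eqt => x y; rewrite tliftE ?dual_lt //; bil.
Qed.
Lemma tsum_lt (f: dual H) h: \dsum_(x, y <- (lt f h)) F x y = \dsum_(x, y <- h) F (lt f x) y.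
by rewrite comul_lt /tmap tsT; apply: eqt => x y; rewrite tliftE.
Qed.
Lemma tsum_rt_lt (f: dual H) h: \dsum_(x, y <- h) F (rt f x) y = \dsum_(x, y <- h) F x (lt f y).
have := congr1 (tlift F) (rt_lt_comul f h); rewrite /tmap !tsT => E.
trans (\dsum_(x, y <- h) tlift F (rt f x *t idfun y)).
 by apply: eqt => x y; rewrite tliftE.
by rewrite E; apply: eqt => x y; rewrite tliftE.
Qed.
End TranslationTensors.

Section Coinvariants.
Variables (K: closedFieldType) (H: hopfType K) (gT: finGroupType).
Variables (v: gT -> H) (P: gT -> dual H).
Local Notation S := (@antipode K H).
(* P a is the component at a of a Hopf projection of H onto the span of the
  v a. *)
Definition dual_grading :=
 [/\ v 1%g = 1, forall a b, v (a * b)%g = v a * v b & forall a, grouplike (v a)] /\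
 [/\ forall a b, P a * P b = if a == b then P a else 0, \sum_a P a = 1,
   forall a x y, P a (x * y) = \sum_b P b x * P (b^-1 * a)%g y,
   forall a, antipode (P a) = P a^-1%g & forall a b, P a (v b) = (a == b)%:R].
Definition coinv: {vspace H} := lker (rt (P 1%g) - \1)%VF.
(** If pi is the projection with components P a, this is h |-> h1 S(pi(h2)), the projection of H
    onto the coinvariants; [canti] is h |-> pi(h1) S(h2), which induces the antipode of the
    Yetter-Drinfeld Hopf algebra. *)
Definition cproj: 'End(H) := linfun (fun h => \sum_a rt (P a) h * v a^-1%g).
Definition canti: 'End(H) := linfun (fun h => \sum_a v a * S (lt (P a) h)).
Hypothesis dat: dual_grading.
Local Notation R := coinv.
Lemma dg_v1: v 1%g = 1. by case: dat => [[]]. Qed.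
Lemma dg_vM a b: v (a * b)%g = v a * v b. by case: dat => [[]]. Qed.
Lemma dg_vG a: grouplike (v a). by case: dat => [[]]. Qed.
Lemma dg_vVr a: v a * v a^-1%g = 1. by rewrite -dg_vM mulgV dg_v1. Qed.
Lemma dg_vVl a: v a^-1%g * v a = 1. by rewrite -dg_vM mulVg dg_v1. Qed.
Lemma dg_vS a: S (v a) = v a^-1%g. exact: vS dg_v1 dg_vM dg_vG a. Qed.
Lemma dg_PP a b: P a * P b = if a == b then P a else 0. by case: dat => [_ []]. Qed.
Lemma dg_sum: \sum_a P a = 1. by case: dat => [_ []]. Qed.
Lemma dg_PS a: antipode (P a) = P a^-1%g. by case: dat => [_ []]. Qed.
Lemma dg_Pv a b: P a (v b) = (a == b)%:R. by case: dat => [_ []]. Qed.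
Lemma dg_comul a: comul (P a) = \sum_b P b *t P (b^-1 * a)%g.
apply: tens_sep => phi psi; have [x xE] := dual_eval phi; have [y yE] := dual_eval psi.
rewrite lsE /=; under eqt => f g do rewrite xE yE.
rewrite dcE; have [_ [_ _ -> _ _]] := dat; apply: eq_bigr => b _.
by rewrite tliftE ?xE ?yE //; bil.
Qed.
Lemma dg_ltM a x y: lt (P a) (x * y) = \sum_b lt (P b) x * lt (P (b^-1 * a)%g) y.
rewrite lt_mul dg_comul lsE; apply: eq_bigr => b _ /=.
by rewrite tliftE //; split=> ?; cbv beta; lin2.
Qed.
Lemma dg_rtM a x y: rt (P a) (x * y) = \sum_b rt (P b) x * rt (P (b^-1 * a)%g) y.
rewrite rt_mul dg_comul lsE; apply: eq_bigr => b _ /=.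
by rewrite tliftE //; split=> ?; cbv beta; lin2.
Qed.
Lemma dg_ltE a b x: lt (P a) (lt (P b) x) = if a == b then lt (P a) x else 0.
rewrite -ltM dg_PP eq_sym; case: eqP => [->//|_]; by rewrite linear0 zlE.
Qed.
Lemma dg_rtE a b x: rt (P a) (rt (P b) x) = if a == b then rt (P a) x else 0.
by rewrite -rtM dg_PP; case: eqP => // _; rewrite linear0 zlE. Qed.
Lemma dg_lt_sum x: \sum_a lt (P a) x = x.
by rewrite -[RHS]lt1 -dg_sum lsE smE. Qed.
Lemma dg_rt_sum x: \sum_a rt (P a) x = x.
by rewrite -[RHS]rt1 -dg_sum lsE smE. Qed.
Lemma dg_lt_vl a c x: lt (P a) (v c * x) = v c * lt (P (c^-1 * a)%g) x.
rewrite dg_ltM (bigD1 c) //= big1 ?addr0 => [|b /negPf bc]; rewrite (lt_grouplike _ (dg_vG c)) dg_Pv ?eqxx ?scale1r //.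
by rewrite bc scale0r mul0r.
Qed.
Lemma dg_lt_vr a c x: lt (P a) (x * v c) = lt (P (a * c^-1)%g) x * v c.
rewrite dg_ltM (bigD1 (a * c^-1)%g) //= big1 ?addr0 => [|b bc]; rewrite (lt_grouplike _ (dg_vG c)) dg_Pv.
 by rewrite invMg invgK mulgKV eqxx scale1r.
case: eqP => [E|_]; last by rewrite scale0r mulr0.
by case/eqP: bc; rewrite -E invMg invgK mulKVg.
Qed.
Lemma dg_rt_vl a c x: rt (P a) (v c * x) = v c * rt (P (c^-1 * a)%g) x.
rewrite dg_rtM (bigD1 c) //= big1 ?addr0 => [|b /negPf bc]; rewrite (rt_grouplike _ (dg_vG c)) dg_Pv ?eqxx ?scale1r //.
by rewrite bc scale0r mul0r.
Qed.
Lemma dg_rt_vr a c x: rt (P a) (x * v c) = rt (P (a * c^-1)%g) x * v c.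
rewrite dg_rtM (bigD1 (a * c^-1)%g) //= big1 ?addr0 => [|b bc]; rewrite (rt_grouplike _ (dg_vG c)) dg_Pv.
 by rewrite invMg invgK mulgKV eqxx scale1r.
case: eqP => [E|_]; last by rewrite scale0r mulr0.
by case/eqP: bc; rewrite -E invMg invgK mulKVg.
Qed.
Lemma dg_lt_conj a c x: lt (P (c * a * c^-1)%g) (v c * x * v c^-1%g) = v c * lt (P a) x * v c^-1%g.
by rewrite dg_lt_vr dg_lt_vl invgK mulgKV mulKg. Qed.
Lemma dg_rt_conj a c x: rt (P (c * a * c^-1)%g) (v c * x * v c^-1%g) = v c * rt (P a) x * v c^-1%g.
by rewrite dg_rt_vr dg_rt_vl invgK mulgKV mulKg. Qed.
Lemma coinvP x: (x \in R) = (rt (P 1%g) x == x).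
by rewrite memv_ker alE olE ilE subr_eq0. Qed.
Lemma coinv_rt a x: x \in R -> rt (P a) x = if a == 1%g then x else 0.
by rewrite coinvP => /eqP E; rewrite -[in LHS]E dg_rtE; case: eqP => // ->. Qed.
Lemma coinv_eval a x: x \in R -> P a x = (a == 1%g)%:R * counit x.
by move=> xR; rewrite -counit_rt coinv_rt //; case: eqP; rewrite ?mul1r ?mul0r ?linear0. Qed.
Lemma coinv1: 1 \in R.
by rewrite coinvP -dg_v1 (rt_grouplike _ (dg_vG 1%g)) dg_Pv eqxx scale1r. Qed.
Lemma coinvM x y: x \in R -> y \in R -> x * y \in R.
move=> xR yR; rewrite coinvP dg_rtM (bigD1 1%g) //= big1 ?addr0 => [|b /negPf b1].
 by rewrite !coinv_rt // invg1 mulg1 eqxx.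
by rewrite coinv_rt // b1 mul0r.
Qed.
Lemma coinv_lt f x: x \in R -> lt f x \in R.
by rewrite !coinvP => /eqP E; rewrite -lt_rtC E. Qed.
Lemma coinv_coid: coid_subalg R.
by split; [exact: coinv1 | exact: coinvM | move=> f x; apply: coinv_lt]. Qed.
Lemma coinv_conj c x: x \in R -> v c * x * v c^-1%g \in R.
move=> xR; rewrite coinvP; have := dg_rt_conj 1 c x; rewrite mulg1 mulgV => ->.
by rewrite coinv_rt ?eqxx.
Qed.
Lemma cprojE h: cproj h = \sum_a rt (P a) h * v a^-1%g.
rewrite linE // => c x y; rewrite scaler_sumr -big_split; apply: eq_bigr => a _ /=.
by rewrite linearP mulrDl scalerAl.
Qed.
Lemma cantiE h: canti h = \sum_a v a * S (lt (P a) h).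
rewrite linE // => c x y; rewrite scaler_sumr -big_split; apply: eq_bigr => a _ /=.
by rewrite !linearP mulrDr scalerAr.
Qed.
Lemma cproj_coinv h: cproj h \in R.
rewrite cprojE memv_suml // => a _; rewrite coinvP dg_rt_vr invgK mul1g dg_rtE eqxx //.
Qed.
Lemma cproj_id x: x \in R -> cproj x = x.
move=> xR; rewrite cprojE (bigD1 1%g) //= big1 ?addr0 => [|b /negPf b1]; rewrite coinv_rt //.
 by rewrite eqxx invg1 dg_v1 mulr1.
by rewrite b1 mul0r.
Qed.
Lemma cproj_vr c h: cproj (h * v c) = cproj h.
rewrite !cprojE (reindex_inj (mulIg c)) /=; apply: eq_bigr => a _.
by rewrite dg_rt_vr mulgK -mulrA -dg_vM invMg mulKVg.
Qed.
Lemma cproj_vl c h: cproj (v c * h) = v c * cproj h * v c^-1%g.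
rewrite !cprojE (reindex_inj (mulgI c)) mulr_sumr mulr_suml /=; apply: eq_bigr => a _.
by rewrite dg_rt_vl mulKg invMg dg_vM !mulrA.
Qed.
Lemma cproj_inv (W: vectType K) (T: H -> W) h: linear T ->
 (forall c h, T (h * v c) = T h) -> T (cproj h) = T h.
move=> TL Tv; rewrite cprojE (lin_sum1 _ _ TL) -[in RHS](dg_rt_sum h) (lin_sum1 _ _ TL).
by apply: eq_bigr => a _; rewrite Tv.
Qed.
Lemma cproj_sum h: \sum_a cproj (rt (P a) h) * v a = h.
rewrite -[RHS]dg_rt_sum; apply: eq_bigr => a _.
rewrite cprojE (bigD1 a) //= big1 ?addr0 => [|b /negPf ba]; rewrite dg_rtE.
 by rewrite eqxx -mulrA dg_vVl mulr1.
by rewrite ba mul0r.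
Qed.
Lemma canti_coinv x: canti x \in R.
rewrite cantiE memv_suml // => a _; rewrite coinvP dg_rt_vl mulg1 rt_antipode dg_PS invgK.
by rewrite dg_ltE eqxx.
Qed.
Lemma canti_vr c h: canti (h * v c) = canti h.
rewrite !cantiE (reindex_inj (mulIg c)) /=; apply: eq_bigr => a _.
by rewrite dg_lt_vr mulgK antipodeM dg_vS dg_vM -mulrA [v c * _]mulrA dg_vVr mul1r.
Qed.
Lemma canti_lt a x: canti (lt (P a) x) = v a * S (lt (P a) x).
rewrite cantiE (bigD1 a) //= big1 ?addr0 => [|b /negPf ba]; rewrite dg_ltE ?eqxx //.
by rewrite ba linear0 mulr0.
Qed.
Lemma canti_conj c x: canti (v c * x * v c^-1%g) = v c * canti x * v c^-1%g.
have I: injective (fun a => c * a * c^-1)%g by move=> a b /mulIg/mulgI.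
rewrite !cantiE (reindex_inj I) mulr_sumr mulr_suml /=; apply: eq_bigr => a _.
rewrite dg_lt_conj !antipodeM !dg_vS invgK !dg_vM -!mulrA; congr (_ * (_ * _)).
by rewrite !mulrA dg_vVl mul1r.
Qed.
Lemma lt_canti b x: x \in R -> lt (P b) (canti x) = canti (lt (P b) x).
move=> xR; rewrite canti_lt cantiE lsE (bigD1 b) //= big1 ?addr0 => [|a /negPf ba].
 rewrite dg_lt_vl mulVg lt_antipode dg_PS invg1 -lt_rtC coinv_rt // eqxx //.
rewrite dg_lt_vl lt_antipode dg_PS -lt_rtC coinv_rt // invMg invgK -eq_invg_mul invgK eq_sym ba.
by rewrite !linear0 mulr0.
Qed.
(** On the second component [cproj] has no effect, since the second components of r can be taken to
    be left translates, which are coinvariants; on the first, [tsum_rt_lt] moves the translations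
    across the coproduct. *)
Lemma coinv_tsum (W: vectType K) (F: H -> H -> W) r: r \in R -> bilin F ->
 \dsum_(x, y <- r) F (cproj x) (cproj y) =
 \sum_a \dsum_(x, y <- r) F (x * v a^-1%g) (lt (P a) y).
move=> rR [F1 F2].
trans (\dsum_(x, y <- r) F (cproj x) y).
 rewrite (tsum_hbasl (F:=fun x y => F (cproj x) (cproj y))); last first.
  by split=> ? c x y; rewrite linearP ?F1 ?F2.
 rewrite (tsum_hbasl (F:=fun x y => F (cproj x) y)); last first.
  by split=> ? c x y; rewrite ?linearP ?F1 ?F2.
 by apply: eq_bigr => i _; rewrite (cproj_id (coinv_lt _ rR)).
under eqt => x y do rewrite cprojE (lin_sum1 _ _ (F1 y)).
rewrite tlift_sumr; apply: eq_bigr => a _.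
rewrite (tsum_rt_lt (F:=fun x y => F (x * v a^-1%g) y)) //.
by split=> ? c x y; rewrite ?mulrDl -?scalerAl ?F1 ?F2.
Qed.
End Coinvariants.
Lemma tlift_eq0 (K: fieldType) (U V W: vectType K) (b: U -> V -> W) t :
 (forall x y, b x y = 0) -> tlift b t = 0.
by move=> b0; rewrite /tlift big1 // => i _; rewrite big1 // => j _; rewrite b0 scaler0. Qed.
Lemma tens0r (K: fieldType) (U V: vectType K) (u: U): u *t (0: V) = 0.
by rewrite /tens linear0 mulmx0. Qed.
Lemma tens0l (K: fieldType) (U V: vectType K) (w: V): (0: U) *t w = 0.
by rewrite /tens !linear0 mul0mx. Qed.

Section CoinvariantAlgebra.
Variables (K: closedFieldType) (H: hopfType K) (gT: finGroupType).
Variables (v: gT -> H) (P: gT -> dual H).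
Local Notation R := (coinv P).
Local Notation A := (group_alg K gT).
Local Notation "'d_ a" := (galg_elt K (a: gT)) (at level 8, format "''d_' a").
Definition coinvariants of dual_grading v P := subvs_of R.
Hypothesis dat: dual_grading v P.
Local Notation B := (coinvariants dat).
HB.instance Definition _ := Vector.on B.
Definition cval: 'Hom(B, H) := linfun (vsval: subvs_of R -> H).
Definition cinj: 'Hom(H, B) := linfun (vsproj R: H -> subvs_of R).
Lemma cvalE (u: B): cval u = vsval (u: subvs_of R). exact: lfunE. Qed.
Lemma cvalP u: cval u \in R. by rewrite cvalE subvsP. Qed.
Lemma cvalK u: cinj (cval u) = u. by rewrite cvalE lfunE /= vsvalK. Qed.
Lemma cinjK x: x \in R -> cval (cinj x) = x.
by move=> xR; rewrite cvalE lfunE /= vsprojK. Qed.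
Lemma cval_inj: injective cval. exact: can_inj cvalK. Qed.
Definition cone: B := cinj 1.
Definition cmul (u w: B): B := cinj (cval u * cval w).
Lemma cval1: cval cone = 1. exact/cinjK/(coinv1 dat). Qed.
Lemma cvalM u w: cval (cmul u w) = cval u * cval w.
by rewrite cinjK // (coinvM dat) ?cvalP. Qed.
Lemma cmulA: associative cmul.
by move=> u w z; apply: cval_inj; rewrite !cvalM mulrA. Qed.
Lemma cmul1l: left_id cone cmul.
by move=> u; apply: cval_inj; rewrite cvalM cval1 mul1r. Qed.
Lemma cmul1r: right_id cone cmul.
by move=> u; apply: cval_inj; rewrite cvalM cval1 mulr1. Qed.
Lemma cmulDl: left_distributive cmul +%R.
by move=> u w z; apply: cval_inj; rewrite linearD /= !cvalM linearD mulrDl. Qed.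
Lemma cmulDr: right_distributive cmul +%R.
by move=> u w z; apply: cval_inj; rewrite linearD /= !cvalM linearD mulrDr. Qed.
Lemma cone_neq0: cone != 0.
by apply/eqP=> E; have /eqP := cval1; rewrite E linear0 eq_sym oner_eq0. Qed.
HB.instance Definition _ := GRing.Zmodule_isNzRing.Build B
 cmulA cmul1l cmul1r cmulDl cmulDr cone_neq0.
Lemma cscaleAl (c: K) (u w: B): c *: (u * w) = c *: u * w.
by apply: cval_inj; rewrite linearZ /= !cvalM linearZ scalerAl. Qed.
Lemma cscaleAr (c: K) (u w: B): c *: (u * w) = u * (c *: w).
by apply: cval_inj; rewrite linearZ /= !cvalM linearZ scalerAr. Qed.
HB.instance Definition _ := GRing.Lmodule_isLalgebra.Build K B cscaleAl.
HB.instance Definition _ := GRing.Lalgebra_isAlgebra.Build K B cscaleAr.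
HB.instance Definition _ := Algebra_isFalgebra.Build K B.
Lemma cval1': cval 1 = 1. exact: cval1. Qed.
Lemma cvalM' u w: cval (u * w) = cval u * cval w. exact: cvalM. Qed.
Definition cpr: 'Hom(H, B) := (cinj \o cproj v P)%VF.
Lemma cval_cpr h: cval (cpr h) = cproj v P h.
by rewrite clE cinjK // (cproj_coinv dat). Qed.
Lemma cpr_val u: cpr (cval u) = u.
by apply: cval_inj; rewrite cval_cpr (cproj_id dat (cvalP u)). Qed.
Lemma cpr_vr c h: cpr (h * v c) = cpr h.
by rewrite !clE (cproj_vr dat). Qed.
(** The coproduct of the coinvariants, extended to all of H. It is invariant under right
    multiplication by the v c and so unchanged by [cproj], which makes coassociativity inherit from
    H. *)
Definition cD (h: H): tensor B B := tmap cpr cpr (comul h).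
Lemma cD_linear: linear cD. by rewrite /cD /tmap; lin. Qed.
Lemma cD_vr h c: cD (h * v c) = cD h.
rewrite /cD /tmap (tsumM (F:=fun x y => cpr x *t cpr y)); last bil.
apply: eqt => x y; rewrite (tsum_grouplike (dg_vG dat c)) ?cpr_vr //; bil.
Qed.
Lemma cD_cproj h: cD (cproj v P h) = cD h.
by apply: (cproj_inv dat) => [|c x]; [exact: cD_linear | exact: cD_vr]. Qed.
Lemma counit_cproj h: counit (cproj v P h) = counit h.
apply: (cproj_inv (T:=@counit K H) dat) => [|c x]; first exact: linearP.
by rewrite counitM (dg_vG dat c).2 mulr1.
Qed.
Definition ccomul: 'Hom(B, tensor B B) := linfun (fun u: B => cD (cval u)).
Definition ccounit: 'Hom(B, K^o) := (counit \o cval)%VF.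
Lemma ccomulE u: ccomul u = cD (cval u).
by rewrite linE // => c x y; rewrite linearP cD_linear. Qed.
Lemma ccounitE u: ccounit u = counit (cval u). exact: clE. Qed.
Lemma ccomul_tsum (W: vectType K) (G: B -> B -> W) u: bilin G ->
 \tsum_(x, y <- ccomul u) G x y = \dsum_(x, y <- cval u) G (cpr x) (cpr y).
move=> GB; rewrite ccomulE /cD /tmap tsT.
by apply: eqt => x y; rewrite tliftE.
Qed.
Lemma ccomul_cpr h: ccomul (cpr h) = cD h.
by rewrite ccomulE cval_cpr cD_cproj. Qed.
Lemma ccomulA u :
 \tsum_(x, y <- ccomul u) \tsum_(x1, x2 <- ccomul x) (x1 *t (x2 *t y)) =
 \tsum_(x, y <- ccomul u) (x *t ccomul y).
rewrite !ccomul_tsum; [| bil | bil].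
trans (\dsum_(x, y <- cval u) \dsum_(x1, x2 <- x) (cpr x1 *t (cpr x2 *t cpr y))).
 apply: eqt => x y; rewrite ccomul_cpr /cD /tmap tsT.
 by apply: eqt => a b; rewrite tliftE //; bil.
rewrite (tsumA (F:=fun a b c => cpr a *t (cpr b *t cpr c))); try by move=> *; lin.
apply: eqt => x y; rewrite ccomul_cpr /cD /tmap [RHS](tlf (fun z => cpr x *t z)) //.
by lin.
Qed.
Lemma ccounitl u: \tsum_(x, y <- ccomul u) ((ccounit x: K) *: y) = u.
rewrite ccomul_tsum; last bil.
under eqt => x y do rewrite ccounitE cval_cpr counit_cproj.
by rewrite (tsum_el (F:=cpr)) ?cpr_val //; lin.
Qed.
Lemma ccounitr u: \tsum_(x, y <- ccomul u) ((ccounit y: K) *: x) = u.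
rewrite ccomul_tsum; last bil.
under eqt => x y do rewrite ccounitE cval_cpr counit_cproj.
by rewrite (tsum_er (F:=cpr)) ?cpr_val //; lin.
Qed.
HB.instance Definition _ := Vector_isCoalgebra.Build K B ccomulA ccounitl ccounitr.
Definition cact (a: gT): 'End(B) :=
 linfun (fun u: B => cinj (v a * cval u * v a^-1%g)).
Definition clt (a: gT): 'End(B) := (cinj \o (lt (P a) \o cval))%VF.
Lemma cval_act a u: cval (cact a u) = v a * cval u * v a^-1%g.
have L: linear (fun u: B => cinj (v a * cval u * v a^-1%g)) by lin.
by rewrite (linE L) cinjK // (coinv_conj dat) ?cvalP.
Qed.
Lemma cval_lt a u: cval (clt a u) = lt (P a) (cval u).
by rewrite !clE cinjK // coinv_lt // cvalP. Qed.
(* The identity r_1 v_a^-1 (x) P_a r_2 = r^1 (x) r^2 relating the coproduct of H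
  to that of the coinvariants. *)
Lemma comul_cval (W: vectType K) (F: H -> H -> W) u: bilin F ->
 \dsum_(x, y <- u) F (cval x) (cval y) =
 \sum_a \dsum_(x, y <- cval u) F (x * v a^-1%g) (lt (P a) y).
move=> FB; rewrite -(coinv_tsum dat (cvalP u) FB) [LHS]ccomul_tsum; last first.
 by case: FB => F1 F2; split=> ? c x y; rewrite linearP ?F1 ?F2.
by apply: eqt => x y; rewrite !cval_cpr.
Qed.
Definition ydact (x: A) (u: B): B := galg_lin (fun a => cact a u) x.
Lemma ydactE a u: ydact 'd_ a u = cact a u. exact: galg_linE. Qed.
Lemma ydact_bilin: bilinear_for *:%R *:%R ydact.
split=> [u c x y|x c u w]; rewrite /ydact ?linearP //= /galg_lin.
rewrite scaler_sumr -big_split; apply: eq_bigr => a _ /=.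
by rewrite linearP scalerDr !scalerA mulrC.
Qed.
Lemma lin_ydactl (V: lmodType K) (F: V -> A) u: linear F -> linear (fun x => ydact (F x) u).
by move=> FL c x y; rewrite FL ydact_bilin.1. Qed.
Lemma lin_ydactr (V: lmodType K) (F: V -> B) x: linear F -> linear (fun u => ydact x (F u)).
by move=> FL c u w; rewrite FL ydact_bilin.2. Qed.
Ltac liny := repeat first
 [ apply: lin_id | apply: lin_ydactl | apply: lin_ydactr | apply: lin_tensl | apply: lin_tensr
 | apply: lin_mull | apply: lin_mulr
 | apply: lin_scalel | apply: lin_scaler
 | apply: lin_lfun | apply: lin_eval | apply: lin_tlift
 | apply: lin_tliftr => ? ? ].
Ltac bily := split=> ?; cbv beta; liny.
(** The coaction (pi (x) id) Delta, written out in the components P a of the projection pi. *)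
Definition ydcoact: 'Hom(B, tensor A B) := linfun (fun u => \sum_a 'd_ a *t clt a u).
Lemma ydcoactE u: ydcoact u = \sum_a 'd_ a *t clt a u.
rewrite linE // => c x y; rewrite scaler_sumr -big_split; apply: eq_bigr => a _ /=.
by rewrite linearP (tens_bilin _ _).2.
Qed.
Lemma ydcoact_tsum (W: vectType K) (G: A -> B -> W) u: bilin G ->
 \tsum_(x, w <- ydcoact u) G x w = \sum_a G 'd_ a (clt a u).
by move=> GB; rewrite ydcoactE lsE; apply: eq_bigr => a _; rewrite /= tliftE. Qed.
Lemma cltE a b u: clt a (clt b u) = if a == b then clt a u else 0.
by apply: cval_inj; rewrite !cval_lt (dg_ltE dat); case: eqP; rewrite ?cval_lt ?linear0. Qed.
Lemma clt_sum u: \sum_a clt a u = u.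
apply: cval_inj; rewrite lsE -[RHS](dg_lt_sum dat); apply: eq_bigr => a _.
by rewrite /= cval_lt.
Qed.
Lemma clt_act a c u: clt (c * a * c^-1)%g (cact c u) = cact c (clt a u).
by apply: cval_inj; rewrite !(cval_lt, cval_act) (dg_lt_conj dat). Qed.
Lemma galg_tsum (W: vectType K) (G: A -> A -> W) a: bilin G ->
 \dsum_(x, y <- 'd_ a) G x y = G 'd_ a 'd_ a.
by move=> GB; rewrite -[comul _]/(galg_comul _ _ _) galg_comulE tliftE. Qed.
Lemma ydact1 u: ydact 1 u = u.
rewrite -[1]/('d_ 1%g) ydactE; apply: cval_inj.
by rewrite cval_act invg1 (dg_v1 dat) mul1r mulr1.
Qed.
Lemma ydactM x y u: ydact (x * y) u = ydact x (ydact y u).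
move: x; apply: galg_ext => [||a]; [liny | liny | ].
move: y; apply: galg_ext => [||b]; [liny | liny | ].
rewrite galg_mulE !ydactE; apply: cval_inj.
by rewrite !cval_act invMg !(dg_vM dat) !mulrA.
Qed.
Lemma ydcoactA u :
 \tsum_(x, w <- ydcoact u) \dsum_(x1, x2 <- x) (x1 *t (x2 *t w)) =
 \tsum_(x, w <- ydcoact u) (x *t ydcoact w).
rewrite !ydcoact_tsum; [| bil | bil]; apply: eq_bigr => a _.
rewrite galg_tsum; last bil.
rewrite ydcoactE (bigD1 a) //= cltE eqxx big1 ?addr0 // => b /negPf ba.
by rewrite cltE ba tens0r.
Qed.
Lemma ydcoact_counit u: \tsum_(x, w <- ydcoact u) ((counit x: K) *: w) = u.
rewrite ydcoact_tsum; last bil.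
rewrite -[RHS]clt_sum; apply: eq_bigr => a _.
by rewrite -[counit _]/(galg_counit _ _ _) galg_counitE scale1r.
Qed.
Lemma ydcoact_act x u: ydcoact (ydact x u) =
 \dsum_(g1, g' <- x) \dsum_(g2, g3 <- g')
  \tsum_(y, w <- ydcoact u) ((g1 * y * antipode g3) *t ydact g2 w).
move: x; apply: galg_ext => [||c]; [liny | liny | ].
rewrite galg_tsum; last bily.
rewrite galg_tsum; last bily.
rewrite ydcoact_tsum; last bily.
have I: injective (fun a => c * a * c^-1)%g by move=> a b /mulIg/mulgI.
rewrite ydactE ydcoactE (reindex_inj I); apply: eq_bigr => a _ /=.
rewrite clt_act ydactE -[antipode _]/(galg_antipode _ _ _) galg_antipodeE.
by rewrite !galg_mulE.
Qed.
HB.instance Definition _ := isYetterDrinfeld.Build K A B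
 ydact_bilin ydact1 ydactM ydcoactA ydcoact_counit ydcoact_act.
Lemma comulBE (u: B): comul u = cD (cval u). exact: ccomulE. Qed.
Lemma counitBE (u: B): counit u = counit (cval u). exact: ccounitE. Qed.
Lemma cpr_vl c h: cpr (v c * h) = cact c (cpr h).
by apply: cval_inj; rewrite cval_act !cval_cpr (cproj_vl dat). Qed.
Lemma yd_unit_act' (x: A): ydact x (1: B) = (counit x: K)%:A.
move: x; apply: galg_ext => [||c]; [liny | liny | ].
rewrite ydactE -[counit _]/(galg_counit _ _ _) galg_counitE scale1r; apply: cval_inj.
by rewrite cval_act cval1' mulr1 (dg_vVr dat).
Qed.
Lemma yd_mul_act' (x: A) (u w: B): ydact x (u * w) = \dsum_(g1, g2 <- x) (ydact g1 u * ydact g2 w).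
move: x; apply: galg_ext => [||c]; [liny | liny | ].
rewrite galg_tsum; last bily.
rewrite !ydactE; apply: cval_inj; rewrite !(cval_act, cvalM') -!mulrA; congr (_ * (_ * _)).
by rewrite !mulrA (dg_vVl dat) mul1r.
Qed.
Lemma yd_unit_coact': ydcoact (1: B) = (1: A) *t 1.
have E a: clt a 1 = (a == 1%g)%:R *: 1.
 apply: cval_inj; rewrite cval_lt linearZ /= cval1' -(dg_v1 dat) (lt_grouplike _ (dg_vG dat 1%g)).
 by rewrite (dg_Pv dat).
rewrite ydcoactE (bigD1 1%g) //= big1 ?addr0 => [|a /negPf a1]; rewrite E.
 by rewrite eqxx scale1r.
by rewrite a1 scale0r tens0r.
Qed.
Lemma clt_mul a u w: clt a (u * w) = \sum_b clt b u * clt (b^-1 * a)%g w.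
apply: cval_inj; rewrite cval_lt cvalM' (dg_ltM dat) lsE; apply: eq_bigr => b _.
by rewrite /= cvalM' !cval_lt.
Qed.
Lemma yd_mul_coact' (u w: B): ydcoact (u * w) =
  \tsum_(x, u0 <- ydcoact u) \tsum_(y, w0 <- ydcoact w) (((x: A) * y) *t (u0 * w0)).
rewrite ydcoact_tsum; last bily.
under [RHS]eq_bigr => b _ do [rewrite ydcoact_tsum; last bily].
rewrite ydcoactE; trans (\sum_a \sum_b 'd_ a *t (clt b u * clt (b^-1 * a)%g w)).
 apply: eq_bigr => a _; rewrite clt_mul.
 exact: (lin_sum1 _ _ (lin_tensr 'd_ a (@lin_id K B))).
rewrite exchange_big; apply: eq_bigr => b _ /=; rewrite (reindex_inj (mulgI b)).
by apply: eq_bigr => a _; rewrite mulKg galg_mulE.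
Qed.
Lemma yd_counit_act' (x: A) (u: B): counit (ydact x u) = counit x * counit u.
move: x; apply: (galg_ext (W:=K^o)) => [||c]; [liny | liny | ].
rewrite ydactE -[counit 'd_ c]/(galg_counit _ _ _) galg_counitE mul1r !counitBE cval_act.
by rewrite !counitM !(dg_vG dat _).2 mul1r mulr1.
Qed.
Lemma yd_comul_act' (x: A) (u: B): comul (ydact x u) =
  \dsum_(g1, g2 <- x) \dsum_(a1, a2 <- u) (ydact g1 a1 *t ydact g2 a2).
move: x; apply: galg_ext => [||c]; [liny | liny | ].
rewrite galg_tsum; last bily.
rewrite ydactE [RHS]ccomul_tsum; last bily.
rewrite comulBE [cval _]cval_act cD_vr /cD /tmap.
rewrite (tsumM (F:=fun x y => cpr x *t cpr y)); last bil.
rewrite (tsum_grouplike (dg_vG dat c)); last bil.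
by apply: eqt => a b; rewrite !cpr_vl !ydactE.
Qed.
Lemma yd_counit_coact' (u: B): \tsum_(x, u0 <- ydcoact u) ((counit u0: K) *: (x: A)) = (counit u: K)%:A.
rewrite ydcoact_tsum; last bil.
rewrite (bigD1 1%g) //= big1 ?addr0 => [|a /negPf a1].
 by rewrite counitBE cval_lt counit_lt (coinv_eval dat _ (cvalP u)) eqxx mul1r counitBE.
by rewrite counitBE cval_lt counit_lt (coinv_eval dat _ (cvalP u)) a1 mul0r scale0r.
Qed.
Lemma yd_comul_coact' (u: B): \tsum_(x, u0 <- ydcoact u) ((x: A) *t comul u0) =
  \dsum_(a1, a2 <- u) \tsum_(x, b <- ydcoact a1)
   \tsum_(y, c <- ydcoact a2) (((x: A) * y) *t (b *t c)).
rewrite ydcoact_tsum; last bil.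
pose F a (x y: H) := 'd_ a *t (cinj x *t cinj y).
have FB a: bilin (F a) by rewrite /F; bil.
have FE a (x y: B): F a (cval x) (cval y) = 'd_ a *t (x *t y) by rewrite /F !cvalK.
trans (\sum_a \sum_c \dsum_(x, y <- cval u) F a (lt (P a) x * v c^-1%g) (lt (P c) y)).
 apply: eq_bigr => a _; trans (\dsum_(x, y <- (clt a u)) F a (cval x) (cval y)).
  rewrite -[comul _ in LHS](_: \dsum_(x, y <- (clt a u)) (x *t y) = _); last first.
   by rewrite comulBE /cD /tmap tsT; apply: eqt => x y; rewrite tliftE //; bil.
  rewrite (tlf (fun z => 'd_ a *t z)); last lin.
  by apply: eqt => x y; rewrite FE.
 rewrite comul_cval //; apply: eq_bigr => c _; rewrite cval_lt.
 by rewrite (tsum_lt (F:=fun x y => F a (x * v c^-1%g) (lt (P c) y))) // /F; bil.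
pose G b c (x y: H) := F (b * c)%g (lt (P b) x) (lt (P c) y).
have GB b c: bilin (G b c) by rewrite /G /F; bil.
trans (\sum_b \sum_c \dsum_(x, y <- u) G b c (cval x) (cval y)); last first.
 under [RHS]eqt => x y do
  [rewrite ydcoact_tsum; last bil];
 rewrite tlift_sumr; apply: eq_bigr => b _.
 under [RHS]eqt => x y do [rewrite ydcoact_tsum; last bil].
 rewrite tlift_sumr; apply: eq_bigr => c _; apply: eqt => x y.
 by rewrite /G -!cval_lt FE galg_mulE.
rewrite exchange_big [RHS]exchange_big; apply: eq_bigr => c _ /=.
rewrite (reindex_inj (mulIg c)); apply: eq_bigr => b _; rewrite comul_cval // (bigD1 c) //= big1 ?addr0.
 by apply: eqt => x y; rewrite /G (dg_lt_vr dat) invgK (dg_ltE dat) eqxx.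
move=> d /negPf dc; apply: tlift_eq0 => x y.
by rewrite /G (dg_ltE dat) eq_sym dc /F linear0 !tens0r.
Qed.
Lemma yd_comul1': comul (1: B) = 1 *t 1.
rewrite comulBE cval1' /cD /tmap (tsum1 (F:=fun x y => cpr x *t cpr y)); last bil.
by rewrite -cval1' cpr_val.
Qed.
(** In the coproduct of the product taken in H, the factor v b^-1 with b = a b' splits as v b'^-1 v
    a^-1. Pulling v a^-1 to the left of the first component of w conjugates that component by v a,
    and this is the action in the braided product. *)
Lemma yd_comulM' (u w: B): comul (u * w) =
  \dsum_(a1, a2 <- u) \dsum_(b1, b2 <- w) \tsum_(x, a20 <- ydcoact a2)
    ((a1 * ydact (x: A) (b1: B)) *t ((a20: B) * b2)).
pose F (x y: H) := cinj x *t cinj y.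
have FB: bilin F by rewrite /F; bil.
have FE (x y: B): F (cval x) (cval y) = x *t y by rewrite /F !cvalK.
trans (\dsum_(x, y <- (u * w)) F (cval x) (cval y)).
 rewrite [LHS]comulBE [RHS]ccomul_tsum; last by rewrite /F; bil.
 by rewrite /cD /tmap; apply: eqt => x y; rewrite FE.
pose Q a (x y x' y': H) := F (x * (v a * x' * v a^-1%g)) (lt (P a) y * y').
rewrite comul_cval // cvalM'; trans (\sum_b \sum_a
  \dsum_(x, y <- cval u) \dsum_(x', y' <- cval w)
   F (x * v a^-1%g * (v a * (x' * v b^-1%g) * v a^-1%g)) (lt (P a) y * lt (P b) y')).
 trans (\sum_a \sum_b \dsum_(x, y <- cval u) \dsum_(x', y' <- cval w)
   F (x * x' * v b^-1%g) (lt (P a) y * lt (P (a^-1 * b)%g) y')).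
  rewrite [RHS]exchange_big; apply: eq_bigr => b _ /=.
  rewrite (tsumM (F:=fun x y => F (x * v b^-1%g) (lt (P b) y))); last by rewrite /F; bil.
  rewrite -tlift_sumr; apply: eqt => x y; rewrite -tlift_sumr; apply: eqt => x' y'.
  by rewrite (dg_ltM dat) (lin_sum1 _ _ (FB.2 _)).
 rewrite [RHS]exchange_big; apply: eq_bigr => a _ /=; rewrite (reindex_inj (mulgI a)); apply: eq_bigr => b _.
 apply: eqt => x y; apply: eqt => x' y'; rewrite mulKg; congr F.
 rewrite -!mulrA [v a^-1%g * _]mulrA (dg_vVl dat) mul1r; congr (_ * (_ * _)).
 by rewrite invMg (dg_vM dat).
trans (\sum_a \dsum_(x, y <- u) \dsum_(x', y' <- w) Q a (cval x) (cval y) (cval x') (cval y')).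
 have QB a x y: bilin (Q a x y) by rewrite /Q /F; bil.
 rewrite [LHS]exchange_big; apply: eq_bigr => a _ /=.
 under [RHS]eqt => x y do rewrite comul_cval //.
 rewrite [RHS]tlift_sumr; apply: eq_bigr => b _; rewrite (comul_cval
   (F:=fun x y => \dsum_(x', y' <- cval w) Q a x y (x' * v b^-1%g) (lt (P b) y'))); last by rewrite /Q /F; bil.
 rewrite (bigD1 a) //= big1 ?addr0.
  by apply: eqt => x y; apply: eqt => x' y'; rewrite /Q (dg_ltE dat) eqxx.
 move=> d /negPf da; apply: tlift_eq0 => x y; apply: tlift_eq0 => x' y'.
 by rewrite /Q (dg_ltE dat) eq_sym da mul0r /F linear0 tens0r.
rewrite -tlift_sumr; apply: eqt => x y; rewrite -tlift_sumr; apply: eqt => x' y'.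
rewrite ydcoact_tsum; last bily.
by apply: eq_bigr => a _; rewrite ydactE /Q -cval_act -cval_lt -!cvalM' FE.
Qed.
Lemma yd_counit1': counit (1: B) = 1. by rewrite counitBE cval1' counit1. Qed.
Lemma yd_counitM' (u w: B): counit (u * w) = counit u * counit w.
by rewrite !counitBE cvalM' counitM. Qed.
Definition ydanti: 'End(B) := (cinj \o (canti v P \o cval))%VF.
Lemma cval_anti u: cval (ydanti u) = canti v P (cval u).
by rewrite !clE cinjK // (canti_coinv dat). Qed.
Lemma canti_mul (u: B): \dsum_(x, y <- cval u) (canti v P x * y) = (counit u: K)%:A.
under eqt => x y do rewrite cantiE mulr_suml.
rewrite tlift_sumr (bigD1 1%g) //= big1 ?addr0 => [|a a1].
 under eqt => x y do rewrite (dg_v1 dat) mul1r.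
 rewrite -(tsum_lt (F:=fun x y => antipode x * y)); last bil.
 by rewrite antipodel counit_lt (coinv_eval dat _ (cvalP u)) eqxx mul1r counitBE.
under eqt => x y do rewrite -mulrA.
rewrite -(tlf (fun z => v a * z)); last lin.
rewrite -(tsum_lt (F:=fun x y => antipode x * y)); last bil.
by rewrite antipodel counit_lt (coinv_eval dat _ (cvalP u)) (negPf a1) mul0r scale0r mulr0.
Qed.
Lemma yd_antipodel' (u: B): \dsum_(x, y <- u) (ydanti x * y) = (counit u: K)%:A.
apply: cval_inj; rewrite linearZ /= cval1' -canti_mul (tlf (cval)); last lin.
under eqt => x y do rewrite cvalM' cval_anti.
rewrite (comul_cval (F:=fun x y => canti v P x * y)); last bil.
rewrite -tlift_sumr; apply: eqt => x y.
under eq_bigr => a _ do rewrite (canti_vr dat).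
by rewrite -mulr_sumr (dg_lt_sum dat).
Qed.
Lemma yd_antipoder' (u: B): \dsum_(x, y <- u) (x * ydanti y) = (counit u: K)%:A.
apply: cval_inj; rewrite linearZ /= cval1' counitBE -antipoder (tlf (cval)); last lin.
under eqt => x y do rewrite cvalM' cval_anti.
rewrite (comul_cval (F:=fun x y => x * canti v P y)); last bil.
rewrite -tlift_sumr; apply: eqt => x y.
under eq_bigr => a _ do rewrite (canti_lt dat) -mulrA [v a^-1%g * _]mulrA (dg_vVl dat) mul1r.
by rewrite -mulr_sumr -lsE /= (dg_lt_sum dat).
Qed.
Lemma yd_antipode_act' (x: A) (u: B): ydanti (ydact x u) = ydact x (ydanti u).
move: x; apply: galg_ext => [||c]; [liny | liny | ].
by rewrite !ydactE; apply: cval_inj; rewrite cval_anti !cval_act cval_anti (canti_conj dat).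
Qed.
Lemma yd_antipode_coact' (u: B): ydcoact (ydanti u) =
  \tsum_(x, u0 <- ydcoact u) ((x: A) *t ydanti u0).
rewrite ydcoact_tsum; last bil.
rewrite ydcoactE; apply: eq_bigr => a _; congr (_ *t _); apply: cval_inj.
by rewrite cval_lt !cval_anti cval_lt (lt_canti dat _ (cvalP u)).
Qed.
HB.instance Definition _ := isYDHopf.Build K A B yd_unit_act' yd_mul_act' yd_unit_coact' yd_mul_coact'
 yd_counit_act' yd_comul_act' yd_counit_coact' yd_comul_coact' yd_comul1' yd_comulM' yd_counit1' yd_counitM'
 yd_antipodel' yd_antipoder' yd_antipode_act' yd_antipode_coact'.
Local Notation BP := (@biprod K A B).
Lemma lin_yactl (V: lmodType K) (F: V -> A) (u: B): linear F -> linear (fun x => yd_act (F x) u).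
exact: lin_ydactl. Qed.
Lemma lin_yactr (V: lmodType K) (F: V -> B) (x: A): linear F -> linear (fun u => yd_act x (F u)).
exact: lin_ydactr. Qed.
Ltac linz := repeat first
 [ apply: lin_id | apply: lin_yactl | apply: lin_yactr | apply: lin_tensl | apply: lin_tensr
 | apply: lin_mull | apply: lin_mulr
 | apply: lin_scalel | apply: lin_scaler
 | apply: lin_lfun | apply: lin_eval | apply: lin_tlift
 | apply: lin_tliftr => ? ? ].
Ltac bilz := split=> ?; cbv beta; linz.
(** Radford's isomorphism r # g |-> r v_g; its inverse [binv] sends h to the sum of the h1 S(pi(h2))
    # pi(h3), one term for each component P a. *)
Definition bmap: 'Hom(BP, H) := linfun (tlift (fun (u: B) (x: A) => cval u * gmap v x)).
Lemma bmapE (u: B) a: bmap (u *t 'd_ a) = cval u * v a.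
by rewrite lfunE /= tliftE ?gmapE //; bil. Qed.
Lemma bmap_tens1 (u: B): bmap (u *t (1: A)) = cval u.
by rewrite -[RHS]mulr1 -(dg_v1 dat) -bmapE. Qed.
Lemma biprod_ext (W: lmodType K) (F G: BP -> W): linear F -> linear G ->
 (forall u a, F (u *t 'd_ a) = G (u *t 'd_ a)) -> F =1 G.
move=> FL GL FG; have L (F': BP -> W) u: linear F' -> linear (fun x: A => F' (u *t x)).
 by move=> F'L c x y; rewrite (tens_bilin _ _).2 F'L.
have FG' u: (fun x: A => F (u *t x)) =1 (fun x => G (u *t x)).
 by apply: galg_ext => [||a]; [exact: L | exact: L | exact: FG].
move=> t; have -> : t = \tsum_(u, x <- t) (u *t x).
 by apply: (tens_ext (f:=id) (g:=tlift _)) => // [|u x]; [exact: tlift_linear | rewrite tliftE //; bil].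
pose F': {linear BP -> W} := HB.pack F (GRing.isLinear.Build _ _ _ _ F FL).
pose G': {linear BP -> W} := HB.pack G (GRing.isLinear.Build _ _ _ _ G GL).
rewrite -[F]/(F': BP -> W) -[G]/(G': BP -> W) /tlift !lsE; apply: eq_bigr => i _.
rewrite !lsE; apply: eq_bigr => j _; rewrite !linearZ /=; congr (_ *: _); exact: FG'.
Qed.
Definition binv (h: H): BP := \sum_a cpr (rt (P a) h) *t 'd_ a.
Lemma binv_linear: linear binv.
move=> c x y; rewrite scaler_sumr -big_split; apply: eq_bigr => a _ /=.
by rewrite !linearP (tens_bilin _ _).1.
Qed.
Lemma bmapK: cancel bmap binv.
apply: biprod_ext => [c x y|//|u c]; first by rewrite linearP binv_linear.
rewrite bmapE /binv (bigD1 c) //= big1 ?addr0 => [|b /negPf bc]; rewrite (dg_rt_vr dat) (coinv_rt dat _ (cvalP u)).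
 by rewrite mulgV eqxx cpr_vr cpr_val.
by rewrite -eq_mulgV1 bc mul0r linear0 tens0l.
Qed.
Lemma binvK: cancel binv bmap.
move=> h; rewrite lsE -[RHS](cproj_sum dat); apply: eq_bigr => a _.
by rewrite /= bmapE cval_cpr.
Qed.
Lemma bmapM s t: bmap (biprod_mul s t) = bmap s * bmap t.
move: s; apply: biprod_ext => [||u a]; [rewrite /biprod_mul; linz | linz | ].
move: t; apply: biprod_ext => [||w b]; [rewrite /biprod_mul; linz | linz | ].
rewrite /biprod_mul tliftE; last bilz.
rewrite tliftE; last bilz.
rewrite galg_tsum; last bilz.
rewrite galg_mulE -[yd_act _ _]/(ydact _ _) ydactE !bmapE cvalM' cval_act (dg_vM dat) -!mulrA.
by rewrite [v a^-1%g * _]mulrA (dg_vVl dat) mul1r.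
Qed.
Lemma bmap1: bmap (biprod_one B) = 1.
by rewrite /biprod_one -[1 in X in _ *t X]/('d_ 1%g) bmapE cval1' (dg_v1 dat) mulr1. Qed.
Lemma bmap_comul t: comul (bmap t) = tmap bmap bmap (biprod_comul t).
move: t; apply: biprod_ext => [||u c]; [linz | rewrite /tmap /biprod_comul; linz | ].
have -> : biprod_comul (u *t 'd_ c) =
  \dsum_(a1, a2 <- u) \sum_a (a1 *t 'd_(a * c)%g) *t (clt a a2 *t 'd_ c).
 rewrite /biprod_comul tliftE; last bilz.
 apply: eqt => a1 a2; rewrite -[yd_coact _]/(ydcoact _) ydcoact_tsum; last bilz.
 by apply: eq_bigr => a _; rewrite galg_tsum ?galg_mulE //; bilz.
rewrite bmapE comulM /tmap tsT.
pose F a (x y: H) := (x * v (a * c)%g) *t (lt (P a) y * v c).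
have FB a: bilin (F a) by rewrite /F; bil.
trans (\sum_a \dsum_(a1, a2 <- u) F a (cval a1) (cval a2)); last first.
 rewrite -tlift_sumr; apply: eqt => a1 a2; rewrite lsE; apply: eq_bigr => a _ /=.
 by rewrite tliftE ?bmapE ?cval_lt //; bil.
trans (\sum_a \dsum_(x, y <- cval u) (x * v c) *t (lt (P a) y * v c)).
 rewrite -tlift_sumr; apply: eqt => x y; rewrite (tsum_grouplike (dg_vG dat c)); last bil.
 rewrite -[in LHS](dg_lt_sum dat y) mulr_suml.
 exact: (lin_sum1 _ _ (lin_tensr (x * v c) (@lin_id K H))).
apply: eq_bigr => a _; rewrite comul_cval // (bigD1 a) //= big1 ?addr0.
 apply: eqt => x y; rewrite /F (dg_ltE dat) eqxx -mulrA -(dg_vM dat) mulKg //.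
move=> d /negPf da; apply: tlift_eq0 => x y.
by rewrite /F (dg_ltE dat) eq_sym da mul0r tens0r.
Qed.
Lemma bmap_counit t: counit (bmap t) = biprod_counit t.
move: t; apply: (biprod_ext (W:=K^o)) => [||u c]; [linz | rewrite /biprod_counit; linz | ].
rewrite bmapE counitM (dg_vG dat c).2 /biprod_counit tliftE; last bilz.
by rewrite -[counit 'd_ c]/(galg_counit _ _ _) galg_counitE counitBE.
Qed.
Lemma bmap_antipode t: antipode (bmap t) = bmap (biprod_antipode t).
move: t; apply: biprod_ext => [||u c]; [linz | rewrite /biprod_antipode; linz | ].
rewrite /biprod_antipode tliftE; last by rewrite /biprod_mul; bilz.
rewrite -[yd_coact _]/(ydcoact _) ydcoact_tsum; last by rewrite /biprod_mul; bilz.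
rewrite lsE bmapE antipodeM (dg_vS dat) -{1}(dg_lt_sum dat (cval u)) !lsE mulr_sumr.
apply: eq_bigr => a _; rewrite /= bmapM galg_mulE -[antipode 'd_ _]/(galg_antipode _ _ _) galg_antipodeE.
rewrite bmapE bmap_tens1 cval1' mul1r.
rewrite -[yd_antipode _]/(ydanti _) cval_anti cval_lt (canti_lt dat) invMg (dg_vM dat) -mulrA.
by rewrite [v a^-1%g * _]mulrA (dg_vVl dat) mul1r.
Qed.
Lemma bmap_ker: lker bmap = 0%VS.
by apply/eqP/lker0P; exact: can_inj bmapK. Qed.
Lemma bmap_img: limg bmap = fullv.
by apply/eqP; rewrite eqEsubv subvf; apply/subvP=> h _; rewrite -[h]binvK memv_img ?memvf.
Qed.
Lemma coinvariants_biprod: @biprod_isom K A B H.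
exists bmap; split; first by rewrite bmap_ker bmap_img.
split; [exact: bmapM | exact: bmap1 | exact: bmap_comul | exact: bmap_counit | exact: bmap_antipode].
Qed.
Lemma coinvariants_dim: (\dim {: B} * #|gT|)%N = \dim {: H}.
have := limg_ker_dim bmap fullv; rewrite capfv bmap_ker dimv0 add0n bmap_img => ->.
by rewrite -(dim_galg K gT) !dimvf.
Qed.
Hypothesis char0: [pchar K] =i pred0.
Hypothesis S2: involutive H.
(** The coinvariants are a coideal subalgebra, so the restricted Haar functional is nondegenerate on
    them, and by [rtr_coid] it computes the traces of right multiplications; it is symmetric because
    [haar] is a trace. These are the hypotheses of [symmetric_semisimple]. *)
Lemma coinvariants_semisimple: semisimple_alg B.
have tE (u: B): (haar H \o cval)%VF u = haar H (cval u) by rewrite clE.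
have cR := coinv_coid dat.
apply: (@symmetric_semisimple K B char0 (haar H \o cval)%VF) => [x y|x x0|y]; rewrite ?tE.
- by rewrite !cvalM' haarC.
- apply: cval_inj; rewrite linear0; apply: (haar_coid_nondeg char0 S2 cR (cvalP x)) => y yR.
 by have := x0 (cinj y); rewrite tE cvalM' cinjK.
have dB: \dim {: B} = \dim R by rewrite dimvf.
rewrite dB -(rtr_coid char0 S2 cR (M:=R) _ _ (cvalP y)); first last.
- by move=> a b; apply: (coinvM dat).
- by move=> f a; apply: coinv_lt.
have pE x: cval (cinj x) = projv R x.
 by rewrite cvalE; have -> : cinj x = vsproj R x; [rewrite lfunE | rewrite unlock].
rewrite /rtr; have -> : projv R = (cval \o cinj)%VF.
 by apply/lfunP=> x; rewrite -pE; exact/esym/clE.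
rewrite -clA ltrC; congr ltr; apply/lfunP=> x.
trans (x * y); first exact: amulrE.
apply: cval_inj; rewrite cvalM' !clE amulrE cinjK // (coinvM dat) ?cvalP //.
Qed.
End CoinvariantAlgebra.

(** * The pairing of the two groups and the final theorem *)

Section Pairing.
Variable K: closedFieldType.
Hypothesis char0: [pchar K] =i pred0.
Variables (H: hopfType K) (gT dT: finGroupType) (v: gT -> H) (w: dT -> dual H).
Hypotheses (fv: grouplike_family v) (fw: grouplike_family w).

Section Nondegenerate.
Hypothesis card_eq: #|gT| = #|dT|.
Hypothesis nd: forall b, (forall a, w b (v a) = 1) -> b = 1%g.
Local Notation A := (group_alg K gT).
(* The characters a |-> w b (v a) form a basis of the functions on gT, so that
  the indicator functions lift to the span of the w b. *)
Lemma pairing_grading: exists P: gT -> dual H, dual_grading v P.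
have [vi v1 vM vG] := fv; have [wi w1 wM wG] := fw.
have vS a: antipode (v a) = v a^-1%g by apply: vS.
pose r: 'Hom(dual H, dual A) := linfun (fun f: dual H => (f \o gmap v)%VF: dual A).
have rE f: r f = (f \o gmap v)%VF by rewrite linE // => c x y; rewrite clDl clZl.
have rv f a: r f (galg_elt K a) = f (v a) by rewrite rE clE gmapE.
have gh: hopf_hom (gmap v) by apply: gmap_hom.
pose w' b: dual A := r (w b).
have w'G b: grouplike (w' b) by rewrite /w' rE; apply: pull_grouplike.
have w'M a b: w' (a * b)%g = w' a * w' b by rewrite /w' wM !rE pullM.
have w'1: w' 1%g = 1 by rewrite /w' w1 rE pull1.
(* Nondegeneracy makes the restrictions of the w b to the group algebra distinct. Being as many
   independent grouplikes of its dual as the dimension of the latter, they span it. *)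
have w'i: injective w'.
 move=> a b E; apply/eqP; rewrite eq_mulgV1; apply/eqP/nd => c.
 have: w' (a * b^-1)%g = w' 1%g by rewrite w'M E -w'M mulgV.
 by move/lfunP/(_ (galg_elt K c)); rewrite !rv w1 dual1 (vG c).2.
have Ir: (r @: gspan w)%VS = fullv.
 apply/eqP; rewrite eqEdim subvf /= dim_dual dim_galg card_eq -(dim_gspan w'i w'G); apply: dimvS.
 by apply: gspan_sub => b; rewrite memv_img // mem_gspan.
have inj f g: f \in gspan w -> g \in gspan w -> (forall c, f (v c) = g (v c)) -> f = g.
 move=> fU gU fg; have := limg_ker_dim r (gspan w).
 rewrite Ir dim_dual dim_galg card_eq dim_gspan // => /eqP; rewrite -[X in _ == X]add0n eqn_add2r dimv_eq0 => /eqP k0.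
 apply/eqP; rewrite -subr_eq0 -memv0 -k0 memv_cap rpredB //= memv_ker; apply/eqP/lfunP => x.
 move: x; apply: (galg_ext (W:=K^o)) => [||c]; [exact: linearP | exact: linearP |].
 by rewrite rv alE olE fg subrr zlE.
have [P PP]: exists P: gT -> dual H, forall a, P a \in gspan w /\ forall c, P a (v c) = (a == c)%:R.
 apply: (fin_all_exists (P:=fun a f => f \in gspan w /\ forall c, f (v c) = (a == c)%:R)) => a.
 pose d: dual A := linfun (fun x: A => x a: K^o).
 have dE x: d x = x a by rewrite linE // => c y z; rewrite !ffunE.
 have /memv_imgP[f fU df]: d \in (r @: gspan w)%VS by rewrite Ir memvf.
 by exists f; split=> // c; rewrite -rv -df dE ffunE.
have PU a: P a \in gspan w by case: (PP a).
have Pv a c: P a (v c) = (a == c)%:R by case: (PP a).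
have [U1 UM _ US]: hopf_subalg (gspan w) by apply: gspan_hopf.
exists P; split; split=> //.
- move=> a b; apply: inj => [||c]; first by apply: (subvP UM); rewrite memv_mul.
  by case: eqP; rewrite ?mem0v.
 rewrite grouplike_evalM // !Pv; case: (a =P b) => [->|ab].
  by rewrite Pv; case: eqP; rewrite ?mulr1 ?mulr0.
 by rewrite zlE; case: eqP => [<-|]; rewrite ?mul0r // eq_sym (introF eqP ab) mulr0.
- apply: inj => [||c]; [by apply: memv_suml | by [] |].
 rewrite smE (bigD1 c) //= big1 ?addr0 => [|b /negPf bc]; rewrite Pv ?eqxx ?bc //.
 by rewrite dual1 (vG c).2.
(* Both sides, as functionals of P a, are compared on the spanning elements w b, which are
   multiplicative; expanding w b in the P c yields the double sum. At P a the condition b d = a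
   leaves one term for each b. *)
- move=> a x y.
 pose F1: 'Hom(dual H, K^o) := linfun (fun f: dual H => f (x * y): K^o).
 have F1E f: F1 f = f (x * y) by rewrite linE //; lin.
 pose F2: 'Hom(dual H, K^o) := linfun (fun f: dual H => \sum_b \sum_d (f (v (b * d)%g) * (P b x * P d y)): K^o).
 have F2E f: F2 f = \sum_b \sum_d (f (v (b * d)%g) * (P b x * P d y)).
  rewrite linE // => c g h; rewrite scaler_sumr -big_split; apply: eq_bigr => b _ /=.
  rewrite scaler_sumr -big_split; apply: eq_bigr => d _ /=.
  by rewrite alE slE mulrDl -scalerAl.
 have wE z b: w b z = \sum_a w b (v a) * P a z.
  have -> : w b = \sum_a (w b (v a): K) *: P a.
   apply: inj => [||c]; [exact: mem_gspan | by apply: memv_suml => i _; rewrite memvZ |].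
   rewrite smE (bigD1 c) //= big1 ?addr0 => [|d /negPf dc]; rewrite slE Pv.
    by rewrite eqxx [_ *: _]mulr1.
   by rewrite dc [_ *: _]mulr0.
  rewrite smE; apply: eq_bigr => c _; rewrite slE; congr (_ * _).
  rewrite smE (bigD1 c) //= big1 ?addr0 => [|d /negPf dc]; rewrite slE Pv.
   by rewrite eqxx [_ *: _]mulr1.
  by rewrite dc [_ *: _]mulr0.
 have: F1 (P a) = F2 (P a).
  apply: gspan_eq (PU a) => b; rewrite F1E F2E grouplike_dualM // !wE mulr_suml.
  apply: eq_bigr => c _; rewrite mulr_sumr; apply: eq_bigr => d _.
  by rewrite vM grouplike_dualM // [RHS]mulrACA.
 rewrite F1E F2E => ->; apply: eq_bigr => b _; rewrite (bigD1 (b^-1 * a)%g) //= big1 ?addr0.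
  by rewrite mulKVg Pv eqxx mul1r.
 move=> d dn; rewrite Pv; case: eqP => [E|_]; last by rewrite mul0r.
 by case/eqP: dn; rewrite E mulKg.
- move=> a; apply: inj => [||c]; [by apply: (subvP US); rewrite memv_img | by [] |].
 by rewrite dual_SE vS !Pv eq_invg_sym.
Qed.
End Nondegenerate.
Hypothesis S2: involutive H.
(** A nontrivial b in the kernel gives, by Cauchy, a group of order p in the dual that pairs
    trivially with the p^2 grouplikes of H; by [pairing_dvd], p^3 would divide p^2 q^2. *)
Lemma pairing_nondegenerate p q b: prime p -> prime q -> p != q -> \dim {: H} = (p ^ 2 * q ^ 2)%N ->
 #|gT| = (p ^ 2)%N -> #|dT| = (p ^ 2)%N -> (forall a, w b (v a) = 1) -> b = 1%g.
have [vi v1 vM vG] := fv; have [wi w1 wM wG] := fw.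
move=> p_pr q_pr pq NE cg cd wb; apply/eqP; apply: contraT => b1.
have: (p %| #|<[b]>|)%g%N.
 have: (#[b]%g %| p ^ 2)%N by rewrite -cd -cardsT order_dvdG ?inE.
 case/(dvdn_pfactor _ _ p_pr) => [[|m] _ bm]; last by rewrite -/(order b) bm expnS dvdn_mulr.
 by move: b1; rewrite -order_eq1 bm.
case/(Cauchy p_pr)=> c cb oc.
have wc a n: (w c ^+ n) (v a) = 1.
 by have /cycleP[m ->] := cb; rewrite (vX w1 wM) -exprM eval_dualX // wb expr1n.
have [eT [u [e [ui u1 uM ue [uX eE]]]]] := cyclic_group (wG c).
have ce: #|eT| = p.
 apply: (cyclic_group_prime p_pr ui u1 uM ue eE).
  by rewrite -(vX w1 wM) -oc expg_order.
 by rewrite -w1 (inj_eq wi) -order_eq1 oc; case: (p) p_pr => [|[]].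
have uG x: grouplike (u x) by have [n ->] := uX x; rewrite -(vX w1 wM).
have uv a x: u x (v a) = 1 by have [n ->] := uX x.
have := pairing_dvd char0 S2 vi v1 vM vG ui u1 uM uG uv.
rewrite cg ce NE dvdn_pmul2l ?expn_gt0 ?prime_gt0 // Euclid_dvdX // andbT dvdn_prime2 //.
by rewrite (negPf pq).
Qed.
End Pairing.

Section GrouplikesOfDimP2Q2.
Variable K: closedFieldType.
Hypothesis char0: [pchar K] =i pred0.
(** The congruence modulo p between dim U and the number of central grouplikes settles the case
    where p divides dim U. Otherwise dim U = q^2 leaves an annihilator of dimension p^2, and for dim
    U = q the annihilator, of dimension p^2 q, is handled by applying [p2q_grouplikes] to its
    dual. *)
Lemma p2q2_dual_grouplikes (H: hopfType K) p q: involutive H -> prime p -> prime q -> (p ^ 4 < q)%N ->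
 \dim {: H} = (p ^ 2 * q ^ 2)%N ->
 (exists z: H, [/\ grouplike z, central z, z ^+ p = 1 & z != 1]) \/
 exists (gT: finGroupType) (w: gT -> dual H), grouplike_family w /\ #|gT| = (p ^ 2)%N.
move=> S2 p_pr q_pr pq NE; have S2d := involutive_dual S2.
have [|U [gT [v [[cU [aU lU] qU UN _] [vi v1 vM vGC _] Umod _ _]]]] :=
 small_coideal_subalgebra char0 S2 (a:=2) (t:=1) p_pr q_pr _ NE.
 by rewrite -expnM.
have [p0 q0] := (prime_gt0 p_pr, prime_gt0 q_pr).
have dA: (\dim (annih U) * \dim U)%N = (p ^ 2 * q ^ 2)%N by rewrite dim_annih.
have [pU|pU] := boolP (p %| \dim U)%N.
 left; apply: (central_Cauchy (v:=v)) p_pr _ => //.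
  by split=> // a; case: (vGC a).
 by rewrite /dvdn -Umod.
right; have hB: hopf_subalg (annih U) by apply: annih_hopf.
have S2B: involutive (hsub hB) by apply: hsub_involutive.
have S2BD := involutive_dual S2B.
have cUq: (\dim U %| q ^ 2)%N.
 by rewrite -(@Gauss_dvdr _ (p ^ 2)) -?NE // coprime_sym coprimeXl // prime_coprime.
case/(dvdn_pfactor _ _ q_pr): cUq => m m2 dU; case: m m2 dU => [|[|[|//]]] _ dU.
- by move: qU; rewrite dU dvdn1; case: (q) q_pr => [|[]].
- have dB: \dim {: hsub hB} = (p ^ 2 * q)%N.
  by rewrite dim_hsub; apply/eqP; rewrite -(eqn_pmul2r q0) -{1}[q]expn1 -dU dA -mulnA mulnn.
 have [|dT [w [fw cw]]] := p2q_grouplikes char0 S2BD p_pr q_pr pq; first by rewrite dim_dual.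
 have [u fu] := double_dual_family fw.
 by exists dT, (fun a => hval hB (u a)); split=> //; apply: hval_family.
have dB: \dim {: hsub hB} = (p ^ 2)%N.
 by rewrite dim_hsub; apply/eqP; rewrite -(@eqn_pmul2r (q ^ 2)) ?expn_gt0 ?q0 // -{1}dU dA.
have [dT [u [fu cu]]] := prime2_grouplikes char0 S2B p_pr dB.
by exists dT, (fun a => hval hB (u a)); split=> //; apply: hval_family.
Qed.
End GrouplikesOfDimP2Q2.

Theorem theorem3p7 (k : closedFieldType) (char0 : [pchar k] =i pred0)
    (p q : nat) (p_pr : prime p) (q_pr : prime q) (ltp4q : (p ^ 4 < q)%N)
    (H : hopfType k) (ssH : semisimple_alg H)
    (dimH : \dim {: H} = (p ^ 2 * q ^ 2)%N) :
  semisolvable H \/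
  exists (gT : finGroupType) (R : ydHopfType (group_alg k gT)),
    [/\ #|gT| = (p ^ 2)%N, semisimple_alg R, \dim {: R} = (q ^ 2)%N
      & biprod_isom R H].
Proof.
have S2 : involutive H by exact: semisimple_involutive.
have pq2 : (p ^ 2 < q)%N.
  by apply: leq_ltn_trans ltp4q; rewrite leq_pexp2l ?prime_gt0.
have pq : p != q.
  apply/eqP=> E; have := leq_pexp2l (prime_gt0 p_pr) (isT : (1 <= 4)%N).
  by rewrite expn1 leqNgt {2}E ltp4q.
have S2d := involutive_dual S2; have dimD := etrans (dim_dual H) dimH.
have NE : \dim {: H} = (p * (p * q ^ 2))%N by rewrite dimH mulnA mulnn.
have IH (Q : hopfType k) := @pq_semisolvable k char0 Q p q 1.
case: (p2q2_dual_grouplikes char0 S2 p_pr q_pr ltp4q dimH) => [cz | [dT [w [fw cw]]]].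
  left; left; apply: (upper_quotient char0 S2 p_pr NE cz) => Q S2Q dQ.
  by have [] := IH Q S2Q p_pr q_pr pq2 isT dQ.
(* The same dichotomy for the dual of H: a central grouplike of the dual leads to the lower chain,
   as one of H led to the upper chain, and the grouplikes of the double dual are those of H. *)
case: (p2q2_dual_grouplikes char0 S2d p_pr q_pr ltp4q dimD) => [[eta [eG ec ep e1]] | [gT [v' [fv' cv]]]].
  left; right; apply: (lower_dual char0 S2 p_pr NE eG ec ep e1) => Q S2Q dQ.
  by have [] := IH Q S2Q p_pr q_pr pq2 isT dQ.
have [v fv] := double_dual_family fv'.
have [|P dat] := pairing_grading fv fw (etrans cv (esym cw)).
  by move=> b; apply: (pairing_nondegenerate char0 fv fw S2 p_pr q_pr pq dimH cv cw).
right; exists gT, (coinvariants dat); split=> //.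
- exact: coinvariants_semisimple.
- apply/eqP; rewrite -(eqn_pmul2r (m := p ^ 2)) ?expn_gt0 ?prime_gt0 // -{1}cv.
  by rewrite coinvariants_dim dimH mulnC.
- exact: coinvariants_biprod.
Qed.
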